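(* There exist a function $[\,\_\,]\colon \{\text{calligraphs}\}\longrightarrow \mathbb{Z}^3$ and the quadratic form \[ \_\cdot\_ \colon \mathbb{Z}^3\times\mathbb{Z}^3\longrightarrow \mathbb{Z},\qquad (a_1,b_1,c_1)\cdot(a_2,b_2,c_2) = 2(a_1a_2-b_1b_2-c_1c_2), \] such that, whenever $G$ is a minimally rigid graph and $(G_1,G_2)$ is a calligraphic split of $G$, the number $c_{S^2}(G)$ of complex realizations of $G$ on the sphere up to complex rotations equals $[G_1]\cdot[G_2]$. Moreover, for the three basic calligraphs $L$, $R$, $C_v$ one has \[ [L]=(1,1,0),\qquad [R]=(1,0,1),\qquad [C_v]=(2,0,0). \]
   Context: All graphs are simple (no loops, no multiple edges). The complex sphere is $S^2_{\mathbb{C}}=\{(x,y,z)\in\mathbb{C}^3 : x^2+y^2+z^2=1\}$. For a graph $G=(V,E)$ and edge lengths $\lambda=(\lambda_e)_{e\in E}$ with $\lambda_e\in\mathbb{R}_{>0}$, a realization on the sphere inducing $\lambda$ is a map $\rho\colon V\to S^2_{\mathbb{C}}$ with $\langle \rho(u)-\rho(v),\rho(u)-\rho(v)\rangle=\lambda_e$ for every edge $e=\{u,v\}$, where $\langle\cdot,\cdot\rangle$ is the bilinear form given by the identity matrix. Two realizations are identified if they differ by an element of $\mathrm{SO}_3(\mathbb{C})$. A graph $G=(V,E)$ is minimally rigid if $|E|=2|V|-3$ and $|E'|\le 2|V'|-3$ for every subgraph $(V',E')$ with at least two vertices; equivalently, for a general choice of edge lengths it has finitely many but not zero realizations (in the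 plane, or equivalently on the sphere) up to complex isometries/rotations. For such $G$, $c_{S^2}(G)$ denotes the number of complex realizations of $G$ on $S^2_{\mathbb{C}}$ inducing a general choice of edge lengths, up to $\mathrm{SO}_3(\mathbb{C})$ (this number does not depend on the general choice). A calligraph is a graph $H=(V,E)$ with vertices $0,1,2\in V$, a distinguished edge $\{1,2\}\in E$ and a distinguished vertex $0$, such that $|E|=2|V|-4$ and at least one of $(V,E\cup\{\{0,1\}\})$, $(V,E\cup\{\{0,2\}\})$ is rigid. A split of a graph $G=(V,E)$ is a pair of subgraphs $G_i=(V_i,E_i)$, $i=1,2$, with $V=V_1\cup V_2$, $E=E_1\cup E_2$, $V_1\cap V_2=\{0,1,2\}$, $E_1\cap E_2=\{\{1,2\}\}$; it is a calligraphic split if both $G_1$ and $G_2$ are calligraphs (with distinguished edge $\{1,2\}$ and vertex $0$). The basic calligraphs are $L=(\{0,1,2\},\{\{1,2\},\{0,1\}\})$, $R=(\{0,1,2\},\{\{1,2\},\{0,2\}\})$, and, for a vertex label $v\notin\{0,1,2\}$, $C_v=(\{0,1,2,v\},\{\{1,2\},\{0,v\},\{1,v\},\{2,v\}\})$. *)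

(* Defs.v *)
From HB Require Import structures.
From mathcomp Require Import all_boot all_order all_algebra.
From mathcomp Require Import finmap.
From mathcomp Require Import boolp classical_sets cardinality reals.
From mathcomp Require Import complex.
From mathcomp Require Import mpoly.

Set Implicit Arguments.
Unset Strict Implicit.
Unset Printing Implicit Defensive.

Import Order.TTheory GRing.Theory Num.Theory.

Local Open Scope fset_scope.
Local Open Scope nat_scope.

(* Vertex labels are natural numbers, so that 0, 1, 2 are literally available
   as labels; an edge {u, v} is the two-element set [fset u; v]. *)
Record graph := Graph {
  vset : {fset nat};
  eset : {fset {fset nat}};
  eset_simple : eset `<=` [fset e in fpowerset vset | #|` e| == 2]
}.

Definition subgraph (H G : graph) : Prop :=
  vset H `<=` vset G /\ eset H `<=` eset G.

(* |E| = 2|V| - 3 and |E'| <= 2|V'| - 3, without truncated subtraction. *)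
Definition minimally_rigid (G : graph) : Prop :=
  #|` eset G| + 3 = 2 * #|` vset G| /\
  forall H : graph, subgraph H G -> 2 <= #|` vset H| ->
    #|` eset H| + 3 <= 2 * #|` vset H|.

Definition rigid (G : graph) : Prop :=
  exists H : graph, [/\ subgraph H G, vset H = vset G & minimally_rigid H].

(* For the calligraph count |E| = 2|V| - 4, rigidity of (V, E U {e}) is the
   same as minimal rigidity, and it forces e to be a new edge. *)
Definition rigid_with_edge (G : graph) (e : {fset nat}) : Prop :=
  exists K : graph, [/\ vset K = vset G, eset K = e |` eset G & rigid K].

Definition is_calligraph (H : graph) : Prop :=
  [/\ [fset 0; 1; 2] `<=` vset H,
      [fset 1; 2] \in eset H,
      #|` eset H| + 4 = 2 * #|` vset H| &
      rigid_with_edge H [fset 0; 1] \/ rigid_with_edge H [fset 0; 2]].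

Record calligraph := Calligraph {
  callig_graph :> graph;
  calligP : is_calligraph callig_graph
}.

Definition is_split (G G1 G2 : graph) : Prop :=
  [/\ vset G = vset G1 `|` vset G2,
      eset G = eset G1 `|` eset G2,
      vset G1 `&` vset G2 = [fset 0; 1; 2] &
      eset G1 `&` eset G2 = [fset [fset 1; 2]]].

Section Realizations.
Local Open Scope ring_scope.
Local Open Scope complex_scope.
Local Open Scope classical_set_scope.

Variables (R : realType) (G : graph).

Definition bilin (u v : 'cV[R[i]]_3) : R[i] := \sum_(k < 3) u k 0 * v k 0.

Definition on_sphere (u : 'cV[R[i]]_3) : Prop := bilin u u = 1.

Definition SO3 (A : 'M[R[i]]_3) : Prop := A^T *m A = 1%:M /\ \det A = 1.

Definition placement : Type := {ffun vset G -> 'cV[R[i]]_3}.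

Definition edge_lengths : Type := {ffun eset G -> R}.

Definition realizations (lam : edge_lengths) : set placement :=
  [set rho | (forall v, on_sphere (rho v)) /\
     forall (u v : vset G) (e : eset G), val e = [fset val u; val v]%fset ->
       bilin (rho u - rho v) (rho u - rho v) = (lam e)%:C].

Definition rotation_orbit (rho : placement) : set placement :=
  [set rho' | exists2 A, SO3 A & forall v, rho' v = A *m rho v].

Definition realization_classes (lam : edge_lengths) : set (set placement) :=
  rotation_orbit @` realizations lam.

(* The number c_{S^2}(G) is n: away from a proper real algebraic subset of the
   space of edge lengths, there are exactly n realizations up to rotations.
   At most one n satisfies this, because a nonzero real polynomial does not
   vanish identically on the positive orthant. *)
Definition sphere_realization_count (n : nat) : Prop :=
  exists2 p : {mpoly R[#|{: eset G}|]}, p != 0 &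
    forall lam : edge_lengths, (forall e, 0 < lam e) ->
      p.@[fun i => lam (enum_val i)] != 0 ->
      (realization_classes lam #= `I_n)%card.

End Realizations.

Arguments sphere_realization_count : clear implicits.

Definition zform (x y : int * int * int) : int :=
  (let: (a1, b1, c1) := x in let: (a2, b2, c2) := y in
   2 * (a1 * a2 - b1 * b2 - c1 * c2))%R.

Lemma edgeP (G : graph) (e : {fset nat}) :
  e \in eset G -> (e `<=` vset G)%fset /\ #|` e| = 2.
Proof.
move=> /(fsubsetP (eset_simple G)); rewrite !inE /= => /andP[].
by rewrite fpowersetE => -> /eqP ->.
Qed.

Lemma simple_edges (V : {fset nat}) (E : {fset {fset nat}}) :
  (forall e, e \in E -> (e `<=` V)%fset /\ #|` e| = 2) ->
  (E `<=` [fset e in fpowerset V | #|` e| == 2])%fset.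
Proof.
move=> H; apply/fsubsetP => e /H [sV c2].
by rewrite !inE /= fpowersetE sV c2.
Qed.

Lemma minimally_rigid_extension (G G' : graph) (v a b : nat) :
  v \notin vset G -> a \in vset G -> b \in vset G -> a != b ->
  vset G' = v |` vset G ->
  eset G' = [fset v; a] |` ([fset v; b] |` eset G) ->
  minimally_rigid G -> minimally_rigid G'.
Proof.
move=> vV aV bV ab VG' EG' [cE cH].
have va : v != a by apply: contraNneq vV => ->.
have vb : v != b by apply: contraNneq vV => ->.
have nE w : [fset v; w] \notin eset G.
  apply/negP => /edgeP [/fsubsetP /(_ v)]; rewrite !inE eqxx => /(_ isT).
  by rewrite (negPf vV).
have nab : [fset v; a] != [fset v; b].
  apply/eqP => /fsetP /(_ a); rewrite !inE eqxx orbT (negPf ab) orbF.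
  by rewrite eq_sym (negPf va).
split.
  rewrite VG' EG' !cardfsU1 vV !inE nE (negPf nab) (negPf (nE a)) /=.
  by rewrite mulnDr -cE !addnA.
move=> H [sV sE] V2.
have HE1 : #|` vset H| = 2 -> #|` eset H| <= 1.
  move=> c2; rewrite -(cardfs1 (vset H)); apply: fsubset_leq_card.
  apply/fsubsetP => e /edgeP [eV e2]; rewrite inE.
  by rewrite eqEfcard eV c2 e2.
have [vH|vH] := boolP (v \in vset H); last first.
  apply: cH => //; split; apply/fsubsetP => x xH.
    move/fsubsetP: sV => /(_ x xH); rewrite VG' !inE => /orP[/eqP xv|//].
    by rewrite -xv xH in vH.
  move/fsubsetP: sE => /(_ x xH); rewrite EG' !inE.
  case/or3P=> [/eqP xe|/eqP xe|//];
  move/edgeP: xH => [/fsubsetP /(_ v)]; rewrite xe !inE eqxx => /(_ isT);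
  by rewrite (negPf vH).
have [c2|c2] := eqVneq (#|` vset H|) 2.
  by rewrite c2; have := HE1 c2; rewrite -(leq_add2r 3).
pose W := vset H `\ v.
pose F := [fset e in eset H | v \notin e].
have FW : F `<=` [fset e in fpowerset W | #|` e| == 2].
  apply: simple_edges => e; rewrite !inE /= => /andP[/edgeP [eH e2] ve].
  split=> //; apply/fsubsetP => x xe; rewrite !inE (fsubsetP eH) // andbT.
  by apply: contraNneq ve => <-.
have cW : #|` vset H| = #|` W|.+1 by rewrite (cardfsD1 v) vH.
have sub : subgraph (Graph FW) G.
  split=> /=; apply/fsubsetP => x; rewrite !inE /=.
    move=> /andP[xv /(fsubsetP sV)]; by rewrite VG' !inE (negPf xv).
  move=> /andP[/(fsubsetP sE)]; rewrite EG' !inE.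
  by case/or3P=> [/eqP->|/eqP->|//]; rewrite !inE eqxx.
have W2 : 2 <= #|` W|.
  by move: V2 c2; rewrite cW; case: (#|` W|) => [|[|]].
have := cH _ sub W2; rewrite /= => FW2.
have EF : #|` eset H| <= 2 + #|` F|.
  have : eset H `<=` [fset v; a] |` ([fset v; b] |` F).
    apply/fsubsetP => e eH; rewrite !inE /= eH /=.
    move/(fsubsetP sE): (eH); rewrite EG' !inE => /or3P[->|->|eG] //.
      by rewrite orbT.
    apply/orP; right; apply/orP; right; apply/negP => ve.
    by have [/fsubsetP /(_ v ve)] := edgeP eG; rewrite (negPf vV).
  move/fsubset_leq_card/leq_trans; apply.
  rewrite !cardfsU1 addnA leq_add2r; do 2!case: (_ \notin _) => //.
rewrite cW mulnS; apply: leq_trans (_ : 2 + #|` F| + 3 <= _).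
  by rewrite leq_add2r.
by rewrite -addnA leq_add2l.
Qed.

Local Ltac simple_tac :=
  rewrite ?fsubUset ?fsub1set !inE /= ?fpowersetE;
  repeat (apply/andP; split);
  try (by rewrite cardfs2);
  by apply/fsubsetP => x; rewrite !inE => /orP[]/eqP->; rewrite ?eqxx ?orbT.

Lemma edge12_simple :
  [fset [fset 1; 2]] `<=` [fset e in fpowerset [fset 1; 2] | #|` e| == 2].
Proof. simple_tac. Qed.

Lemma basic_L_simple :
  [fset [fset 1; 2]; [fset 0; 1]] `<=`
  [fset e in fpowerset [fset 0; 1; 2] | #|` e| == 2].
Proof. simple_tac. Qed.

Lemma basic_R_simple :
  [fset [fset 1; 2]; [fset 0; 2]] `<=`
  [fset e in fpowerset [fset 0; 1; 2] | #|` e| == 2].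
Proof. simple_tac. Qed.

Lemma basic_C_simple (v : nat) (hv : v \notin [fset 0; 1; 2]) :
  [fset [fset 1; 2]; [fset 0; v]; [fset 1; v]; [fset 2; v]] `<=`
  [fset e in fpowerset [fset 0; 1; 2; v] | #|` e| == 2].
Proof.
move: hv; rewrite !inE !negb_or -andbA => /and3P[].
rewrite ![v == _]eq_sym => v0 v1 v2.
rewrite !fsubUset !fsub1set !inE /= !fpowersetE !cardfs2 v0 v1 v2 /=.
by rewrite !andbT; repeat (apply/andP; split);
  apply/fsubsetP => x; rewrite !inE => /orP[]/eqP->; rewrite ?eqxx ?orbT.
Qed.

Definition basic_L_graph : graph := Graph basic_L_simple.
Definition basic_R_graph : graph := Graph basic_R_simple.
Definition basic_C_graph (v : nat) (hv : v \notin [fset 0; 1; 2]) : graph :=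
  Graph (basic_C_simple hv).

Lemma minimally_rigid_edge12 : minimally_rigid (Graph edge12_simple).
Proof.
split=> /=; first by rewrite cardfs1 cardfs2.
move=> H [/= /fsubset_leq_card sV /fsubset_leq_card sE] V2.
rewrite cardfs1 in sE; apply: (@leq_trans 4); first by rewrite (leq_add2r 3 _ 1).
by rewrite (leq_mul2l 2 2).
Qed.

Lemma minimally_rigid_triangle (K : graph) :
  vset K = [fset 0; 1; 2] ->
  eset K = [fset [fset 0; 1]; [fset 0; 2]; [fset 1; 2]] -> minimally_rigid K.
Proof.
move=> VK EK.
apply: (@minimally_rigid_extension (Graph edge12_simple) K 0 1 2) => //=.
- by rewrite !inE.
- by rewrite !inE.
- by rewrite !inE.
- by rewrite VK fsetUA.
- by rewrite EK fsetUA.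
- exact: minimally_rigid_edge12.
Qed.

Lemma rigid_minimally (G : graph) : minimally_rigid G -> rigid G.
Proof. by move=> Gr; exists G; split=> //; split; apply: fsubset_refl. Qed.

Lemma triangle_simple :
  [fset [fset 0; 1]; [fset 0; 2]; [fset 1; 2]] `<=`
  [fset e in fpowerset [fset 0; 1; 2] | #|` e| == 2].
Proof. simple_tac. Qed.

Lemma ne_fset2 (a b c d : nat) :
  a \notin [fset c; d] -> [fset a; b] != [fset c; d].
Proof. by apply: contraNneq => <-; rewrite !inE eqxx. Qed.

Lemma basic_L_calligraph : is_calligraph basic_L_graph.
Proof.
split=> /=.
- exact: fsubset_refl.
- by rewrite !inE eqxx.
- rewrite cardfs2 eq_sym ne_fset2 ?inE //.
  by rewrite -fsetUA cardfsU1 cardfs2 !inE.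
- right; exists (Graph triangle_simple); split=> //=.
    by apply/fsetP => e; rewrite !inE; do 3!case: (e == _).
  exact/rigid_minimally/minimally_rigid_triangle.
Qed.

Lemma basic_R_calligraph : is_calligraph basic_R_graph.
Proof.
split=> /=.
- exact: fsubset_refl.
- by rewrite !inE eqxx.
- rewrite cardfs2 eq_sym ne_fset2 ?inE //.
  by rewrite -fsetUA cardfsU1 cardfs2 !inE.
- left; exists (Graph triangle_simple); split=> //=.
    by apply/fsetP => e; rewrite !inE; do 3!case: (e == _).
  exact/rigid_minimally/minimally_rigid_triangle.
Qed.

Lemma basic_C_calligraph (v : nat) (hv : v \notin [fset 0; 1; 2]) :
  is_calligraph (basic_C_graph hv).
Proof.
have := hv; rewrite !inE !negb_or -andbA => /and3P[v0 v1 v2].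
have v12 : v \notin [fset 1; 2] by rewrite !inE negb_or v1.
split=> /=.
- by apply/fsubsetP => x; rewrite !inE => ->.
- by rewrite !inE eqxx.
- have e1 : [fset 0; v] != [fset 1; 2] by apply: ne_fset2; rewrite !inE.
  have e2 : [fset 1; v] != [fset 0; v].
    by apply: ne_fset2; rewrite !inE /= eq_sym.
  have e3 : [fset 2; v] != [fset 0; v].
    by apply: ne_fset2; rewrite !inE /= eq_sym.
  have e4 : [fset 2; v] != [fset 1; v].
    by apply: ne_fset2; rewrite !inE /= eq_sym.
  have e5 : [fset 1; v] != [fset 1; 2].
    by rewrite [ [fset 1; v] ]fsetUC; apply: ne_fset2.
  have e6 : [fset 2; v] != [fset 1; 2].
    by rewrite [ [fset 2; v] ]fsetUC; apply: ne_fset2.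
  rewrite !cardfsU !cardfs1.
  have d (T : choiceType) (A : {fset T}) (x : T) :
    #|` A `&` [fset x] | = (x \in A).
    have [xA|xA] := boolP (x \in A).
      by rewrite (fsetIidPr _) ?cardfs1 // fsub1set.
    by apply/eqP; rewrite cardfs_eq0; apply/eqP/fsetP => y; rewrite !inE;
      apply/negbTE; rewrite negb_and -implybE; apply/implyP => yA;
      apply: contraNneq xA => <-.
  rewrite !d !inE (negPf e1) (negPf e2) (negPf e3) (negPf e4) (negPf e5).
  by rewrite (negPf e6) (negPf v0) (negPf v1) (negPf v2).
have E1 : [fset [fset v; 1]; [fset v; 2]; [fset 1; 2]] `<=`
    [fset e in fpowerset [fset v; 1; 2] | #|` e| == 2].
  rewrite !fsubUset !fsub1set !inE /= !fpowersetE !cardfs2 v1 v2 /= !andbT.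
  by repeat (apply/andP; split);
    apply/fsubsetP => x; rewrite !inE => /orP[]/eqP->; rewrite ?eqxx ?orbT.
have M1 : minimally_rigid (Graph E1).
  apply: (@minimally_rigid_extension (Graph edge12_simple) _ v 1 2) => //=.
  - by rewrite !inE.
  - by rewrite !inE.
  - by rewrite fsetUA.
  - by rewrite fsetUA.
  - exact: minimally_rigid_edge12.
have E2 : [fset 0; 1] |`
    [fset [fset 1; 2]; [fset 0; v]; [fset 1; v]; [fset 2; v]] `<=`
    [fset e in fpowerset [fset 0; 1; 2; v] | #|` e| == 2].
  apply: simple_edges => e; rewrite in_fset1U => /orP[/eqP->|].
    rewrite cardfs2; split=> //; apply/fsubsetP => x.
    by rewrite !inE => /orP[]->; rewrite ?orbT.
  exact: (@edgeP (basic_C_graph hv)).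
left; exists (Graph E2); split=> //=.
apply/rigid_minimally.
apply: (@minimally_rigid_extension (Graph E1) _ 0 1 v) => //=.
- by rewrite !inE !negb_or [0 == v]eq_sym v0.
- by rewrite !inE eqxx orbT.
- by rewrite !inE eqxx.
- by rewrite eq_sym.
- by apply/fsetP => x; rewrite !inE; do 4!case: (x == _).
- apply/fsetP => x; rewrite !inE.
  rewrite [ [fset v; 1] ]fsetUC [ [fset v; 2] ]fsetUC.
  by do 5!case: (x == _).
Qed.

Definition basic_L : calligraph := Calligraph basic_L_calligraph.
Definition basic_R : calligraph := Calligraph basic_R_calligraph.
Definition basic_C (v : nat) (hv : v \notin [fset 0; 1; 2]) : calligraph :=
  Calligraph (basic_C_calligraph hv).

(* Main.v *)
(* Put the vertices 1 and 2 in a fixed position on the sphere. With generic edge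
   lengths, the squared distances s and t from vertex 0 to 1 and 2 then trace, for
   each calligraph, a coupler curve. Let d, n and m be the numbers of configurations
   on a generic line s + t = u, s = sigma and t = sigma; as u goes to infinity,
   s stays finite on b branches and t on c branches. Two such curves with independent
   edge lengths have no common limit at infinity, because a limit position never
   depends on the length of the edge {1, 2} alone: the residual configuration would
   have fewer parameters than there are independent edge lengths. Hence they share
   d1 d2 - b1 b2 - c1 c2 points, every one counted with its number of configurations,
   and the reflection in the plane through 1 and 2 shows that half of them are
   realizations of the glued graph. Gluing with L and R gives b = d - n and c = d - m,
   so that [H] = (d, d - n, d - m) / 2.

   Generic points, places and conjugation live in an algebraically closed field F:
   subfields are subsets of F, isomorphisms are subrings of F * F, and the intersection
   multiplicities are multiplicities of roots of a resultant. Elimination of quantifiers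
   carries the count at one generic choice of edge lengths to a Zariski open set. *)

Require Import Defs.
From HB Require Import structures.
From mathcomp Require Import all_boot all_order all_algebra.
From mathcomp Require Import finmap boolp classical_sets cardinality reals complex mpoly closed_field ring zify.
Set Implicit Arguments.
Unset Strict Implicit.
Unset Printing Implicit Defensive.
Import Order.TTheory GRing.Theory Num.Theory.
Local Open Scope ring_scope.
Local Open Scope classical_set_scope.

(** The pencil of lines s + t = u is chosen because no branch of a coupler curve is infinite at a
    finite u: there s/t would tend to -1, a limit in the base field, and such limits are excluded.
    Hence the resultant of two curves along this pencil is a polynomial in u, whose degree can be
    read off from the growth of its factors at one pole of u.

    The exclusion rests on a count of moduli. A point of the sphere is a pair of points of the
    projective line, its two isotropic lines, and squared distances are cross-ratios of such points.
    Under a place, the residual data of a finite set on the line gain at most one modulus for each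
    added point. Vertices 1 and 2 and a limit of 0 algebraic over the length of {1, 2} contribute
    none, so n vertices carry at most 2(n - 3) moduli, against 2n - 5 independent lengths, which are
    constants and so equal their own residues.

    Dimensions are transcendence degrees, counted by Steinitz exchange; generic means algebraically
    independent over a countable algebraically closed subfield. *)

Definition subring (A : nzRingType) (S : set A) :=
  [/\ S 1, forall x y, S x -> S y -> S (x - y) & forall x y, S x -> S y -> S (x * y)].

Definition pov (A : nzRingType) (S : set A) (p : {poly A}) := forall i, S p`_i.

(** * Subrings and polynomials with coefficients in them *)

Section Subrings.
Variable A : comNzRingType.
Implicit Types (S : set A) (p q : {poly A}).

Variable S : set A.
Hypothesis HS : subring S.

Lemma subring1 : S 1. Proof. by case: HS. Qed.
Lemma subringB x y : S x -> S y -> S (x - y). Proof. by case: HS => _ + _; apply. Qed.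
Lemma subringM x y : S x -> S y -> S (x * y). Proof. by case: HS => _ _; apply. Qed.
Lemma subring0 : S 0. Proof. by rewrite -(subrr 1); apply: subringB; apply: subring1. Qed.
Lemma subringN x : S x -> S (- x).
Proof. by move=> Sx; rewrite -sub0r; apply: subringB => //; apply: subring0. Qed.
Lemma subringD x y : S x -> S y -> S (x + y).
Proof. by move=> Sx Sy; rewrite -[y]opprK; apply: subringB => //; apply: subringN. Qed.
Lemma subringX x n : S x -> S (x ^+ n).
Proof.
move=> Sx; elim: n => [|n IH]; first by rewrite expr0; apply: subring1.
by rewrite exprS; apply: subringM.
Qed.
Lemma subring_nat n : S n%:R.
Proof.
elim: n => [|n IH]; first exact: subring0.
by rewrite -addn1 natrD; apply: subringD => //; apply: subring1.
Qed.
Lemma subring_sum I (r : seq I) (P : pred I) (f : I -> A) :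
  (forall i, P i -> S (f i)) -> S (\sum_(i <- r | P i) f i).
Proof. by move=> h; apply: big_ind => //; [exact: subring0 | exact: subringD]. Qed.
Lemma subring_prod I (r : seq I) (P : pred I) (f : I -> A) :
  (forall i, P i -> S (f i)) -> S (\prod_(i <- r | P i) f i).
Proof. by move=> h; apply: big_ind => //; [exact: subring1 | exact: subringM]. Qed.

Lemma pov0 : pov S 0. Proof. by move=> i; rewrite coef0; apply: subring0. Qed.
Lemma povC c : S c -> pov S c%:P.
Proof. by move=> Sc i; rewrite coefC; case: ifP => // _; apply: subring0. Qed.
Lemma povX : pov S 'X.
Proof. by move=> i; rewrite coefX; apply: subring_nat. Qed.
Lemma povD p q : pov S p -> pov S q -> pov S (p + q).
Proof. by move=> Sp Sq i; rewrite coefD; apply: subringD. Qed.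
Lemma povB p q : pov S p -> pov S q -> pov S (p - q).
Proof. by move=> Sp Sq i; rewrite coefB; apply: subringB. Qed.
Lemma povM p q : pov S p -> pov S q -> pov S (p * q).
Proof.
move=> Sp Sq i; rewrite coefM; apply: subring_sum => j _; exact: subringM.
Qed.
Lemma povZ c p : S c -> pov S p -> pov S (c *: p).
Proof. by move=> Sc Sp i; rewrite coefZ; apply: subringM. Qed.
Lemma povXn n : pov S 'X^n.
Proof. by move=> i; rewrite coefXn; apply: subring_nat. Qed.
Lemma pov_subring : subring [set p | pov S p].
Proof.
split=> /=; first exact/povC/subring1.
  exact: povB.
exact: povM.
Qed.
Lemma pov_horner p x : pov S p -> S x -> S p.[x].
Proof.
move=> Sp Sx; rewrite horner_coef; apply: subring_sum => i _.
by apply: subringM => //; apply: subringX.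
Qed.
Lemma pov_deriv p : pov S p -> pov S p^`().
Proof. by move=> Sp i; rewrite coef_deriv -mulr_natr; apply: subringM => //; apply: subring_nat. Qed.

Lemma subring_adj x : subring [set p.[x] | p in [set p | pov S p]].
Proof.
split=> [|_ _ [p /= Sp <-] [q /= Sq <-]|_ _ [p /= Sp <-] [q /= Sq <-]].
- by exists 1; rewrite ?hornerC //; apply/povC/subring1.
- by exists (p - q); rewrite ?hornerD ?hornerN //; apply: povB.
- by exists (p * q); rewrite ?hornerM //; apply: povM.
Qed.

(** Each step multiplies by the leading coefficient of [q] instead of dividing by it, so that all
    coefficients stay in the subring. *)
Lemma pseudo_div p q : pov S p -> pov S q -> q != 0 ->
  exists k h r, [/\ pov S h, pov S r,
    (lead_coef q ^+ k) *: p = h * q + r & (size r < size q)%N].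
Proof.
move=> Sp Sq q0; have [n] := ubnP (size p); elim: n p Sp => // n IH p Sp pn.
have [pq|qp] := ltnP (size p) (size q).
  exists 0%N, 0, p; split=> //; first exact: pov0.
  by rewrite expr0 scale1r mul0r add0r.
have sq : (0 < size q)%N by rewrite size_poly_gt0.
have sp : (0 < size p)%N by apply: leq_trans qp.
pose d := (size p - size q)%N.
pose c := lead_coef p *: 'X^d : {poly A}.
have Sc : pov S c by apply: povZ; [exact: Sp | exact: povXn].
pose p' := lead_coef q *: p - c * q.
have Sp' : pov S p' by apply: povB; [apply: povZ => //; exact: Sq | exact: povM].
have sp' : (size p' < size p)%N.
  rewrite -[ltnRHS](prednK sp) ltnS; apply/leq_sizeP => j jp.
  have dj : (j < d)%N = false.
    apply/negbTE; rewrite -leqNgt /d; apply: leq_trans jp.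
    by rewrite -subn1 leq_sub2l.
  rewrite coefB coefZ /c -scalerAl coefZ coefXnM dj.
  have [->|pj] := eqVneq j (size p).-1.
    have -> : ((size p).-1 - d = (size q).-1)%N.
      rewrite /d; move: sp sq qp; move: (size p) (size q) => a b; lia.
    by rewrite -!lead_coefE mulrC subrr.
  have pj' : (size p <= j)%N by rewrite -(prednK sp) ltn_neqAle eq_sym pj.
  have qj : (size q <= j - d)%N.
    rewrite /d; move: sp sq qp pj'; move: (size p) (size q) => a b; lia.
  by rewrite (nth_default 0 pj') (nth_default 0 qj) !mulr0 subrr.
have [|k [h [r [Sh Sr E sr]]]] := IH p' Sp'; first exact: leq_trans sp' pn.
exists k.+1, (lead_coef q ^+ k *: c + h), r; split=> //.
  by apply: povD => //; apply: povZ => //; apply: subringX; apply: Sq.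
have -> : lead_coef q ^+ k.+1 *: p = lead_coef q ^+ k *: p' + lead_coef q ^+ k *: (c * q).
  by rewrite /p' -scalerDr subrK scalerA -exprSr.
by rewrite E mulrDl scalerAl addrC addrA.
Qed.

End Subrings.

Lemma pov_sub (A : comNzRingType) (S T : set A) (p : {poly A}) : S `<=` T -> pov S p -> pov T p.
Proof. by move=> ST Sp i; apply: ST. Qed.

(** Zorn's lemma. The last clause is maximality, since the adjunction of such an [x] keeps [Q]. It
    serves for isomorphisms as well as for places. *)
Lemma max_subring (A : comNzRingType) (S0 : set A) (Q : A -> Prop) :
  subring S0 -> (forall a, S0 a -> Q a) ->
  exists S, [/\ S0 `<=` S, subring S, forall a, S a -> Q a &
    forall x, (forall p, pov S p -> Q p.[x]) -> S x].
Proof.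
move=> H0 Q0; pose good S := subring S /\ forall a, S a -> Q a.
(* The union with [S0] makes the empty chain harmless. *)
have [|M [[HM QM] max]] := @Zorn_bigcup A (fun X => good (S0 `|` X)).
  move=> C CP Ctot; have [Ce|/set0P[X0 CX0]] := eqVneq C set0.
    by rewrite Ce bigcup_set0 setU0; split.
  have mem2 x y : (S0 `|` \bigcup_(X in C) X) x -> (S0 `|` \bigcup_(X in C) X) y ->
      exists2 X, C X & (S0 `|` X) x /\ (S0 `|` X) y.
    move=> [Sx|[X CX Xx]] [Sy|[Y CY Yy]].
    - by exists X0 => //; split; left.
    - by exists Y => //; split; [left|right].
    - by exists X => //; split; [right|left].
    - have [XY|YX] := Ctot X Y CX CY.
        by exists Y => //; split; right=> //; apply: XY.
      by exists X => //; split; right=> //; apply: YX.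
  have up X x : C X -> (S0 `|` X) x -> (S0 `|` \bigcup_(X in C) X) x.
    by move=> CX [Sx|Xx]; [left|right; exists X].
  split; first split.
  - by left; case: H0.
  - move=> x y Sx Sy; have [X CX [Xx Xy]] := mem2 x y Sx Sy.
    by apply: (up X) => //; have [HX _] := CP X CX; apply: subringB.
  - move=> x y Sx Sy; have [X CX [Xx Xy]] := mem2 x y Sx Sy.
    by apply: (up X) => //; have [HX _] := CP X CX; apply: subringM.
  - move=> x Sx; have [X CX [Xx _]] := mem2 x x Sx Sx.
    by have [_ QX] := CP X CX; apply: QX.
pose S := S0 `|` M; exists S; split=> // [|x Qx]; first exact: subsetUl.
apply: contrapT => Sx; pose T := [set p.[x] | p in [set p | pov S p]].
have ST : S `<=` T by move=> a Sa; exists a%:P; rewrite ?hornerC //=; apply: povC.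
have Tx : T x by exists 'X; rewrite ?hornerX //=; apply: povX.
apply: (max T).
  rewrite properEneq; split; last by apply: subset_trans ST; apply: subsetUr.
  by apply/eqP => MT; apply: Sx; right; rewrite MT.
have -> : S0 `|` T = T by apply/setUidPr; apply: subset_trans ST; apply: subsetUl.
by split; [apply: subring_adj | move=> _ [p Sp <-]; apply: Qx].
Qed.

(** * Fraction fields inside a field *)

Section Frac.
Variables (F : fieldType) (S : set F).
Hypothesis HS : subring S.

Definition fracs : set F := [set x | exists a b, [/\ S a, S b, b != 0 & x = a / b]].
Definition fracsp : {pred F} := [pred x | x \in fracs].

Fact fracsp_divring : divring_closed fracsp.
Proof.
split=> [|x y|x y].
- by rewrite !inE; exists 1, 1; rewrite divr1 oner_neq0; split=> //; apply: subring1.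
- rewrite !inE => -[a [b [Sa Sb b0 ->]]] [c [d [Sc Sd d0 ->]]].
  exists (a * d - c * b), (b * d); rewrite mulf_neq0 //; split=> //.
  + by apply: (subringB HS); apply: (subringM HS).
  + exact: (subringM HS).
  + by field; rewrite b0 d0.
- rewrite !inE => -[a [b [Sa Sb b0 ->]]] [c [d [Sc Sd d0 ->]]].
  have [->|c0] := eqVneq c 0.
    rewrite mul0r invr0 mulr0; exists 0, 1; rewrite mul0r oner_neq0; split=> //;
    [exact: subring0 | exact: subring1].
  exists (a * d), (b * c); rewrite mulf_neq0 //; split=> //.
  + exact: (subringM HS).
  + exact: (subringM HS).
  + by field; rewrite b0 c0 d0.
Qed.

End Frac.

(* The proof that [S] is a subring is kept in the type so that the field
   structure can be inferred. *)
Definition fract (F : fieldType) (S : set F) (HS : subring S) := {x : F | fracsp S x}.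

Section FracField.
Variables (F : fieldType) (S : set F) (HS : subring S).
HB.instance Definition _ := GRing.isDivringClosed.Build F (fracsp S) (fracsp_divring HS).
HB.instance Definition _ := SubChoice.on (fract HS).
HB.instance Definition _ := [SubChoice_isSubIntegralDomain of fract HS by <:].
HB.instance Definition _ := [SubIntegralDomain_isSubField of fract HS by <:].
End FracField.

(** * Algebraically closed subfields and algebraic independence *)

Definition alg (F : fieldType) (S : set F) : set F :=
  [set y | exists p, [/\ pov S p, p != 0 & root p y]].

(** Closure under inverses follows from closure under roots: the inverse of x is the root of x X -
    1. *)
Definition acf (F : fieldType) (S : set F) :=
  subring S /\ forall p y, pov S p -> p != 0 -> root p y -> S y.

Section Alg.
Variables (F : fieldType) (S : set F).
Hypothesis HS : subring S.

Let ftoF : {rmorphism fract HS -> F} := val.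

Lemma frac_sub : S `<=` fracs S.
Proof.
by move=> x Sx; exists x, 1; rewrite divr1 oner_neq0; split=> //; apply: subring1.
Qed.

Lemma frac_lift p : pov (fracs S) p -> exists q : {poly fract HS}, map_poly ftoF q = p.
Proof.
move=> Sp; exists (\poly_(i < size p) (insubd 0 p`_i)); apply/polyP => i.
rewrite coef_map coef_poly; case: ltnP => pi; last by rewrite nth_default.
by rewrite /ftoF /= insubdK // unfold_in /= inE.
Qed.

Lemma frac_denom p : pov (fracs S) p -> exists d, [/\ S d, d != 0 & pov S (d *: p)].
Proof.
move=> Sp; suff [d [Sd d0 Sdp]] : exists d, [/\ S d, d != 0 &
    forall i, (i < size p)%N -> S (d * p`_i)].
  exists d; split=> // i; rewrite coefZ; have [/Sdp//|pi] := ltnP i (size p).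
  by rewrite nth_default // mulr0; apply: subring0.
elim: (size p) => [|n [d [Sd d0 Sdp]]].
  by exists 1; rewrite oner_neq0; split=> //; apply: subring1.
have [a [b [Sa Sb b0 E]]] := Sp n; exists (d * b); rewrite mulf_neq0 //; split=> //.
  exact: (subringM HS).
move=> i; rewrite ltnS leq_eqVlt => /orP[/eqP->|ni].
  rewrite E -mulrA [b * _]mulrC divfK //; exact: (subringM HS).
rewrite mulrAC; apply: (subringM HS) => //; exact: Sdp.
Qed.

(** Clearing denominators identifies [alg] with algebraicity over the fraction field, which gives
    access to the closure of algebraic elements under ring operations and roots. *)
Lemma algP y : algebraicOver ftoF y <-> alg S y.
Proof.
split=> [[p p0 py]|[p [Sp p0 py]]].
  have [|d [Sd d0 Sdp]] := @frac_denom (map_poly ftoF p).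
    move=> i; rewrite coef_map /=; have := valP p`_i.
    by rewrite /fracsp /= inE.
  exists (d *: map_poly ftoF p); rewrite scaler_eq0 negb_or d0 map_poly_eq0 p0; split=> //.
  by rewrite rootZ.
have [q E] := @frac_lift p (pov_sub frac_sub Sp).
by exists q; rewrite ?E // -(map_poly_eq0 ftoF) E.
Qed.

Lemma alg_acf : acf (alg S).
Proof.
split; first split=> [|x y|x y].
- exact/algP/algebraic1.
- by move=> /algP Sx /algP Sy; apply/algP/algebraic_sub.
- by move=> /algP Sx /algP Sy; apply/algP/algebraic_mul.
move=> p y Sp p0 py; apply/algP/integral_algebraic.
apply: (integral_root p0 py) => z /(nthP 0)[i _ <-].
exact/integral_algebraic/algP/Sp.
Qed.

Lemma alg_sub : S `<=` alg S.
Proof.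
move=> x Sx; exists ('X - x%:P); rewrite polyXsubC_eq0 root_XsubC eqxx; split=> //.
by apply: povB => //; [exact: povX | exact: povC].
Qed.
End Alg.

Section ACtheory.
Variable F : numClosedFieldType.
Variable K : set F.
Hypothesis HK : acf K.

Lemma acf_subring : subring K. Proof. by case: HK. Qed.
Local Notation Ks := acf_subring.

Lemma acf_root p y : pov K p -> p != 0 -> root p y -> K y.
Proof. by case: HK => _; apply. Qed.

Lemma acf_horner0 p y : ~ K y -> pov K p -> p.[y] = 0 -> p = 0.
Proof.
move=> Ky Kp py; apply/eqP; apply: contrapT => p0; apply: Ky.
by apply: (acf_root Kp); [exact/negP | exact/rootP].
Qed.

Lemma acf_inv x : K x -> K x^-1.
Proof.
move=> Kx; have [->|x0] := eqVneq x 0; first by rewrite invr0; apply: (subring0 Ks).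
apply: (@acf_root (x *: 'X - 1)).
- apply: (povB Ks); last by apply: (povC Ks); apply: (subring1 Ks).
  by apply: (povZ Ks) => //; apply: (povX Ks).
- apply/eqP => /(congr1 (fun p : {poly F} => p`_0)) /eqP.
  by rewrite coefB coefZ coefX coefC mulr0 coef0 sub0r oppr_eq0 oner_eq0.
- by rewrite rootE !hornerE mulfV // subrr.
Qed.

Lemma acf_div x y : K x -> K y -> K (x / y).
Proof. by move=> Kx Ky; apply: (subringM Ks) => //; apply: acf_inv. Qed.

Lemma acf_split p : pov K p -> p != 0 ->
  exists rs : seq F, (forall r, r \in rs -> K r) /\
    p = lead_coef p *: \prod_(r <- rs) ('X - r%:P).
Proof.
move=> Kp p0; have [rs E] := closed_field_poly_normal p.
exists rs; split=> // r rrs; apply: (acf_root Kp p0).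
by rewrite E rootZ ?lead_coef_eq0 // root_prod_XsubC.
Qed.

Definition adj x : set F := [set p.[x] | p in [set p | pov K p]].

Lemma adj_ring x : subring (adj x). Proof. exact: subring_adj Ks x. Qed.

Lemma adj_sub x : K `<=` adj x.
Proof. by move=> a Ka; exists a%:P; rewrite ?hornerC //=; apply: (povC Ks). Qed.

Lemma adj_gen x : adj x x.
Proof. by exists 'X; rewrite ?hornerX //=; apply: (povX Ks). Qed.

(** The algebraic closure of the field K(x) inside [F]; [adj] is the ring K[x]. *)
Definition cl x : set F := alg (adj x).

Lemma cl_acf x : acf (cl x). Proof. exact/alg_acf/adj_ring. Qed.
Lemma cl_sub x : K `<=` cl x.
Proof. by apply: subset_trans (@adj_sub x) _; apply: alg_sub; apply: adj_ring. Qed.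
Lemma cl_gen x : cl x x. Proof. by apply: alg_sub; [exact: adj_ring | exact: adj_gen]. Qed.

Lemma cl_min x G : acf G -> K `<=` G -> G x -> cl x `<=` G.
Proof.
move=> HG KG Gx y [p [Sp p0 py]]; case: (HG) => Gs Gr; apply: Gr py => // i.
have [q Kq <-] := Sp i; apply: pov_horner => //; exact: pov_sub Kq.
Qed.

(** Lifting the coefficients from K[x] to polynomials gives a relation in two variables. Here and
    below [horner_eval] evaluates the inner variable, and the root concerns the outer one. *)
Lemma cl_rel x y : cl x y -> exists P : {poly {poly F}},
  [/\ pov [set q | pov K q] P, map_poly (horner_eval x) P != 0 &
      root (map_poly (horner_eval x) P) y].
Proof.
case=> p [Sp p0 py].
have [f Hf] : exists f : nat -> {poly F}, forall i, pov K (f i) /\ (f i).[x] = p`_i.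
  have /choice[f Hf] : forall i, exists q : {poly F}, pov K q /\ q.[x] = p`_i.
    by move=> i; have [q Kq E] := Sp i; exists q.
  by exists f.
pose P := \poly_(i < size p) f i.
have E : map_poly (horner_eval x) P = p.
  apply/polyP => i; rewrite coef_map coef_poly /=.
  case: ltnP => pi; first by rewrite /horner_eval; have [] := Hf i.
  by rewrite /horner_eval horner0 nth_default.
exists P; rewrite E; split=> // i; rewrite coef_poly; case: ltnP => _ /=.
  by have [] := Hf i.
exact: (pov0 Ks).
Qed.

Lemma horner_map_eval (P : {poly {poly F}}) x y :
  (map_poly (horner_eval x) P).[y] = (P.[y%:P]).[x].
Proof.
rewrite [RHS](_ : _ = horner_eval x P.[y%:P]) //.
by rewrite -horner_map /= /horner_eval hornerC.
Qed.

Lemma map_horner0 (P : {poly {poly F}}) x : ~ K x -> pov [set q | pov K q] P ->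
  map_poly (horner_eval x) P = 0 -> P = 0.
Proof.
move=> Kx KP P0; apply/polyP => i; rewrite coef0; apply: (acf_horner0 Kx (KP i)).
by have := congr1 (fun q : {poly F} => q`_i) P0; rewrite coef_map coef0.
Qed.

Lemma pov2_swap (P : {poly {poly F}}) :
  pov [set q | pov K q] P -> pov [set q | pov K q] (swapXY P).
Proof. by move=> KP i j; rewrite coef_swapXY; apply: KP. Qed.

(** The relation between x and y is read with its variables swapped; it stays nonzero at y because y
    is transcendental over [K]. *)
Lemma cl_exchange x y : cl x y -> ~ K y -> cl y x.
Proof.
move=> /cl_rel[P [KP P0 Py]] Ky.
have P0' : swapXY P != 0.
  by rewrite swapXY_eq0; apply: contraNneq P0 => ->; rewrite map_poly0.
exists (map_poly (horner_eval y) (swapXY P)); split.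
- by move=> i; rewrite coef_map; exists (swapXY P)`_i => //; apply: pov2_swap.
- apply: contra_neq P0' => E0; apply: map_horner0 E0 => //; exact: pov2_swap.
- by rewrite -[map_poly _ _]horner_swapXY swapXYK rootE -horner_map_eval -rootE.
Qed.
End ACtheory.

Section Span.
Variable F : numClosedFieldType.
Implicit Types (K G : set F) (s b : seq F).

(** The algebraic closure of K(s), the last entry being adjoined first. Accordingly [indep] asks
    each entry to be transcendental over the closure of the later ones. *)
Fixpoint spanf K s : set F := if s is x :: s' then cl (spanf K s') x else K.

Fixpoint indep K s : Prop := if s is x :: s' then ~ spanf K s' x /\ indep K s' else True.

Lemma span_acf K s : acf K -> acf (spanf K s).
Proof. by move=> HK; elim: s => //= x s IH; apply: cl_acf. Qed.

Lemma span_sub K s : acf K -> K `<=` spanf K s.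
Proof.
move=> HK; elim: s => //= x s IH; apply: subset_trans IH _.
by apply: cl_sub; apply: span_acf.
Qed.

Lemma span_mem K s x : acf K -> x \in s -> spanf K s x.
Proof.
move=> HK; elim: s => //= y s IH; rewrite inE => /orP[/eqP->|xs].
  exact/cl_gen/span_acf.
by apply: cl_sub; [exact: span_acf | exact: IH].
Qed.

Lemma span_min K s G : acf G -> K `<=` G -> (forall x, x \in s -> G x) -> spanf K s `<=` G.
Proof.
move=> HG KG; elim: s => //= y s IH sG.
apply: cl_min => //; last by apply: sG; rewrite mem_head.
by apply: IH => x xs; apply: sG; rewrite inE xs orbT.
Qed.

Lemma span_mono K s b : acf K -> (forall x, x \in s -> spanf K b x) -> spanf K s `<=` spanf K b.
Proof. by move=> HK; apply: span_min; [exact: span_acf | exact: span_sub]. Qed.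

Lemma span_subseq K s b : acf K -> {subset s <= b} -> spanf K s `<=` spanf K b.
Proof. by move=> HK sb; apply: span_mono => // x xs; apply: span_mem => //; apply: sb. Qed.

Lemma span_eq K s b : acf K -> s =i b -> spanf K s = spanf K b.
Proof.
by move=> HK sb; apply/seteqP; split; apply: span_subseq => // x; rewrite sb.
Qed.

Lemma span_base K G s : acf K -> acf G -> K `<=` G -> spanf K s `<=` spanf G s.
Proof.
move=> HK HG KG; apply: span_min; first exact: span_acf.
  by apply: subset_trans KG _; apply: span_sub.
by move=> x xs; apply: span_mem.
Qed.

Lemma span_cl K y s : acf K -> spanf (cl K y) s = spanf K (y :: s).
Proof.
move=> HK; apply/seteqP; split.
  apply: span_min; first exact: span_acf.
    apply: cl_min => //; [exact: span_acf| exact: span_sub |exact: span_mem (mem_head _ _)].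
  by move=> x xs; apply: span_mem => //; rewrite inE xs orbT.
apply: span_min; first by apply: span_acf; apply: cl_acf.
  by apply: subset_trans (span_sub _ (cl_acf HK _)); apply: cl_sub.
move=> x; rewrite inE => /orP[/eqP->|xs]; last by apply: span_mem => //; apply: cl_acf.
by apply: span_sub; [exact: cl_acf | exact: cl_gen].
Qed.

Lemma span_cat K s b : acf K -> spanf (spanf K s) b = spanf K (s ++ b).
Proof.
move=> HK; elim: s => [|x s IH] //.
rewrite -[spanf K (x :: s)]/(cl (spanf K s) x) span_cl; last exact: span_acf.
by rewrite -[LHS]/(cl (spanf (spanf K s) b) x) IH.
Qed.

(** The entry traded for [y] is the one whose adjunction first brings [y] into the span. *)
Lemma exchange K s y : acf K -> indep K s -> spanf K s y -> ~ K y ->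
  exists s', [/\ size s = (size s').+1, indep (cl K y) s', {subset s' <= s} &
    spanf (cl K y) s' = spanf K s].
Proof.
move=> HK; have HKy := cl_acf HK y; elim: s => [|x s IH] //= [sx is_] sy Ky.
have [sy'|sy'] := EM (spanf K s y).
  have [s' [E1 E2 E3 E4]] := IH is_ sy' Ky; exists (x :: s'); rewrite /= E4; split=> //.
    by rewrite E1.
  move=> z; rewrite !inE => /orP[->//|/E3 ->]; exact: orbT.
have ind t : indep K t -> ~ spanf K t y -> indep (cl K y) t.
  elim: t => //= z t IHt [zt it] yt; split.
    rewrite span_cl //= => zy; apply: yt; apply: cl_exchange => //; exact: span_acf.
  by apply: IHt => // yt'; apply: yt; apply: cl_sub => //; apply: span_acf.
exists s; split=> //; first exact: ind.
  by move=> z zs; rewrite inE zs orbT.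
rewrite span_cl //=; apply/seteqP; split; apply: cl_min.
- exact/cl_acf/span_acf.
- exact/cl_sub/span_acf.
- by [].
- exact/cl_acf/span_acf.
- exact/cl_sub/span_acf.
- apply: cl_exchange => //; exact: span_acf.
Qed.

Lemma indep_cl K s y : acf K -> indep K s -> ~ spanf K s y -> indep (cl K y) s.
Proof.
move=> HK; elim: s => //= z t IHt [zt it] yt; split.
  rewrite span_cl //= => zy; apply: yt; apply: cl_exchange => //; exact: span_acf.
by apply: IHt => // yt'; apply: yt; apply: cl_sub => //; apply: span_acf.
Qed.

Lemma steinitz K s b : acf K -> indep K s -> (forall x, x \in s -> spanf K b x) ->
  (size s <= size b)%N.
Proof.
elim: b K s => [|y b IH] K s HK is_ sb.
  case: s is_ sb => //= x s [sx _] /(_ x (mem_head _ _)) Kx; case: sx; exact: span_sub.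
have HKy := cl_acf HK y; have sb' x : x \in s -> spanf (cl K y) b x.
  by move=> /sb; rewrite span_cl.
have [sy|sy] := EM (spanf K s y); last first.
  by apply: leqW; apply: IH HKy _ sb'; apply: indep_cl.
have [Ky|Ky] := EM (K y).
  apply: leqW; apply: (IH _ _ HK is_) => x /sb; apply: span_mono => // z.
  by rewrite inE => /orP[/eqP->|zb]; [exact: (span_sub _ HK) | exact: span_mem].
have [s' [-> is' s's _]] := exchange HK is_ sy Ky.
by rewrite ltnS; apply: IH HKy is' _ => x /s's/sb'.
Qed.

Lemma steinitz_span K s b : acf K -> indep K s -> (forall x, x \in s -> spanf K b x) ->
  (size b <= size s)%N -> spanf K b `<=` spanf K s.
Proof.
move=> HK is_ sb bs; apply: span_mono => // y yb; apply: contrapT => ys.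
have := @steinitz K (y :: s) b HK (conj ys is_); rewrite /= => /(_ _)/leq_trans/(_ bs).
rewrite ltnn; apply/not_implyP; split=> // x; rewrite inE => /orP[/eqP->|/sb//].
exact: span_mem.
Qed.

Lemma indep_catE K s b : acf K -> indep K (s ++ b) <-> indep K b /\ indep (spanf K b) s.
Proof.
move=> HK; elim: s => [|x s IH] /=; first by split=> [|[]].
have -> : spanf K (s ++ b) = spanf (spanf K b) s.
  by rewrite span_cat //; apply: span_eq => // z; rewrite !mem_cat orbC.
by rewrite IH; tauto.
Qed.

Lemma indep_perm K s b : acf K -> perm_eq s b -> indep K s -> indep K b.
Proof.
move=> HK; elim: s b => [|x s IH] b; first by move=> /perm_size/esym/eqP/nilP->.
move=> pb /= [xs is_]; have xb : x \in b by rewrite -(perm_mem pb) mem_head.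
case/splitPr: xb pb => b1 b2 pb.
have pb' : perm_eq s (b1 ++ b2).
  by rewrite -(perm_cons x) (permPl pb) perm_catC cat_cons perm_cons perm_catC.
have := IH _ pb' is_; rewrite !indep_catE //= => -[i2 i1].
have xb12 : ~ spanf (spanf K b2) b1 x.
  rewrite span_cat // => xb; apply: xs; move: xb; apply: span_subseq => // z.
  by rewrite (perm_mem pb') !mem_cat orbC.
split; first split=> //.
  by move=> xb; apply: xb12; apply: span_sub => //; apply: span_acf.
by apply: indep_cl => //; apply: span_acf.
Qed.

Lemma indep_subseq K s b : acf K -> indep K (s ++ b) -> indep K s.
Proof.
move=> HK /(@indep_perm _ _ (b ++ s) HK); rewrite perm_catC => /(_ (perm_refl _)).
by rewrite indep_catE // => -[].
Qed.

(** An element of both spans outside [K] could replace one entry on each side, and the whole would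
    be generated by one element too few. *)
Lemma span_capI K s1 s2 : acf K -> indep K (s1 ++ s2) -> spanf K s1 `&` spanf K s2 `<=` K.
Proof.
move=> HK is_ y [y1 y2]; apply: contrapT => Ky.
have i1 := indep_subseq HK is_.
have i2 : indep K s2 by move: is_; rewrite indep_catE // => -[].
have [s1' [E1 _ _ F1]] := exchange HK i1 y1 Ky.
have [s2' [E2 _ _ F2]] := exchange HK i2 y2 Ky.
have := @steinitz K (s1 ++ s2) (y :: s1' ++ s2') HK is_.
rewrite /= !size_cat E1 E2 => /(_ _); rewrite addSn addnS !ltnS ltnn.
move=> H; suff : false by []; apply: H => x; rewrite -[cl _ _]/(spanf K (y :: s1' ++ s2')) mem_cat => /orP[xs|xs].
  have := span_mem HK xs; rewrite -F1 span_cl //; apply: span_subseq => // z.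
  by rewrite !inE mem_cat => /orP[->|->] //; rewrite orbT.
have := span_mem HK xs; rewrite -F2 span_cl //; apply: span_subseq => // z.
by rewrite !inE mem_cat => /orP[->|->] //; rewrite !orbT.
Qed.

(* Two generic points of a plane curve over [spanf K s1] cannot lie on a curve
   over [spanf K s2] whose points have dimension one. *)
Lemma span_cap2 K s1 s2 (a b g : F) : acf K -> indep K (s1 ++ s2) -> indep K [:: b; a] ->
  spanf K s1 a -> spanf K s1 b -> spanf K (g :: s2) a -> spanf K (g :: s2) b -> False.
Proof.
move=> HK is_ iab a1 b1 a2 b2; have [/= ba [Ka _]] := iab.
have i1 := indep_subseq HK is_.
have [s1' [E1 I1 _ F1]] := exchange HK i1 a1 Ka.
have HKa := cl_acf HK a; rewrite -F1 in b1.
have [s1'' [E1' I1' _ F1']] := exchange HKa I1 b1 ba.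
have := @steinitz K (s1 ++ s2) (g :: s1'' ++ s2) HK is_.
rewrite /= !size_cat E1 E1' => H; suff : false by [].
rewrite -(ltnn (size s1'' + size s2).+1); apply: H => x.
rewrite -[cl _ _]/(spanf K (g :: s1'' ++ s2)) mem_cat => /orP[xs|xs]; last first.
  by apply: span_mem => //; rewrite inE mem_cat xs !orbT.
have := span_mem HK xs; rewrite -F1 -F1' span_cl // span_cl //.
apply: span_mono => // z; rewrite !inE => /or3P[/eqP->|/eqP->|zs].
- by move: a2; apply: span_subseq => // z'; rewrite !inE mem_cat => /orP[->//|->]; rewrite !orbT.
- by move: b2; apply: span_subseq => // z'; rewrite !inE mem_cat => /orP[->//|->]; rewrite !orbT.
- by apply: span_mem => //; rewrite inE mem_cat zs !orbT.
Qed.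
End Span.

(** * Isomorphisms between subfields *)

Lemma min_size (A : nzRingType) (Pr : {poly A} -> Prop) :
  (exists P, Pr P) -> exists P, Pr P /\ forall Q, Pr Q -> (size P <= size Q)%N.
Proof.
move=> [P0 HP0]; pose pn n := `[< exists P, Pr P /\ size P = n >].
have [|n /asboolP[P [HP En]] nmin] := @ex_minnP pn.
  by exists (size P0); apply/asboolP; exists P0.
exists P; split=> // Q HQ; rewrite En; apply: nmin; apply/asboolP; by exists Q.
Qed.

Section PartialIso.
Variable F : numClosedFieldType.
Implicit Types (G : set (F * F)) (P Q : {poly (F * F)}) (p q : {poly F}).

(* Graphs of isomorphisms between subrings of F, as subrings of F * F. *)
Definition piso G := subring G /\ forall a, G a -> (a.1 = 0 <-> a.2 = 0).

Definition dom G : set F := [set x | exists y, G (x, y)].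
Definition cod G : set F := [set y | exists x, G (x, y)].

Definition prel G p q := forall i, G (p`_i, q`_i).

Let pr1 P := map_poly fst P.
Let pr2 P := map_poly snd P.

Lemma prelP G p q : prel G p q -> exists P, [/\ pov G P, pr1 P = p & pr2 P = q].
Proof.
move=> Gpq; exists (\poly_(i < maxn (size p) (size q)) (p`_i, q`_i)).
have E i : (\poly_(i < maxn (size p) (size q)) (p`_i, q`_i) : {poly F * F})`_i = (p`_i, q`_i).
  rewrite coef_poly; case: ltnP => //; rewrite geq_max => /andP[pi qi].
  by rewrite !nth_default.
by split; [move=> i; rewrite E | apply/polyP => i; rewrite coef_map E..].
Qed.

Lemma pov_prel G P : pov G P -> prel G (pr1 P) (pr2 P).
Proof. by move=> GP i; rewrite !coef_map /=; case: (P`_i) (GP i). Qed.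

Section Piso.
Variable G : set (F * F).
Hypothesis HG : piso G.

Let Gs : subring G := HG.1.

Lemma piso0 a : G a -> (a.1 == 0) = (a == 0) /\ (a.2 == 0) = (a == 0).
Proof.
case: a => x y Ga; have [/= h1 h2] := HG.2 _ Ga.
have [x0|x0] := eqVneq x 0.
  by rewrite x0 (h1 x0) /= eqxx; split; apply/esym/eqP.
have [y0|y0] := eqVneq y 0; first by rewrite h2 ?eqxx in x0.
by split; apply/esym/negbTE/eqP => -[E1 E2]; [rewrite E1 eqxx in x0|rewrite E2 eqxx in y0].
Qed.

Lemma size_pr1 P : pov G P -> size (pr1 P) = size P.
Proof.
move=> GP; have [->|P0] := eqVneq P 0; first by rewrite /pr1 map_poly0 !size_poly0.
apply: size_poly_eq => //; rewrite -?lead_coefE.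
by rewrite (piso0 (GP _)).1 -lead_coefE lead_coef_eq0.
Qed.

Lemma size_pr2 P : pov G P -> size (pr2 P) = size P.
Proof.
move=> GP; have [->|P0] := eqVneq P 0; first by rewrite /pr2 map_poly0 !size_poly0.
apply: size_poly_eq => //; rewrite -?lead_coefE.
by rewrite (piso0 (GP _)).2 -lead_coefE lead_coef_eq0.
Qed.

Lemma piso_fun x y y' : G (x, y) -> G (x, y') -> y = y'.
Proof.
move=> G1 G2; apply/eqP; rewrite -subr_eq0; apply/eqP.
have [/= + _] := HG.2 _ (subringB Gs G1 G2); apply; exact: subrr.
Qed.

Lemma piso_inj x x' y : G (x, y) -> G (x', y) -> x = x'.
Proof.
move=> G1 G2; apply/eqP; rewrite -subr_eq0; apply/eqP.
have [/= _] := HG.2 _ (subringB Gs G1 G2); apply; exact: subrr.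
Qed.

(** From x to y by pseudo-division by the minimal [P]. For the converse take a minimal relation [R]
    at y. Up to a constant, [P] is a product h R, so x is a root of [R] or of h; in the second case
    minimality of [P] makes [R] constant. *)
Lemma adjoin P x y : pov G P -> P != 0 -> (pr1 P).[x] = 0 -> (pr2 P).[y] = 0 ->
  (forall Q, pov G Q -> Q != 0 -> (pr1 Q).[x] = 0 -> (size P <= size Q)%N) ->
  forall Q, pov G Q -> ((pr1 Q).[x] = 0 <-> (pr2 Q).[y] = 0).
Proof.
move=> GP P0 Px Py Pmin.
have lcE Q k : pov G Q -> Q != 0 -> (lead_coef Q ^+ k).1 != 0 /\ (lead_coef Q ^+ k).2 != 0.
  move=> GQ Q0; have [E1 E2] := piso0 (GQ (size Q).-1).
  rewrite !(rmorphXn fst, rmorphXn snd) /= !expf_eq0 /= -lead_coefE in E1 E2 *.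
  by rewrite E1 E2 lead_coef_eq0 (negPf Q0) !andbF.
have evZ a Q : (pr1 (a *: Q)).[x] = a.1 * (pr1 Q).[x] /\ (pr2 (a *: Q)).[y] = a.2 * (pr2 Q).[y].
  by rewrite /pr1 /pr2 !map_polyZ !hornerZ.
have evD Q R S : (pr1 (Q * R + S)).[x] = (pr1 Q).[x] * (pr1 R).[x] + (pr1 S).[x] /\
     (pr2 (Q * R + S)).[y] = (pr2 Q).[y] * (pr2 R).[y] + (pr2 S).[y].
  by rewrite /pr1 /pr2 !rmorphD !rmorphM /= !hornerE.
move=> Q GQ; split=> [Qx|Qy].
  have [k [h [r [Gh Gr E sr]]]] := pseudo_div Gs GQ GP P0.
  have r0 : r = 0.
    apply/eqP; apply: contraTT sr => r0; rewrite -leqNgt; apply: Pmin => //.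
    have := (evD h P r).1; rewrite -E (evZ _ _).1 Qx Px !mulr0 add0r; by move->.
  have := (evD h P r).2; rewrite -E (evZ _ _).2 Py r0 mulr0 add0r /pr2 map_poly0 horner0.
  by move/eqP; rewrite mulf_eq0 (negPf (lcE P k GP P0).2) => /eqP.
have [|R [[GR R0 Ry] Rmin]] := @min_size _ (fun R => [/\ pov G R, R != 0 & (pr2 R).[y] = 0]).
  by exists P.
have Rdiv T : pov G T -> (pr2 T).[y] = 0 -> exists k h, pov G h /\ lead_coef R ^+ k *: T = h * R.
  move=> GT Ty; have [k [h [r [Gh Gr E sr]]]] := pseudo_div Gs GT GR R0.
  have r0 : r = 0.
    apply/eqP; apply: contraTT sr => r0; rewrite -leqNgt; apply: Rmin => //; split=> //.
    have := (evD h R r).2; rewrite -E (evZ _ _).2 Ty Ry !mulr0 add0r; by move->.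
  by exists k, h; rewrite E r0 addr0.
suff Rx : (pr1 R).[x] = 0.
  have [k [h [Gh E]]] := Rdiv _ GQ Qy; have := (evZ (lead_coef R ^+ k) Q).1.
  rewrite E; have := (evD h R 0).1; rewrite addr0 /pr1 map_poly0 horner0 addr0 -/pr1 => ->.
  rewrite Rx mulr0 => /esym/eqP; rewrite mulf_eq0 (negPf (lcE R k GR R0).1) => /eqP//.
have [k [h [Gh E]]] := Rdiv _ GP Py.
have : (pr1 (lead_coef R ^+ k *: P)).[x] = (pr1 (h * R)).[x] by rewrite E.
rewrite (evZ _ _).1 Px mulr0 /pr1 rmorphM /= hornerM => /esym/eqP.
rewrite mulf_eq0 => /orP[/eqP hx|/eqP//].
have GcP : pov G (lead_coef R ^+ k *: P).
  by apply: (povZ Gs) => //; apply: (subringX Gs); apply: GR.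
have sE : size (pr1 (lead_coef R ^+ k *: P)) = size P.
  by rewrite /pr1 map_polyZ /= size_scale ?size_pr1 //; have [] := lcE R k GR R0.
have h0 : h != 0.
  apply: contraTneq P0 => h0; rewrite -size_poly_eq0 -sE E h0 mul0r /pr1 map_poly0.
  by rewrite size_poly0 negbK.
have := Pmin h Gh h0 hx; rewrite -sE E /pr1 rmorphM /= size_mul; last first.
- by rewrite -size_poly_eq0 size_pr1 // size_poly_eq0.
- by rewrite -size_poly_eq0 size_pr1 // size_poly_eq0.
rewrite !size_pr1 //; have : (0 < size h)%N by rewrite size_poly_gt0.
have : (0 < size R)%N by rewrite size_poly_gt0.
move: R Ry GR R0 {Rdiv Rmin E GcP sE} => R Ry GR R0 sR sh ss.
have /eqP/size_poly1P[c c0 ERc] : size (pr2 R) = 1%N.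
  rewrite size_pr2 //; move: sR sh ss; move: (size h) (size R) => a b; lia.
by rewrite ERc hornerC in Ry; rewrite Ry eqxx in c0.
Qed.

Lemma pair_horner P x y : P.[(x, y)] = ((pr1 P).[x], (pr2 P).[y]).
Proof.
have E1 : (pr1 P).[x] = P.[(x, y)].1 := horner_map fst P (x, y).
have E2 : (pr2 P).[y] = P.[(x, y)].2 := horner_map snd P (x, y).
by rewrite E1 E2 -surjective_pairing.
Qed.
End Piso.

Lemma piso_adj G x y : subring G ->
  (forall p q, prel G p q -> (p.[x] = 0 <-> q.[y] = 0)) ->
  piso [set P.[(x, y)] | P in [set P | pov G P]].
Proof.
move=> Gs H; split; first exact: subring_adj.
by move=> _ [P GP <-]; rewrite pair_horner; apply: H; apply: pov_prel.
Qed.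

(** A maximal graph has an algebraically closed domain: the conjugate of the minimal relation of x
    has a root, and x can be sent there. *)
Lemma piso_root G x : piso G -> alg (dom G) x -> ~ dom G x ->
  (forall y, (forall p q, prel G p q -> (p.[x] = 0 <-> q.[y] = 0)) -> G (x, y)) -> False.
Proof.
move=> HG [p [dp p0 px]] Gx max.
have /choice[f Hf] : forall i, exists y, G (p`_i, y) by exact: dp.
have [|P [[GP P0 Px] Pmin]] := @min_size _ (fun P => [/\ pov G P, P != 0 & (pr1 P).[x] = 0]).
  have [|P [GP EP1 _]] := @prelP G p (\poly_(i < size p) f i).
    move=> i; rewrite coef_poly; case: ltnP => // pi.
    by rewrite nth_default //; apply: (subring0 HG.1).
  exists P; split=> //; last by rewrite EP1; apply/rootP.
  by apply: contraNneq p0 => P0; rewrite -EP1 P0 /pr1 map_poly0.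
have sP : size (pr2 P) != 1%N.
  rewrite (size_pr2 HG) // -(size_pr1 HG) //; apply/eqP => /eqP/size_poly1P[c c0 E].
  by rewrite E hornerC in Px; rewrite Px eqxx in c0.
have [y /rootP Py] := closed_rootP (pr2 P) sP.
apply: Gx; exists y; apply: max => a b /prelP[Q [GQ <- <-]].
apply: (adjoin HG GP) => // R GR R0 Rx; exact: Pmin.
Qed.

Lemma piso_sym G : piso G -> piso [set a | G (a.2, a.1)].
Proof.
move=> HG; split; first split=> [|x y|x y] /=.
- exact: (subring1 HG.1).
- exact: (subringB HG.1).
- exact: (subringM HG.1).
by move=> a Ga; have [h1 h2] := HG.2 _ Ga; split.
Qed.

Lemma dom_subring G : piso G -> subring (dom G).
Proof.
move=> [Gs _]; split.
- by exists 1; apply: (subring1 Gs).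
- by move=> x y [x' Gx] [y' Gy]; exists (x' - y'); apply: (subringB Gs Gx Gy).
- by move=> x y [x' Gx] [y' Gy]; exists (x' * y'); apply: (subringM Gs Gx Gy).
Qed.

(** A maximal extension inside F * F. The codomain is algebraically closed by the symmetry of the
    definition. *)
Lemma piso_extend G0 : piso G0 ->
  exists G, [/\ G0 `<=` G, piso G, acf (dom G) & acf (cod G)].
Proof.
move=> [G0s G00].
have [G [sub Gs Gq Gmax]] := max_subring G0s G00.
have HG : piso G by [].
have max x y : (forall p q, prel G p q -> (p.[x] = 0 <-> q.[y] = 0)) -> G (x, y).
  move=> H; apply: Gmax => P GP; rewrite pair_horner /=; apply: H; exact: pov_prel.
exists G; split=> //.
  split; first exact: dom_subring.
  move=> p x dp p0 px; apply: contrapT => Gx; apply: (piso_root HG _ Gx (max x)).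
  by exists p.
have HG' := piso_sym HG; split; first exact: (dom_subring HG').
move=> p x dp p0 px; apply: contrapT => Gx; apply: (piso_root HG' _ Gx); first by exists p.
by move=> y H; apply: max => a b Gab; split; apply H.
Qed.

(** Over algebraically closed ends, x and y satisfy no relation, so nothing obstructs sending one to
    the other. *)
Lemma piso_transc G x y : piso G -> acf (dom G) -> acf (cod G) ->
  ~ dom G x -> ~ cod G y ->
  exists G', [/\ G `<=` G', piso G', acf (dom G'), acf (cod G') & G' (x, y)].
Proof.
move=> HG Hd Hc dx cy.
have [|G' [sub HG' Hd' Hc']] := @piso_extend [set P.[(x, y)] | P in [set P | pov G P]].
  apply: (piso_adj HG.1) => p q Gpq.
  have p0q0 : p = 0 <-> q = 0.
    by split=> [p0|q0]; apply/polyP => i; rewrite coef0;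
      have [/= h1 h2] := HG.2 _ (Gpq i); [apply h1; rewrite p0|apply h2; rewrite q0]; rewrite coef0.
  split=> [px|qy].
    have -> : q = 0 by apply p0q0; apply: (acf_horner0 Hd dx) => // i; exists q`_i.
    exact: horner0.
  have -> : p = 0 by apply p0q0; apply: (acf_horner0 Hc cy) => // i; exists p`_i.
  exact: horner0.
exists G'; split=> //.
  by move=> a Ga; apply: sub; exists a%:P; rewrite ?hornerC //=; apply: (povC HG.1).
by apply: sub; exists 'X; rewrite ?hornerX //=; apply: (povX HG.1).
Qed.

Definition idon (S : set F) : set (F * F) := [set a | S a.1 /\ a.2 = a.1].

Lemma piso_id (S : set F) : subring S -> piso (idon S).
Proof.
move=> HS; split; last by move=> [x y] [/= _ ->].
split=> [|[x x'] [y y'] [/= Sx ->] [/= Sy ->]|[x x'] [y y'] [/= Sx ->] [/= Sy ->]].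
- by split; [apply: (subring1 HS)|].
- by split=> //=; apply: (subringB HS).
- by split=> //=; apply: (subringM HS).
Qed.

Lemma piso_sum G I (r : seq I) (Pr : pred I) (f g : I -> F) : piso G ->
  (forall i, Pr i -> G (f i, g i)) -> G (\sum_(i <- r | Pr i) f i, \sum_(i <- r | Pr i) g i).
Proof.
move=> [Gs _] Gfg; elim/big_rec2: _ => [|i x y Pi Gxy]; first exact: (subring0 Gs).
exact: (subringD Gs (Gfg _ Pi) Gxy).
Qed.

Lemma prel_horner G p q x y : piso G -> prel G p q -> G (x, y) -> G (p.[x], q.[y]).
Proof.
move=> HG /prelP[P [GP <- <-]] Gxy; rewrite -pair_horner; exact: (pov_horner HG.1).
Qed.

Lemma prelM G p p' q q' : piso G -> prel G p p' -> prel G q q' -> prel G (p * q) (p' * q').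
Proof.
move=> HG Gp Gq i; rewrite !coefM; apply: piso_sum => // j _.
exact: (subringM HG.1 (Gp _) (Gq _)).
Qed.

Lemma prelXsubC G x y : piso G -> G (x, y) -> prel G ('X - x%:P) ('X - y%:P).
Proof.
move=> HG Gxy i; rewrite !coefB !coefX !coefC; apply: (subringB HG.1 (_ : G (_, _)) (_ : G (_, _))).
  by case: (i == 1%N); [exact: (subring1 HG.1) | exact: (subring0 HG.1)].
by case: ifP => // _; apply: (subring0 HG.1).
Qed.

(* An algebraic element fixed by all isomorphisms over [S] lies in the fraction
   field of [S]: otherwise it has a second conjugate, the characteristic being 0. *)
Lemma galois_fixed (S : set F) y : subring S -> alg S y ->
  (forall G y', piso G -> acf (dom G) -> acf (cod G) -> idon S `<=` G -> G (y, y') -> y' = y) ->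
  fracs S y.
Proof.
move=> HS aS fix_y; have HG := piso_id HS.
have idP P : pov (idon S) P -> pr2 P = pr1 P.
  by move=> GP; apply/polyP => i; rewrite !coef_map /=; have [] := GP i.
have [|P [[GP P0 Py] Pmin]] := @min_size _ (fun P => [/\ pov (idon S) P, P != 0 & (pr1 P).[y] = 0]).
  case: aS => p [Sp p0 py]; have [|P [GP EP1 _]] := @prelP (idon S) p p; first by move=> i; split=> /=.
  exists P; split=> //; last by rewrite EP1; apply/rootP.
  by apply: contraNneq p0 => P0; rewrite -EP1 P0 /pr1 map_poly0.
pose p := pr1 P; have Sp : pov S p by move=> i; rewrite coef_map; have [] := GP i.
have p0 : p != 0 by rewrite -size_poly_eq0 (size_pr1 HG) // size_poly_eq0.
have [rs E] := closed_field_poly_normal p.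
have rsy r : r \in rs -> r = y.
  move=> rrs; have pr0 : p.[r] = 0.
    by apply/rootP; rewrite E rootZ ?lead_coef_eq0 // root_prod_XsubC.
  have [|G [sub HG1 Hd Hc]] := @piso_extend [set P.[(y, r)] | P in [set P | pov (idon S) P]].
    apply: (piso_adj HG.1) => a b /prelP[Q [GQ <- <-]].
    apply: (adjoin HG GP) => //; first by rewrite idP.
    by move=> R GR R0 Ry; apply: Pmin.
  apply: (fix_y G) => //.
    by move=> a Ga; apply: sub; exists a%:P; rewrite ?hornerC //=; apply: (povC HG.1).
  by apply: sub; exists 'X; rewrite ?hornerX //=; apply: (povX HG.1).
have {}rsy : rs = nseq (size rs) y.
  by apply/all_pred1P/allP => r /rsy ->; rewrite /= eqxx.
rewrite rsy big_nseq_cond /= -Monoid.iteropE in E.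
have {}E : p = lead_coef p *: ('X - y%:P) ^+ size rs by [].
have lc0 : lead_coef p != 0 by rewrite lead_coef_eq0.
have [n1|] := eqVneq (size rs) 1%N.
  rewrite n1 expr1 in E; exists (- p`_0), (p`_1); split=> //.
  - by apply: (subringN HS).
  - by rewrite E coefZ coefB coefX coefC subr0 mulr1.
  - rewrite E !coefZ !coefB !coefX !coefC /= subr0 sub0r mulr1 mulrN opprK.
    by rewrite mulrAC mulfV ?mul1r // lead_coef_eq0 -E.
case: (size rs) E => [|[|n]] E // _.
  have := introT rootP Py; rewrite -/p rootE E expr0 hornerZ hornerC mulr1.
  by rewrite (negPf lc0).
(* A multiple root would also be a root of the derivative, which is shorter than the minimal
   relation and nonzero. *)
have Ed : p^`() = lead_coef p *: (('X - y%:P) ^+ n.+1 *+ n.+2).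
  by rewrite {1}E derivZ deriv_exp derivXsubC mul1r.
have : (size P <= size P^`())%N.
  apply: Pmin; split; first exact: (pov_deriv HG.1 GP).
    apply: contraTneq lc0 => dP0; have := congr1 pr1 dP0; rewrite /pr1 -deriv_map map_poly0 -/pr1 -/p Ed.
    move=> /eqP; rewrite scaler_eq0 negbK -mulr_natr mulf_eq0 expf_eq0 polyXsubC_eq0 andbF /=.
    by rewrite -polyC_natr polyC_eq0 pnatr_eq0 orbF.
  by rewrite /pr1 -deriv_map -/pr1 -/p Ed hornerZ hornerMn horner_exp !hornerE subrr expr0n mul0rn mulr0.
by rewrite leqNgt lt_size_deriv.
Qed.
End PartialIso.

(** * Places *)

Section Places.
Variable F : numClosedFieldType.
Implicit Types (K B O : set F) (x y z a b c d w : F) (A : seq F).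

(** A valuation ring over [K] in whose maximal ideal [w] lies. *)
Definition place K w O :=
  [/\ subring O, K `<=` O, O w, ~ O w^-1 & forall x, O x \/ O x^-1].

Section MaxPlace.
Variables (O : set F) (w : F).
Hypotheses (HO : subring O) (Ow : O w) (Owi : ~ O w^-1).
Hypothesis Omax : forall x, (forall p, pov O p -> p.[x] <> w^-1) -> O x.

Let IO : set F := [set w * a | a in O].

(** If adjoining the inverse of u = 1 - w a produced w^-1 as a polynomial in u^-1, multiplication by
    a power of u, which is 1 modulo w, would put w^-1 into [O]. *)
Lemma max_unit a : O a -> O (1 - w * a)^-1.
Proof.
move=> Oa; apply: Omax => p Op; set u := 1 - w * a => pu.
have w0 : w != 0 by apply/eqP => w0; apply: Owi; rewrite w0 invr0; apply: (subring0 HO).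
have u0 : u != 0.
  apply/eqP => u0; apply: Owi; have -> : w^-1 = a; last by [].
  by apply: (mulfI w0); rewrite mulfV //; apply/eqP; rewrite -subr_eq0 -/u u0.
have Ou : O u by apply: (subringB HO); [exact: (subring1 HO) | exact: (subringM HO)].
have [c Oc Ec] : exists2 c, O c & u ^+ size p = 1 - w * c.
  elim: (size p) => [|n [c Oc Ec]].
    by exists 0; [exact: (subring0 HO)|rewrite expr0 mulr0 subr0].
  exists (c + a - w * a * c); last by rewrite exprS Ec /u; ring.
  apply: (subringB HO); first exact: (subringD HO).
  by do 2!apply: (subringM HO) => //.
apply: Owi; have -> : w^-1 = c + u ^+ size p * p.[u^-1].
  by rewrite pu Ec mulrBl mul1r mulrAC mulfV // mul1r addrC subrK.
apply: (subringD HO) => //; rewrite horner_coef mulr_sumr; apply: (subring_sum HO) => i _.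
rewrite mulrCA; apply: (subringM HO) => //.
have -> : u ^+ size p = u ^+ (size p - i) * u ^+ i by rewrite -exprD subnK // ltnW.
by rewrite -mulrA -exprMn mulfV // expr1n mulr1; apply: (subringX HO).
Qed.

(** Chevalley's argument: if neither x nor x^-1 can be adjoined, each satisfies a relation that
    writes 1 with coefficients in the ideal [IO] generated by [w], and two shortest ones contradict
    each other. *)
Lemma max_valuation x : O x \/ O x^-1.
Proof.
apply: contrapT => /not_orP[Ox Oxi].
have w0 : w != 0 by apply/eqP => w0; apply: Owi; rewrite w0 invr0; apply: (subring0 HO).
have ex y : ~ O y -> exists p, pov IO p /\ p.[y] = 1.
  move=> Oy; have /existsNP[p /not_implyP[Op /contrapT py]] :
    ~ (forall p, pov O p -> p.[y] <> w^-1) by move=> /Omax.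
  exists (w *: p); rewrite hornerZ py mulfV //; split=> // i; rewrite coefZ; by exists p`_i.
have ID a b : IO a -> IO b -> IO (a + b).
  by move=> [a' Oa <-] [b' Ob <-]; exists (a' + b'); [exact: (subringD HO)|rewrite mulrDr].
have IM a b : O a -> IO b -> IO (a * b).
  by move=> Oa [b' Ob <-]; exists (a * b'); [exact: (subringM HO)|rewrite mulrCA].
have I0 : IO 0 by exists 0; rewrite ?mulr0 //; apply: (subring0 HO).
have IO' a : IO a -> O a by move=> [a' Oa <-]; apply: (subringM HO).
(* A minimal relation for one of x, x^-1 is shortened with one for the other. *)
have key y p q : y != 0 -> pov IO p -> p.[y] = 1 -> pov IO q -> q.[y^-1] = 1 ->
    (size q <= size p)%N -> exists p', [/\ pov IO p', p'.[y] = 1 & (size p' < size p)%N].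
  move=> y0 Ip py Iq qy qp.
  have p0 : (0 < size p)%N.
    rewrite size_poly_gt0; apply: contraPneq py => ->; rewrite horner0 => /esym/eqP.
    by rewrite oner_eq0.
  set n := (size p).-1; have En : size p = n.+1 by rewrite prednK.
  have [b0 Ob0 Eb0] := Iq 0%N; pose e := (1 - q`_0)^-1.
  have Oe : O e by rewrite /e -Eb0; apply: max_unit.
  have e0 : 1 - q`_0 != 0.
    apply/eqP => e0; apply: Owi; have -> : w^-1 = b0; last by [].
    by apply: (mulfI w0); rewrite mulfV // Eb0; apply/eqP; rewrite -subr_eq0 e0.
  (* Since 1 - q_0 is a unit, the relation for y^-1 expresses y^n by lower powers of y. *)
  pose R := \poly_(i < n) (e * q`_(n - i)).
  have Ry : R.[y] = y ^+ n.
    have := qy; rewrite (@horner_coef_wide _ n.+1) -?En // En big_ord_recl expr0 mulr1 => Eq.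
    rewrite horner_poly (reindex_inj rev_ord_inj) /=.
    have -> : y ^+ n = e * (1 - q`_0) * y ^+ n by rewrite mulVf ?mul1r.
    rewrite -{1}Eq addrAC subrr add0r -mulrA mulr_suml mulr_sumr; apply: eq_bigr => i _.
    rewrite -!mulrA subKn // lift0; congr (_ * (_ * _)); have -> : y ^+ n = y ^+ (n - i.+1) * y ^+ i.+1.
      by rewrite -exprD subnK.
    by rewrite mulrCA -exprMn mulVf // expr1n mulr1.
  have Ia : IO p`_n by exact: Ip.
  exists (\poly_(i < n) p`_i + p`_n *: R); split.
  - move=> i; rewrite coefD coefZ !coef_poly; case: ifP => _; last by rewrite mulr0 addr0.
    apply: (ID); [exact: Ip|]; apply: (IM); [exact: IO'|]; apply: (IM) => //; exact: Iq.
  - rewrite hornerD hornerZ Ry -py [RHS]horner_coef En big_ord_recr /= horner_poly //.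
  - rewrite En ltnS; apply: (leq_trans (size_polyD _ _)); rewrite geq_max size_poly /=.
    by apply: leq_trans (size_scale_leq _ _) _; rewrite size_poly.
have x0 : x != 0 by apply/eqP => x0; apply: Ox; rewrite x0; apply: (subring0 HO).
have [p [[Ip px] pmin]] := min_size (ex _ Ox).
have [q [[Iq qx] qmin]] := min_size (ex _ Oxi).
have [qp|/ltnW pq] := leqP (size q) (size p).
  have [p' [Ip' px' sp']] := key x p q x0 Ip px Iq qx qp.
  by have := pmin p' (conj Ip' px'); rewrite leqNgt sp'.
have [||p' [Ip' px' sp']] := key x^-1 q p _ Iq qx Ip _ pq; rewrite ?invr_eq0 ?invrK //.
by have := qmin p' (conj Ip' px'); rewrite leqNgt sp'.
Qed.
End MaxPlace.

(** The ring K[w] omits w^-1 because [w] is transcendental over [K], and a maximal subring that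
    omits it is a valuation ring. *)
Lemma place_exists K w : acf K -> ~ K w -> exists O, place K w O.
Proof.
move=> HK Kw; have Ks := acf_subring HK.
have w0 : w != 0 by apply/eqP => w0; apply: Kw; rewrite w0; apply: (subring0 Ks).
have [|O [sub HO OQ Omax]] := @max_subring _ (adj K w) (fun a => a <> w^-1) (adj_ring HK w).
  move=> _ [p /= Kp <-] pw.
  have : 'X * p - 1 = 0.
    apply: (acf_horner0 HK Kw); last by rewrite !hornerE pw mulfV ?subrr.
    apply: (povB Ks); first by apply: (povM Ks) => //; apply: (povX Ks).
    by apply: (povC Ks); apply: (subring1 Ks).
  move=> /(congr1 (fun q : {poly F} => q`_0))/eqP.
  by rewrite coefB coefXM coefC coef0 sub0r oppr_eq0 oner_eq0.
have Ow : O w by apply: sub; apply: adj_gen.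
have Owi : ~ O w^-1 by move=> /OQ.
exists O; split=> //; last exact: (max_valuation HO Ow Owi Omax).
by apply: subset_trans sub; apply: adj_sub.
Qed.

Section Valuation.
Variables (O : set F).
Hypotheses (HO : subring O) (OV : forall x, O x \/ O x^-1).

(** The maximal ideal of [O]. Zero is listed apart because its inverse is 0 by convention, an
    element of [O]. *)
Definition mx : set F := [set x | x = 0 \/ ~ O x^-1].

Lemma mx0 : mx 0. Proof. by left. Qed.
Lemma mx_O x : mx x -> O x.
Proof. by move=> [->|Ox]; [exact: (subring0 HO)|case: (OV x)]. Qed.
Lemma mx1 : ~ mx 1.
Proof.
by move=> [/eqP|]; [rewrite oner_eq0|rewrite invr1; apply; apply: (subring1 HO)].
Qed.
Lemma mxN x : mx x -> mx (- x).
Proof.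
move=> [->|Ox]; first by left; rewrite oppr0.
by right; rewrite invrN => /(subringN HO); rewrite opprK.
Qed.
Lemma mxM x y : O x -> mx y -> mx (x * y).
Proof.
move=> Ox my; have [->|x0] := eqVneq x 0; first by left; rewrite mul0r.
case: my => [->|Oy]; first by left; rewrite mulr0.
right=> Oxy; apply: Oy; have -> : y^-1 = x * (x * y)^-1 by rewrite invfM mulVKf.
exact: (subringM HO).
Qed.
Lemma mxMr x y : mx x -> O y -> mx (x * y).
Proof. by rewrite mulrC => mx_ Oy; apply: mxM. Qed.
Lemma mxD x y : mx x -> mx y -> mx (x + y).
Proof.
wlog Oxy : x y / O (x / y) => [H|] hx hy.
  case: (OV (x / y)) => [Oxy|]; first exact: H.
  by rewrite invfM invrK mulrC addrC => Oyx; apply: H.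
have [->|y0] := eqVneq y 0; first by rewrite addr0.
have -> : x + y = (1 + x / y) * y by field.
by apply: mxM => //; apply: (subringD HO) => //; apply: (subring1 HO).
Qed.
Lemma mxB x y : mx x -> mx y -> mx (x - y).
Proof. by move=> hx hy; apply: mxD => //; apply: mxN. Qed.
Lemma NOmx x : ~ O x -> mx x^-1.
Proof. by move=> Ox; right; rewrite invrK. Qed.
Lemma mxNO x : x != 0 -> mx x -> ~ O x^-1.
Proof. by move=> x0 [/eqP|//]; rewrite (negPf x0). Qed.
Lemma NO0 x : ~ O x -> x != 0.
Proof. by move=> Ox; apply/eqP => x0; apply: Ox; rewrite x0; apply: (subring0 HO). Qed.
Lemma mx_unit x : O x -> ~ mx x -> O x^-1.
Proof. by move=> Ox hx; apply: contrapT => Oxi; apply: hx; right. Qed.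
Lemma mx_prime x y : O x -> O y -> mx (x * y) -> mx x \/ mx y.
Proof.
move=> Ox Oy mxy; apply: contrapT => /not_orP[hx hy].
have [x0|x0] := eqVneq x 0; first by apply: hx; left.
apply: hy; have -> : y = x^-1 * (x * y) by rewrite mulKf.
by apply: mxM => //; apply: mx_unit.
Qed.
Lemma NO_mul x y : ~ O x -> O y -> ~ mx y -> ~ O (x * y).
Proof.
move=> Ox Oy hy Oxy; apply: Ox; have y0 : y != 0 by apply/eqP => y0; apply: hy; left.
have -> : x = (x * y) * y^-1 by rewrite mulfK.
by apply: (subringM HO) => //; apply: mx_unit.
Qed.

Section Residues.
Variable K : set F.
Hypotheses (HK : acf K) (KO : K `<=` O).

Lemma K_mx a : K a -> mx a -> a = 0.
Proof. by move=> Ka [->//|Oa]; case: Oa; apply: KO; exact: acf_inv. Qed.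

Lemma res_uniq x a b : K a -> K b -> mx (x - a) -> mx (x - b) -> a = b.
Proof.
move=> Ka Kb ma mb; apply/eqP; rewrite -subr_eq0; apply/eqP; apply: K_mx.
  exact: (subringB (acf_subring HK)).
have -> : a - b = (x - b) - (x - a) by ring.
by apply: mxB.
Qed.

Lemma res_O x a : K a -> mx (x - a) -> O x.
Proof.
by move=> Ka /mx_O h; rewrite -[x](subrK a); apply: (subringD HO) => //; apply: KO.
Qed.

Lemma resB x y a b : mx (x - a) -> mx (y - b) -> mx (x - y - (a - b)).
Proof.
move=> hx hy; have -> : x - y - (a - b) = (x - a) - (y - b) by ring.
exact: mxB.
Qed.
Lemma resM x y a b : K a -> K b -> mx (x - a) -> mx (y - b) -> mx (x * y - a * b).
Proof.
move=> Ka Kb hx hy; have -> : x * y - a * b = y * (x - a) + a * (y - b) by ring.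
by apply: mxD; apply: mxM => //; [exact: res_O hy | exact: KO].
Qed.
Lemma res_unit x a : K a -> a != 0 -> mx (x - a) -> ~ mx x.
Proof.
move=> Ka a0 hx mxx; move/eqP: a0; apply; apply: K_mx => //.
have -> : a = x - (x - a) by ring.
by apply: mxB.
Qed.
Lemma resV x a : K a -> a != 0 -> mx (x - a) -> mx (x^-1 - a^-1).
Proof.
move=> Ka a0 hx; have x0 : x != 0.
  by apply/eqP => x0; apply: (res_unit Ka a0 hx); rewrite x0; left.
have -> : x^-1 - a^-1 = (- (x^-1 * a^-1)) * (x - a) by field; rewrite a0 x0.
apply: mxM => //; apply: (subringN HO); apply: (subringM HO); last by apply: KO; exact: acf_inv.
by apply: mx_unit; [exact: res_O hx | exact: res_unit hx].
Qed.

(** The residue field does not grow. A shortest relation between w and x is not divisible by w, so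
    its part free of w is a nonzero polynomial over [K] that is infinitesimal at x; as it splits
    over [K], one of its factors x - r is infinitesimal. *)
Lemma residue w x : w != 0 -> mx w -> cl K w x -> O x -> exists2 a, K a & mx (x - a).
Proof.
move=> w0 mw xw Ox; have Ks := acf_subring HK.
pose Pr (R : {poly {poly F}}) :=
  [/\ pov [set q | pov K q] R, R != 0 & (map_poly (horner_eval x) R).[w] = 0].
have [|R [[KR R0 Rw] Rmin]] := @min_size _ Pr.
  have [P [KP P0 Px]] := cl_rel HK xw; exists (swapXY P); split; first exact: pov2_swap.
    by rewrite swapXY_eq0; apply: contraNneq P0 => ->; rewrite map_poly0.
  by rewrite horner_map_eval horner_swapXY -[_.[x]]/((map_poly (horner_eval w) P).[x]); apply/rootP.
have [R' ER] : exists R', R = R' * 'X + (R`_0)%:P.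
  have : root (R - (R`_0)%:P) 0 by rewrite rootE !hornerE horner_coef0 subrr.
  by case/factor_theorem=> R'; rewrite subr0 => E; exists R'; rewrite -E subrK.
have KR' : pov [set q | pov K q] R'.
  by move=> i; have := KR i.+1; rewrite ER coefD coefMX coefC addr0.
have ev : (map_poly (horner_eval x) R).[w] = (map_poly (horner_eval x) R').[w] * w + (R`_0).[x].
  by rewrite {1}ER rmorphD rmorphM /= map_polyX map_polyC hornerD hornerMX hornerC.
have p0 : R`_0 != 0.
  apply: contraT => /negPn/eqP R00.
  rewrite R00 addr0 in ER.
  have R'0 : R' != 0 by apply: contraNneq R0 => R'0; rewrite ER R'0 mul0r.
  have : (size R <= size R')%N.
    apply: Rmin; split=> //.
    move/eqP: Rw; rewrite ev R00 horner0 addr0 mulf_eq0 (negPf w0) orbF; by move/eqP.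
  by rewrite ER size_mulX // ltnn.
have Kp := KR 0%N; move: p0 Kp; set p := R`_0 => p0 Kp.
have mp : mx p.[x].
  move/eqP: Rw; rewrite ev addr_eq0 => /eqP Ew.
  rewrite -[p.[x]]opprK -Ew -mulNr; apply: mxM => //; apply: (subringN HO); apply: (pov_horner HO).
    move=> i; rewrite coef_map; apply: (pov_horner HO) => //.
    exact: pov_sub (KR' i).
  exact: mx_O.
have [rs [Krs E]] := acf_split HK Kp p0.
have Klc : K (lead_coef p) by exact: Kp.
have lc0 : ~ mx (lead_coef p) by move=> /(K_mx Klc)/eqP; rewrite lead_coef_eq0 (negPf p0).
move: mp; rewrite E hornerZ horner_prod => mp.
have Ox' r : K r -> O (x - r) by move=> /KO; apply: (subringB HO).
have mq : mx (\prod_(r <- rs) ('X - r%:P).[x]).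
  have [||/lc0//|//] := mx_prime _ _ mp; first exact: KO.
  by rewrite big_seq; apply: (subring_prod HO) => r /Krs; rewrite hornerXsubC; apply: Ox'.
elim: rs Krs mq {E mp} => [|r rs IH] Krs; first by rewrite big_nil => /mx1.
rewrite big_cons hornerXsubC => mp; have Kr : K r by apply: Krs; rewrite mem_head.
have Krs' r' : r' \in rs -> K r' by move=> h; apply: Krs; rewrite inE h orbT.
have [||h|] := mx_prime _ _ mp; first exact: Ox'.
- by rewrite big_seq; apply: (subring_prod HO) => r' /Krs'; rewrite hornerXsubC; apply: Ox'.
- by exists r.
- exact: IH.
Qed.
End Residues.
End Valuation.
End Places.

(** * Limits of point configurations on the projective line *)

Section Control.
Variable F : numClosedFieldType.
Implicit Types (B : set F) (x y z a b c d : F) (A : seq F).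
Variables (O K M : set F).
Hypotheses (HO : subring O) (OV : forall x, O x \/ O x^-1).
Hypotheses (HK : acf K) (KO : K `<=` O) (HM : acf M).
Hypothesis resE : forall x, M x -> O x -> exists2 a, K a & mx O (x - a).

Local Notation mx := (mx O).

(* The residue of x lies in the projective line over B. *)
Definition ctrl B x := (exists2 b, B b & mx (x - b)) \/ ~ O x.

(** The quotient is the cross-ratio of a, b, c and infinity. Control means that the limit shape of
    [A], seen at every scale, is defined over [B]. *)
Definition controls B A :=
  forall a b c, a \in A -> b \in A -> c \in A -> ctrl B ((a - b) / (a - c)).

Lemma ctrl_sub B B' x : B `<=` B' -> ctrl B x -> ctrl B' x.
Proof. by move=> BB' [[b Bb h]|h]; [left; exists b => //; apply: BB'|right]. Qed.

Section Fixed.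
Variable B : set F.
Hypotheses (HB : acf B) (BK : B `<=` K).
Let Bs := acf_subring HB.

Lemma ctrl_mem x : B x -> ctrl B x.
Proof. by move=> Bx; left; exists x; rewrite // subrr; left. Qed.

Lemma ctrl0 : ctrl B 0. Proof. by apply/ctrl_mem/(subring0 Bs). Qed.
Lemma ctrl1 : ctrl B 1. Proof. by apply/ctrl_mem/(subring1 Bs). Qed.

Lemma ctrlV x : ctrl B x -> ctrl B x^-1.
Proof.
move=> [[b Bb h]|h]; last first.
  by left; exists 0; [exact: (subring0 Bs)|rewrite subr0; exact: NOmx].
have [b0|b0] := eqVneq b 0; last first.
  left; exists b^-1; [exact: acf_inv | exact: (resV HO OV HK KO (BK Bb))].
have [->|x0] := eqVneq x 0; first by rewrite invr0; exact: ctrl0.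
by right; apply: mxNO x0 _; rewrite b0 subr0 in h.
Qed.

Lemma ctrl_sub1 x : ctrl B x -> ctrl B (1 - x).
Proof.
move=> [[b Bb h]|h].
  left; exists (1 - b); first by apply: (subringB Bs) => //; apply: (subring1 Bs).
  have -> : 1 - x - (1 - b) = - (x - b) by ring.
  exact: (mxN HO).
right=> Ox; apply: h; have -> : x = 1 - (1 - x) by ring.
by apply: (subringB HO) => //; apply: (subring1 HO).
Qed.

Lemma ctrlZ c x : B c -> ctrl B x -> ctrl B (c * x).
Proof.
move=> Bc [[b Bb h]|h].
  left; exists (c * b); first exact: (subringM Bs).
  by rewrite -mulrBr; apply: (mxM HO) => //; apply/KO/BK.
have [->|c0] := eqVneq c 0; first by rewrite mul0r; apply: ctrl0.
right=> Ocx; apply: h; have -> : x = c^-1 * (c * x) by rewrite mulKf.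
by apply: (subringM HO) => //; apply/KO/BK; apply: acf_inv.
Qed.

Lemma ctrlD c x : B c -> ctrl B x -> ctrl B (x + c).
Proof.
move=> Bc [[b Bb h]|h].
  left; exists (b + c); first exact: (subringD Bs).
  by have -> : x + c - (b + c) = x - b by ring.
right=> Oxc; apply: h; have -> : x = (x + c) - c by ring.
by apply: (subringB HO) => //; apply/KO/BK.
Qed.

Lemma ctrlM x y : O x -> O y -> ctrl B x -> ctrl B y -> ctrl B (x * y).
Proof.
move=> Ox Oy [[a Ba ha]|//] [[b Bb hb]|//].
left; exists (a * b); first exact: (subringM Bs).
by apply: (resM HO OV KO) => //; apply: BK.
Qed.

Lemma mx_ctrl x : mx x -> ctrl B x.
Proof. by move=> h; left; exists 0; [exact: (subring0 Bs)|rewrite subr0]. Qed.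

Lemma ctrl_unit x u : mx (u - 1) -> ctrl B x -> ctrl B (x * u).
Proof.
have K1 : K 1 := subring1 (acf_subring HK).
move=> hu; have Ou : O u by exact: (res_O HO OV KO K1).
have nu : ~ mx u by apply: (res_unit HO OV HK KO K1) hu; rewrite oner_neq0.
have [Ox|nOx _] := EM (O x).
  move=> hx; apply: ctrlM => //; left; exists 1 => //; exact: (subring1 Bs).
by right; apply: (NO_mul HO).
Qed.

Lemma K_ctrl x : K x -> ctrl B x -> B x.
Proof.
move=> Kx [[b Bb h]|]; last by case; apply: KO.
have := K_mx HK KO (subringB (acf_subring HK) Kx (BK Bb)) h.
by move/eqP; rewrite subr_eq0 => /eqP ->.
Qed.

(** The cross-ratio is a product of two controlled ratios. The product is undetermined only if one
    factor is infinitesimal and the other infinite; then it is rewritten as a ratio based at another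
    point, times a unit of residue 1. *)
Lemma ctrl_cross A a b c d : controls B A -> a \in A -> b \in A -> c \in A -> d \in A ->
  a != d -> c != b -> ctrl B (((a - b) * (c - d)) / ((a - d) * (c - b))).
Proof.
move=> CA aA bA cA dA ad cb.
have ad0 : a - d != 0 by rewrite subr_eq0.
have cb0 : c - b != 0 by rewrite subr_eq0.
have [->|ab] := eqVneq a b; first by rewrite subrr !mul0r; exact: ctrl0.
have [->|cd] := eqVneq c d; first by rewrite subrr mulr0 mul0r; exact: ctrl0.
have ab0 : a - b != 0 by rewrite subr_eq0.
have cd0 : c - d != 0 by rewrite subr_eq0.
pose r1 := (a - b) / (a - d); pose r2 := (c - d) / (c - b).
have E : (a - b) * (c - d) / ((a - d) * (c - b)) = r1 * r2.
  by rewrite /r1 /r2; field; rewrite ad0 cb0.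
have C1 : ctrl B r1 by exact: CA.
have C2 : ctrl B r2 by exact: CA.
have m1 u v : mx u -> u + v = 1 -> mx (v - 1).
  move=> h e; have -> : v - 1 = - u by rewrite -e; ring.
  exact: (mxN HO).
have unitV u : mx (u - 1) -> mx (u^-1 - 1).
  have K1 : K 1 := subring1 (acf_subring HK).
  by move/(resV HO OV HK KO K1 (oner_neq0 _)); rewrite invr1.
have unitM u v : mx (u - 1) -> mx (v - 1) -> mx (u * v - 1).
  have K1 : K 1 := subring1 (acf_subring HK).
  by move=> hu hv; have := resM HO OV KO K1 K1 hu hv; rewrite mulr1.
have [O1|O1] := EM (O r1); have [O2|O2] := EM (O r2).
- by rewrite E; apply: ctrlM.
- have [h1|h1] := EM (mx r1); last first.
    by rewrite E mulrC; right; apply: (NO_mul HO).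
  have h2 := NOmx O2.
  have e1 : mx ((b - d) / (a - d) - 1).
    by apply: m1 h1 _; rewrite /r1; field; rewrite ad0.
  have e2 : mx ((b - d) / (c - d) - 1).
    by apply: m1 h2 _; rewrite /r2; field; rewrite cd0 cb0.
  have bd0 : b - d != 0.
    apply: contraPneq e1 => ->; rewrite mul0r sub0r => /(mxN HO); rewrite opprK.
    exact: (mx1 HO).
  have -> : (a - b) * (c - d) / ((a - d) * (c - b)) =
      ((b - a) / (b - c)) * (((b - d) / (a - d)) * ((b - d) / (c - d))^-1).
    by field; rewrite ad0 cb0 bd0 cd0 subr_eq0 eq_sym -subr_eq0 cb0.
  by apply: ctrl_unit; [apply: unitM => //; apply: unitV | apply: CA].
- have [h2|h2] := EM (mx r2); last first.
    by rewrite E; right; apply: (NO_mul HO).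
  have h1 := NOmx O1.
  have e1 : mx ((d - b) / (a - b) - 1).
    by apply: m1 h1 _; rewrite /r1; field; rewrite ad0 ab0.
  have e2 : mx ((d - b) / (c - b) - 1).
    by apply: m1 h2 _; rewrite /r2; field; rewrite cb0.
  have db0 : d - b != 0.
    apply: contraPneq e1 => ->; rewrite mul0r sub0r => /(mxN HO); rewrite opprK.
    exact: (mx1 HO).
  have -> : (a - b) * (c - d) / ((a - d) * (c - b)) =
      ((d - c) / (d - a)) * (((d - b) / (c - b)) * ((d - b) / (a - b))^-1).
    by field; rewrite ad0 cb0 db0 ab0 subr_eq0 eq_sym -subr_eq0 ad0.
  by apply: ctrl_unit; [apply: unitM => //; apply: unitV | apply: CA].
- rewrite E; right=> h; have := O1; apply.
  have r20 := NO0 HO O2; have -> : r1 = (r1 * r2) * r2^-1 by rewrite mulfK.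
  by apply: (subringM HO) => //; apply: (mx_O HO OV); apply: NOmx.
Qed.

End Fixed.

(** The remaining ratios that involve [x] arise from those in the hypothesis by r -> 1/r and r -> 1
    - r. *)
Lemma controls_cons B A x : acf B -> B `<=` K -> controls B A -> x \notin A ->
  (forall c d, c \in A -> d \in A -> c != d -> ctrl B ((x - c) / (d - c))) ->
  controls B (x :: A).
Proof.
move=> HB BK CA xA CX.
have xc c : c \in A -> x - c != 0.
  by move=> cA; rewrite subr_eq0; apply: contraNneq xA => ->.
have c0 := ctrl0 HB; have c1 := ctrl1 HB.
have CX' c d : c \in A -> d \in A -> ctrl B ((x - c) / (d - c)).
  by move=> cA dA; have [->|] := eqVneq c d; [rewrite subrr invr0 mulr0|exact: CX].
move=> a b c; rewrite !inE => /predU1P[->|aA] /predU1P[->|bA] /predU1P[->|cA].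
- by rewrite subrr mul0r.
- by rewrite subrr mul0r.
- by rewrite subrr invr0 mulr0.
- have [->|bc] := eqVneq b c; first by rewrite divff ?xc.
  have -> : (x - b) / (x - c) = (1 - ((x - b) / (c - b))^-1)^-1.
    have cb0 : c - b != 0 by rewrite subr_eq0 eq_sym.
    have xc0 := xc c cA; have xb0 := xc b bA.
    field; rewrite cb0 xb0 /=.
    by have -> : x - b - (c - b) = x - c by ring.
  by apply: ctrlV => //; apply: ctrl_sub1 => //; apply: ctrlV => //; apply: CX'.
- have [->|ax] := eqVneq a x; first by rewrite subrr mul0r.
  by rewrite divff ?subr_eq0.
- have -> : (a - x) / (a - c) = (x - a) / (c - a).
    by rewrite -[a - x]opprB -[a - c]opprB invrN mulrNN.
  exact: CX'.
- have -> : (a - b) / (a - x) = ((x - a) / (b - a))^-1.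
    by rewrite -[a - x]opprB -[a - b]opprB invrN mulrNN invfM invrK mulrC.
  by apply: ctrlV => //; apply: CX'.
- exact: CA.
Qed.

Lemma closest A x a0 : a0 \in A -> x \notin A ->
  exists2 a, a \in A & forall b, b \in A -> O ((x - a) / (x - b)).
Proof.
have K1 := subring1 HO.
elim: A a0 => // b A IH a0 _; rewrite inE negb_or => /andP[xb xA].
have xb0 : x - b != 0 by rewrite subr_eq0.
case: A IH xA => [_ _|c A IH xA].
  by exists b; rewrite ?mem_head // => z; rewrite inE => /eqP ->; rewrite divff.
have [a aA Ha] := IH c (mem_head _ _) xA.
have xa0 : x - a != 0 by rewrite subr_eq0; apply: contraNneq xA => ->.
have [h|] := OV ((x - a) / (x - b)).
  by exists a; [rewrite in_cons aA orbT | move=> z; rewrite in_cons => /predU1P[->|/Ha]].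
rewrite invfM invrK mulrC => h; exists b; rewrite ?mem_head // => z.
rewrite in_cons => /predU1P[->|zA]; first by rewrite divff.
have -> : (x - b) / (x - z) = ((x - b) / (x - a)) * ((x - a) / (x - z)).
  by rewrite mulrA divfK.
by apply: (subringM HO) => //; apply: Ha.
Qed.

(** One more point costs at most one modulus. Let [a] be a point of [A] closest to [x]. If some [b]
    in [A] has the same distance from [a] as [x], the modulus is the residue of (x - a)/(b - a).
    Otherwise [x] opens a scale of its own, on which every ratio tends to 0, 1 or infinity or is
    already controlled. *)
Lemma controls_add B A x : acf B -> B `<=` K -> controls B A ->
  (forall a, a \in A -> M a) -> M x ->
  exists y, [/\ K y & controls (cl B y) (x :: A)].
Proof.
move=> HB BK CA AM Mx.
have Ms := acf_subring HM; have Ks := acf_subring HK; have Bs := acf_subring HB.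
have sub y : B `<=` cl B y by apply: cl_sub.
have cK y : K y -> cl B y `<=` K by apply: cl_min.
have wk y : controls B (x :: A) -> controls (cl B y) (x :: A).
  by move=> C a b c aA bA cA; apply: ctrl_sub (C a b c aA bA cA).
have K0 := subring0 Ks.
have [xA|xA] := boolP (x \in A).
  exists 0; split=> //; apply: wk.
  have h z : z \in x :: A -> z \in A by rewrite inE => /predU1P[->|].
  by move=> a b c /h aA /h bA /h cA; apply: CA.
have xc c : c \in A -> x - c != 0.
  by move=> cA; rewrite subr_eq0; apply: contraNneq xA => ->.
have [A0|[a0 a0A]] : A = [::] \/ exists a0, a0 \in A.
  by case: (A) => [|a0 A']; [left|right; exists a0; rewrite mem_head].
  by exists 0; split=> //; apply: wk; apply: controls_cons => //; rewrite A0.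
have [a aA amin] := closest a0A xA.
have xa0 := xc a aA.
have nmx1 := mx1 HO.
(* Seen from a point [c] that is farther from [x] than [a] is, [x] may be replaced by [a]. *)
have far B' c d : acf B' -> B `<=` B' -> B' `<=` K -> c \in A -> d \in A -> c != d ->
    ~ O ((x - c) / (x - a)) -> ctrl B' ((x - c) / (d - c)).
  move=> HB' BB' B'K cA dA cd h.
  have h' : mx ((x - a) / (x - c)) by rewrite -[_ / _]invrK invfM invrK mulrC; apply: NOmx.
  have ac0 : a - c != 0.
    rewrite subr_eq0; apply: contra_notN h => /eqP <-; rewrite divff //.
    exact: (subring1 HO).
  have xc0 := xc c cA; have cd0 : c - d != 0 by rewrite subr_eq0.
  have dc0 : d - c != 0 by rewrite subr_eq0 eq_sym.
  have -> : (x - c) / (d - c) = ((c - a) / (c - d)) * ((a - c) / (x - c))^-1.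
    by field; rewrite xc0 ac0 cd0 dc0.
  apply: ctrl_unit => //; last by apply: ctrl_sub BB' _; apply: CA.
  have K1 : K 1 := subring1 Ks.
  rewrite -[X in _ - X]invr1; apply: (resV HO OV HK KO K1 (oner_neq0 _)).
  have -> : (a - c) / (x - c) - 1 = - ((x - a) / (x - c)) by field.
  exact: (mxN HO).
have [[b bA [/eqP ba Ob1 Ob2]]|nb] := EM (exists2 b, b \in A &
    [/\ b <> a, O ((x - a) / (b - a)) & O ((b - a) / (x - a))]).
  have ba0 : b - a != 0 by rewrite subr_eq0.
  have [|y Ky hy] := resE _ Ob1.
    by apply: (acf_div HM); apply: (subringB Ms) => //; apply: AM.
  exists y; split=> //; have HBy := cl_acf HB y.
  have BY : cl B y y by apply: cl_gen.
  apply: controls_cons => //; [exact: cK | by move=> *; apply: ctrl_sub (sub y) _; apply: CA|].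
  move=> c d cA dA cd.
  have [h|] := EM (O ((x - c) / (x - a))); last by apply: far => //; apply: cK.
  have cb : ctrl B ((c - a) / (b - a)).
    by rewrite -[c - a]opprB -[b - a]opprB invrN mulrNN; apply: CA.
  have Oc : O ((c - a) / (b - a)).
    have -> : (c - a) / (b - a) = (x - a) / (b - a) - (x - c) / (x - a) * ((x - a) / (b - a)).
      by field; rewrite ba0 xa0.
    by apply: (subringB HO) => //; apply: (subringM HO).
  case: cb => [[e Be he]|//].
  have hx : mx ((x - c) / (b - a) - (y - e)).
    have -> : (x - c) / (b - a) = (x - a) / (b - a) - (c - a) / (b - a) by field.
    exact: (resB HO OV).
  have xc0 := xc c cA; have dc0 : d - c != 0 by rewrite subr_eq0 eq_sym.
  have nx : ~ mx ((x - c) / (b - a)).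
    move=> hm; apply: nmx1.
    have -> : 1 = ((b - a) / (x - a)) * ((x - a) / (x - c)) * ((x - c) / (b - a)).
      by field; rewrite xa0 ba0 xc0.
    by apply: (mxM HO) => //; apply: (subringM HO) => //; apply: amin.
  have Kye : K (y - e) by apply: (subringB Ks) => //; apply: BK.
  have Bye : cl B y (y - e) by apply: (subringB (acf_subring HBy)) => //; apply: sub.
  have ye0 : y - e != 0.
    by apply: contra_notN nx => /eqP ye; move: hx; rewrite ye subr0.
  have cbd : ctrl B ((d - a) / (b - a)).
    by rewrite -[d - a]opprB -[b - a]opprB invrN mulrNN; apply: CA.
  have Edc : (d - c) / (b - a) = (d - a) / (b - a) - (c - a) / (b - a) by field.
  case: cbd => [[f Bf hf]|nO].
    have hd : mx ((d - c) / (b - a) - (f - e)) by rewrite Edc; apply: (resB HO OV).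
    have Kfe : K (f - e) by apply: (subringB Ks); apply: BK.
    have Bfe : cl B y (f - e) by apply: (subringB (acf_subring HBy)); apply: sub.
    have -> : (x - c) / (d - c) = (((d - c) / (b - a)) * ((x - c) / (b - a))^-1)^-1.
      by field; rewrite xc0 dc0 ba0.
    apply: (ctrlV HBy (cK _ Ky)); left; exists ((f - e) * (y - e)^-1).
      by apply: (subringM (acf_subring HBy)) => //; apply: acf_inv.
    apply: (resM HO OV KO) => //; first exact: acf_inv.
    exact: (resV HO OV HK KO).
  have nO' : ~ O ((d - c) / (b - a)).
    move=> hO; apply: nO; rewrite -[_ / _](subrK ((c - a) / (b - a))) -Edc.
    exact: (subringD HO).
  have -> : (x - c) / (d - c) = ((x - c) / (b - a)) * ((d - c) / (b - a))^-1.
    by field; rewrite dc0 ba0.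
  apply: (mx_ctrl HBy); apply: (mxM HO); last exact: NOmx.
  exact: (res_O HO OV KO Kye).
exists 0; split=> //; apply: wk; apply: controls_cons => // c d cA dA cd.
have [h|] := EM (O ((x - c) / (x - a))); last exact: far.
have xc0 := xc c cA; have dc0 : d - c != 0 by rewrite subr_eq0 eq_sym.
pose e := (d - c) / (x - c); pose u := (x - c) / (x - a).
have -> : (x - c) / (d - c) = e^-1 by rewrite /e invfM invrK mulrC.
apply: ctrlV => //.
have [Oe|] := EM (O e); last by right.
have [me|me] := EM (mx e); first exact: mx_ctrl.
(* A residue of [e] other than 0 and infinity would put [c] or [d] at the same distance from [a] as
   [x], contrary to [nb]. *)
have Oei := mx_unit Oe me.
have nmu : ~ mx (e * u).
  move=> hm; apply: nmx1; have -> : 1 = e^-1 * ((x - a) / (x - c)) * (e * u).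
    by rewrite /e /u; field; rewrite xc0 dc0 xa0.
  by apply: (mxM HO) => //; apply: (subringM HO) => //; apply: amin.
have Op : O ((c - a) / (x - a)).
  have -> : (c - a) / (x - a) = 1 - u by rewrite /u; field.
  by apply: (subringB HO) => //; apply: (subring1 HO).
have Eq : (d - a) / (x - a) = e * u + (c - a) / (x - a).
  by rewrite /e /u; field; rewrite xa0 xc0.
have Oq : O ((d - a) / (x - a)).
  by rewrite Eq; apply: (subringD HO) => //; apply: (subringM HO).
have mq : mx ((d - a) / (x - a)).
  apply: contrapT => nq; apply: nb; exists d => //; split=> //.
    by move=> da; apply: nq; rewrite da subrr mul0r; left.
  by have := mx_unit Oq nq; rewrite invfM invrK mulrC.
exfalso; apply: nb; have np : ~ mx ((c - a) / (x - a)).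
  move=> hp; apply: nmu; have -> : e * u = (d - a) / (x - a) - (c - a) / (x - a).
    by rewrite Eq addrK.
  exact: (mxB HO).
exists c => //; split=> //.
  by move=> ca; apply: np; rewrite ca subrr mul0r; left.
by have := mx_unit Op np; rewrite invfM invrK mulrC.
Qed.

Lemma controls_adds B A xs : acf B -> B `<=` K -> controls B A ->
  (forall a, a \in A -> M a) -> (forall x, x \in xs -> M x) ->
  exists ys, [/\ size ys = size xs, spanf B ys `<=` K & controls (spanf B ys) (xs ++ A)].
Proof.
move=> HB BK CA AM; elim: xs => [|x xs IH] XM; first by exists [::].
have [|ys [sys ysK C]] := IH; first by move=> z zx; apply: XM; rewrite inE zx orbT.
have [|y [Ky C']] := controls_add (span_acf ys HB) ysK C _ (XM x (mem_head _ _)).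
  by move=> a; rewrite mem_cat => /orP[ax|/AM//]; apply: XM; rewrite inE ax orbT.
exists (y :: ys); split=> //=; [by rewrite sys | exact: cl_min].
Qed.
End Control.

(** * Limits of the frame formed by vertices 0, 1 and 2 *)

Section Frame.
Variable F : numClosedFieldType.
Variables (O K M B : set F).
Hypotheses (HO : subring O) (OV : forall x, O x \/ O x^-1).
Hypotheses (HK : acf K) (KO : K `<=` O) (HM : acf M).
Hypothesis resE : forall x, M x -> O x -> exists2 a, K a & mx O (x - a).
Hypotheses (HB : acf B) (BK : B `<=` K).
Local Notation mx := (mx O).
Local Notation C := (ctrl O B).
Let Bs := acf_subring HB.
Let Ks := acf_subring HK.

Lemma controls_cons' A x : controls O B A ->
  (forall c d, c \in A -> d \in A -> c != d -> C ((x - c) / (d - c))) ->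
  controls O B (x :: A).
Proof.
move=> CA CX; have [xA|xA] := boolP (x \in A); last exact: (controls_cons HO OV HK KO).
have h z : z \in x :: A -> z \in A by rewrite inE => /predU1P[->|].
by move=> a b c /h aA /h bA /h cA; apply: CA.
Qed.

Lemma ctrl_unitB x u c : B c -> c != 0 -> mx (u - c) -> C x -> C (x * u).
Proof.
move=> Bc c0 hu Cx; have -> : x * u = c * (x * (u / c)) by field.
apply: (ctrlZ HO KO) => //; apply: (ctrl_unit HO OV HK KO) => //.
have -> : u / c - 1 = c^-1 * (u - c) by field.
by apply: (mxM HO) => //; apply: KO; apply: BK; exact: acf_inv.
Qed.

Lemma res_ctrl x a : K a -> mx (x - a) -> C x -> B a.
Proof.
move=> Ka ha [[b Bb hb]|]; last by case; apply: (res_O HO OV KO Ka).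
by rewrite (res_uniq HO OV HK KO Ka (BK Bb) ha hb).
Qed.

Lemma resc x : mx (x - x). Proof. by left; rewrite subrr. Qed.

(** The residues of a, b and b/a determine the ratio unless both points cluster at [c]; that case is
    left to the last hypothesis. *)
Lemma ctrl_frame a b c : B c -> M a -> M b -> C a -> C b -> C (b / a) ->
  (mx (a - c) -> mx (b - c) -> C ((b - c) / (a - c))) -> C ((b - c) / (a - c)).
Proof.
move=> Bc Ma Mb Ca Cb Cba cluster.
have Kc := BK Bc; have Oc := KO Kc.
have ac0 : a = c -> C ((b - c) / (a - c)).
  by move=> ->; rewrite subrr invr0 mulr0; apply: (ctrl0 O HB).
have OB z : O z -> O (z - c) by move=> Oz; apply: (subringB HO).
have NB z : ~ O z -> ~ O (z - c).
  by move=> nz h; apply: nz; rewrite -[z](subrK c); apply: (subringD HO).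
case: (Ca) => [[a' Ba ha]|na].
  have Oa := res_O HO OV KO (BK Ba) ha.
  have hac : mx ((a - c) - (a' - c)) by apply: (resB HO OV ha); apply: resc.
  have [a'c|a'c] := eqVneq a' c; last first.
    have ac' : a' - c != 0 by rewrite subr_eq0.
    have Bac : B (a' - c) by apply: (subringB Bs).
    apply: (@ctrl_unitB _ _ (a' - c)^-1); rewrite ?invr_eq0 //.
    - exact: acf_inv.
    - by apply: (resV HO OV HK KO) => //; apply: BK.
    - apply: (ctrlD HO KO) => //; exact: (subringN Bs).
  have hac0 : mx (a - c) by move: ha; rewrite a'c.
  have [ac|ac] := eqVneq a c; first exact: ac0.
  have acn : a - c != 0 by rewrite subr_eq0.
  case: (Cb) => [[b' Bb hb]|nb].
    have [b'c|b'c] := eqVneq b' c; first by apply: cluster => //; rewrite -b'c.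
    have bc' : b' - c != 0 by rewrite subr_eq0.
    have hbc : mx ((b - c) - (b' - c)) by apply: (resB HO OV hb); apply: resc.
    have Kbc : K (b' - c) by apply: (subringB Ks) => //; apply: BK.
    rewrite -[_ / _]invrK invfM invrK mulrC; apply: (ctrlV HO OV HK KO) => //.
    apply: (mx_ctrl HB); apply: (mxMr HO) => //; apply: mx_unit.
      exact: (res_O HO OV KO Kbc).
    exact: (res_unit HO OV HK KO Kbc).
  right=> h; apply: (NB _ nb); have -> : b - c = (b - c) / (a - c) * (a - c) by rewrite divfK.
  by apply: (subringM HO) => //; apply: OB.
have nac := NB _ na; have acn := NO0 HO nac.
case: (Cb) => [[b' Bb hb]|nb].
  apply: (mx_ctrl HB); apply: (mxM HO); last exact: NOmx.
  exact/OB/(res_O HO OV KO (BK Bb)).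
have an := NO0 HO na; have bn := NO0 HO nb.
have -> : (b - c) / (a - c) = (b / a) * ((1 - c / b) * (1 - c / a)^-1).
  by field; rewrite an bn acn.
have K1 := subring1 Ks.
have r1 z : ~ O z -> mx (1 - c / z - 1).
  move=> nz; have -> : 1 - c / z - 1 = - (c / z) by ring.
  by apply: (mxN HO); apply: (mxM HO) => //; apply: NOmx.
apply: (ctrl_unit HO OV HK KO) => //.
rewrite -[X in _ - X](mulr1 1) -[X in _ - (_ * X)]invr1.
apply: (resM HO OV KO) => //; [exact: acf_inv|exact: r1|].
by apply: (resV HO OV HK KO K1 (oner_neq0 _)); apply: r1.
Qed.

(* If the point with isotropic coordinates [a, b] goes to a limit algebraic over
   [B] in the blown-up quadric, then the residual configuration of the frame
   and of this point has no modulus over [B]. *)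
Lemma frame_controlled z2 w2 a b s t : B z2 -> B w2 -> z2 != 0 -> w2 != 0 ->
  z2 - w2 = 2 -> a != b -> M a -> M b ->
  s = 4 * b / (b - a) -> t = 2 * (z2 - a) * (w2 - b) / (a - b) ->
  C s -> C t -> [\/ O s, O t | C (s / t)] ->
  controls O B [:: b; a; w2; z2; 0].
Proof.
move=> Bz Bw z0 w0 zw ab Ma Mb Es Et Cs Ct Cst.
have B0 := subring0 Bs; have B1 := subring1 Bs.
have Bn n : B n%:R by apply: (subring_nat Bs).
have BD := subringD Bs; have BB := subringB Bs; have BM := subringM Bs.
have BV x : B x -> B x^-1 by apply: acf_inv.
have B2p : forall p x, pov B p -> p.[0] != 0 -> p.[x] = 0 -> B x.
  move=> p x Bp p0 px; apply: (acf_root HB Bp); last exact/rootP.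
  by apply: contraNneq p0 => ->; rewrite horner0.
have ab0 : a - b != 0 by rewrite subr_eq0.
have ba0 : b - a != 0 by rewrite subr_eq0 eq_sym.
have K1 := subring1 Ks; have KB := subringB Ks; have KM := subringM Ks.
have Kn n : K n%:R by apply: (subring_nat Ks).
have KV x : K x -> K x^-1 by apply: acf_inv.
have Kz := BK Bz; have Kw := BK Bw.
have rM := resM HO OV KO; have rB := resB HO OV; have rV := resV HO OV HK KO.
have [Ca Cb] : C a /\ C b.
  have [Oa|na] := EM (O a); have [Ob|nb] := EM (O b); last by split; right.
  - have [a' Ka ha] := resE Ma Oa; have [b' Kb hb] := resE Mb Ob.
    suff [Ba Bb] : B a' /\ B b' by split; left; [exists a'|exists b'].
    have [e|ne] := eqVneq a' b'; last first.
      have h0 : a' - b' != 0 by rewrite subr_eq0.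
      have h0' : b' - a' != 0 by rewrite subr_eq0 eq_sym.
      pose s' := 4 * b' / (b' - a'); pose t' := 2 * (z2 - a') * (w2 - b') / (a' - b').
      have Bs' : B s'.
        apply: (@res_ctrl s s') => //; first by apply: (KM) => //; [exact: KM | exact/KV/KB].
        rewrite Es; apply: (rM) => //; [exact: KM | exact/KV/KB| |].
          by apply: (rM) => //; apply: resc.
        by apply: (rV); [exact: KB | | exact: rB].
      have Bt' : B t'.
        apply: (@res_ctrl t t') => //.
          by apply: (KM); [apply: (KM); [apply: (KM)|]; try apply: (KB)|apply/KV/KB].
        rewrite Et; apply: (rM) => //.
        - by apply: (KM); [apply: (KM)|]; try apply: (KB).
        - exact/KV/KB.
        - apply: (rM); [by apply: (KM) => //; apply: (KB)|exact: KB| |].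
            by apply: (rM) => //; [exact: KB|exact: resc|apply: (rB) => //; exact: resc].
          by apply: (rB) => //; exact: resc.
        - by apply: (rV); [exact: KB| |exact: rB].
      (* With h = a' - b' one has b' = - s' h / 4, and the equation for t' becomes quadratic in h
         with constant term - 2 z2 w2, which is nonzero. *)
      have Bh : B (a' - b').
        apply: (B2p (t' *: 'X - 2 *: ((z2%:P - (1 - s' / 4) *: 'X) * (w2%:P + (s' / 4) *: 'X)))).
        - apply: (povB Bs); first by apply: (povZ Bs) => //; apply: (povX Bs).
          apply: (povZ Bs) => //; apply: (povM Bs).
            apply: (povB Bs); [exact: (povC Bs)|apply: (povZ Bs); last exact: (povX Bs)].
            by apply: (BB) => //; apply: (BM) => //; apply: (BV).
          apply: (povD Bs); [exact: (povC Bs)|apply: (povZ Bs); last exact: (povX Bs)].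
          by apply: (BM) => //; apply: (BV).
        - by rewrite !hornerE /= ?subr0 oppr_eq0 !mulf_neq0 ?pnatr_eq0.
        - by rewrite !hornerE /= /s' /t'; field; rewrite h0 h0'.
      have Bb : B b'.
        have -> : b' = - (s' * (a' - b') / 4) by rewrite /s'; field.
        by apply: (subringN Bs); apply: (BM); [exact: BM | exact: BV].
      by split=> //; rewrite -[a'](subrK b'); apply: (BD).
    (* Here a and b have a common limit. Away from 0, z2 and w2 this makes s and t infinite, and the
       residue of s/t gives a quadratic equation for the limit. *)
    rewrite -e in hb *; suff Ba : B a' by [].
    have [->//|q0] := eqVneq a' 0.
    have [->//|qz] := eqVneq a' z2; have [->//|qw] := eqVneq a' w2.
    have mab : mx (b - a) by have := rB _ _ _ _ hb ha; rewrite subrr subr0.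
    have qz0 : z2 - a' != 0 by rewrite subr_eq0 eq_sym.
    have qw0 : w2 - a' != 0 by rewrite subr_eq0 eq_sym.
    have bn : b != 0.
      by apply: contra_neq q0 => b0; rewrite b0 in hb; apply: (K_mx HK KO) => //;
        move: (mxN HO hb); rewrite opprB subr0.
    have hza : mx (z2 - a - (z2 - a')) by apply: (rB) => //; exact: resc.
    have hwb : mx (w2 - b - (w2 - a')) by apply: (rB) => //; exact: resc.
    have zan : z2 - a != 0.
      by apply/eqP => h; apply: (res_unit HO OV HK KO _ qz0 hza); [exact: KB|rewrite h; left].
    have wbn : w2 - b != 0.
      by apply/eqP => h; apply: (res_unit HO OV HK KO _ qw0 hwb); [exact: KB|rewrite h; left].
    have ns : ~ O s.
      rewrite -[s]invrK; apply: mxNO; first by rewrite Es invr_eq0 !mulf_neq0 ?invr_eq0 ?pnatr_eq0.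
      rewrite Es invfM invrK invfM mulrC; apply: (mxMr HO) => //.
      apply: (subringM HO); first exact/KO/KV.
      by apply: mx_unit; [exact: (res_O HO OV KO Ka) | exact: (res_unit HO OV HK KO Ka)].
    have nt : ~ O t.
      rewrite -[t]invrK; apply: mxNO; first by rewrite Et invr_eq0 !mulf_neq0 ?invr_eq0 ?pnatr_eq0.
      rewrite Et invfM invrK mulrC; apply: (mxMr HO); first by rewrite -opprB; exact: (mxN HO).
      rewrite !invfM; apply: (subringM HO); first apply: (subringM HO); first exact/KO/KV.
        by apply: mx_unit; [exact: (res_O HO OV KO (KB _ _ Kz Ka)) | exact: (res_unit HO OV HK KO (KB _ _ Kz Ka))].
      by apply: mx_unit; [exact: (res_O HO OV KO (KB _ _ Kw Ka)) | exact: (res_unit HO OV HK KO (KB _ _ Kw Ka))].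
    have {}Cst : C (s / t) by case: Cst.
    pose c := - 2 * a' / ((z2 - a') * (w2 - a')).
    have K2 : K (- 2) by apply: (subringN Ks).
    have Bc : B c.
      apply: (@res_ctrl (s / t) c) => //.
        by apply: (KM); [exact: KM|apply/KV/KM; exact: KB].
      have -> : s / t = - 2 * b / ((z2 - a) * (w2 - b)).
        by rewrite Es Et; field; rewrite ba0 ab0 zan wbn.
      apply: (rM); [exact: KM | by apply/KV/KM; exact: KB| by apply: (rM) => //; exact: resc|].
      apply: (rV); [by apply: (KM); exact: KB|exact: mulf_neq0|].
      by apply: (rM) => //; exact: KB.
    apply: (B2p (c *: ((z2%:P - 'X) * (w2%:P - 'X)) + 2 *: 'X)).
    + apply: (povD Bs); last by apply: (povZ Bs) => //; apply: (povX Bs).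
      apply: (povZ Bs) => //; apply: (povM Bs);
        by apply: (povB Bs); [exact: (povC Bs) | exact: (povX Bs)].
    + by rewrite !hornerE /= ?subr0 !mulf_neq0 // ?invr_eq0 ?mulf_neq0 ?oppr_eq0 ?pnatr_eq0.
    + by rewrite !hornerE /= /c; field; rewrite qz0 qw0.
  - have [a' Ka ha] := resE Ma Oa; split; last by right.
    have bn := NO0 HO nb.
    have Oabn : ~ O (a - b).
      by move=> h; apply: nb; rewrite -(subKr a b); exact: (subringB HO).
    left; exists a' => //; have h2 : B (2 * (z2 - a')).
      apply: (@res_ctrl t) Ct; first by apply: (KM) => //; exact: KB.
      have -> : t = (2 * (z2 - a)) * (1 + (w2 - a) * (a - b)^-1) by rewrite Et; field.
      rewrite -[2 * (z2 - a')]mulr1; apply: (rM) => //; first by apply: (KM) => //; exact: KB.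
        by apply: (rM) => //; [exact: KB|exact: resc|apply: (rB) => //; exact: resc].
      rewrite addrAC subrr add0r; apply: (mxM HO); last exact: NOmx.
      by apply: (subringB HO) => //; exact: KO.
    have -> : a' = z2 - (2 * (z2 - a')) / 2 by field.
    by apply: (BB) => //; apply: (BM) => //; exact: BV.
  - have [b' Kb hb] := resE Mb Ob; split; first by right.
    have an := NO0 HO na.
    have Oabn : ~ O (a - b).
      by move=> h; apply: na; rewrite -[a](subrK b); apply: (subringD HO).
    left; exists b' => //; have h2 : B (- 2 * (w2 - b')).
      have K2 : K (- 2) by apply: (subringN Ks).
      apply: (@res_ctrl t) Ct; first by apply: (KM) => //; exact: KB.
      have -> : t = (- 2 * (w2 - b)) * (1 + (b - z2) * (a - b)^-1) by rewrite Et; field.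
      rewrite -[- 2 * (w2 - b')]mulr1; apply: (rM) => //; first by apply: (KM) => //; exact: KB.
        by apply: (rM) => //; [exact: KB|exact: resc|apply: (rB) => //; exact: resc].
      rewrite addrAC subrr add0r; apply: (mxM HO); last exact: NOmx.
      by apply: (subringB HO) => //; exact: KO.
    have -> : b' = w2 + (- 2 * (w2 - b')) / 2 by field.
    by apply: (BD) => //; apply: (BM) => //; exact: BV.
have Cba : C (b / a).
  have [->|bn] := eqVneq b 0; first by rewrite mul0r; exact: (ctrl0 O HB).
  have -> : b / a = (1 - 4 * s^-1)^-1.
    have [a0|an] := eqVneq a 0.
      by rewrite a0 Es a0 subr0 invr0 mulr0 mulfK // mulfV ?pnatr_eq0 // subrr invr0.
    by rewrite Es; field; rewrite bn ba0 subKr.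
  apply: (ctrlV HO OV HK KO) => //; apply: (ctrl_sub1 HO) => //; apply: (ctrlZ HO KO) => //.
  exact: (ctrlV HO OV HK KO).
have Cc c : c \in [:: w2; z2; 0] -> C ((b - c) / (a - c)).
  rewrite !inE => /or3P[/eqP->|/eqP->|/eqP->]; last by rewrite !subr0.
    apply: ctrl_frame => // ha hb.
    have [->|bw] := eqVneq b w2; first by rewrite subrr mul0r; exact: (ctrl0 O HB).
    have bw0 : b - w2 != 0 by rewrite subr_eq0.
    (* The normalisation z2 - w2 = 2 makes the factor 2 (z2 - a) tend to 4, so that t controls (w2 -
       b)/(a - b). *)
    have hz : mx ((2 * (z2 - a))^-1 - (2 * 2)^-1).
      apply: (rV); [exact: KM|by rewrite mulf_neq0 ?pnatr_eq0|].
      apply: (rM) => //; first exact: resc.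
      by rewrite -[X in mx (_ - X)]zw; apply: (rB) => //; exact: resc.
    have Cr : C ((w2 - b) / (a - b)).
      have zan : z2 - a != 0.
        apply/eqP => h; have := mx1 HO; apply; rewrite h mulr0 invr0 sub0r in hz.
        have := mxM HO (KO (KM _ _ (Kn 2) (Kn 2))) (mxN HO hz).
        by rewrite opprK mulfV // mulf_neq0 ?pnatr_eq0.
      have -> : (w2 - b) / (a - b) = t * (2 * (z2 - a))^-1 by rewrite Et; field; rewrite ab0 zan.
      apply: ctrl_unitB hz Ct; first by apply: (BV); exact: BM.
      by rewrite invr_eq0 mulf_neq0 ?pnatr_eq0.
    have -> : (b - w2) / (a - w2) = (1 - ((w2 - b) / (a - b))^-1)^-1.
      have wb0 : w2 - b != 0 by rewrite subr_eq0 eq_sym.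
      have [->|aw] := eqVneq a w2.
        by rewrite subrr invr0 mulr0 mulfV // invr1 subrr invr0.
      have aw0 : a - w2 != 0 by rewrite subr_eq0.
      field; rewrite wb0 ab0 aw0 /=.
      have -> : w2 - b - (a - b) = - (a - w2) by ring.
      by rewrite oppr_eq0 aw0.
    by apply: (ctrlV HO OV HK KO) => //; apply: (ctrl_sub1 HO) => //; apply: (ctrlV HO OV HK KO).
  apply: ctrl_frame => // ha hb.
  have [->|az] := eqVneq a z2; first by rewrite subrr invr0 mulr0; exact: (ctrl0 O HB).
  have za0 : z2 - a != 0 by rewrite subr_eq0 eq_sym.
  have az0 : a - z2 != 0 by rewrite subr_eq0.
  have hz : mx ((2 * (w2 - b))^-1 - (2 * (- 2))^-1).
    have K2 : K (- 2) by apply: (subringN Ks).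
    apply: (rV); [exact: KM|by rewrite mulf_neq0 ?oppr_eq0 ?pnatr_eq0|].
    apply: (rM) => //; first exact: resc.
    have -> : - 2 = w2 - z2 :> F by rewrite -zw; ring.
    by apply: (rB) => //; exact: resc.
  have Cr : C ((z2 - a) / (a - b)).
    have wbn : w2 - b != 0.
      apply/eqP => h; have := mx1 HO; apply; rewrite h mulr0 invr0 sub0r in hz.
      have K2 : K (- 2) by apply: (subringN Ks).
      have := mxM HO (KO (KM _ _ (Kn 2) K2)) (mxN HO hz).
      by rewrite opprK mulfV // mulf_neq0 ?oppr_eq0 ?pnatr_eq0.
    have -> : (z2 - a) / (a - b) = t * (2 * (w2 - b))^-1 by rewrite Et; field; rewrite ab0 wbn.
    apply: ctrl_unitB hz Ct; first by apply: (BV); apply: (BM) => //; exact: (subringN Bs).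
    by rewrite invr_eq0 mulf_neq0 ?oppr_eq0 ?pnatr_eq0.
  have -> : (b - z2) / (a - z2) = ((z2 - a) / (a - b))^-1 + 1.
    by field; rewrite az0 ab0 za0.
  by apply: (ctrlD HO KO) => //; apply: (ctrlV HO OV HK KO).
have C3 : controls O B [:: w2; z2; 0].
  have B3 c : c \in [:: w2; z2; 0] -> B c by rewrite !inE => /or3P[]/eqP->.
  by move=> x y z /B3 Bx /B3 By /B3 Bz'; apply: ctrl_mem; apply: (BM); [exact: BB|exact/BV/BB].
have CK x c d : c \in [:: w2; z2; 0] -> d \in [:: w2; z2; 0] -> C x -> C ((x - c) / (d - c)).
  have B3 e : e \in [:: w2; z2; 0] -> B e by rewrite !inE => /or3P[]/eqP->.
  move=> /B3 Bc /B3 Bd Cx; rewrite mulrC; apply: (ctrlZ HO KO) => //; first exact/BV/BB.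
  by apply: (ctrlD HO KO) => //; exact: (subringN Bs).
have C4 : controls O B [:: a; w2; z2; 0].
  by apply: controls_cons' => // c d cA dA _; apply: CK.
apply: controls_cons' => // c d; rewrite ![_ \in a :: _]in_cons.
move=> /predU1P[->|cA] /predU1P[->|dA]; rewrite ?eqxx // => cd.
- have ad0 : a - d != 0 by rewrite subr_eq0.
  have -> : (b - a) / (d - a) = 1 - (b - d) / (a - d).
    have da0 : d - a != 0 by rewrite subr_eq0 eq_sym.
    by field; rewrite da0 ad0.
  by apply: (ctrl_sub1 HO) => //; apply: Cc.
- exact: Cc.
- exact: CK.
Qed.
End Frame.

(** * Configurations in normal position *)

Lemma edge_pair (e : {fset nat}) : #|` e| = 2%N ->
  exists u v, [/\ e = [fset u; v]%fset, u != v, u \in e & v \in e].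
Proof.
move=> ec; have /fset0Pn[u ue] : e != fset0 by rewrite -cardfs_gt0 ec.
have := cardfsD1 u e; rewrite ue ec => -[/esym/eqP/cardfs1P[v Ev]].
have : v \in (e `\ u)%fset by rewrite Ev inE.
rewrite !inE => /andP[vu ve]; exists u, v; rewrite eq_sym vu ue ve; split=> //.
by rewrite -(fsetD1K ue) Ev.
Qed.

Section Points.
Variable F : numClosedFieldType.

(* A point (X, Y, Z) of the sphere is encoded by (P, Z, Q) with P = X + iY and
   Q = X - iY, so that the equation of the sphere is P Q + Z^2 = 1. *)
Definition pt : Type := (F * F * F)%type.
Definition ptP (p : pt) : F := p.1.1.
Definition ptZ (p : pt) : F := p.1.2.
Definition ptQ (p : pt) : F := p.2.

Definition onq (p : pt) := ptP p * ptQ p + ptZ p ^+ 2 = 1.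
(** For points of the sphere the squared distance is 2 - 2<p, q>. This expression, affine in each
    point, is used off the sphere as well. *)
Definition dist (p q : pt) := 2 - 2 * ptZ p * ptZ q - ptP p * ptQ q - ptQ p * ptP q.

Definition north : pt := (0, 1, 0).
(** The point at squared distance [l] from [north], turned about the axis through [north] so that
    [ptP] is 1. *)
Definition second (l : F) : pt := (1, 1 - l / 2, 1 - (1 - l / 2) ^+ 2).

Lemma onq_north : onq (north).
Proof. by rewrite /onq /north /ptP /ptZ /ptQ /= mul0r add0r expr1n. Qed.

Lemma onq_second (a : F) : onq (second a).
Proof. by rewrite /onq /second /ptP /ptZ /ptQ /= mul1r subrK. Qed.

Definition conf : Type := nat -> pt.

(** Vertices outside the graph are parked at [north], so that equality of functions is equality of
    configurations. *)
Definition confs (H : graph) (l : {fset nat} -> F) : set conf := [set x |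
  [/\ x 1%N = north, x 2%N = second (l [fset 1; 2]%N%fset),
      forall v, v \notin vset H -> x v = north, forall v, onq (x v) &
      forall u v, [fset u; v]%fset \in eset H -> dist (x u) (x v) = l [fset u; v]%fset]].

Definition cs (x : conf) := dist (x 0%N) (x 1%N).
Definition ct (x : conf) := dist (x 0%N) (x 2%N).

(** The length of {1, 2} is left out because it will belong to the base field. *)
Definition lens (H : graph) (l : {fset nat} -> F) : seq F :=
  [seq l e | e <- (eset H `\ [fset 1; 2]%N)%fset].

(* The counting conditions on a calligraph; rigidity plays no further role. *)
Definition precal (H : graph) :=
  [/\ ([fset 0; 1; 2]%N `<=` vset H)%fset, [fset 1; 2]%N%fset \in eset H &
      (#|` eset H| + 4 = 2 * #|` vset H|)%N].

Definition framed (H : graph) :=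
  ([fset 0; 1; 2]%N `<=` vset H)%fset /\ [fset 1; 2]%N%fset \in eset H.

Lemma precal_framed H : precal H -> framed H. Proof. by case. Qed.

Lemma distC p q : dist p q = dist q p.
Proof. by rewrite /dist; ring. Qed.

Definition inB (B : set F) (p : pt) := [/\ B (ptP p), B (ptZ p) & B (ptQ p)].

Lemma inB_sub (B B' : set F) p : B `<=` B' -> inB B p -> inB B' p.
Proof. by move=> BB' [h1 h2 h3]; split; apply: BB'. Qed.

Lemma dist_in (B : set F) p q : acf B -> inB B p -> inB B q -> B (dist p q).
Proof.
move=> HB [p1 p2 p3] [q1 q2 q3]; have Bs := acf_subring HB.
have Bn n : B n%:R by apply: (subring_nat Bs).
rewrite /dist; apply: (subringB Bs); last exact: (subringM Bs).
apply: (subringB Bs); last exact: (subringM Bs).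
by apply: (subringB Bs) => //; apply: (subringM Bs) => //; apply: (subringM Bs).
Qed.

(** Generators of the coordinates of a point of the sphere up to algebraic closure. If [ptP]
    vanishes, then ptZ^2 = 1 and a single one remains; this drop is what excludes such points from
    generic configurations. *)
Definition gens (p : pt) : seq F := if ptP p == 0 then [:: ptQ p] else [:: ptP p; ptZ p].

Lemma gens_in (B : set F) p : acf B -> onq p -> (forall y, y \in gens p -> B y) -> inB B p.
Proof.
move=> HB; rewrite /onq /gens; have Bs := acf_subring HB.
have [P0|P0] := eqVneq (ptP p) 0 => E gB.
  rewrite P0 mul0r add0r in E; split; [rewrite P0; exact: (subring0 Bs)| |by apply: gB; rewrite inE].
  apply: (@acf_root _ _ HB ('X^2 - 1)).
  - apply: (povB Bs); first exact: (povXn Bs).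
    by apply: (povC Bs); apply: (subring1 Bs).
  - by rewrite -size_poly_eq0 size_XnsubC.
  - by rewrite rootE !hornerE E subrr.
have BP : B (ptP p) by apply: gB; rewrite inE eqxx.
have BZ : B (ptZ p) by apply: gB; rewrite !inE eqxx orbT.
split=> //; have -> : ptQ p = (1 - ptZ p ^+ 2) / ptP p.
  by rewrite -E addrK mulrC mulKf.
apply: (acf_div HB) => //; apply: (subringB Bs); first exact: (subring1 Bs).
exact: (subringX Bs).
Qed.

Lemma gens_self (B : set F) p y : inB B p -> y \in gens p -> B y.
Proof.
by move=> [h1 h2 h3]; rewrite /gens; case: ifP => _; rewrite !inE; [move=> /eqP->|case/orP=> /eqP->].
Qed.

Definition gensS (x : conf) (vs : seq nat) := flatten [seq gens (x v) | v <- vs].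

Lemma size_gensS x vs : (size (gensS x vs) <= 2 * size vs)%N.
Proof.
elim: vs => //= v vs IH; rewrite /gensS /= size_cat -/(gensS x vs) mulnS leq_add //.
by rewrite /gens; case: ifP.
Qed.

Lemma size_gensS_lt x vs v : v \in vs -> ptP (x v) = 0 -> (size (gensS x vs) < 2 * size vs)%N.
Proof.
move=> vvs P0; elim: vs vvs => //= u vs IH; rewrite /gensS /= size_cat -/(gensS x vs) mulnS.
rewrite inE => /predU1P[<-|/IH h].
  by rewrite /gens P0 eqxx /= add1n !add2n !ltnS; exact: size_gensS.
by rewrite -addnS leq_add // /gens; case: ifP.
Qed.

Lemma gensS_in (B : set F) x vs v : acf B -> onq (x v) -> v \in vs ->
  inB (spanf B (gensS x vs)) (x v).
Proof.
move=> HB ov vvs; apply: gens_in => // [|y yg]; first exact: span_acf.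
by apply: span_mem => //; apply/flattenP; exists (gens (x v)) => //; apply: map_f.
Qed.

(** * Transcendence degrees of configurations *)

Section Rank.
Variables (K : set F) (H : graph) (l : {fset nat} -> F) (x : conf).
Hypotheses (HK : acf K) (HH : precal H) (Hx : confs H l x).
Let l12 := l [fset 1; 2]%N%fset.
Hypotheses (Kl : K l12) (l0 : l12 != 0) (l4 : l12 != 4).
Hypothesis Hind : indep K (lens H l).
Let n := #|` vset H|.
Let Ks := acf_subring HK.
Let vs1 : seq nat := (vset H `\` [fset 1; 2]%N)%fset.
Let vs0 : seq nat := (vset H `\` [fset 0; 1; 2]%N)%fset.

Lemma conf_onq v : onq (x v). Proof. by case: Hx. Qed.
Lemma conf1 : x 1%N = north. Proof. by case: Hx. Qed.
Lemma conf2 : x 2%N = second l12. Proof. by case: Hx. Qed.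

Lemma inB_north (B : set F) : acf B -> inB B north.
Proof.
move=> HB; have Bs := acf_subring HB.
by split; [exact: (subring0 Bs)|exact: (subring1 Bs)|exact: (subring0 Bs)].
Qed.

Lemma inB_second (B : set F) : acf B -> K `<=` B -> inB B (second l12).
Proof.
move=> HB KB; have Bs := acf_subring HB; have B1 := subring1 Bs.
have h : B (1 - l12 / 2).
  apply: (subringB Bs) => //; apply: (acf_div HB); first exact: KB.
  exact: (subring_nat Bs).
by split=> //; apply: (subringB Bs) => //; apply: (subringX Bs).
Qed.

Lemma vset3 : (2 < n)%N /\ size vs1 = (n - 2)%N /\ size vs0 = (n - 3)%N.
Proof.
have [sV _ _] := HH.
have h0 : 0%N \in vset H by apply: (fsubsetP sV); rewrite !inE.
have h1 : 1%N \in vset H by apply: (fsubsetP sV); rewrite !inE.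
have h2 : 2%N \in vset H by apply: (fsubsetP sV); rewrite !inE.
have E3 : #|` [fset 0; 1; 2]%N%fset| = 3%N.
  by rewrite -fsetUA cardfsU1 cardfs2 !inE.
have := fsubset_leq_card sV; rewrite E3 => h; split=> //; split.
  rewrite /vs1 -/(#|` _|) cardfsDS ?cardfs2 //.
  by apply/fsubsetP => v; rewrite !inE => /orP[]/eqP->.
by rewrite /vs0 -/(#|` _|) cardfsDS ?E3.
Qed.

Lemma size_lens : size (lens H l) = (2 * n - 5)%N.
Proof.
have [sV e12 cE] := HH; have E1 := cardfsD1 [fset 1; 2]%N%fset (eset H).
rewrite e12 in E1; rewrite size_map -/(#|` _|); move: cE E1; rewrite -/n.
by move: (#|` _|) (#|` eset H|) n => a b m; lia.
Qed.

Lemma mem_vs1 v : (v \in vs1) = [&& v != 1%N, v != 2 & v \in vset H].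
Proof. by rewrite /vs1 !inE negb_or -andbA. Qed.
Lemma mem_vs0 v : (v \in vs0) = [&& v != 0%N, v != 1%N, v != 2 & v \in vset H].
Proof. by rewrite /vs0 !inE !negb_or -!andbA. Qed.

Lemma lens_span (B : set F) vs : acf B -> K `<=` B ->
  (forall v, v \in vset H -> v != 1%N -> v != 2%N -> v \in vs \/ inB B (x v)) ->
  forall y, y \in lens H l -> spanf B (gensS x vs) y.
Proof.
move=> HB KB hv y /mapP[e]; rewrite !inE => /andP[e12 eE] ->.
have HS := span_acf (gensS x vs) HB.
have hin v : v \in vset H -> inB (spanf B (gensS x vs)) (x v).
  move=> vV; have [->|v1] := eqVneq v 1%N; first by rewrite conf1; apply: inB_north.
  have [->|v2] := eqVneq v 2%N.
    by rewrite conf2; apply: inB_second => //; apply: subset_trans KB (span_sub _ HB).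
  have [vvs|vB] := hv v vV v1 v2; first by apply: gensS_in => //; apply: conf_onq.
  exact: inB_sub (span_sub _ HB) vB.
have [eV /edge_pair[u [v [Ee _ _ _]]]] := edgeP eE.
rewrite Ee in eE eV *; have [_ _ _ _ hd] := Hx.
rewrite -hd //; apply: dist_in => //; apply: hin.
all: by apply: (fsubsetP eV); rewrite !inE eqxx ?orbT.
Qed.

Lemma conf_all (B : set F) : acf B -> K `<=` B -> (forall y, y \in gensS x vs1 -> B y) ->
  forall v, inB B (x v).
Proof.
move=> HB KB gB v; have [vV|vV] := boolP (v \in vset H); last first.
  by case: Hx => _ _ + _ _ => -> //; apply: inB_north.
have [->|v1] := eqVneq v 1%N; first by rewrite conf1; apply: inB_north.
have [->|v2] := eqVneq v 2%N; first by rewrite conf2; apply: inB_second.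
apply: gens_in => //; first exact: conf_onq.
move=> y yg; apply: gB; apply/flattenP; exists (gens (x v)) => //.
by apply: map_f; rewrite mem_vs1 v1 v2.
Qed.

(** Otherwise at most 2(n - 3) coordinates would generate the 2n - 5 independent lengths. *)
Lemma no_K : ~ inB K (x 0%N).
Proof.
move=> h0; have [n3 [_ s0]] := vset3.
have := @steinitz _ K (lens H l) (gensS x vs0) HK Hind.
have : (size (gensS x vs0) <= 2 * (n - 3))%N by rewrite -s0 size_gensS.
rewrite size_lens => s1 /(_ _)/leq_trans/(_ s1) h; suff : (2 * n - 5 <= 2 * (n - 3))%N by lia.
apply: h => y; apply: lens_span => // v vV v1 v2.
by have [->|v0] := eqVneq v 0%N; [right|left; rewrite mem_vs0 v0 v1 v2].
Qed.

Section Generic.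
Variable g : F.
Hypotheses (Hg : ~ spanf K (lens H l) g) (gx : spanf K (gensS x vs1) g).

Lemma gen_ind : indep K (g :: lens H l). Proof. by split. Qed.

Lemma gen_lens y : y \in g :: lens H l -> spanf K (gensS x vs1) y.
Proof.
rewrite inE => /predU1P[->//|]; apply: lens_span => // v vV v1 v2.
by left; rewrite mem_vs1 v1 v2.
Qed.

(** The 2n - 4 independent elements formed by [g] and the lengths lie in the closure of at most 2(n
    - 2) coordinates, so both families have the same closure. *)
Lemma gen_span v : inB (spanf K (g :: lens H l)) (x v).
Proof.
apply: conf_all; [exact: span_acf|exact: span_sub|move=> y yg].
apply: (steinitz_span HK gen_ind gen_lens); last exact: span_mem.
have [n3 [s1 _]] := vset3; rewrite /= size_lens.
apply: leq_trans (size_gensS _ _) _; rewrite s1; lia.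
Qed.

(** A vanishing [ptP] would leave at most 2n - 5 generators for 2n - 4 independent elements. *)
Lemma gen_P v : v \in vset H -> v != 1%N -> ptP (x v) != 0.
Proof.
move=> vV v1; have [->|v2] := eqVneq v 2%N; first by rewrite conf2 /= oner_neq0.
apply/eqP => P0; have [n3 [s1 _]] := vset3.
have vvs : v \in vs1 by rewrite mem_vs1 v1 v2.
have := size_gensS_lt vvs P0; rewrite s1.
have := steinitz HK gen_ind gen_lens; rewrite /= size_lens; lia.
Qed.

(** Otherwise [y] and the remaining n - 3 vertices would give at most 2n - 5 generators for 2n - 4
    independent elements. *)
Lemma gen_no_curve y : ~ inB (cl K y) (x 0%N).
Proof.
move=> h0; have [n3 [s1 s0]] := vset3.
have HKy := cl_acf HK y; have KKy : K `<=` cl K y by apply: cl_sub.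
have sub1 v : inB (spanf (cl K y) (gensS x vs0)) (x v).
  have [->|v0] := eqVneq v 0%N; first exact: inB_sub (span_sub _ HKy) h0.
  have [vV|vV] := boolP (v \in vset H); last first.
    by case: Hx => _ _ + _ _ => -> //; apply/inB_north/span_acf.
  have [->|v1] := eqVneq v 1%N; first by rewrite conf1; apply/inB_north/span_acf.
  have [->|v2] := eqVneq v 2%N.
    rewrite conf2; apply: inB_second; first exact: span_acf.
    exact: subset_trans KKy (span_sub _ HKy).
  by apply: gensS_in => //; [exact: conf_onq|rewrite mem_vs0 v0 v1 v2].
have sub2 z : spanf K (gensS x vs1) z -> spanf K (y :: gensS x vs0) z.
  rewrite -span_cl //; apply: span_min; first exact: span_acf.
    exact: subset_trans KKy (span_sub _ HKy).
  by move=> z' /flattenP[_ /mapP[v _ ->]]; apply: gens_self.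
have := @steinitz _ K _ (y :: gensS x vs0) HK gen_ind (fun z hz => sub2 z (gen_lens hz)).
rewrite /= size_lens ltnS => h; have := leq_trans h (size_gensS _ _); rewrite s0; lia.
Qed.
End Generic.

Lemma dist1 p : dist p north = 2 - 2 * ptZ p.
Proof. by rewrite /dist /north /ptP /ptZ /ptQ /=; ring. Qed.

(** The distance s gives [ptZ] linearly, and t then gives a quadratic equation for [ptP]. Its
    leading coefficient l12 (4 - l12) / 4 is nonzero by [l0] and [l4]. *)
Lemma st_coords (B : set F) : acf B -> K `<=` B -> B (cs x) -> B (ct x) -> inB B (x 0%N).
Proof.
move=> HB KB Bs' Bt; have Bs := acf_subring HB.
have Bn m : B m%:R by apply: (subring_nat Bs).
have [_ BZ2 BQ2] := inB_second HB KB.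
set Z2 := ptZ (second l12) in BZ2; set Q2 := ptQ (second l12) in BQ2.
have BZ : B (ptZ (x 0%N)).
  have -> : ptZ (x 0%N) = (2 - cs x) / 2 by rewrite /cs conf1 dist1; field.
  by apply: (acf_div HB) => //; apply: (subringB Bs).
pose m := 2 - 2 * ptZ (x 0%N) * Z2 - ct x.
have Bm : B m.
  by apply: (subringB Bs) => //; apply: (subringB Bs) => //; apply: (subringM Bs) => //; apply: (subringM Bs).
have Em : ptQ (x 0%N) = m - ptP (x 0%N) * Q2.
  by rewrite /m /ct conf2 /dist -/Z2 -/Q2 (_ : ptP (second l12) = 1) //; ring.
have Q20 : Q2 != 0.
  have -> : Q2 = l12 * (4 - l12) / 4 by rewrite /Q2 /ptQ /second /=; field.
  by rewrite !mulf_neq0 ?invr_eq0 ?pnatr_eq0 // subr_eq0 eq_sym.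
have BP : B (ptP (x 0%N)).
  apply: (@acf_root _ _ HB (Q2 *: 'X^2 - m *: 'X + (1 - ptZ (x 0%N) ^+ 2)%:P)).
  - apply: (povD Bs); first apply: (povB Bs).
    + by apply: (povZ Bs) => //; apply: (povXn Bs).
    + by apply: (povZ Bs) => //; apply: (povX Bs).
    + apply: (povC Bs); apply: (subringB Bs); [exact: (subring1 Bs)|exact: (subringX Bs)].
  - apply: contraNneq Q20 => /(congr1 (fun p : {poly F} => p`_2)).
    by rewrite coefD coefB !coefZ coefXn coefX coefC /= mulr1 mulr0 subr0 addr0 coef0 => ->.
  - have E := conf_onq 0%N; rewrite /onq Em in E; rewrite rootE !hornerE /= -{1}E.
    by apply/eqP; ring.
split=> //; rewrite Em; apply: (subringB Bs) => //; exact: (subringM Bs).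
Qed.

Lemma st_gens : spanf K (gensS x vs1) (cs x) /\ spanf K (gensS x vs1) (ct x).
Proof.
have hs := span_acf (gensS x vs1) HK; have all_in := conf_all hs (span_sub _ HK) (fun y => span_mem HK).
by split; apply: dist_in.
Qed.

(** A dependence between s and t would make the position of vertex 0 algebraic over a single
    element, against [gen_no_curve]. *)
Lemma st_indep g : ~ spanf K (lens H l) g -> spanf K (gensS x vs1) g ->
  indep K [:: ct x; cs x].
Proof.
move=> Hg gx; have nc := gen_no_curve Hg gx.
have sub y : K `<=` cl K y by apply: cl_sub.
have gn y : cl K y y by apply: cl_gen.
split=> /= [h|]; last split=> // h.
  by apply: (nc (cs x)); apply: st_coords => //; exact: cl_acf.
by apply: (nc (ct x)); apply: st_coords => //; [exact: cl_acf | exact: sub].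
Qed.
End Rank.
End Points.

(** * Excluded limits: edge lengths against moduli *)

Section KeyPlace.
Variable F : numClosedFieldType.

(* The parameters of the two isotropic lines through a point of the sphere. *)
Definition zc (p : pt F) := (1 + ptZ p) / ptP p.
Definition wc (p : pt F) := (ptZ p - 1) / ptP p.

Lemma zwcB p : ptP p != 0 -> zc p - wc p = 2 / ptP p.
Proof. by rewrite /zc /wc; move: (ptP p) (ptZ p) => P Z p0; field. Qed.

Lemma zwc_neq p : ptP p != 0 -> zc p != wc p.
Proof.
by move=> P0; rewrite -subr_eq0 zwcB // mulf_neq0 ?invr_eq0 ?pnatr_eq0.
Qed.

Lemma onqQ (p : pt F) : onq p -> ptP p != 0 -> ptQ p = (1 - ptZ p ^+ 2) / ptP p.
Proof. by rewrite /onq => <- P0; rewrite addrK mulrC mulKf. Qed.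

(** Distances are cross-ratios of isotropic parameters; through this formula the control of a
    residual configuration reaches the edge lengths. *)
Lemma dist_cross p q : onq p -> onq q -> ptP p != 0 -> ptP q != 0 ->
  dist p q = 4 * ((zc p - zc q) * (wc q - wc p) / ((zc p - wc p) * (wc q - zc q))).
Proof.
move=> op oq p0 q0; rewrite zwcB // -[wc q - zc q]opprB zwcB // /dist !onqQ // /zc /wc.
move: p0 q0; move: (ptP p) (ptP q) (ptZ p) (ptZ q) => P P' Z Z' p0 q0.
by field; rewrite p0 q0.
Qed.

(** The parameters of [north] are infinity and 0, so the cross-ratio reduces to a ratio of three
    points, and 0 has to belong to the controlled set. *)
Lemma dist_north_cross p : ptP p != 0 -> dist (north F) p = 4 * ((wc p - 0) / (wc p - zc p)).
Proof.
move=> p0; rewrite distC dist1 -[wc p - zc p]opprB zwcB // /wc.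
by move: p0; move: (ptP p) (ptZ p) => P Z p0; field; rewrite p0.
Qed.

Lemma zc_in (B : set F) p : acf B -> inB B p -> B (zc p) /\ B (wc p).
Proof.
move=> HB [h1 h2 h3]; have Bs := acf_subring HB; have B1 := subring1 Bs.
by split; apply: (acf_div HB) => //; [exact: (subringD Bs) | exact: (subringB Bs)].
Qed.

Variables (K : set F) (H : graph) (l : {fset nat} -> F) (x : conf F).
Hypotheses (HK : acf K) (HH : precal H) (Hx : confs H l x).
Let l12 := l [fset 1; 2]%N%fset.
Hypotheses (Kl : K l12) (l0 : l12 != 0) (l4 : l12 != 4).
Hypothesis Hind : indep K (lens H l).
Let vs1 : seq nat := (vset H `\` [fset 1; 2]%N)%fset.
Let vs0 : seq nat := (vset H `\` [fset 0; 1; 2]%N)%fset.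
Let k1 := spanf K (lens H l).

Variables (O : set F) (w : F).
Hypotheses (HO : subring O) (OV : forall x, O x \/ O x^-1) (kO : k1 `<=` O).
Hypotheses (w0 : w != 0) (mw : mx O w) (xw : spanf K (gensS x vs1) w).

Lemma place_gen : ~ k1 w.
Proof. by move=> kw; apply: (mxNO w0 mw); apply: kO; apply: acf_inv => //; exact: span_acf. Qed.

Let M := spanf K (w :: lens H l).
Let Hk1 : acf k1 := span_acf _ HK.

Lemma place_res y : M y -> O y -> exists2 a, k1 a & mx O (y - a).
Proof. exact: (residue HO OV Hk1 kO w0 mw). Qed.

Lemma place_conf v : inB M (x v).
Proof. exact: (gen_span HK HH Hx Kl l0 l4 Hind place_gen xw). Qed.

(* A place of the coupler curve never has a limit position of vertex 0 that is
   algebraic over the length of the base edge: the residual configuration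
   would have too few moduli to carry independent edge lengths. *)
Lemma place_bad : ctrl O K (cs x) -> ctrl O K (ct x) ->
  [\/ O (cs x), O (ct x) | ctrl O K (cs x / ct x)] -> False.
Proof.
move=> Cs Ct Cst; have [n3 [s1 s0]] := vset3 HH.
have HM : acf M := span_acf _ HK; have KK1 : K `<=` k1 := span_sub _ HK.
have Kn m : K m%:R by apply: (subring_nat (acf_subring HK)).
have oq v : onq (x v) := conf_onq Hx v.
have P0 v : v \in vset H -> v != 1%N -> ptP (x v) != 0.
  exact: (gen_P HK HH Hx Kl l0 l4 Hind place_gen xw).
have [sV _ _] := HH.
have V0 : 0%N \in vset H by apply: (fsubsetP sV); rewrite !inE.
have V2 : 2%N \in vset H by apply: (fsubsetP sV); rewrite !inE.
pose z2 := zc (x 2%N); pose w2 := wc (x 2%N); pose a := zc (x 0%N); pose b := wc (x 0%N).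
have Ez2 : z2 = (4 - l12) / 2 by rewrite /z2 /zc (conf2 Hx) /ptP /ptZ /second -/l12 /= divr1; field.
have Ew2 : w2 = - l12 / 2 by rewrite /w2 /wc (conf2 Hx) /ptP /ptZ /second -/l12 /= divr1; field.
have [Kz2 Kw2] : K z2 /\ K w2.
  by apply: zc_in => //; rewrite (conf2 Hx); apply: (inB_second Kl HK).
have [Ma Mb] : M a /\ M b by apply: zc_in => //; exact: place_conf.
have P00 := P0 0%N V0 isT.
have C5 : controls O K [:: b; a; w2; z2; 0].
  apply: (frame_controlled HO OV Hk1 kO place_res HK KK1 Kz2 Kw2 (s := cs x) (t := ct x)) => //.
  - by rewrite Ez2 mulf_neq0 ?invr_eq0 ?pnatr_eq0 // subr_eq0 eq_sym.
  - by rewrite Ew2 mulf_neq0 ?invr_eq0 ?pnatr_eq0 // oppr_eq0.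
  - by rewrite Ez2 Ew2; field.
  - exact: zwc_neq.
  - rewrite /cs (conf1 Hx) distC dist_north_cross // -/a -/b subr0 mulrA //.
  - have ab : a != b by exact: zwc_neq.
    rewrite /ct dist_cross ?P0 // -/a -/b -/z2 -/w2.
    have -> : w2 - z2 = - 2 by rewrite Ez2 Ew2; field.
    by field; rewrite subr_eq0 ab.
(* Both parameters of every vertex other than 0, 1 and 2: they add at most 2(n - 3) moduli, one
   fewer than the number of independent lengths. *)
pose xs := flatten [seq [:: zc (x v); wc (x v)] | v <- vs0].
have sxs : size xs = (2 * size vs0)%N.
  by rewrite /xs; elim: (vs0) => //= v vs ->; rewrite mulnS.
have [||ys [sys ysk C]] := controls_adds HO OV Hk1 kO HM place_res HK KK1 (xs := xs) C5.
- move=> y; rewrite !inE => /or4P[/eqP->|/eqP->|/eqP->|/orP[]/eqP->] //.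
  + by apply: (span_sub _ HK).
  + by apply: (span_sub _ HK).
  + exact: (subring0 (acf_subring HM)).
- move=> y /flattenP[_ /mapP[v _ ->]]; have [h1 h2] := zc_in HM (place_conf v).
  by rewrite !inE => /orP[]/eqP->.
have HB := span_acf ys HK; set B := spanf K ys in HB ysk C.
have KB : K `<=` B by apply: span_sub.
set A := xs ++ _ in C.
have inA v : v \in vset H -> v != 1%N -> zc (x v) \in A /\ wc (x v) \in A.
  move=> vV v1; rewrite /A !mem_cat !inE.
  have [->|v2] := eqVneq v 2%N; first by rewrite -/z2 -/w2 !eqxx !orbT.
  have [->|v0] := eqVneq v 0%N; first by rewrite -/a -/b !eqxx !orbT.
  have vv : v \in vs0 by rewrite mem_vs0 v0 v1 v2.
  by split; apply/orP; left; apply/flattenP; exists [:: zc (x v); wc (x v)];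
    rewrite ?inE ?eqxx ?orbT //; apply/mapP; exists v.
have zA : 0 \in A by rewrite /A mem_cat !inE eqxx !orbT.
(* A length belongs to [k1], hence equals its own residue, and the cross-ratios control that residue
   over [B]. *)
have lB y : y \in lens H l -> B y.
  move=> yl; have ky : k1 y by apply: span_mem.
  apply: (K_ctrl Hk1 kO ysk ky); case/mapP: yl => e; rewrite !inE => /andP[_ eE] ->.
  have [eV /edge_pair[u [v [Ee uv ue ve]]]] := edgeP eE.
  have [uV vV] := (fsubsetP eV u ue, fsubsetP eV v ve).
  have [_ _ _ _ hd] := Hx; rewrite Ee -hd -?Ee //.
  have north_edge v' : v' \in vset H -> v' != 1%N -> ctrl O B (dist (north F) (x v')).
    move=> vV' v1'; rewrite dist_north_cross ?P0 //; have [h1 h2] := inA v' vV' v1'.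
    by apply: (ctrlZ HO kO) => //; [exact/KB/Kn | exact: C].
  have [u1|u1] := eqVneq u 1%N.
    by rewrite u1 (conf1 Hx); apply: north_edge => //; rewrite eq_sym -u1.
  have [v1|v1] := eqVneq v 1%N.
    by rewrite v1 (conf1 Hx) distC; apply: north_edge.
  have [h1 h2] := inA u uV u1; have [h3 h4] := inA v vV v1.
  rewrite dist_cross ?P0 //; apply: (ctrlZ HO kO) => //; first exact/KB/Kn.
  apply: (ctrl_cross HO OV Hk1 kO) C _ _ _ _ _ _ => //; rewrite ?zwc_neq ?P0 //.
  by rewrite eq_sym zwc_neq ?P0.
have := steinitz HK Hind lB; rewrite sys sxs s0 (size_lens HH l0 l4); lia.
Qed.
End KeyPlace.

(** * Elimination of quantifiers *)

Section QE.
Variable F : numClosedFieldType.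
Local Notation term := (GRing.term F).
Local Notation formula := (GRing.formula F).
Implicit Types (e : seq F) (f : formula) (t : term).

Section Generic.
Variables (R : idomainType) (T : Type) (env : T -> seq F) (ev : T -> {rmorphism R -> F}).
Hypothesis evV : forall k, exists r, forall tau, ev tau r = (env tau)`_k.
Hypothesis evC : forall c, exists r, forall tau, ev tau r = c.

Lemma term_generic t : GRing.rterm t -> exists r, forall tau, ev tau r = GRing.eval (env tau) t.
Proof.
elim: t => /=.
- by move=> k _; apply: evV.
- by move=> c _; apply: evC.
- by move=> k _; exists k%:R => tau; rewrite rmorph_nat.
- by move=> t1 I1 t2 I2 /andP[/I1[r1 h1] /I2[r2 h2]]; exists (r1 + r2) => tau; rewrite rmorphD h1 h2.
- by move=> t1 I1 /I1[r1 h1]; exists (- r1) => tau; rewrite rmorphN h1.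
- by move=> t1 I1 k /I1[r1 h1]; exists (r1 *+ k) => tau; rewrite rmorphMn h1.
- by move=> t1 I1 t2 I2 /andP[/I1[r1 h1] /I2[r2 h2]]; exists (r1 * r2) => tau; rewrite rmorphM h1 h2.
- by [].
- by move=> t1 I1 k /I1[r1 h1]; exists (r1 ^+ k) => tau; rewrite rmorphXn h1.
Qed.

(** An equation between terms holds identically or only where a nonzero element of [R] vanishes; the
    product of these elements over all atoms is the exceptional locus. *)
Lemma qf_generic f : GRing.qf_form f && GRing.rformula f ->
  exists r b, r != 0 /\ forall tau, ev tau r != 0 -> GRing.qf_eval (env tau) f = b.
Proof.
have two f1 f2 (op : bool -> bool -> bool) :
    (exists r b, r != 0 /\ forall tau, ev tau r != 0 -> GRing.qf_eval (env tau) f1 = b) ->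
    (exists r b, r != 0 /\ forall tau, ev tau r != 0 -> GRing.qf_eval (env tau) f2 = b) ->
    exists r b, r != 0 /\ forall tau, ev tau r != 0 ->
      op (GRing.qf_eval (env tau) f1) (GRing.qf_eval (env tau) f2) = b.
  move=> [r1 [b1 [n1 h1]]] [r2 [b2 [n2 h2]]]; exists (r1 * r2), (op b1 b2).
  rewrite mulf_neq0 //; split=> // tau; rewrite rmorphM mulf_eq0 negb_or => /andP[e1 e2].
  by rewrite h1 // h2.
elim: f => //=.
- by move=> b _; exists 1, b; rewrite oner_neq0.
- move=> t1 t2 /andP[/term_generic[r1 h1] /term_generic[r2 h2]].
  have [e12|n12] := eqVneq (r1 - r2) 0.
    exists 1, true; rewrite oner_neq0; split=> // tau _; rewrite -h1 -h2 -subr_eq0 -rmorphB e12.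
    by rewrite rmorph0 eqxx.
  exists (r1 - r2), false; split=> // tau h; rewrite -h1 -h2 -subr_eq0 -rmorphB.
  exact/negbTE.
- by move=> f1 I1 f2 I2 /andP[/andP[a b] /andP[c d]]; apply: (two f1 f2 andb); [apply: I1|apply: I2]; apply/andP.
- by move=> f1 I1 f2 I2 /andP[/andP[a b] /andP[c d]]; apply: (two f1 f2 orb); [apply: I1|apply: I2]; apply/andP.
- by move=> f1 I1 f2 I2 /andP[/andP[a b] /andP[c d]]; apply: (two f1 f2 implb); [apply: I1|apply: I2]; apply/andP.
- by move=> f1 I1 /I1[r [b [r0 h]]]; exists r, (~~ b); split=> // tau /h ->.
Qed.

Lemma formula_generic f :
  exists r b, r != 0 /\ forall tau, ev tau r != 0 -> (GRing.holds (env tau) f <-> b = true).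
Proof.
have ax : GRing.closed_field_axiom F := @solve_monicpoly F.
pose proj := @ClosedFieldQE.ex_elim F.
have wf : GRing.wf_QE_proj proj := @ClosedFieldQE.wf_ex_elim F.
have ok : GRing.valid_QE_proj proj := ClosedFieldQE.holds_ex_elim ax.
have rf := GRing.to_rform_rformula f.
have [r [b [r0 h]]] := qf_generic (GRing.quantifier_elim_wf wf rf).
exists r, b; split=> // tau /h <-.
have P := GRing.quantifier_elim_rformP wf ok (env tau) rf.
by split=> [/GRing.to_rformP/P|/P/GRing.to_rformP].
Qed.
End Generic.

Lemma formula_finite f :
  exists p : {poly F}, exists b : bool, p != 0 /\
    forall y, p.[y] != 0 -> (GRing.holds [:: y] f <-> b = true).
Proof.
apply: (@formula_generic {poly F} F (fun y => [:: y]) (fun y => horner_eval y)).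
- case=> [|k]; first by exists 'X => y; rewrite /= /horner_eval hornerX.
  by exists 0 => y; rewrite rmorph0 /= nth_nil.
- by move=> c; exists c%:P => y; rewrite /= /horner_eval hornerC.
Qed.

Lemma formula_mpoly n f :
  exists p : {mpoly F[n]}, exists b : bool, p != 0 /\
    forall v : 'I_n -> F, p.@[v] != 0 ->
      (GRing.holds [seq v i | i <- enum 'I_n] f <-> b = true).
Proof.
apply: (@formula_generic {mpoly F[n]} ('I_n -> F) (fun v => [seq v i | i <- enum 'I_n]) (fun v => meval v)).
- move=> k; have [kn|nk] := ltnP k n.
    exists ('X_(Ordinal kn))%R => v; rewrite /= mevalXU (nth_map (Ordinal kn)) ?size_enum_ord //.
    by congr v; apply: val_inj; rewrite /= nth_enum_ord.
  by exists 0 => v; rewrite rmorph0 nth_default // size_map size_enum_ord.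
- by move=> c; exists c%:MP => v; rewrite /= mevalC.
Qed.

Lemma holds_exists f M L e : size e = M ->
  (GRing.holds e (foldr GRing.Exists f (iota M L)) <->
   exists y, size y = L /\ GRing.holds (e ++ y) f).
Proof.
elim: L M e => [|L IH] M e sM /=.
  split=> [h|[y [/size0nil->]]]; last by rewrite cats0.
  by exists [::]; rewrite cats0.
have E y : set_nth 0 e M y = rcons e y.
  by rewrite -sM; elim: (e) => //= a e' ->.
split.
  move=> [y]; rewrite E => /IH[|ys [sys h]]; first by rewrite size_rcons sM.
  by exists (y :: ys); rewrite /= sys -cat_rcons.
move=> [[|y ys] [//= [sy] h]]; exists y; rewrite E; apply/IH; first by rewrite size_rcons sM.
by exists ys; rewrite cat_rcons.
Qed.

Definition conjF (I : Type) (s : seq I) (g : I -> formula) :=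
  foldr (fun i f => GRing.And (g i) f) (GRing.Bool true) s.
Definition disjF (I : Type) (s : seq I) (g : I -> formula) :=
  foldr (fun i f => GRing.Or (g i) f) (GRing.Bool false) s.

Lemma holds_conjF (I : eqType) (s : seq I) g e :
  GRing.holds e (conjF s g) <-> forall i, i \in s -> GRing.holds e (g i).
Proof.
elim: s => //= i s ->; split=> [[h1 h2] j|h]; last first.
  by split=> [|j js]; apply: h; rewrite inE ?eqxx // js orbT.
by rewrite inE => /predU1P[->|/h2].
Qed.

Lemma holds_disjF (I : eqType) (s : seq I) g e :
  GRing.holds e (disjF s g) <-> exists2 i, i \in s & GRing.holds e (g i).
Proof.
elim: s => /= [|i s IH]; first by split=> // -[].
split=> [[h|/IH[j js h]]|[j]].
- by exists i; rewrite ?mem_head.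
- by exists j; rewrite // inE js orbT.
- by rewrite inE => /predU1P[->|js] h; [left|right; apply/IH; exists j].
Qed.

Definition pcoord (p : pt F) (c : nat) : F :=
  match c with 0%N => ptP p | 1%N => ptZ p | _ => ptQ p end.

Definition tpt : Type := (term * term * term)%type.
Definition evalpt e (p : tpt) : pt F := (GRing.eval e p.1.1, GRing.eval e p.1.2, GRing.eval e p.2).

Definition distT (p q : tpt) : term :=
  (GRing.NatConst F 2 - GRing.NatConst F 2 * p.1.2 * q.1.2 - p.1.1 * q.2 - p.2 * q.1.1)%T.

Section System.
Variables (H : graph) (lt : {fset nat} -> term) (M : nat).
Let vs : seq nat := (vset H `\` [fset 1; 2]%N)%fset.
Let k3 := (3 * size vs)%N.

Definition tnorth : tpt := (GRing.NatConst F 0, GRing.NatConst F 1, GRing.NatConst F 0).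
Definition tsecond : tpt :=
  let z := (GRing.NatConst F 1 - lt [fset 1; 2]%N%fset * GRing.Const (2^-1)%R)%T in
  (GRing.NatConst F 1, z, GRing.NatConst F 1 - z ^+ 2)%T.

(** The free vertices of configuration number [i] use the [i]-th block of [k3] variables after the
    first [M], three variables for each vertex. *)
Definition tconf (i v : nat) : tpt :=
  if v == 1%N then tnorth else if v == 2%N then tsecond else
  if v \in vs then
    let b := (M + (i * k3 + index v vs * 3))%N in
    (GRing.Var F b, GRing.Var F (b + 1), GRing.Var F (b + 2))
  else tnorth.

Definition sysF (i : nat) : formula :=
  GRing.And
    (conjF vs (fun v => GRing.Equal
       ((tconf i v).1.1 * (tconf i v).2 + (tconf i v).1.2 ^+ 2)%T (GRing.NatConst F 1)))
    (conjF [seq (u, v) | u <- vset H, v <- vset H] (fun uv =>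
       if [fset uv.1; uv.2]%fset \in eset H
       then GRing.Equal (distT (tconf i uv.1) (tconf i uv.2)) (lt [fset uv.1; uv.2]%fset)
       else GRing.Bool true)).

Definition diffF (i j : nat) : formula :=
  disjF vs (fun v => GRing.Not (GRing.And (GRing.Equal (tconf i v).1.1 (tconf j v).1.1)
    (GRing.And (GRing.Equal (tconf i v).1.2 (tconf j v).1.2)
               (GRing.Equal (tconf i v).2 (tconf j v).2)))).

Definition aconf e i : conf F := fun v => evalpt e (tconf i v).

Hypothesis HH : framed H.

Lemma in_frame v : v \in vset H -> v \notin vs -> v = 1%N \/ v = 2%N.
Proof.
by move=> vV; rewrite /vs !inE vV andbT negbK => /orP[]/eqP->; [left|right].
Qed.

Lemma aconf_notin e i v : v \notin vset H -> aconf e i v = north F.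
Proof.
have [sV _] := HH => vV; rewrite /aconf /tconf; case: eqP => // v1.
have [v2|v2] := eqVneq v 2%N.
  by rewrite v2 in vV; case/negP: vV; apply: (fsubsetP sV); rewrite !inE.
by rewrite /vs !inE (negPf vV) andbF.
Qed.

Lemma aconf_onq e i v : (v \in vs -> onq (aconf e i v)) -> onq (aconf e i v).
Proof.
have [vvs|vvs] := boolP (v \in vs); first exact.
move=> _; have [vV|vV] := boolP (v \in vset H); last by rewrite aconf_notin //; exact: onq_north.
have [->|->] := in_frame vV vvs; first exact: onq_north.
exact: onq_second.
Qed.

Lemma holds_sysF e i :
  GRing.holds e (sysF i) <-> confs H (fun a => GRing.eval e (lt a)) (aconf e i).
Proof.
rewrite /sysF /=; split=> [[/holds_conjF h1 /holds_conjF h2]|[_ _ _ h1 h2]]; last first.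
  split; apply/holds_conjF; first by move=> v vV; exact: (h1 v).
  by move=> [u v] _ /=; case: ifP => //= uv; exact: h2.
split=> //.
- exact: aconf_notin.
- by move=> v; apply: aconf_onq => vvs; exact: (h1 v vvs).
- move=> u v uv; have [/fsubsetP sub _] := edgeP uv.
  have := h2 (u, v); rewrite /= uv; apply; apply/allpairsP; exists (u, v); split=> //=.
    by apply: sub; rewrite !inE eqxx.
  by apply: sub; rewrite !inE eqxx orbT.
Qed.

Lemma holds_diffF e i j : GRing.holds e (diffF i j) <-> aconf e i <> aconf e j.
Proof.
split=> [/holds_disjF[v vvs /= h] E|ne].
  apply: h; have := congr1 (fun c : conf F => c v) E; rewrite /aconf /evalpt => -[h1 h2 h3]; by split.
apply/holds_disjF; apply: contrapT => h; apply: ne; apply/funext => v.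
have [vvs|vvs] := boolP (v \in vs).
  apply: contrapT => nv; apply: h; exists v => //= -[h1 [h2 h3]]; apply: nv.
  by rewrite /aconf /evalpt h1 h2 h3.
by rewrite /aconf /tconf (negPf vvs).
Qed.

Definition encode (xs : seq (conf F)) : seq F :=
  mkseq (fun j => pcoord (nth (fun _ => north F) xs (j %/ k3) (nth 0%N vs ((j %% k3) %/ 3))) (j %% 3))
    (size xs * k3).

Lemma aconf_encode e xs i : size e = M -> (i < size xs)%N ->
  confs H (fun a => GRing.eval (e ++ encode xs) (lt a)) (nth (fun _ => north F) xs i) ->
  aconf (e ++ encode xs) i = nth (fun _ => north F) xs i.
Proof.
move=> sM isz; set x := nth _ xs i => -[x1 x2 xn _ _]; apply/funext => v.
have [vV|vV] := boolP (v \in vset H); last by rewrite aconf_notin // xn.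
have [vvs|vvs] := boolP (v \in vs); last first.
  by have [->|->] := in_frame vV vvs; rewrite ?x1 ?x2.
rewrite /aconf /tconf vvs.
have -> : (v == 1%N) = false by apply: contraTF vvs => /eqP ->; rewrite /vs !inE.
have -> : (v == 2%N) = false by apply: contraTF vvs => /eqP ->; rewrite /vs !inE.
have iv : (index v vs < size vs)%N by rewrite index_mem.
have key c : (c < 3)%N -> (e ++ encode xs)`_(M + (i * k3 + index v vs * 3) + c) = pcoord (x v) c.
  move=> c3; rewrite nth_cat sM -addnA ltnNge leq_addr /= addKn.
  have rk : (index v vs * 3 + c < k3)%N by rewrite /k3; move: iv; lia.
  have k0 : (0 < k3)%N by apply: leq_trans rk.
  rewrite -addnA nth_mkseq; last first.
    by rewrite (@leq_trans (i.+1 * k3)) ?leq_mul2r ?isz ?orbT // mulSn addnC ltn_add2r.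
  rewrite divnMDl // modnMDl (divn_small rk) (modn_small rk) addn0 -/x.
  rewrite divnMDl // (divn_small c3) addn0 nth_index //; congr pcoord.
  by rewrite /k3 (mulnCA i 3) [(3 * _)%N]mulnC addnA -mulnDl modnMDl modn_small.
rewrite /evalpt /= -[X in _`_X]addn0 !key //.
by case: (x v) => -[].
Qed.

(** There are [N] distinct configurations that satisfy the additional condition [g]; the first [M]
    variables remain free as parameters. *)
Definition extF (N : nat) (g : formula) : formula :=
  foldr GRing.Exists (GRing.And (conjF (iota 0 N) sysF) (GRing.And
     (conjF [seq ij <- [seq (i, j) | i <- iota 0 N, j <- iota 0 N] | (ij.1 < ij.2)%N]
            (fun ij => diffF ij.1 ij.2)) g)) (iota M (N * k3)).

Definition readall e N := [seq aconf e i | i <- iota 0 N].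

Variable l : {fset nat} -> F.

Lemma confs_ext y : (forall a, a \in eset H -> GRing.eval y (lt a) = l a) ->
  confs H (fun a => GRing.eval y (lt a)) = confs H l.
Proof.
move=> lE; have [_ e12] := HH; apply/seteqP; split=> x [h1 h2 h3 h4 h5].
  by split=> //; [rewrite h2 lE|move=> u v uv; rewrite (h5 u v uv) lE].
by split=> //; [rewrite h2 lE|move=> u v uv; rewrite (h5 u v uv) lE].
Qed.

Lemma readall_encode e xs : size e = M ->
  (forall a y, a \in eset H -> GRing.eval (e ++ y) (lt a) = l a) ->
  (forall x, x \in xs -> confs H l x) -> readall (e ++ encode xs) (size xs) = xs.
Proof.
move=> sM lE cx; apply: (@eq_from_nth _ (fun _ => north F)); rewrite size_map size_iota // => i iN.
rewrite (nth_map 0%N) ?size_iota // nth_iota // add0n aconf_encode //.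
rewrite (confs_ext (lE^~ _)); exact/cx/mem_nth.
Qed.

Lemma holds_extF N g e : size e = M ->
  (forall a y, a \in eset H -> GRing.eval (e ++ y) (lt a) = l a) ->
  (GRing.holds e (extF N g) <-> exists y, [/\ size y = (N * k3)%N, uniq (readall (e ++ y) N),
     forall x, x \in readall (e ++ y) N -> confs H l x & GRing.holds (e ++ y) g]).
Proof.
move=> sM lE; have cE y := confs_ext (lE^~ y); rewrite /extF holds_exists //.
have nx y i : (i < N)%N -> nth (fun _ => north F) (readall (e ++ y) N) i = aconf (e ++ y) i.
  by move=> iN; rewrite (nth_map 0%N) ?size_iota // nth_iota // add0n.
split=> [[y [sy /= [/holds_conjF h1 [/holds_conjF h2 hg]]]]|[y [sy ux cx hg]]]; exists y; split=> //.
- apply/(uniqP (fun _ => north F)) => i j; rewrite !inE size_map size_iota => iN jN.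
  rewrite !nx // => E; apply/eqP; rewrite eqn_leq; apply/andP.
  have {}h2 a b : (a < b < N)%N -> aconf (e ++ y) a <> aconf (e ++ y) b.
    move=> /andP[ab bN]; apply/holds_diffF; apply: (h2 (a, b)); rewrite mem_filter /= ab.
    by apply/allpairsP; exists (a, b); split; rewrite ?mem_iota ?add0n //= (ltn_trans ab bN).
  by split; rewrite leqNgt; apply/negP => lt_;
    [apply: (h2 j i); rewrite ?lt_ // E | apply: (h2 i j); rewrite ?lt_ // E].
- by move=> x /mapP[i iN ->]; rewrite -(cE y); apply/holds_sysF/h1.
- split; first apply/holds_conjF => i iN.
    by apply/holds_sysF; rewrite cE; apply: cx; apply: map_f.
  split=> //; apply/holds_conjF => -[i j]; rewrite mem_filter => /andP[/= ij /allpairsP[[i' j'] /= [hi hj [Ei Ej]]]].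
  move: hi hj; rewrite -Ei -Ej !mem_iota /= add0n => hi hj; apply/holds_diffF => E.
  have := uniqP (fun _ => north F) ux i j; rewrite !inE size_map size_iota hi hj !nx // => /(_ isT isT E) ij'.
  by rewrite ij' ltnn in ij.
Qed.
End System.
End QE.

(** * Finiteness and genericity of the number of configurations *)

Section Counting.
Variable F : numClosedFieldType.
Variable H : graph.
Hypothesis HH : framed H.
Let vs : seq nat := (vset H `\` [fset 1; 2]%N)%fset.

(** All the elements g + m with m a natural number lie outside [D], and only finitely many are roots
    of [p]. *)
Lemma acf_infinite_compl (D : set F) g (p : {poly F}) : acf D -> ~ D g -> p != 0 ->
  exists y, ~ D y /\ p.[y] != 0.
Proof.
move=> HD Dg p0; apply: contrapT => h.
have all_root m : root p (g + m%:R).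
  apply: contrapT => /negP nr; apply: h; exists (g + m%:R); split=> // Dgm; apply: Dg.
  rewrite -[g](addrK m%:R); apply: (subringB (acf_subring HD)) => //.
  exact: (subring_nat (acf_subring HD)).
have := @max_poly_roots _ p [seq g + m%:R | m <- iota 0 (size p)] p0.
rewrite size_map size_iota ltnn => /(_ _ _); apply/not_implyP; split.
  by apply/allP => _ /mapP[m _ ->]; exact: all_root.
apply/not_implyP; split=> //; rewrite map_inj_uniq ?iota_uniq // => m m' /addrI/eqP.
by rewrite eqr_nat => /eqP.
Qed.

Section Finite.
Variables (l : {fset nat} -> F) (D : set F) (g al be ga : F).
Hypotheses (HD : acf D) (Dg : ~ D g).
Let cond x := al * cs x + be * ct x = ga.
Hypothesis inD : forall x, confs H l x -> cond x -> forall v, inB D (x v).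

(** The set of values of a coordinate is definable, hence finite or cofinite. It is contained in the
    proper algebraically closed subfield [D], and so cannot be cofinite. *)
Lemma coord_finite v c : exists s : seq F, forall x, confs H l x -> cond x -> pcoord (x v) c \in s.
Proof.
pose lt a : GRing.term F := GRing.Const (l a).
pose tc i := @tconf F H lt 1 0 i.
pose tcoord (p : tpt F) := match c with 0%N => p.1.1 | 1%N => p.1.2 | _ => p.2 end.
pose gf : GRing.formula F := GRing.And
  (GRing.Equal (GRing.Const al * distT (tc 0%N) (tc 1%N) + GRing.Const be * distT (tc 0%N) (tc 2%N))%T
    (GRing.Const ga))
  (GRing.Equal (tcoord (tc v)) (GRing.Var F 0%N)).
have [p [b [p0 hp]]] := formula_finite (extF H lt 1 1 gf).
have sem y : GRing.holds [:: y] (extF H lt 1 1 gf) <->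
    exists x, [/\ confs H l x, cond x & pcoord (x v) c = y].
  rewrite (@holds_extF _ H lt 1 HH l 1) //; split.
    move=> [ys [sy _ cx /= [h1 h2]]]; exists (aconf H lt 1 ([:: y] ++ ys) 0); split.
    - by apply: cx; rewrite inE.
    - exact: h1.
    - by rewrite -[RHS]h2 /pcoord /tcoord; case: (c) => [|[|]].
  move=> [x [cx condx cy]]; exists (encode H [:: x]).
  have E : readall H lt 1 ([:: y] ++ encode H [:: x]) 1 = [:: x].
    by apply: (@readall_encode _ H lt 1 HH l) => // z; rewrite inE => /eqP ->.
  rewrite E; split=> //; first by rewrite size_mkseq.
    by move=> z; rewrite inE => /eqP ->.
  have Ex : aconf H lt 1 ([:: y] ++ encode H [:: x]) 0 = x by case: E.
  have Ev i : evalpt ([:: y] ++ encode H [:: x]) (tc i) = x i by rewrite -{2}Ex.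
  split; first by move: condx; rewrite /cond /cs /ct -(Ev 0%N) -(Ev 1%N) -(Ev 2%N).
  transitivity (pcoord (evalpt ([:: y] ++ encode H [:: x]) (tc v)) c); last by rewrite Ev.
  by rewrite /pcoord /tcoord; case: (c) => [|[|]].
have b0 : b = false.
  apply: contraTF isT => bt; have [y [Dy py]] := acf_infinite_compl HD Dg p0.
  have /sem[x [cx condx cy]] : GRing.holds [:: y] (extF H lt 1 1 gf) by apply/hp.
  have [h1 h2 h3] := inD cx condx v.
  by case: Dy; rewrite -cy; case: (c) => [|[|]].
have [rs Ers] := closed_field_poly_normal p.
exists rs => x cx condx; apply: contraT => nrs.
have : p.[pcoord (x v) c] != 0.
  by rewrite -rootE Ers rootZ ?lead_coef_eq0 // root_prod_XsubC.
by move=> /hp; rewrite b0 => -[h _]; have /h : GRing.holds [:: pcoord (x v) c] (extF H lt 1 1 gf) by apply/sem; exists x.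
Qed.

Lemma confs_finite : exists s : seq (conf F), uniq s /\ forall x, x \in s <-> (confs H l x /\ cond x).
Proof.
have [L HL] : exists L : seq (conf F), forall x, confs H l x -> cond x ->
    exists2 x', x' \in L & forall v, v \in vs -> x v = x' v.
  elim: vs => [|v ws [L HL]]; first by exists [:: fun _ => north F] => x _ _; exists (fun _ => north F); rewrite ?inE.
  have [s0 h0] := coord_finite v 0; have [s1 h1] := coord_finite v 1; have [s2 h2] := coord_finite v 2.
  pose pts := [seq (p, q) | p <- [seq (p, z) | p <- s0, z <- s1], q <- s2].
  exists [seq (fun u => if u == v then p else x' u) : conf F | x' <- L, p <- pts] => x cx condx.
  have [x' x'L Ex'] := HL x cx condx.
  exists (fun u => if u == v then x v else x' u).
    apply/allpairsP; exists (x', x v); split=> //=.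
    apply/allpairsP; exists (ptP (x v), ptZ (x v), ptQ (x v)); split=> /=; last by case: (x v) => -[].
      apply/allpairsP; exists (ptP (x v), ptZ (x v)); split=> //=; [exact: (h0 x) | exact: (h1 x)].
    exact: (h2 x).
  by move=> u; rewrite inE; case: eqP => [->|_] //= /Ex'.
pose fix_ (x' : conf F) : conf F := fun v => if v \in vs then x' v else
  if v == 2%N then second (l [fset 1; 2]%N%fset) else north F.
exists (undup [seq x <- [seq fix_ x' | x' <- L] | `[< confs H l x /\ cond x >]]).
split=> [|x]; first exact: undup_uniq.
rewrite mem_undup mem_filter; split=> [/andP[/asboolP//]|[cx condx]].
rewrite asboolT //=; have [x' x'L Ex] := HL x cx condx.
apply/mapP; exists x' => //; apply/funext => v; rewrite /fix_.
have [x1 x2 xn _ _] := cx; case: ifP => [/Ex//|nv].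
case: eqP => [->//|v2]; have [vV|/xn//] := boolP (v \in vset H).
by have [->|//] := in_frame vV (negbT nv).
Qed.
End Finite.

(** Applied to the expected number and to its successor, this pins down the number of configurations
    on a Zariski open set. *)
Lemma generic_count N : exists p : {mpoly F[#|{: eset H}|]}, exists b : bool, p != 0 /\
  forall l : {fset nat} -> F, p.@[fun i => l (val (enum_val i))] != 0 ->
    ((exists xs : seq (conf F), [/\ size xs = N, uniq xs & forall x, x \in xs -> confs H l x])
      <-> b = true).
Proof.
pose lt (a : {fset nat}) : GRing.term F :=
  if (insub a : option (eset H)) is Some e then GRing.Var F (enum_rank e) else GRing.NatConst F 0.
set n := #|_|; pose M := n.
have [p [b [p0 hp]]] := formula_mpoly n (extF H lt M N (GRing.Bool true)).
exists p, b; split=> // l /hp <-; set e := [seq _ | _ <- _].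
have se : size e = n by rewrite size_map size_enum_ord.
have lE a y : a \in eset H -> GRing.eval (e ++ y) (lt a) = l a.
  move=> aE; rewrite /lt insubT /= nth_cat se ltn_ord (nth_map (enum_rank [` aE]%fset)) ?size_enum_ord //.
  by rewrite nth_ord_enum enum_rankK.
rewrite (holds_extF HH N _ se lE); split=> [[xs [sx ux cx]]|[y [_ uy cy _]]].
  exists (encode H xs); have E := readall_encode HH se lE cx; rewrite sx in E.
  by rewrite E; split=> //; rewrite size_mkseq sx.
by exists (readall H lt M (e ++ y) N); split=> //; rewrite size_map size_iota.
Qed.
End Counting.

Lemma min_measure (T : Type) (m : T -> nat) (Pr : T -> Prop) :
  (exists P, Pr P) -> exists P, Pr P /\ forall Q, Pr Q -> (m P <= m Q)%N.
Proof.
move=> [P0 HP0]; pose pn n := `[< exists P, Pr P /\ m P = n >].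
have [|n /asboolP[P [HP En]] nmin] := @ex_minnP pn.
  by exists (m P0); apply/asboolP; exists P0.
exists P; split=> // Q HQ; rewrite En; apply: nmin; apply/asboolP; by exists Q.
Qed.

(** * Coupler curves *)

Section Multiplicity.
Variable F : numClosedFieldType.

Lemma mup1_deriv (p : {poly F}) x : root p x -> ~~ root p^`() x -> mup x p = 1%N.
Proof.
move=> /factor_theorem[q ->]; rewrite derivM derivXsubC mulr1 => h.
have qx : ~~ root q x.
  by move: h; rewrite rootE !hornerE /= subrr mulr0 add0r.
by rewrite mupMr // (@mup_XsubCX _ 1) eqxx.
Qed.

Lemma mup_scale (p : {poly F}) x c : c != 0 -> mup x (c *: p) = mup x p.
Proof. by move=> c0; rewrite -mul_polyC mupMr // rootC. Qed.

Lemma mup_prod I (s : seq I) (f : I -> {poly F}) x : \prod_(i <- s) f i != 0 ->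
  mup x (\prod_(i <- s) f i) = (\sum_(i <- s) mup x (f i))%N.
Proof.
elim: s => [|i s IH]; first by rewrite !big_nil mupNroot // rootC oner_neq0.
rewrite !big_cons => h; move: (h); rewrite mulf_eq0 negb_or => /andP[fi h'].
by rewrite mupM // IH.
Qed.

Variable K : set F.
Hypothesis HK : acf K.
Let Ks := acf_subring HK.
Let P1 := [set q : {poly F} | pov K q].
Let P1s : subring P1 := pov_subring Ks.

Lemma horner_map_deriv (M : {poly {poly F}}) r :
  (map_poly (@deriv F) M).[r%:P] = (M.[r%:P])^`().
Proof.
rewrite (@horner_coef_wide _ (size M)) ?size_poly // horner_coef raddf_sum /=.
apply: eq_bigr => i _; rewrite coef_map_id0 ?linear0 // derivM -polyC_exp derivC mulr0 addr0 //.
Qed.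

(* Both sides are the exponent of the irreducible relation between [t] and [r]. *)
Lemma mup_swap (M : {poly {poly F}}) t r : pov P1 M -> M != 0 -> ~ K t -> ~ K r ->
  mup r (map_poly (horner_eval t) M) = mup t (M.[r%:P]).
Proof.
move=> KM M0 Kt Kr.
pose ev (R : {poly {poly F}}) := (map_poly (horner_eval t) R).[r].
have evE R : ev R = (R.[r%:P]).[t] by rewrite /ev horner_map_eval.
pose Pr (R : {poly {poly F}}) := [/\ pov P1 R, R != 0 & ev R = 0].
have [n] := ubnP (size M); elim: n M KM M0 => // n IH M KM M0 sM.
have [Mv|Mv] := eqVneq (ev M) 0; last first.
  by rewrite !mupNroot // rootE -?evE.
(* A relation between t and r of least degree in the outer variable and, among those, of least
   degree in the inner one; then neither partial derivative vanishes at the point. *)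
have [|p1 [Hp1 min1]] := @min_measure _ (fun R : {poly {poly F}} => size R) Pr; first by exists M.
have [|p [[Hp sp] min2]] := @min_measure _ (fun R : {poly {poly F}} => size (swapXY R))
    (fun R => Pr R /\ size R = size p1); first by exists p1.
rewrite -sp in min1 min2; case: Hp => Kp p0 pv.
have Amap R : pov P1 R -> R != 0 -> map_poly (horner_eval t) R != 0.
  by move=> KR; apply: contra_neq => /(map_horner0 HK Kt KR).
have Bmap R : pov P1 R -> R != 0 -> R.[r%:P] != 0.
  move=> KR; apply: contra_neq => R0; apply/eqP; rewrite -swapXY_eq0; apply/eqP.
  apply: (map_horner0 HK Kr (pov2_swap KR)); by rewrite -horner_swapXY swapXYK.
have sp2 : (1 < size p)%N.
  rewrite ltnNge; apply/negP => sp1; have Ep : p = (p`_0)%:P by apply: size1_polyC.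
  move: pv; rewrite /ev Ep map_polyC hornerC => pv.
  by move: p0; rewrite Ep (acf_horner0 HK Kt (Kp 0%N) pv) eqxx.
have natn0 (q : {poly F}) m : q != 0 -> q *+ m.+1 != 0.
  by move=> q0; rewrite -scaler_nat scaler_eq0 pnatr_eq0 negb_or q0.
have smaller R : pov P1 R -> (size R < size p)%N -> ev R = 0 -> R = 0.
  move=> KR sR Rv; apply/eqP; apply: contraTT sR => R0; rewrite -leqNgt.
  exact: min1.
have dX : ~~ root (map_poly (horner_eval t) p)^`() r.
  rewrite deriv_map rootE -/(ev _); apply/eqP => dv.
  have /eqP := smaller _ (pov_deriv P1s Kp) (lt_size_deriv p0) dv; apply/negP.
  apply/eqP => /(congr1 (fun q : {poly {poly F}} => q`_((size p).-2))).
  rewrite coef_deriv coef0; apply/eqP; rewrite prednK -?subn1 ?subn_gt0 // subn1.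
  by case: (size p) sp2 (lead_coefE p) => [|[|m]] //= _ El; apply: natn0; rewrite -El lead_coef_eq0.
have dT : ~~ root (p.[r%:P])^`() t.
  rewrite -horner_map_deriv rootE -evE; apply/eqP => dv.
  have Kd : pov P1 (map_poly (@deriv F) p).
    by move=> i; rewrite coef_map_id0 ?linear0 //; apply: (pov_deriv Ks); apply: Kp.
  have sd : (size (map_poly (@deriv F) p) <= size p)%N by apply: size_poly.
  (* If the derivative in the inner variable were zero, [p] would have constant coefficients and
     make [r] algebraic over [K]. *)
  have [d0|d0] := eqVneq (map_poly (@deriv F) p) 0.
    apply: Kr; pose q := map_poly (horner_eval 0) p.
    have Eq i : p`_i = (q`_i)%:P.
      have : (p`_i)^`() = 0.
        by rewrite -[_^`()](@coef_map_id0 _ _ (@deriv F)) ?linear0 // d0 coef0.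
      move=> di; rewrite coef_map /= /horner_eval horner_coef0.
      apply/polyP => j; rewrite coefC; case: j => [|j] //=.
      have := congr1 (fun q : {poly F} => q`_j) di; rewrite coef_deriv coef0 => /eqP.
      by rewrite -mulr_natr mulf_eq0 pnatr_eq0 orbF => /eqP.
    have Kq : pov K q.
      move=> i; rewrite coef_map; apply: (pov_horner Ks); [exact: Kp|exact: (subring0 Ks)].
    apply: (acf_root HK Kq).
      by apply: contraNneq p0 => q0; apply/eqP/polyP => i; rewrite Eq q0 !coef0.
    have Ep : p = map_poly polyC q by apply/polyP => i; rewrite coef_map Eq.
    by move: pv; rewrite evE Ep horner_map hornerC => /rootP.
  move: sd; rewrite leq_eqVlt => /orP[/eqP sd|sd]; last first.
    by move: d0; rewrite (smaller _ Kd sd dv) eqxx.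
  have := min2 _ (conj (And3 Kd d0 dv) sd); rewrite leqNgt.
  have -> : swapXY (map_poly (@deriv F) p) = (swapXY p)^`().
    apply/polyP => i; apply/polyP => j.
    rewrite coef_swapXY [in RHS]coef_deriv coefMn coef_swapXY.
    rewrite (@coef_map_id0 _ _ (@deriv F)) ?linear0 //; exact: coef_deriv.
  by rewrite lt_size_deriv // swapXY_eq0.
have rA : root (map_poly (horner_eval t) p) r by apply/rootP.
have rB : root p.[r%:P] t by apply/rootP; rewrite -evE.
have mA := mup1_deriv rA dX; have mB := mup1_deriv rB dT.
(* Dividing by [p] lowers both multiplicities by one; the factor introduced by pseudo-division does
   not vanish at [t]. *)
have [k [h [R [Kh KR E sR]]]] := pseudo_div P1s KM Kp p0.
have R0 : R = 0.
  apply: smaller => //; have := congr1 ev E.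
  rewrite /ev rmorphD rmorphM map_polyZ /= !hornerE.
  by rewrite -/(ev M) -/(ev p) Mv pv !mulr0 add0r.
have {}E : (lead_coef p ^+ k)%:P * M = h * p by rewrite mul_polyC E R0 addr0.
clear KR sR R0.
have Klc : pov K (lead_coef p) by exact: Kp.
have lct : (lead_coef p).[t] != 0.
  apply: contra p0 => /eqP h0; rewrite -lead_coef_eq0.
  by rewrite (acf_horner0 HK Kt Klc h0).
have ck : lead_coef p ^+ k != 0 by rewrite expf_neq0 // lead_coef_eq0.
have h0 : h != 0.
  by apply: contra_neq M0 => h0; move/eqP: E; rewrite h0 mul0r mulf_eq0 polyC_eq0 (negPf ck) => /eqP.
have sh : (size h < size M)%N.
  have := congr1 (fun q : {poly {poly F}} => size q) E; rewrite /= mul_polyC size_scale // size_mul // => ->.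
  by move: sp2; move: (size h) (size p) => a b; case: b => [|[|b]] // _; rewrite addnS addnS /= ltnS leq_addr.
have IHh := IH h Kh h0 (leq_trans sh sM).
have -> : mup r (map_poly (horner_eval t) M) = (mup r (map_poly (horner_eval t) h)).+1.
  rewrite -(@mup_scale _ _ ((lead_coef p).[t] ^+ k)) ?expf_neq0 //.
  have -> : (lead_coef p).[t] ^+ k *: map_poly (horner_eval t) M =
      map_poly (horner_eval t) h * map_poly (horner_eval t) p.
    by rewrite -rmorphM -E rmorphM /= map_polyC /= /horner_eval horner_exp mul_polyC.
  by rewrite mupM ?Amap // mA addn1.
have <- : mup t ((lead_coef p ^+ k) * M.[r%:P]) = mup t M.[r%:P].
  by rewrite mupMr // rootE horner_exp expf_neq0.
have -> : lead_coef p ^+ k * M.[r%:P] = h.[r%:P] * p.[r%:P].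
  by rewrite -hornerM -E hornerM hornerC.
by rewrite mupM ?Bmap // mB addn1 IHh.
Qed.
End Multiplicity.

(** * Polynomial dependence from conjugation and integrality *)

Section Integral.
Variable F : numClosedFieldType.

Lemma val_integral (O : set F) (p : {poly F}) y : subring O -> (forall x, O x \/ O x^-1) ->
  pov O p -> p \is monic -> root p y -> O y.
Proof.
move=> HO OV Op mp /rootP py; case: (OV y) => // Oy.
have [->|y0] := eqVneq y 0; first exact: (subring0 HO).
have p0 : (0 < size p)%N by rewrite size_poly_gt0 monic_neq0.
have sE : size p = (size p).-1.+1 by rewrite prednK.
have : p.[y] = 0 by []; rewrite horner_coef sE big_ord_recr /= -lead_coefE (monicP mp) mul1r.
case: (size p).-1 => [|n].
  by rewrite big_ord0 expr0 add0r => /eqP; rewrite oner_eq0.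
move=> /eqP; rewrite addr_eq0 => /eqP E.
have -> : y = - (\sum_(i < n.+1) p`_i * y^-1 ^+ (n - i)).
  apply: (mulIf (expf_neq0 n y0)); rewrite -exprS -[LHS]opprK -E mulNr; congr (- _).
  rewrite mulr_suml; apply: eq_bigr => i _; rewrite -mulrA; congr (_ * _).
  have -> : y ^+ n = y ^+ (n - i) * y ^+ i by rewrite -exprD subnK // -ltnS.
  by rewrite mulrA -exprMn mulVf // expr1n mul1r.
apply: (subringN HO); apply: (subring_sum HO) => i _.
by apply: (subringM HO) => //; apply: (subringX HO).
Qed.

Variable k : set F.
Hypothesis Hk : acf k.
Let ks := acf_subring Hk.

Lemma pov_divXsubC p a : pov k p -> k a -> root p a ->
  exists2 q, pov k q & p = q * ('X - a%:P).
Proof.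
move=> kp ka pa; have kX : pov k ('X - a%:P) by apply: (povB ks); [exact: (povX ks)|exact: (povC ks)].
have X0 : 'X - a%:P != 0 by rewrite polyXsubC_eq0.
have [m [h [r [kh kr]]]] := pseudo_div ks kp kX X0.
rewrite lead_coefXsubC expr1n scale1r size_XsubC => E sr.
have Er : r = (r`_0)%:P by apply: size1_polyC; rewrite -ltnS.
have r0 : r`_0 = 0.
  move/rootP: pa; rewrite E hornerD hornerM hornerXsubC subrr mulr0 add0r.
  by rewrite [X in X.[a]]Er hornerC.
by exists h => //; rewrite E Er r0 addr0.
Qed.

Lemma mx_horner (O : set F) u a p : subring O -> (forall x, O x \/ O x^-1) -> k `<=` O ->
  k a -> mx O (u - a) -> pov k p -> mx O (p.[u] - p.[a]).
Proof.
move=> HO OV kO ka mu kp.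
have kp' : pov k (p - p.[a]%:P) by apply: (povB ks) => //; apply: (povC ks); exact: (pov_horner ks).
have ra : root (p - p.[a]%:P) a by rewrite rootE !hornerE subrr.
have [q kq E] := pov_divXsubC kp' ka ra.
have -> : p.[u] - p.[a] = (p - p.[a]%:P).[u] by rewrite !hornerE.
rewrite E !hornerE; apply: (mxM HO) => //; apply: (pov_horner HO); first exact: pov_sub kO kq.
by rewrite -[u](subrK a); apply: (subringD HO); [exact: (mx_O HO OV) | exact: kO].
Qed.

(* The invariance makes y a rational function of u, and the integrality at the
   finite places removes the denominators. *)
Lemma poly_integral u y : ~ k u -> cl k u y ->
  (forall G y', piso G -> acf (dom G) -> acf (cod G) -> idon k `<=` G -> G (u, u) ->
     G (y, y') -> y' = y) ->
  (forall a O, k a -> place k (u - a) O -> O y) ->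
  exists p, pov k p /\ p.[u] = y.
Proof.
move=> ku cy fix_y int_y.
have [_ [_ [[p kp <-] [q kq <-] qu0 Ey]]] : fracs (adj k u) y.
  apply: galois_fixed => //; first exact: adj_ring.
  move=> G y' HG Hd Hc sub Gy; apply: (fix_y G) => //.
    by move=> [a b] [/= ka ->]; apply: sub; split=> //=; exact: adj_sub.
  by apply: sub; split=> //=; exact: adj_gen.
have [|[p' q'] [[/= kp' kq' qu' Ey'] qmin]] :=
    @min_measure _ (fun pq : {poly F} * {poly F} => size pq.2)
      (fun pq => [/\ pov k pq.1, pov k pq.2, pq.2.[u] != 0 & y = pq.1.[u] / pq.2.[u]]).
  by exists (p, q).
have q'0 : q' != 0 by apply: contraNneq qu' => ->; rewrite horner0.
have [sq|sq] := eqVneq (size q') 1%N.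
  have /eqP/size_poly1P[c c0 Ec] := sq.
  exists (c^-1 *: p'); split; last by rewrite hornerZ Ey' Ec hornerC mulrC.
  apply: (povZ ks) => //; apply: acf_inv => //.
  by have := kq' 0%N; rewrite Ec coefC.
(* At a place over a root of the denominator y is finite, so the numerator vanishes there too and a
   common factor can be cancelled, against minimality. *)
have [a qa] := closed_rootP q' sq; have ka : k a by exact: (acf_root Hk kq' q'0 qa).
have kua : ~ k (u - a) by move=> h; apply: ku; rewrite -[u](subrK a); apply: (subringD ks).
have [O HP] := place_exists Hk kua; have Oy := int_y a O ka HP.
have [HO kO Ow Ow' OV] := HP.
have w0 : u - a != 0.
  by apply/eqP => w0; apply: Ow'; rewrite w0 invr0; exact: (subring0 HO).
have mw : mx O (u - a) by right.
have mq := mx_horner HO OV kO ka mw kq'; rewrite (rootP qa) subr0 in mq.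
have mp : mx O (p'.[u]).
  have -> : p'.[u] = y * q'.[u] by rewrite Ey' divfK.
  exact: (mxM HO).
have pa : root p' a.
  apply/rootP; apply: (K_mx Hk kO); first exact: (pov_horner ks).
  have -> : p'.[a] = p'.[u] - (p'.[u] - p'.[a]) by rewrite subKr.
  by apply: (mxB HO OV) => //; apply: mx_horner.
have [p2 kp2 Ep] := pov_divXsubC kp' ka pa; have [q2 kq2 Eq] := pov_divXsubC kq' ka qa.
have q2u : q2.[u] != 0 by apply: contraNneq qu' => h; rewrite Eq hornerM h mul0r.
have q20 : q2 != 0 by apply: contraNneq q2u => ->; rewrite horner0.
have Ey2 : y = p2.[u] / q2.[u].
  by rewrite Ey' Ep Eq !hornerM hornerXsubC; field; rewrite q2u w0.
have := qmin (p2, q2) (And4 kp2 kq2 q2u Ey2).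
by rewrite /= Eq size_mul ?polyXsubC_eq0 // size_XsubC addn2 /= ltnn.
Qed.
End Integral.

(** [poly_integral] finds the coefficients at one transcendental [u]; an isomorphism over [k]
    carries the identity to every other one. *)
Lemma poly_family (F : numClosedFieldType) (k : set F) (f : F -> {poly F}) : acf k ->
  (exists u, ~ k u) ->
  (forall u, ~ k u -> pov (cl k u) (f u)) ->
  (forall G u u', piso G -> acf (dom G) -> acf (cod G) -> idon k `<=` G -> ~ k u -> ~ k u' ->
    G (u, u') -> prel G (f u) (f u')) ->
  (forall u a O, ~ k u -> k a -> place k (u - a) O -> pov O (f u)) ->
  exists2 P : {poly {poly F}}, pov [set q | pov k q] P &
    forall u, ~ k u -> map_poly (horner_eval u) P = f u.
Proof.
move=> Hk [u ku] fin fconj fint; have ks := acf_subring Hk.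
have /choice[p Hp] : forall i, exists p, pov k p /\ p.[u] = (f u)`_i.
  move=> i; apply: (poly_integral Hk ku); first exact: fin.
  - by move=> G y' HG Hd Hc sub Gu Gy; apply: (piso_fun HG Gy); exact: (fconj G u u).
  - by move=> a O ka HO; exact: (fint u a).
pose P := \poly_(i < size (f u)) p i.
have Pi i : pov k P`_i /\ (P`_i).[u] = (f u)`_i.
  rewrite coef_poly; case: ltnP => h; first exact: Hp.
  by rewrite nth_default // horner0; split=> //; exact: (pov0 ks).
exists P => [i|u0 ku0]; first exact: (Pi i).1.
have dI : dom (idon k) = k /\ cod (idon k) = k.
  by split; apply/seteqP; split=> x; [case=> y [/= h _]|exists x; split|case=> y [/= h ->]|exists x; split].
have [G [sub HG Hd Hc Gu]] : exists G', [/\ idon k `<=` G', piso G', acf (dom G'), acf (cod G') & G' (u, u0)].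
  by apply: piso_transc; rewrite ?dI.1 ?dI.2 //; exact: piso_id.
have Gf := fconj G u u0 HG Hd Hc sub ku ku0 Gu.
apply/polyP => i; rewrite coef_map /= /horner_eval; apply: (piso_fun HG (x := (f u)`_i)); last exact: Gf.
rewrite -(Pi i).2; apply: prel_horner => // j; apply: sub; split=> //=; exact: (Pi i).1.
Qed.

(** * Configurations on a line al s + be t = ga, and the equation of a coupler curve *)

Section CurveLists.
Variable F : numClosedFieldType.

Definition cset (H : graph) (l : {fset nat} -> F) (al be ga : F) : set (conf F) :=
  [set x | confs H l x /\ al * cs x + be * ct x = ga].

Definition lists (T : eqType) (X : set T) (s : seq T) := uniq s /\ forall x, x \in s <-> X x.

(* A listing of [cset]; the junk value [::] occurs only if [cset] is infinite. *)
Definition clist H l al be ga : seq (conf F) :=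
  if pselect (exists s, lists (cset H l al be ga) s) is left p then projT1 (cid p) else [::].

Definition Gpt (G : set (F * F)) (p q : pt F) :=
  [/\ G (ptP p, ptP q), G (ptZ p, ptZ q) & G (ptQ p, ptQ q)].

Section Transport.
Variables (G : set (F * F)) (H : graph).
Hypotheses (HG : piso G) (HH : precal H).
Let Gs := HG.1.

Lemma G1 : G (1, 1). Proof. exact: (subring1 Gs). Qed.
Lemma G0 : G (0, 0). Proof. exact: (subring0 Gs). Qed.
Lemma GB x x' y y' : G (x, x') -> G (y, y') -> G (x - y, x' - y').
Proof. by move=> h1 h2; exact: (subringB Gs h1 h2). Qed.
Lemma GD x x' y y' : G (x, x') -> G (y, y') -> G (x + y, x' + y').
Proof. by move=> h1 h2; exact: (subringD Gs h1 h2). Qed.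
Lemma GM x x' y y' : G (x, x') -> G (y, y') -> G (x * y, x' * y').
Proof. by move=> h1 h2; exact: (subringM Gs h1 h2). Qed.
Lemma G2 : G (2, 2). Proof. exact: (GD G1 G1). Qed.

Lemma G_inv x x' : acf (dom G) -> G (x, x') -> G (x^-1, x'^-1).
Proof.
move=> Hd Gx; have [x0|x0] := eqVneq x 0.
  have x'0 : x' = 0 by have [/= h _] := HG.2 _ Gx; apply: h.
  by rewrite x0 x'0 invr0; exact: G0.
have [y Gy] : dom G x^-1 by apply: acf_inv => //; exists x'.
suff -> : x'^-1 = y by [].
have x'0 : x' != 0.
  apply: contraNneq x0 => x'0; have [/= _ h] := HG.2 _ Gx; exact/eqP/h.
apply: (mulfI x'0); rewrite mulfV //.
by apply: (piso_fun HG G1); have := GM Gx Gy; rewrite mulfV.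
Qed.

Lemma G_dist p p' q q' : Gpt G p p' -> Gpt G q q' -> G (dist p q, dist p' q').
Proof.
move=> [p1 p2 p3] [q1 q2 q3]; apply: GB; last exact: GM.
apply: GB; last exact: GM; apply: GB; first exact: G2.
by apply: GM => //; apply: GM => //; exact: G2.
Qed.

Lemma G_fun p q q' : Gpt G p q -> Gpt G p q' -> q = q'.
Proof.
case: q q' => -[a b] c [[a' b'] c'] [h1 h2 h3] [h1' h2' h3'].
by rewrite (piso_fun HG h1 h1' : a = a') (piso_fun HG h2 h2' : b = b') (piso_fun HG h3 h3' : c = c').
Qed.

Lemma G_injp p p' q : Gpt G p q -> Gpt G p' q -> p = p'.
Proof.
case: p p' => -[a b] c [[a' b'] c'] [h1 h2 h3] [h1' h2' h3'].
by rewrite (piso_inj HG h1 h1' : a = a') (piso_inj HG h2 h2' : b = b') (piso_inj HG h3 h3' : c = c').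
Qed.

Variables (l l' : {fset nat} -> F) (al be ga ga' : F).
Hypotheses (Hd : acf (dom G)) (Gl : forall e, e \in eset H -> G (l e, l' e)).
Hypotheses (Ga : G (al, al)) (Gb : G (be, be)) (Gg : G (ga, ga')).

Lemma G_north : Gpt G (north F) (north F).
Proof. by split; [exact: G0|exact: G1|exact: G0]. Qed.

Lemma cset_transport x x' : (forall v, Gpt G (x v) (x' v)) -> cset H l al be ga x ->
  cset H l' al be ga' x'.
Proof.
move=> Gx [[x1 x2 xn xq xe] xc]; have [_ e12 _] := HH; split; first split.
- by have := Gx 1%N; rewrite x1 => h; exact: (G_fun h G_north).
- have := Gx 2%N; rewrite x2 => h2; apply: (G_fun h2).
  have h : G (1 - l [fset 1; 2]%N%fset / 2, 1 - l' [fset 1; 2]%N%fset / 2).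
    apply: GB; first exact: G1; apply: GM; first exact: Gl.
    by apply: G_inv => //; exact: G2.
  by split; [exact: G1|exact: h|apply: GB; [exact: G1|exact: GM]].
- by move=> v vV; have := Gx v; rewrite xn // => h; exact: (G_fun h G_north).
- move=> v; have [h1 h2 h3] := Gx v; apply: (piso_fun HG _ G1).
  rewrite -{1}(xq v); apply: GD; [exact: GM|exact: GM].
- move=> u v uv; apply: (piso_fun HG _ (Gl uv)).
  by rewrite -(xe u v uv); exact: G_dist.
- by apply: (piso_fun HG _ Gg); rewrite -xc; apply: GD; apply: GM => //; exact: G_dist.
Qed.

Lemma transport_map s s' : lists (cset H l al be ga) s -> lists (cset H l' al be ga') s' ->
  (forall x, x \in s -> forall v, inB (dom G) (x v)) ->
  exists phi : conf F -> conf F, [/\ uniq (map phi s), {subset map phi s <= s'} &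
    forall x, x \in s -> forall v, Gpt G (x v) (phi x v)].
Proof.
move=> [us ms] [us' ms'] ds.
have /choice[phi Hphi] : forall x, exists x', x \in s -> forall v, Gpt G (x v) (x' v).
  move=> x; have [xs|_] := boolP (x \in s); last by exists x.
  have /choice[f Hf] : forall v, exists q, Gpt G (x v) q.
    by move=> v; have [[a Ha] [b Hb] [c Hc]] := ds x xs v; exists (a, b, c).
  by exists f.
exists phi; split=> //.
  rewrite map_inj_in_uniq // => x y xs ys E; apply/funext => v.
  by apply: G_injp (Hphi x xs v) _; rewrite E; exact: Hphi.
by move=> _ /mapP[x xs ->]; apply/ms'; apply: cset_transport (Hphi x xs) _; exact/ms.
Qed.
End Transport.

(** Conjugation embeds each list into the other, so the two have the same length and the embedding
    is a bijection. *)
Lemma transport G H l l' al be ga ga' s s' : piso G -> precal H ->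
  acf (dom G) -> acf (cod G) -> (forall e, e \in eset H -> G (l e, l' e)) ->
  G (al, al) -> G (be, be) -> G (ga, ga') ->
  lists (cset H l al be ga) s -> lists (cset H l' al be ga') s' ->
  (forall x, x \in s -> forall v, inB (dom G) (x v)) ->
  (forall x, x \in s' -> forall v, inB (cod G) (x v)) ->
  exists phi : conf F -> conf F, perm_eq (map phi s) s' /\
    forall x, x \in s -> forall v, Gpt G (x v) (phi x v).
Proof.
move=> HG HH Hd Hc Gl Ga Gb Gg ls ls' ds ds'.
have [phi [u1 sub1 h1]] := transport_map HG HH Hd Gl Ga Gb Gg ls ls' ds.
have [psi [u2 sub2 _]] := @transport_map _ H (piso_sym HG) HH l' l al be ga' ga Hc Gl Ga Gb Gg _ _ ls' ls ds'.
exists phi; split=> //; apply: uniq_perm => //; first by case: ls'.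
have s12 := uniq_leq_size u1 sub1; have s21 := uniq_leq_size u2 sub2.
rewrite !size_map in s12 s21.
by apply: (uniq_min_size u1 sub1 _).2; rewrite size_map.
Qed.

(** A root is repeated according to the number of configurations above it; the intersection count
    needs this weight. *)
Definition cpoly (s : seq (conf F)) : {poly F} := \prod_(x <- s) ('X - (ct x)%:P).

Lemma root_cpoly (s : seq (conf F)) t : root (cpoly s) t <-> exists2 x, x \in s & ct x = t.
Proof.
have -> : cpoly s = \prod_(r <- map (@ct F) s) ('X - r%:P) by rewrite big_map.
rewrite root_prod_XsubC; split=> [/mapP[x xs ->]|[x xs <-]]; [by exists x|exact: map_f].
Qed.

Lemma G_ct (G : set (F * F)) x x' : piso G -> (forall v, Gpt G (x v) (x' v)) -> G (ct x, ct x').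
Proof. by move=> HG h; exact: G_dist. Qed.

Lemma prel_cpoly G s (phi : conf F -> conf F) : piso G ->
  (forall x, x \in s -> forall v, Gpt G (x v) (phi x v)) ->
  prel G (cpoly s) (cpoly (map phi s)).
Proof.
move=> HG; elim: s => [|x s IH] h.
  move=> i; rewrite /cpoly big_nil coefC; case: ifP => _; [exact: (G1 HG)|exact: (G0 HG)].
rewrite /cpoly /= !big_cons; apply: prelM => //.
  by apply: prelXsubC => //; apply: G_ct => // v; apply: h; exact: mem_head.
by apply: IH => y ys; apply: h; rewrite inE ys orbT.
Qed.

Lemma pov_cpoly (S : set F) s : subring S -> (forall x, x \in s -> S (ct x)) -> pov S (cpoly s).
Proof.
move=> HS; elim: s => [|x s IH] h; rewrite /cpoly ?big_nil ?big_cons.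
  by apply: (povC HS); exact: (subring1 HS).
apply: (povM HS); last by apply: IH => y ys; apply: h; rewrite inE ys orbT.
apply: (povB HS); first exact: (povX HS).
by apply: (povC HS); apply: h; exact: mem_head.
Qed.

Section Curve.
Variables (K : set F) (H : graph) (l : {fset nat} -> F).
Hypotheses (HK : acf K) (HH : precal H).
Let l12 := l [fset 1; 2]%N%fset.
Hypotheses (Kl : K l12) (l0 : l12 != 0) (l4 : l12 != 4).
Hypothesis Hind : indep K (lens H l).
Hypothesis Hbig : forall s, exists g, ~ spanf K s g.
Let k1 := spanf K (lens H l).
Let Hk1 : acf k1 := span_acf _ HK.
Let vs1 : seq nat := (vset H `\` [fset 1; 2]%N)%fset.

Lemma k1_len e : e \in eset H -> k1 (l e).
Proof.
move=> eE; have [->|ne] := eqVneq e [fset 1; 2]%N%fset; first exact: span_sub.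
by apply: span_mem => //; apply: map_f; rewrite !inE ne.
Qed.

Lemma cset_gen al be ga x : K al -> K be -> cset H l al be ga x -> spanf K (gensS x vs1) ga.
Proof.
move=> Ka Kb [cx <-]; have [h1 h2] := st_gens HK cx Kl.
have Ss := acf_subring (span_acf (gensS x vs1) HK).
by apply: (subringD Ss); apply: (subringM Ss) => //; apply: (span_sub _ HK).
Qed.

Lemma cset_in al be ga x : K al -> K be -> ~ k1 ga -> cset H l al be ga x ->
  forall v, inB (spanf K (ga :: lens H l)) (x v).
Proof.
move=> Ka Kb kga cx; have [Hx _] := cx.
exact: (gen_span HK HH Hx Kl l0 l4 Hind kga (cset_gen Ka Kb cx)).
Qed.

Lemma clistP al be ga : K al -> K be -> ~ k1 ga -> lists (cset H l al be ga) (clist H l al be ga).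
Proof.
move=> Ka Kb kga; rewrite /clist; case: pselect => [p|]; first exact: (projT2 (cid p)).
move=> ne; case: ne; have [g Hg] := Hbig (ga :: lens H l).
apply: (confs_finite (precal_framed HH) (span_acf _ HK) Hg) => x cx cond.
exact: (cset_in Ka Kb kga (conj cx cond)).
Qed.

Lemma K1 : K 1. Proof. exact: (subring1 (acf_subring HK)). Qed.

Lemma clist1P u : ~ k1 u -> lists (cset H l 1 1 u) (clist H l 1 1 u).
Proof. by apply: clistP; exact: K1. Qed.

Lemma clist1_in u x : ~ k1 u -> x \in clist H l 1 1 u -> forall v, inB (cl k1 u) (x v).
Proof. by move=> ku /(clist1P ku).2; apply: cset_in => //; exact: K1. Qed.

Lemma cs_u u x : ~ k1 u -> x \in clist H l 1 1 u -> cs x = u - ct x.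
Proof. by move=> ku /(clist1P ku).2[_]; rewrite !mul1r => <-; rewrite addrK. Qed.

Lemma ct_in u x : ~ k1 u -> x \in clist H l 1 1 u -> cl k1 u (ct x).
Proof. by move=> ku xs; apply: dist_in; [exact: cl_acf|exact: clist1_in|exact: clist1_in]. Qed.

Lemma clist_conj G u u' : piso G -> acf (dom G) -> acf (cod G) ->
  (forall e, e \in eset H -> G (l e, l e)) -> k1 `<=` dom G -> k1 `<=` cod G ->
  G (u, u') -> ~ k1 u -> ~ k1 u' -> exists phi : conf F -> conf F,
    perm_eq (map phi (clist H l 1 1 u)) (clist H l 1 1 u') /\
    forall x, x \in clist H l 1 1 u -> forall v, Gpt G (x v) (phi x v).
Proof.
move=> HG Hd Hc gl kd kc Gu ku ku'.
apply: (transport HG HH Hd Hc gl (G1 HG) (G1 HG) Gu (clist1P ku) (clist1P ku')).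
- move=> x xs v; apply: inB_sub (clist1_in ku xs v); apply: cl_min => //; by exists u'.
- move=> x xs v; apply: inB_sub (clist1_in ku' xs v); apply: cl_min => //; by exists u.
Qed.

Lemma idon_len G : idon k1 `<=` G ->
  [/\ forall e, e \in eset H -> G (l e, l e), k1 `<=` dom G & k1 `<=` cod G].
Proof.
move=> sub; split=> [e eE|a ka|a ka]; first by apply: sub; split=> //; exact: k1_len.
  by exists a; apply: sub.
by exists a; apply: sub.
Qed.

Lemma cpoly_conj G u u' : piso G -> acf (dom G) -> acf (cod G) ->
  (forall e, e \in eset H -> G (l e, l e)) -> k1 `<=` dom G -> k1 `<=` cod G ->
  G (u, u') -> ~ k1 u -> ~ k1 u' ->
  prel G (cpoly (clist H l 1 1 u)) (cpoly (clist H l 1 1 u')).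
Proof.
move=> HG Hd Hc gl kd kc Gu ku ku'.
have [phi [pe hphi]] := clist_conj HG Hd Hc gl kd kc Gu ku ku'.
have -> : cpoly (clist H l 1 1 u') = cpoly (map phi (clist H l 1 1 u)).
  by rewrite /cpoly (perm_big _ pe).
exact: prel_cpoly.
Qed.

(** At a finite u an infinite t makes s infinite too, with s/t tending to -1. That limit lies in [K]
    and is excluded by [place_bad]. *)
Lemma ct_place u a O x : ~ k1 u -> k1 a -> place k1 (u - a) O ->
  x \in clist H l 1 1 u -> O (ct x).
Proof.
move=> ku ka [HO kO Ow Ow' OV] xs; apply: contrapT => nO.
have w0 : u - a != 0.
  by apply/eqP => w0; apply: Ow'; rewrite w0 invr0; exact: (subring0 HO).
have Cx : cset H l 1 1 u x by apply/(clist1P ku).2.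
have Hx := Cx.1; have mw : mx O (u - a) by right.
have xu := cset_gen K1 K1 Cx.
have kx : k1 `<=` spanf K (gensS x vs1).
  apply: span_min; [exact: span_acf|exact: span_sub|move=> y yl].
  apply: (lens_span Hx Kl) => // v vV v1 v2; left; by rewrite mem_vs1 v1 v2.
have xw : spanf K (gensS x vs1) (u - a).
  by apply: (subringB (acf_subring (span_acf _ HK))) => //; exact: kx.
have Ou : O u by rewrite -[u](subrK a); apply: (subringD HO) => //; exact: kO.
have Ecs := cs_u ku xs; have nS : ~ O (cs x).
  move=> h; apply: nO; have -> : ct x = u - cs x by rewrite Ecs subKr.
  exact: (subringB HO).
apply: (place_bad HK HH Hx Kl l0 l4 Hind HO OV kO w0 mw xw); [by right|by right|].
have K1' := subring1 (acf_subring HK).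
constructor 3; left; exists (- 1); first exact: (subringN (acf_subring HK)).
have t0 := NO0 HO nO; have -> : cs x / ct x - -1 = u * (ct x)^-1 by rewrite Ecs; field.
by apply: (mxM HO) => //; exact: NOmx.
Qed.

(** The equation of the curve in the coordinates u = s + t and t, with weights. That t has no pole
    at a finite u makes its coefficients polynomials in u. *)
Lemma curve_poly : exists P : {poly {poly F}}, [/\ pov [set q | pov k1 q] P, P \is monic &
  forall u, ~ k1 u -> map_poly (horner_eval u) P = cpoly (clist H l 1 1 u)].
Proof.
have ks := acf_subring Hk1.
have [] := @poly_family F k1 (fun u => cpoly (clist H l 1 1 u)) Hk1 (Hbig (lens H l)).
- by move=> u ku; apply: (pov_cpoly (acf_subring (cl_acf Hk1 u))) => x xs; exact: ct_in.
- by move=> G u u' HG Hd Hc /idon_len[gl kd kc] ku ku' Gu; exact: cpoly_conj.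
- move=> u a O ku ka HO; have [HO' _ _ _ _] := HO.
  by apply: (pov_cpoly HO') => x xs; exact: (ct_place ku ka HO xs).
move=> P KP EP; exists P; split=> //.
have [u ku] := Hbig (lens H l).
have : (lead_coef P).[u] = 1.
  have h : (lead_coef P).[u] != 0.
    have P0 : P != 0.
      apply: contraTneq (monic_prod_XsubC (clist H l 1 1 u) predT (@ct F)) => P0.
      by rewrite -/(cpoly _) -EP // P0 rmorph0 monicE lead_coef0 eq_sym oner_eq0.
    apply/eqP => h; move: P0; rewrite -lead_coef_eq0.
    by rewrite [lead_coef P](acf_horner0 Hk1 ku (KP _) h) eqxx.
  have := lead_coef_map_eq (f := horner_eval u) (p := P) h; rewrite EP // => E.
  by rewrite -[LHS]E; apply/monicP; exact: monic_prod_XsubC.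
move=> h; rewrite monicE -subr_eq0; apply/eqP; apply: (acf_horner0 Hk1 ku).
  by apply: (povB ks); [exact: KP|apply: (povC ks); exact: (subring1 ks)].
by rewrite !hornerE h subrr.
Qed.

Lemma ct_integral (O : set F) u x : subring O -> (forall z, O z \/ O z^-1) -> k1 `<=` O ->
  ~ k1 u -> O u -> x \in clist H l 1 1 u -> O (ct x).
Proof.
move=> HO OV kO ku Ou xs; have [P [KP _ EP]] := curve_poly.
apply: (val_integral HO OV (p := cpoly (clist H l 1 1 u))).
- rewrite -EP // => i; rewrite coef_map /=; apply: (pov_horner HO) => //.
  exact: pov_sub kO (KP i).
- exact: monic_prod_XsubC.
- by apply/root_cpoly; exists x.
Qed.

(** An isomorphism that fixes k' and [tau] fixes all edge lengths and hence the equation; so the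
    coefficients are rational in the single length [tau], by [galois_fixed]. This allows [tau] to be
    treated as a variable. *)
Lemma curve_poly_tau (P : {poly {poly F}}) (k' : set F) tau :
  pov [set q | pov k1 q] P ->
  (forall u, ~ k1 u -> map_poly (horner_eval u) P = cpoly (clist H l 1 1 u)) ->
  acf k' -> cl k' tau = k1 -> (forall e, e \in eset H -> adj k' tau (l e)) ->
  forall i j, fracs (adj k' tau) P`_i`_j.
Proof.
move=> KP EP Hk' Ek adl i j; have ks := acf_subring Hk1.
have As := adj_ring Hk' tau; apply: galois_fixed => //.
  by rewrite -/(cl k' tau) Ek; exact: KP.
move=> G y' HG Hd Hc sub Gy.
(* The restriction to [k1] leaves room to send a transcendental [u] to itself. *)
have GG := HG.1; pose G' : set (F * F) := [set a | [/\ G a, k1 a.1 & k1 a.2]].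
have HG' : piso G'.
  split; last by move=> a [Ga _ _]; exact: HG.2.
  split=> [|a b [Ga a1 a2] [Gb b1 b2]|a b [Ga a1 a2] [Gb b1 b2]].
  - by split; [exact: (subring1 GG)|exact: (subring1 ks)|exact: (subring1 ks)].
  - by split; [exact: (subringB GG)|exact: (subringB ks)|exact: (subringB ks)].
  - by split; [exact: (subringM GG)|exact: (subringM ks)|exact: (subringM ks)].
have tot a b : G (a, b) -> (k1 a -> k1 b) /\ (k1 b -> k1 a).
  move=> Gab; split=> [ka|kb].
    have : alg (adj k' tau) a by rewrite -/(cl k' tau) Ek.
    move=> [p [Sp p0 /rootP pa]]; rewrite -Ek; exists p; split=> //; apply/rootP.
    apply: (piso_fun HG (x := 0)); last exact: (G0 HG).
    by rewrite -pa; apply: prel_horner => // m; apply: sub; split=> //=; exact: Sp.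
  have : alg (adj k' tau) b by rewrite -/(cl k' tau) Ek.
  move=> [p [Sp p0 /rootP pb]]; rewrite -Ek; exists p; split=> //; apply/rootP.
  apply: (piso_inj HG (y := 0)); last exact: (G0 HG).
  by rewrite -pb; apply: prel_horner => // m; apply: sub; split=> //=; exact: Sp.
have idk a : k' a -> G (a, a) by move=> ka; apply: sub; split=> //=; exact: adj_sub.
have Gt : G (tau, tau) by apply: sub; split=> //=; exact: adj_gen.
have kd : k1 `<=` dom G.
  by rewrite -Ek; apply: cl_min => //; [move=> a /idk; exists a|exists tau].
have kc : k1 `<=` cod G.
  by rewrite -Ek; apply: cl_min => //; [move=> a /idk; exists a|exists tau].
have dE : dom G' = k1.
  apply/seteqP; split=> a; first by case=> b [].
  by move=> ka; have [b Gab] := kd a ka; exists b; split=> //=; exact: (tot a b Gab).1.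
have cE : cod G' = k1.
  apply/seteqP; split=> b; first by case=> a [].
  by move=> kb; have [a Gab] := kc b kb; exists a; split=> //=; exact: (tot a b Gab).2.
have [u ku] := Hbig (lens H l).
have Ad : acf (dom G') by rewrite dE.
have Ac : acf (cod G') by rewrite cE.
have nd : ~ dom G' u by rewrite dE.
have nc : ~ cod G' u by rewrite cE.
have [G3 [sub3 HG3 Hd3 Hc3 Gu]] := piso_transc HG' Ad Ac nd nc.
have dk : k1 `<=` dom G3.
  by move=> a; rewrite -{1}dE => -[b Gb]; exists b; exact: sub3.
have ck : k1 `<=` cod G3.
  by move=> b; rewrite -{1}cE => -[a Ga]; exists a; exact: sub3.
have gl e : e \in eset H -> G3 (l e, l e).
  move=> eE; apply: sub3; split; [apply: sub; split=> //=; exact: adl|exact: k1_len|exact: k1_len].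
have Gf := cpoly_conj HG3 Hd3 Hc3 gl dk ck Gu ku ku.
have /choice[f Hf] : forall m, exists b, G' (P`_i`_m, b).
  by move=> m; have : dom G' (P`_i`_m) by [rewrite dE; exact: KP].
pose q := \poly_(m < size P`_i) f m.
have rq : prel G3 P`_i q.
  move=> m; rewrite coef_poly; case: ltnP => h; first exact/sub3/Hf.
  by rewrite nth_default //; exact: (G0 HG3).
have kq : pov k1 q.
  move=> m; rewrite coef_poly; case: ifP => _; last exact: (subring0 ks).
  by have [] := Hf m.
have Pq : P`_i = q.
  have E : (P`_i).[u] = q.[u].
    apply: (piso_fun HG3 (x := (P`_i).[u])); last exact: prel_horner.
    have -> : (P`_i).[u] = (cpoly (clist H l 1 1 u))`_i by rewrite -EP // coef_map.
    exact: Gf.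
  apply/eqP; rewrite -subr_eq0; apply/eqP; apply: (acf_horner0 Hk1 ku).
    by apply: (povB ks) => //; exact: KP.
  by rewrite !hornerE E subrr.
have Gy3 : G3 (P`_i`_j, y').
  by apply: sub3; split=> //=; [exact: KP|apply: (tot _ _ Gy).1; exact: KP].
by apply: (piso_fun HG3 Gy3); have := rq j; rewrite -Pq.
Qed.
End Curve.
End CurveLists.

(** * Intersection of two coupler curves *)

Section Pair.
Variable F : numClosedFieldType.

Lemma mx_horner2 (O k : set F) (P : {poly {poly F}}) u r y t : acf k -> subring O ->
  (forall x, O x \/ O x^-1) -> k `<=` O -> k r -> k t -> pov [set q | pov k q] P ->
  mx O (u - r) -> mx O (y - t) ->
  mx O ((map_poly (horner_eval u) P).[y] - (map_poly (horner_eval r) P).[t]).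
Proof.
move=> Hk HO OV kO kr kt KP mu my.
rewrite (@horner_coef_wide _ (size P)) ?size_poly // [X in _ - X](@horner_coef_wide _ (size P)) ?size_poly //.
rewrite -sumrB; apply: big_ind => [|a b|i _]; [exact: mx0|exact: (mxD HO OV)|].
have ks := acf_subring Hk; rewrite !coef_map /= /horner_eval.
apply: (resM HO OV kO); [by apply: (pov_horner ks) => //; exact: KP|exact: (subringX ks)| |].
  by apply: (mx_horner Hk) => //; exact: KP.
elim: (nat_of_ord i) => [|n IH]; first by rewrite !expr0 subrr; exact: mx0.
by rewrite !exprS; apply: (resM HO OV kO) => //; exact: (subringX ks).
Qed.

(** If r, once found without x, were to need x beyond the other entries, exchange would make x
    algebraic over the rest of the independent family. *)
Lemma choose_tau (K : set F) s r : acf K -> indep K s -> spanf K s r -> ~ K r ->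
  exists A tau B, s = A ++ tau :: B /\ ~ spanf K (A ++ B) r.
Proof.
move=> HK; elim: s => [|x s IH] /=; first by move=> _ Kr nKr.
move=> [xs is_] rs nKr; have [rs'|nrs] := EM (spanf K s r); last by exists [::], x, s.
have [A [tau [B [E h]]]] := IH is_ rs' nKr; exists (x :: A), tau, B; rewrite E; split=> //= rAB.
apply: xs; have HAB := span_acf (A ++ B) HK.
have := cl_exchange HAB rAB h; apply: cl_min; first exact: span_acf.
  by apply: span_subseq => // z; rewrite E !mem_cat inE => /orP[]->; rewrite ?orbT.
exact: rs'.
Qed.

Variables (K : set F) (H1 H2 : graph) (l1 l2 : {fset nat} -> F).
Let a12 := l1 [fset 1; 2]%N%fset.
Let b12 := l2 [fset 1; 2]%N%fset.
Hypotheses (HK : acf K) (HH1 : precal H1) (HH2 : precal H2).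
Hypotheses (Ka : K a12) (a0 : a12 != 0) (a4 : a12 != 4).
Hypotheses (Kb : K b12) (b0 : b12 != 0) (b4 : b12 != 4).
Hypothesis Hind : indep K (lens H1 l1 ++ lens H2 l2).
Hypothesis Hbig : forall s, exists g, ~ spanf K s g.
Let L1 := lens H1 l1.
Let L2 := lens H2 l2.
Let k1 := spanf K L1.
Let k2 := spanf K L2.
Let k12 := spanf K (L1 ++ L2).
Let Hk1 : acf k1 := span_acf _ HK.
Let Hk2 : acf k2 := span_acf _ HK.
Let Hk12 : acf k12 := span_acf _ HK.

Lemma ind1 : indep K L1. Proof. exact: indep_subseq Hind. Qed.
Lemma ind2 : indep K L2. Proof. by move: Hind; rewrite indep_catE // => -[]. Qed.
Lemma k1_12 : k1 `<=` k12.
Proof. by apply: span_subseq => // z; rewrite mem_cat => ->. Qed.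
Lemma k2_12 : k2 `<=` k12.
Proof. by apply: span_subseq => // z; rewrite mem_cat => ->; rewrite orbT. Qed.
Lemma k1_k2 x : k1 x -> k2 x -> K x.
Proof. by move=> h1 h2; apply: (span_capI HK Hind). Qed.

(** A point of the second curve that is not algebraic over [k2] has s and t independent over [K];
    two independent elements of [k1] cannot lie on a curve over [k2], by [span_cap2]. *)
Lemma common_curve x : confs H2 l2 x -> k1 (cs x) -> k1 (ct x) ->
  ~ (k2 (cs x) /\ k2 (ct x)) -> False.
Proof.
move=> Hx s1 t1 n2; have [gs gt] := st_gens HK Hx Kb.
have [g [ng Sg]] : exists g, ~ k2 g /\ spanf K (gensS x (vset H2 `\` [fset 1; 2]%N)%fset) g.
  have [ks|ns] := EM (k2 (cs x)); last by exists (cs x).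
  by exists (ct x); split=> // kt; apply: n2.
have ist := st_indep HK HH2 Hx Kb b0 b4 ind2 ng Sg.
have gin := gen_span HK HH2 Hx Kb b0 b4 ind2 ng Sg.
apply: (span_cap2 HK Hind ist s1 t1 (g := g)); apply: dist_in => //; exact: span_acf.
Qed.

(** Suppose that s + t is in [k1]. If t is too, the point is either algebraic over [k2] as well,
    hence over [K], against [no_K], or it contradicts [common_curve]. If t is transcendental over
    [k1], then s/t tends to -1 at a pole of t, against [place_bad]. *)
Lemma pair_generic x1 x2 : confs H1 l1 x1 -> confs H2 l2 x2 -> cs x1 = cs x2 -> ct x1 = ct x2 ->
  ~ k1 (cs x1 + ct x1).
Proof.
move=> Hx1 Hx2 Es Et kr; have ks := acf_subring Hk1; have Ks := acf_subring HK.
have [t1|nt] := EM (k1 (ct x1)).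
  have s1 : k1 (cs x1) by rewrite -[cs x1](addrK (ct x1)); exact: (subringB ks).
  have [[s2 t2]|n2] := EM (k2 (cs x2) /\ k2 (ct x2)).
    rewrite -Es -Et in s2 t2; apply: (no_K HK HH1 Hx1 Ka a0 a4 ind1).
    by apply: (st_coords Hx1 Ka a0 a4 HK) => //; exact: k1_k2.
  by apply: (common_curve Hx2) n2; rewrite -?Es -?Et.
have nt' : ~ k1 (ct x1)^-1 by move=> h; apply: nt; rewrite -[ct x1]invrK; exact: acf_inv.
have [O [HO kO Ow Ow' OV]] := place_exists Hk1 nt'; rewrite invrK in Ow'.
have t0 := NO0 HO Ow'.
have w0 : (ct x1)^-1 != 0 by rewrite invr_eq0.
have mw : mx O (ct x1)^-1 := NOmx Ow'.
have xw : spanf K (gensS x1 (vset H1 `\` [fset 1; 2]%N)%fset) (ct x1)^-1.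
  by apply: acf_inv; [exact: span_acf|exact: (st_gens HK Hx1 Ka).2].
have Or : O (cs x1 + ct x1) by exact: kO.
have ns : ~ O (cs x1).
  move=> h; apply: Ow'; have -> : ct x1 = (cs x1 + ct x1) - cs x1 by ring.
  exact: (subringB HO).
apply: (place_bad HK HH1 Hx1 Ka a0 a4 ind1 HO OV kO w0 mw xw); [by right|by right|].
constructor 3; left; exists (- 1); first by apply: (subringN Ks); exact: (subring1 Ks).
have -> : cs x1 / ct x1 - -1 = (cs x1 + ct x1) * (ct x1)^-1 by field.
exact: (mxM HO).
Qed.

Let C1 u := clist H1 l1 1 1 u.
Let C2 u := clist H2 l2 1 1 u.

(** If r were in [k1], so would be the common limit of the ordinates. For r in [k2] the limit
    position is then defined over [K], against [place_bad]; otherwise it is a point of the second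
    curve with coordinates in [k1], against [common_curve]. *)
Lemma root_generic u r O x1 x2 : ~ k12 u -> k12 r -> place k12 (u - r) O ->
  x1 \in C1 u -> x2 \in C2 u -> mx O (ct x1 - ct x2) -> ~ k1 r.
Proof.
move=> ku kr HP x1s x2s mt kr1; have [HO kO Ow Ow' OV] := HP.
have Ks := acf_subring HK; have ks1 := acf_subring Hk1.
have ku1 : ~ k1 u by move=> /k1_12.
have ku2 : ~ k2 u by move=> /k2_12.
have kO1 : k1 `<=` O by apply: subset_trans kO; exact: k1_12.
have kO2 : k2 `<=` O by apply: subset_trans kO; exact: k2_12.
have w0 : u - r != 0.
  by apply/eqP => w0; apply: Ow'; rewrite w0 invr0; exact: (subring0 HO).
have mw : mx O (u - r) by right.
have L1P := clist1P HK HH1 Ka a0 a4 ind1 Hbig ku1.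
have L2P := clist1P HK HH2 Kb b0 b4 ind2 Hbig ku2.
have Cx1 := (L1P.2 x1).1 x1s; have Cx2 := (L2P.2 x2).1 x2s.
have cl_u k : acf k -> k r -> cl k u `<=` cl k (u - r).
  move=> Hk kkr; apply: cl_min; [exact: cl_acf|exact: (cl_sub Hk)|].
  have := subringD (acf_subring (cl_acf Hk (u - r))) (cl_gen Hk (u - r)) (cl_sub Hk (u - r) kkr).
  by rewrite subrK.
have Ot1 : O (ct x1) by apply: (ct_place HK HH1 Ka a0 a4 ind1 Hbig ku1 kr1 _ x1s).
have [t0 kt0 ht0] : exists2 a, k1 a & mx O (ct x1 - a).
  apply: (residue HO OV Hk1 kO1 w0 mw) => //; apply: cl_u => //.
  exact: (ct_in HK HH1 Ka a0 a4 ind1 Hbig ku1 x1s).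
have ht2 : mx O (ct x2 - t0).
  have -> : ct x2 - t0 = (ct x1 - t0) - (ct x1 - ct x2) by ring.
  exact: (mxB HO OV).
have kt12 := k1_12 kt0.
have Ot2 : O (ct x2) by exact: (res_O HO OV kO kt12).
have [kr2|nkr2] := EM (k2 r).
  have [t0' kt0' ht0'] : exists2 a, k2 a & mx O (ct x2 - a).
    apply: (residue HO OV Hk2 kO2 w0 mw) => //; apply: cl_u => //.
    exact: (ct_in HK HH2 Kb b0 b4 ind2 Hbig ku2 x2s).
  have Et := res_uniq HO OV Hk12 kO kt12 (k2_12 kt0') ht2 ht0'.
  have Kt0 : K t0 by apply: k1_k2 => //; rewrite Et.
  have Kr : K r by exact: k1_k2.
  have Ecs := cs_u HK HH1 Ka a0 a4 ind1 Hbig ku1 x1s.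
  have hs : mx O (cs x1 - (r - t0)) by rewrite Ecs; exact: (resB HO OV).
  have Ou : O u by exact: (res_O HO OV kO kr).
  have xw : spanf K (gensS x1 (vset H1 `\` [fset 1; 2]%N)%fset) (u - r).
    apply: (subringB (acf_subring (span_acf _ HK))); last exact: span_sub.
    exact: (cset_gen HK Ka (K1 HK) (K1 HK) Cx1).
  apply: (place_bad HK HH1 Cx1.1 Ka a0 a4 ind1 HO OV kO1 w0 mw xw).
  - by left; exists (r - t0) => //; exact: (subringB Ks).
  - by left; exists t0.
  - by constructor 2.
have [P2 [KP2 mP2 EP2]] := curve_poly HK HH2 Kb b0 b4 ind2 Hbig.
have r2 : (map_poly (horner_eval r) P2).[t0] = 0.
  have KP : pov [set q | pov k12 q] P2 by move=> i; apply: pov_sub (KP2 i); exact: k2_12.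
  have := mx_horner2 Hk12 HO OV kO kr kt12 KP mw ht2.
  have -> : (map_poly (horner_eval u) P2).[ct x2] = 0.
    by rewrite EP2 //; apply/rootP/root_cpoly; exists x2.
  rewrite sub0r => /(mxN HO); rewrite opprK; apply: (K_mx Hk12 kO).
  apply: (pov_horner (acf_subring Hk12)) => // i; rewrite coef_map /=.
  by apply: (pov_horner (acf_subring Hk12)) => //; exact: KP.
have : root (cpoly (C2 r)) t0 by rewrite -EP2 //; exact/rootP.
case/root_cpoly => x2' x2s' Et2.
have Cx2' := ((clist1P HK HH2 Kb b0 b4 ind2 Hbig nkr2).2 x2').1 x2s'.
have Es2 := cs_u HK HH2 Kb b0 b4 ind2 Hbig nkr2 x2s'; rewrite Et2 in Es2.
apply: (common_curve Cx2'.1); rewrite ?Es2 ?Et2 //; first exact: (subringB ks1).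
move=> [ks kt]; apply: nkr2; rewrite -[r](subrK t0); exact: (subringD (acf_subring Hk2)).
Qed.
End Pair.

Lemma prel_prod (F : numClosedFieldType) (G : set (F * F)) (I : eqType) (s : seq I) (f g : I -> {poly F}) :
  piso G -> (forall i, i \in s -> prel G (f i) (g i)) ->
  prel G (\prod_(i <- s) f i) (\prod_(i <- s) g i).
Proof.
move=> HG; elim: s => [|i s IH] h.
  by rewrite !big_nil => j; rewrite !coefC; case: ifP => _; [exact: (G1 HG)|exact: (G0 HG)].
rewrite !big_cons; apply: prelM => //; first by apply: h; exact: mem_head.
by apply: IH => j js; apply: h; rewrite inE js orbT.
Qed.

Lemma piso_prod (F : numClosedFieldType) (G : set (F * F)) (I : eqType) (s : seq I) (f g : I -> F) :
  piso G -> (forall i, i \in s -> G (f i, g i)) -> G (\prod_(i <- s) f i, \prod_(i <- s) g i).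
Proof.
move=> HG; elim: s => [|i s IH] h; first by rewrite !big_nil; exact: (G1 HG).
rewrite !big_cons; apply: (GM HG); first by apply: h; exact: mem_head.
by apply: IH => j js; apply: h; rewrite inE js orbT.
Qed.

Lemma pov_prod (F : numClosedFieldType) (S : set F) (I : eqType) (s : seq I) (f : I -> {poly F}) :
  subring S -> (forall i, i \in s -> pov S (f i)) -> pov S (\prod_(i <- s) f i).
Proof.
move=> HS h; rewrite big_seq; have Sp := pov_subring HS.
by apply: (big_ind (fun p => [set q | pov S q] p)) => [|p q|]; [exact: (subring1 Sp)|exact: (subringM Sp)|].
Qed.

Lemma mup_cpoly (F : numClosedFieldType) (s : seq (conf F)) t :
  mup t (cpoly s) = count (fun x => ct x == t) s.
Proof.
have -> : cpoly s = \prod_(r <- map (@ct F) s) ('X - r%:P) by rewrite big_map.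
by rewrite mu_prod_XsubC count_map; apply: eq_count.
Qed.

Lemma common_denom (F : fieldType) (S : set F) (P : {poly {poly F}}) : subring S ->
  (forall i j, fracs S P`_i`_j) -> exists d, [/\ S d, d != 0 & forall i j, S (d * P`_i`_j)].
Proof.
move=> HS fr; suff [d [Sd d0 h]] : exists d, [/\ S d, d != 0 & forall i j, (i < size P)%N -> S (d * P`_i`_j)].
  exists d; split=> // i j; have [/h//|h'] := ltnP i (size P).
  by rewrite (nth_default 0 h') coef0 mulr0; exact: (subring0 HS).
elim: (size P) => [|n [d [Sd d0 IH]]]; first by exists 1; split=> //; [exact: (subring1 HS)|exact: oner_neq0].
have [e [Se e0 h]] := frac_denom HS (fr n).
exists (d * e); split=> [||i j]; [exact: (subringM HS)|exact: mulf_neq0|].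
rewrite ltnS leq_eqVlt => /orP[/eqP->|/IH h'].
  by rewrite -mulrA; apply: (subringM HS) => //; have := h j; rewrite coefZ.
by rewrite mulrAC; apply: (subringM HS).
Qed.

(** After a denominator [d] is cleared, the equation at the parameter r becomes a polynomial [M r]
    with inner variable [tau] and outer variable t, so that the three quantities r, [tau] and t can
    exchange roles. *)
Lemma theta_exists (F : numClosedFieldType) (k : set F) tau (P : {poly {poly F}}) : acf k ->
  (forall i j, fracs (adj k tau) P`_i`_j) ->
  exists d (M : F -> {poly {poly F}}), [/\ d != 0, adj k tau d,
    forall r, map_poly (horner_eval tau) (M r) = d *: map_poly (horner_eval r) P,
    forall S r, subring S -> k `<=` S -> S r -> pov [set q | pov S q] (M r) &
    forall G r r' t t', piso G -> idon k `<=` G -> G (r, r') -> G (t, t') ->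
      prel G (M r).[t%:P] (M r').[t'%:P]].
Proof.
move=> Hk fr; have ks := acf_subring Hk.
have [d [Sd d0 h]] := common_denom (adj_ring Hk tau) fr.
have /choice[phi Hphi] : forall ij : nat * nat, exists q, pov k q /\ q.[tau] = d * P`_(ij.1)`_(ij.2).
  by move=> [i j]; have [q kq E] := h i j; exists q.
pose m := sizeY P; pose M (r : F) : {poly {poly F}} := \poly_(i < size P) \sum_(j < m) r ^+ j *: phi (i, j : nat).
exists d, M; split=> //.
- move=> r; apply/polyP => i; rewrite coefZ !coef_map /= coef_poly /horner_eval.
  case: ltnP => hi; last by rewrite (nth_default 0 hi) !horner0 mulr0.
  rewrite horner_sum (@horner_coef_wide _ m (P`_i)) ?max_size_coefXY // mulr_sumr.
  by apply: eq_bigr => j _; rewrite hornerZ (Hphi _).2 /=; ring.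
- move=> S r HS kS Sr i; rewrite coef_poly; case: ifP => _; last exact: (pov0 HS).
  apply: (subring_sum (pov_subring HS)) => j _; apply: (povZ HS); first exact: (subringX HS).
  exact: pov_sub kS (Hphi _).1.
- move=> G r r' t t' HG sub Gr Gt n.
  have E a b : ((M a).[b%:P])`_n = \sum_(i < size P) (\sum_(j < m) a ^+ j * (phi (i : nat, j : nat))`_n) * b ^+ i.
    rewrite (@horner_coef_wide _ (size P)) ?size_poly // coef_sum.
    apply: eq_bigr => i _; rewrite coef_poly ltn_ord -polyC_exp coefMC coef_sum.
    by congr (_ * _); apply: eq_bigr => j _; rewrite coefZ.
  have GX a b (e : nat) : G (a, b) -> G (a ^+ e, b ^+ e).
    by move=> Gab; elim: e => [|e IH]; [exact: (G1 HG)|rewrite !exprS; exact: (GM HG)].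
  rewrite !E; apply: piso_sum => // i _; apply: (GM HG); last exact: GX.
  apply: piso_sum => // j _; apply: (GM HG); first exact: GX.
  by apply: sub; split=> //=; exact: (Hphi _).1.
Qed.

Section Mult.
Variable F : numClosedFieldType.
Variables (K : set F) (H1 H2 : graph) (l1 l2 : {fset nat} -> F).
Let a12 := l1 [fset 1; 2]%N%fset.
Let b12 := l2 [fset 1; 2]%N%fset.
Hypotheses (HK : acf K) (HH1 : precal H1) (HH2 : precal H2).
Hypotheses (Ka : K a12) (a0 : a12 != 0) (a4 : a12 != 4).
Hypotheses (Kb : K b12) (b0 : b12 != 0) (b4 : b12 != 4).
Hypothesis Hind : indep K (lens H1 l1 ++ lens H2 l2).
Hypothesis Hbig : forall s, exists g, ~ spanf K s g.
Let L1 := lens H1 l1.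
Let L2 := lens H2 l2.
Let k1 := spanf K L1.
Let k2 := spanf K L2.
Let k12 := spanf K (L1 ++ L2).
Let Hk1 : acf k1 := span_acf _ HK.
Let Hk2 : acf k2 := span_acf _ HK.
Let Hk12 : acf k12 := span_acf _ HK.
Let C1 u := clist H1 l1 1 1 u.
Let C2 u := clist H2 l2 1 1 u.
Let i1 : indep K L1 := ind1 HK Hind.
Let i2 : indep K L2 := ind2 HK Hind.

(* Choosing an edge length tau of the first graph on which r really depends, the
   multiplicity is moved twice between the parameter, tau and the ordinate. *)
Lemma mult_root (Pp : {poly F}) r : pov k12 Pp -> Pp != 0 ->
  (forall u, ~ k12 u -> Pp.[u] = \prod_(x2 <- C2 u) (cpoly (C1 u)).[ct x2]) ->
  k12 r -> ~ k1 r -> ~ k2 r ->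
  mup r Pp = (\sum_(x2 <- C2 r) count (fun x1 => ct x1 == ct x2) (C1 r))%N.
Proof.
move=> KPp Pp0 EPp kr nkr1 nkr2.
have [P1 [KP1 mP1 EP1]] := curve_poly HK HH1 Ka a0 a4 i1 Hbig.
have i21 : indep k2 L1 by have [h _] := indep_catE L1 L2 HK; have [] := h Hind.
have Ek12 : spanf k2 L1 = k12.
  by rewrite /k2 span_cat //; apply: span_eq => // z; rewrite !mem_cat orbC.
have [A [tau [B [EL nr]]]] : exists A tau B, L1 = A ++ tau :: B /\ ~ spanf k2 (A ++ B) r.
  by apply: choose_tau => //; rewrite Ek12.
pose kap1 := spanf K (A ++ B); pose kap := spanf k2 (A ++ B).
have Hkap1 : acf kap1 := span_acf _ HK; have Hkap : acf kap := span_acf _ Hk2.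
have Ekap : kap = spanf K (L2 ++ (A ++ B)) by rewrite /kap /k2 span_cat.
have Ek1 : cl kap1 tau = k1.
  rewrite -/(spanf K (tau :: (A ++ B))); apply: span_eq => // z.
  by rewrite -/L1 EL !(inE, mem_cat) orbCA.
have kap1k : kap1 `<=` kap by apply: span_base => //; exact: span_sub.
have k2k : k2 `<=` kap by exact: span_sub.
have kapk : kap `<=` k12.
  by rewrite -Ek12; apply: span_subseq => // z; rewrite EL !(inE, mem_cat) => /orP[]->; rewrite ?orbT.
have adl e : e \in eset H1 -> adj kap1 tau (l1 e).
  move=> eE; have [->|ne] := eqVneq e [fset 1; 2]%N%fset; first by apply: (adj_sub Hkap1); exact: span_sub.
  have : l1 e \in L1 by apply: map_f; rewrite !inE ne.
  rewrite EL mem_cat inE orbCA => /orP[/eqP->|h]; first exact: adj_gen.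
  by apply: (adj_sub Hkap1); apply: span_mem => //; rewrite mem_cat.
have fr := curve_poly_tau HK HH1 Ka a0 a4 i1 Hbig KP1 EP1 Hkap1 Ek1 adl.
have [d [M [d0 dad EM' SM GMM]]] := theta_exists Hkap1 fr.
have tk12 : k12 tau.
  by apply: k1_12 => //; apply: span_mem => //; rewrite -/L1 EL mem_cat mem_head orbT.
have ntk : ~ kap tau.
  have : indep k2 (tau :: (A ++ B)).
    by apply: (indep_perm Hk2 _ i21); rewrite EL perm_catC /= perm_cons perm_catC.
  by case.
have nk2 u : ~ kap u -> ~ k2 u by move=> h /k2k.
(* As a polynomial in [tau], this takes at the actual length the value of the resultant at u, times
   a power of [d]. *)
pose f u := \prod_(x2 <- C2 u) (M u).[(ct x2)%:P].
have sub2 u : cl k2 u `<=` cl kap u.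
  apply: cl_min; [exact: cl_acf|by move=> z /k2k; exact: cl_sub|exact: cl_gen].
have Opov S u : subring S -> kap `<=` S -> S u -> (forall x, x \in C2 u -> S (ct x)) -> pov S (f u).
  move=> HS kS Su Sx; apply: pov_prod => // x xs.
  apply: (pov_horner (pov_subring HS)); last by apply: (povC HS); exact: Sx.
  by apply: SM => //; apply: subset_trans kS.
have [] := @poly_family F kap f Hkap.
- by rewrite Ekap; exact: Hbig.
- move=> u ku; have cu := acf_subring (cl_acf Hkap u); apply: Opov => //; first exact: cl_sub.
    exact: cl_gen.
  by move=> x xs; apply: sub2; apply: (ct_in HK HH2 Kb b0 b4 i2 Hbig) => //; exact: nk2.
- move=> G u u' HG Hd Hc sub ku ku' Gu.
  have sub' : idon k2 `<=` G by move=> a [h1 h2]; apply: sub; split=> //; exact: k2k.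
  have [gl kd kc] := idon_len HK Kb sub'.
  have [phi [pe hphi]] := clist_conj HK HH2 Kb b0 b4 i2 Hbig HG Hd Hc gl kd kc Gu (nk2 _ ku) (nk2 _ ku').
  rewrite /f /C2 -(perm_big _ pe) big_map; apply: prel_prod => // x xs.
  apply: GMM => //; last by apply: G_ct => //; exact: hphi.
  by move=> a [h1 h2]; apply: sub; split=> //; exact: kap1k.
- move=> u a O ku ka [HO kO Ow Ow' OV].
  have Ou : O u by rewrite -[u](subrK a); apply: (subringD HO) => //; exact: kO.
  apply: Opov => // x xs; apply: (ct_integral HK HH2 Kb b0 b4 i2 Hbig HO OV _ (nk2 _ ku) Ou xs).
  exact: subset_trans kO.
move=> N KN EN.
have [u ku] := Hbig (L1 ++ L2).
have kuk : ~ kap u by move=> /kapk.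
have nku1 : ~ k1 u by move=> h; apply: ku; exact: k1_12.
have EMt v t : ((M v).[t%:P]).[tau] = d * (map_poly (horner_eval v) P1).[t].
  by rewrite -horner_map_eval EM' hornerZ.
have k12s := acf_subring Hk12.
have ENt : N.[tau%:P] = d ^+ size (C2 u) *: Pp.
  apply/eqP; rewrite -subr_eq0; apply/eqP; apply: (acf_horner0 Hk12 ku).
    apply: (povB k12s); last apply: (povZ k12s) => //.
      apply: (pov_horner (pov_subring k12s)); last exact: (povC k12s).
      by move=> i; apply: pov_sub (KN i).
    apply: (subringX k12s); case: dad => q kq <-; apply: (pov_horner k12s) => //.
    by apply: pov_sub kq; apply: subset_trans kapk.
  rewrite !hornerE /= -horner_map_eval EN // EPp // horner_prod.
  have -> : \prod_(x <- C2 u) ((M u).[(ct x)%:P]).[tau] = \prod_(x <- C2 u) (d * (cpoly (C1 u)).[ct x]).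
    by apply: eq_bigr => x _; rewrite EMt EP1.
  by rewrite big_split /= big_const_seq count_predT iter_mulr_1 subrr.
have dn0 : d ^+ size (C2 u) != 0 by rewrite expf_neq0.
have N0 : N != 0.
  by apply: contra_neq Pp0 => N0; move/esym/eqP: ENt; rewrite N0 horner0 -mul_polyC mulf_eq0 polyC_eq0 (negPf dn0) => /eqP.
(* First exchange: the multiplicity of the root [r] becomes that of [tau] in [f r], a product over
   the points of the second curve. *)
rewrite -(@mup_scale _ Pp r _ dn0) -ENt -(mup_swap Hkap KN N0) // EN //.
have fr0 : f r != 0.
  by rewrite -EN //; apply: contra_neq N0 => h; apply: (map_horner0 Hkap _ KN h).
rewrite mup_prod //; apply: eq_big_seq => x2 xs.
pose k3 := cl kap1 r; have Hk3 : acf k3 := cl_acf Hkap1 r.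
have nk1r : ~ kap1 r by move=> /kap1k.
have Cx2 := ((clist1P HK HH2 Kb b0 b4 i2 Hbig nkr2).2 x2).1 xs.
have nt3 : ~ k3 tau.
  move=> h; apply: nkr1; rewrite -/k1 -Ek1; apply: cl_exchange => // /kap1k //.
(* The ordinate is algebraic over r and [L2]. Were it also algebraic over r and the lengths of the
   first graph other than [tau], it would be so over r alone, and vertex 0 would depend on one
   parameter. *)
have nt0 : ~ k3 (ct x2).
  move=> h; pose Kr := cl K r; have HKr : acf Kr := cl_acf HK r.
  have ir : indep Kr ((A ++ B) ++ L2).
    apply: indep_cl => //; last by rewrite (@span_eq _ _ _ (L2 ++ (A ++ B))) // -?Ekap // => z; rewrite !mem_cat orbC.
    move: Hind; rewrite -/L1 -/L2 EL => hh.
    have : indep K (tau :: ((A ++ B) ++ L2)).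
      apply: (indep_perm HK _ hh).
      by rewrite -catA /= perm_catC /= perm_cons perm_catC catA.
    by case.
  have kt : Kr (ct x2).
    apply: (span_capI HKr ir); split; rewrite span_cl //.
    exact: (ct_in HK HH2 Kb b0 b4 i2 Hbig nkr2 xs).
  have Krr : Kr r by exact: cl_gen.
  have ks : Kr (cs x2).
    by rewrite (cs_u HK HH2 Kb b0 b4 i2 Hbig nkr2 xs); apply: (subringB (acf_subring HKr)).
  apply: (gen_no_curve HK HH2 Cx2.1 Kb b0 b4 i2 nkr2 (cset_gen HK Kb (K1 HK) (K1 HK) Cx2) (y := r)).
  by apply: (st_coords Cx2.1 Kb b0 b4) => //; exact: cl_sub.
have KM : pov [set q | pov k3 q] (M r).
  by apply: SM; [exact: acf_subring|exact: cl_sub|exact: cl_gen].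
have M0 : M r != 0.
  apply: contraTneq (monic_prod_XsubC (C1 r) predT (@ct F)) => h.
  have := EM' r; rewrite h rmorph0 EP1 // -mul_polyC => /esym/eqP.
  by rewrite mulf_eq0 polyC_eq0 (negPf d0) /= => /eqP; rewrite /cpoly => ->; rewrite monicE lead_coef0 eq_sym oner_eq0.
(* Second exchange: the multiplicity of [tau] becomes that of the ordinate in the equation of the
   first curve at [r], which counts configurations. *)
rewrite -(mup_swap Hk3 KM M0 nt3 nt0) EM' EP1 // mup_scale //; exact: mup_cpoly.
Qed.
End Mult.

(** * Growth of functions at a pole of u *)

Section Asymptotics.
Variables (F : numClosedFieldType) (O : set F) (u : F).
Hypotheses (HO : subring O) (OV : forall x, O x \/ O x^-1) (nu : ~ O u).

Definition unitO x := O x /\ ~ mx O x.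

Lemma unitOM x y : unitO x -> unitO y -> unitO (x * y).
Proof.
by move=> [Ox mx_] [Oy my]; split; [exact: (subringM HO)|move=> /(mx_prime HO Ox Oy)[]].
Qed.

Lemma unitOD x y : unitO x -> mx O y -> unitO (x + y).
Proof.
move=> [Ox nx] my; split; first by apply: (subringD HO) => //; exact: (mx_O HO OV).
by move=> h; apply: nx; rewrite -(addrK y x); exact: (mxB HO OV).
Qed.

Lemma unitO1 : unitO 1.
Proof. by split; [exact: (subring1 HO)|exact: (mx1 HO)]. Qed.

(* y grows like u ^+ n at the place O, where u has a pole *)
Definition asym n y := unitO (y / u ^+ n).

Lemma u_neq0 : u != 0. Proof. exact: (NO0 HO nu). Qed.

Lemma asymM n m x y : asym n x -> asym m y -> asym (n + m) (x * y).
Proof.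
move=> h1 h2; rewrite /asym exprD invfM mulrACA; exact: unitOM.
Qed.

Lemma asym_prod (I : eqType) (s : seq I) (e : I -> nat) (f : I -> F) :
  (forall i, i \in s -> asym (e i) (f i)) -> asym (\sum_(i <- s) e i) (\prod_(i <- s) f i).
Proof.
elim: s => [|i s IH] h; first by rewrite !big_nil /asym expr0 divr1; exact: unitO1.
rewrite !big_cons; apply: asymM; first by apply: h; exact: mem_head.
by apply: IH => j js; apply: h; rewrite inE js orbT.
Qed.

Lemma mx_uV n : mx O (u ^+ n.+1)^-1.
Proof.
rewrite -exprVn; elim: n => [|n IH]; first by rewrite expr1; exact: NOmx.
by rewrite exprS; apply: (mxM HO) => //; apply: (mx_O HO OV); exact: NOmx.
Qed.

Lemma asym_uniq n m y : asym n y -> asym m y -> n = m.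
Proof.
wlog le : n m / (n <= m)%N => [h h1 h2|[On mn] [Om mm]].
  by case/orP: (leq_total n m) => le; [exact: h|apply/esym; exact: h].
apply/eqP; rewrite eqn_leq le leqNgt; apply/negP => lt.
apply: mm; have -> : y / u ^+ m = y / u ^+ n * (u ^+ (m - n))^-1.
  by rewrite -mulrA -invfM -exprD subnKC.
apply: (mxM HO) => //; have : (0 < m - n)%N by rewrite subn_gt0.
by case: (m - n)%N => // k _; exact: mx_uV.
Qed.

Lemma asym_poly (k : set F) (p : {poly F}) : acf k -> k `<=` O -> pov k p -> p != 0 ->
  asym (size p).-1 p.[u].
Proof.
move=> Hk kO; have ks := acf_subring Hk; have u0 := u_neq0.
have unitk a : k a -> a != 0 -> unitO a.
  by move=> ka a0; split; [exact: kO|move=> h; move: a0; rewrite (K_mx Hk kO ka h) eqxx].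
elim/poly_ind: p => [|q c IH] kp p0; first by rewrite eqxx in p0.
have kc : k c by have := kp 0%N; rewrite coefD coefMX coefC /= add0r.
have [q0|q0] := eqVneq q 0.
  move: p0; rewrite q0 mul0r add0r polyC_eq0 => c0.
  by rewrite size_polyC c0 /= hornerC /asym expr0 divr1; exact: unitk.
have kq : pov k q by move=> i; have := kp i.+1; rewrite coefD coefMX coefC /= addr0.
have := IH kq q0; rewrite size_MXaddC (negPf q0) /= hornerMXaddC /asym.
have : (0 < size q)%N by rewrite size_poly_gt0.
case: (size q) => // n _ /=; move=> h.
have -> : (q.[u] * u + c) / u ^+ n.+1 = q.[u] / u ^+ n + c * (u ^+ n.+1)^-1.
  rewrite mulrDl; congr (_ + _); rewrite exprSr; have : u ^+ n != 0 by rewrite expf_neq0.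
  by move: (u ^+ n) => v v0; field; rewrite u0 v0.
by apply: unitOD => //; apply: (mxM HO); [exact: kO|exact: mx_uV].
Qed.
End Asymptotics.

(** * Branches of a coupler curve at infinity *)

Section Infinity.
Variables (F : numClosedFieldType) (K : set F) (H : graph) (l : {fset nat} -> F).
Let l12 := l [fset 1; 2]%N%fset.
Hypotheses (HK : acf K) (HH : precal H) (Kl : K l12) (l0 : l12 != 0) (l4 : l12 != 4).
Hypothesis Hind : indep K (lens H l).
Hypothesis Hbig : forall s, exists g, ~ spanf K s g.
Let k := spanf K (lens H l).
Let Hk : acf k := span_acf _ HK.
Variables (O : set F) (u : F).
Hypotheses (HO : subring O) (OV : forall x, O x \/ O x^-1) (kO : k `<=` O) (nu : ~ O u).

(** The three cases are t finite, s finite, and both infinite. [place_bad] keeps the limit of t, of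
    s, or of t/u respectively out of [K], which later separates the branches of two curves. *)
Lemma infinity_class x : x \in clist H l 1 1 u ->
  [\/ O (ct x) /\ (exists a, [/\ k a, ~ K a & mx O (ct x - a)]),
      O (cs x) /\ (exists a, [/\ k a, ~ K a & mx O (cs x - a)]) |
      [/\ ~ O (cs x), ~ O (ct x) & exists b, [/\ k b, ~ K b & mx O (ct x / u - b)]] ].
Proof.
have u0 : u != 0 := NO0 HO nu.
have ku : ~ k u by move=> /kO.
move=> xs; have Cx := ((clist1P HK HH Kl l0 l4 Hind Hbig ku).2 x).1 xs.
have Ecs := cs_u HK HH Kl l0 l4 Hind Hbig ku xs.
have ctin := ct_in HK HH Kl l0 l4 Hind Hbig ku xs.
have Cs := acf_subring (cl_acf Hk u); have C1 := cl_gen Hk u.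
have csin : cl k u (cs x) by rewrite Ecs; exact: (subringB Cs).
have w0 : u^-1 != 0 by rewrite invr_eq0.
have mw : mx O u^-1 := NOmx nu.
have cl_w : cl k u `<=` cl k u^-1.
  apply: cl_min; [exact: cl_acf|exact: cl_sub|rewrite -{2}[u]invrK].
  by apply: acf_inv; [exact: cl_acf|exact: cl_gen].
have res z : cl k u z -> O z -> exists2 a, k a & mx O (z - a).
  by move=> cz; apply: (residue HO OV Hk kO w0 mw); exact: cl_w.
have xw : spanf K (gensS x (vset H `\` [fset 1; 2]%N)%fset) u^-1.
  by apply: acf_inv; [exact: span_acf|exact: (cset_gen HK Kl (K1 HK) (K1 HK) Cx)].
have bad := place_bad HK HH Cx.1 Kl l0 l4 Hind HO OV kO w0 mw xw.
have Ks := acf_subring HK; have Kk : K `<=` k := span_sub _ HK.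
have Esum : u = cs x + ct x by rewrite Ecs subrK.
have [Ot|nt] := EM (O (ct x)).
  have ns : ~ O (cs x) by move=> Os; apply: nu; rewrite Esum; exact: (subringD HO).
  constructor 1; split=> //; have [a ka ma] := res _ ctin Ot; exists a; split=> // Ka.
  by apply: bad; [right|left; exists a|constructor 2].
have [Os|ns] := EM (O (cs x)).
  constructor 2; split=> //; have [a ka ma] := res _ csin Os; exists a; split=> // Ka.
  by apply: bad; [left; exists a|right|constructor 1].
have t0 := NO0 HO nt; constructor 3; split=> //.
have bad' : ~ ctrl O K (cs x / ct x).
  by move=> h; apply: bad; [right|right|constructor 3].
have Er : cs x / ct x = u / ct x - 1 by rewrite Ecs mulrBl divff.
have K1' : K 1 := subring1 Ks.
have Ot : O (ct x / u).
  apply: contrapT => /NOmx; rewrite invfM invrK mulrC => m; apply: bad'; left; exists (- 1).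
    exact: (subringN Ks).
  by rewrite Er opprK subrK.
have [b kb mb] : exists2 b, k b & mx O (ct x / u - b).
  by apply: res => //; apply: (subringM Cs) => //; apply: acf_inv => //; exact: cl_acf.
exists b; split=> // Kb; apply: bad'; have [b0|b0] := eqVneq b 0.
  have tu0 : ct x / u != 0 by rewrite mulf_neq0.
  have mb0 : mx O (ct x / u) by move: mb; rewrite b0 subr0.
  have := mxNO tu0 mb0; rewrite invfM invrK mulrC => h.
  right; rewrite Er => h'; apply: h; rewrite -[u / ct x](subrK 1).
  by apply: (subringD HO) => //; exact: (subring1 HO).
left; exists (b^-1 - 1); first by apply: (subringB Ks) => //; exact: acf_inv.
rewrite Er; apply: (resB HO OV); last by rewrite subrr; exact: mx0.
by have := resV HO OV Hk kO kb b0 mb; rewrite invfM invrK mulrC.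
Qed.
End Infinity.

(** * The resultant of two coupler curves and its degree *)

Section Degree.
Variable F : numClosedFieldType.
Variables (K : set F) (H1 H2 : graph) (l1 l2 : {fset nat} -> F).
Let a12 := l1 [fset 1; 2]%N%fset.
Let b12 := l2 [fset 1; 2]%N%fset.
Hypotheses (HK : acf K) (HH1 : precal H1) (HH2 : precal H2).
Hypotheses (Ka : K a12) (a0 : a12 != 0) (a4 : a12 != 4).
Hypotheses (Kb : K b12) (b0 : b12 != 0) (b4 : b12 != 4).
Hypothesis Hind : indep K (lens H1 l1 ++ lens H2 l2).
Hypothesis Hbig : forall s, exists g, ~ spanf K s g.
Let L1 := lens H1 l1.
Let L2 := lens H2 l2.
Let k1 := spanf K L1.
Let k2 := spanf K L2.
Let k12 := spanf K (L1 ++ L2).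
Let Hk1 : acf k1 := span_acf _ HK.
Let Hk2 : acf k2 := span_acf _ HK.
Let Hk12 : acf k12 := span_acf _ HK.
Let C1 u := clist H1 l1 1 1 u.
Let C2 u := clist H2 l2 1 1 u.
Let i1 : indep K L1 := ind1 HK Hind.
Let i2 : indep K L2 := ind2 HK Hind.
Let sub1 : k1 `<=` k12 := @k1_12 F K H1 H2 l1 l2 HK.
Let sub2 : k2 `<=` k12 := @k2_12 F K H1 H2 l1 l2 HK.

(** The two families of lengths remain independent over K(u), so a common ordinate would be
    algebraic over K(u), and vertex 0 with it, against [gen_no_curve]. *)
Lemma no_meet u x1 x2 : ~ k12 u -> x1 \in C1 u -> x2 \in C2 u -> ct x1 <> ct x2.
Proof.
move=> ku x1s x2s Et; pose Ku := cl K u; have HKu : acf Ku := cl_acf HK u.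
have ku1 : ~ k1 u by move=> /sub1.
have ku2 : ~ k2 u by move=> /sub2.
have iu : indep Ku (L1 ++ L2) by exact: indep_cl.
have kt : Ku (ct x2).
  apply: (span_capI HKu iu); split; rewrite span_cl //.
    by rewrite -Et; exact: (ct_in HK HH1 Ka a0 a4 i1 Hbig ku1 x1s).
  exact: (ct_in HK HH2 Kb b0 b4 i2 Hbig ku2 x2s).
have Cx2 := ((clist1P HK HH2 Kb b0 b4 i2 Hbig ku2).2 x2).1 x2s.
have ks : Ku (cs x2).
  rewrite (cs_u HK HH2 Kb b0 b4 i2 Hbig ku2 x2s); apply: (subringB (acf_subring HKu)) => //.
  exact: cl_gen.
apply: (gen_no_curve HK HH2 Cx2.1 Kb b0 b4 i2 ku2 (cset_gen HK Kb (K1 HK) (K1 HK) Cx2) (y := u)).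
by apply: (st_coords Cx2.1 Kb b0 b4) => //; exact: cl_sub.
Qed.

(** The resultant of the two equations with respect to t; it is nonzero by [no_meet] and a
    polynomial in u by [ct_integral]. *)
Lemma pair_poly : exists Pp, [/\ pov k12 Pp, Pp != 0 &
  forall u, ~ k12 u -> Pp.[u] = \prod_(x2 <- C2 u) (cpoly (C1 u)).[ct x2] ].
Proof.
pose f u : F := \prod_(x2 <- C2 u) (cpoly (C1 u)).[ct x2].
have nk1 u : ~ k12 u -> ~ k1 u by move=> h /sub1.
have nk2 u : ~ k12 u -> ~ k2 u by move=> h /sub2.
have fin (S : set F) u : subring S -> (forall x, x \in C1 u -> S (ct x)) ->
    (forall x, x \in C2 u -> S (ct x)) -> pov S (f u)%:P.
  move=> HS h1 h2; apply: (povC HS); rewrite /f big_seq; apply: (subring_prod HS) => x xs.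
  by apply: (pov_horner HS); [exact: pov_cpoly|exact: h2].
have [] := @poly_family F k12 (fun u => (f u)%:P) Hk12.
- exact: Hbig.
- move=> u ku; have cu := acf_subring (cl_acf Hk12 u); apply: fin => // x xs.
    have := ct_in HK HH1 Ka a0 a4 i1 Hbig (nk1 u ku) xs; apply: cl_min; [exact: cl_acf| |exact: cl_gen].
    by move=> z /sub1; exact: cl_sub.
  have := ct_in HK HH2 Kb b0 b4 i2 Hbig (nk2 u ku) xs; apply: cl_min; [exact: cl_acf| |exact: cl_gen].
  by move=> z /sub2; exact: cl_sub.
- move=> G u u' HG Hd Hc sub ku ku' Gu.
  have subi k : k `<=` k12 -> idon k `<=` G by move=> kk a [h1 h2]; apply: sub; split=> //; exact: kk.
  have [gl1 kd1 kc1] := idon_len HK Ka (subi _ sub1).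
  have [gl2 kd2 kc2] := idon_len HK Kb (subi _ sub2).
  have Gc := cpoly_conj HK HH1 Ka a0 a4 i1 Hbig HG Hd Hc gl1 kd1 kc1 Gu (nk1 _ ku) (nk1 _ ku').
  have [phi [pe hphi]] := clist_conj HK HH2 Kb b0 b4 i2 Hbig HG Hd Hc gl2 kd2 kc2 Gu (nk2 _ ku) (nk2 _ ku').
  move=> i; rewrite !coefC; case: ifP => _; last exact: (G0 HG).
  rewrite /f /C2 -(perm_big _ pe) big_map; apply: piso_prod => // x xs.
  by apply: prel_horner => //; apply: G_ct => //; exact: hphi.
- move=> u a O ku ka [HO kO Ow Ow' OV].
  have Ou : O u by rewrite -[u](subrK a); apply: (subringD HO) => //; exact: kO.
  apply: fin => // x xs.
    by apply: (ct_integral HK HH1 Ka a0 a4 i1 Hbig HO OV _ (nk1 _ ku) Ou xs); exact: subset_trans kO.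
  by apply: (ct_integral HK HH2 Kb b0 b4 i2 Hbig HO OV _ (nk2 _ ku) Ou xs); exact: subset_trans kO.
move=> P KP EP; exists P`_0.
have EP0 u : ~ k12 u -> (P`_0).[u] = f u.
  by move=> ku; have := EP u ku; move=> /(congr1 (fun q : {poly F} => q`_0)); rewrite coef_map coefC.
split=> //; first exact: KP.
have [u ku] := Hbig (L1 ++ L2); apply/eqP => P0; have := EP0 u ku; rewrite P0 horner0 => /esym/eqP; rewrite /f big_seq prodf_seq_eq0 => /hasP[x2 _ /andP[x2s]].
rewrite -[_ == 0]/(root _ _) => /root_cpoly[x1 x1s].
exact: (no_meet ku x1s x2s).
Qed.

Variables (O : set F) (u : F).
Hypotheses (HO : subring O) (OV : forall x, O x \/ O x^-1) (kO : k12 `<=` O) (nu : ~ O u).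

(** The difference grows like u unless both ordinates or both abscissas stay finite, in which case
    it tends to a nonzero constant. Equal limits would lie in both [k1] and [k2], hence in [K],
    against [infinity_class]. *)
Lemma asym_diff x1 x2 : x1 \in C1 u -> x2 \in C2 u ->
  asym O u (~~ (`[< O (ct x1) >] && `[< O (ct x2) >]) && ~~ (`[< O (cs x1) >] && `[< O (cs x2) >]))
    (ct x2 - ct x1).
Proof.
have kO1 : k1 `<=` O by apply: subset_trans kO.
have kO2 : k2 `<=` O by apply: subset_trans kO.
have ku1 : ~ k1 u by move=> /kO1.
have ku2 : ~ k2 u by move=> /kO2.
have u0 : u != 0 := NO0 HO nu.
have k12s := acf_subring Hk12; have Ks := acf_subring HK.
have K0' : K 0 := subring0 Ks; have K1' : K 1 := subring1 Ks.
move=> x1s x2s.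
have E1 := cs_u HK HH1 Ka a0 a4 i1 Hbig ku1 x1s.
have E2 := cs_u HK HH2 Kb b0 b4 i2 Hbig ku2 x2s.
have diff (y b1 b2 : F) : k1 b1 -> k2 b2 -> b1 <> b2 -> mx O (y - (b2 - b1)) -> unitO O y.
  move=> kb1 kb2 ne m; have kb : k12 (b2 - b1) by apply: (subringB k12s); [exact: sub2|exact: sub1].
  split; first exact: (res_O HO OV kO kb).
  by apply: (res_unit HO OV Hk12 kO kb) => //; rewrite subr_eq0; apply/eqP => /esym.
have same b1 b2 : k1 b1 -> k2 b2 -> ~ K b1 -> b1 <> b2.
  by move=> h1 h2 nb eb; apply: nb; apply: (k1_k2 HK Hind) => //; rewrite -/k2 eb.
have notboth (x : conf F) : cs x = u - ct x -> O (ct x) -> ~ O (cs x).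
  by move=> Ex h1 h2; apply: nu; rewrite -[u](subrK (ct x)) -Ex; exact: (subringD HO).
have T x : O (ct x) -> mx O (ct x / u - 0) by rewrite subr0 => h; apply: (mxM HO) => //; exact: NOmx.
have S x : cs x = u - ct x -> O (cs x) -> mx O (ct x / u - 1).
  move=> Ex h; have -> : ct x / u - 1 = - (cs x / u) by rewrite Ex; field.
  by apply: (mxN HO); apply: (mxM HO) => //; exact: NOmx.
have one b1 b2 : k1 b1 -> k2 b2 -> b1 <> b2 -> mx O (ct x1 / u - b1) -> mx O (ct x2 / u - b2) ->
    asym O u 1 (ct x2 - ct x1).
  move=> h1 h2 ne m1 m2; rewrite /asym expr1; apply: (diff _ b1 b2) => //.
  by rewrite mulrBl; exact: (resB HO OV).
have kK1 x : K x -> k1 x by exact: span_sub.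
have kK2 x : K x -> k2 x by exact: span_sub.
have z1 : (0 : F) <> 1 by apply/eqP; rewrite eq_sym oner_eq0.
case: (infinity_class HK HH1 Ka a0 a4 i1 Hbig HO OV kO1 nu x1s) => [[O1 [b1 [kb1 nb1 mb1]]]|[O1 [b1 [kb1 nb1 mb1]]]|[ns1 nt1 [b1 [kb1 nb1 mb1]]]];
case: (infinity_class HK HH2 Kb b0 b4 i2 Hbig HO OV kO2 nu x2s) => [[O2 [b2 [kb2 nb2 mb2]]]|[O2 [b2 [kb2 nb2 mb2]]]|[ns2 nt2 [b2 [kb2 nb2 mb2]]]].
- rewrite (asboolT O1) (asboolT O2) /= /asym expr0 divr1; apply: (diff _ b1 b2) => //; first exact: same.
  exact: (resB HO OV).
- have n1 := notboth _ E1 O1; have n2 : ~ O (ct x2) by move=> /(notboth _ E2).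
  rewrite (asboolF n1) (asboolF n2) andbF /=; apply: (one 0 1); [exact: kK1|exact: kK2|done|exact: T|exact: S].
- have n1 := notboth _ E1 O1; rewrite (asboolF n1) (asboolF nt2) andbF /=.
  by apply: (one 0 b2) => //; [exact: kK1|move=> h; apply: nb2; rewrite -h|exact: T].
- have n2 := notboth _ E2 O2; have n1 : ~ O (ct x1) by move=> /(notboth _ E1).
  rewrite (asboolF n1) (asboolF n2) andbF /=; apply: (one 1 0); [exact: kK1|exact: kK2|exact/nesym|exact: S|exact: T].
- have n1 : ~ O (ct x1) by move=> /(notboth _ E1).
  rewrite (asboolF n1) (asboolT O1) (asboolT O2) /= /asym expr0 divr1; apply: (diff _ (- b1) (- b2)).
  + by apply: (subringN (acf_subring Hk1)).
  + by apply: (subringN (acf_subring Hk2)).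
  + by apply: same; [apply: (subringN (acf_subring Hk1))|apply: (subringN (acf_subring Hk2))|move=> /(subringN Ks); rewrite opprK].
  + have -> : ct x2 - ct x1 - (- b2 - - b1) = cs x1 - b1 - (cs x2 - b2) by rewrite E1 E2; ring.
    exact: (mxB HO OV).
- have n1 : ~ O (ct x1) by move=> /(notboth _ E1).
  rewrite (asboolF n1) (asboolF ns2) andbF /=.
  by apply: (one 1 b2) => //; [exact: kK1|move=> h; apply: nb2; rewrite -h|exact: S].
- have n2 := notboth _ E2 O2; rewrite (asboolF ns1) (asboolF nt1) /=.
  by apply: (one b1 0) => //; [exact: kK2|move=> h; apply: nb1; rewrite h|exact: T].
- rewrite (asboolF ns1) (asboolF nt1) /=.
  by apply: (one b1 1) => //; [exact: kK2|move=> h; apply: nb1; rewrite h|exact: S].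
- by rewrite (asboolF ns1) (asboolF nt1) /=; apply: (one b1 b2) => //; exact: same.
Qed.

Let b_ (s : seq (conf F)) := count (fun x => `[< O (cs x) >]) s.
Let c_ (s : seq (conf F)) := count (fun x => `[< O (ct x) >]) s.

(** The growth exponents of the factors add up to the degree. A pair contributes 0 if both t or both
    s are finite, and the two events exclude each other because s + t = u is infinite. *)
Lemma degree_pair (Pp : {poly F}) : pov k12 Pp -> Pp != 0 ->
  (forall u, ~ k12 u -> Pp.[u] = \prod_(x2 <- C2 u) (cpoly (C1 u)).[ct x2]) ->
  ((size Pp).-1 + b_ (C1 u) * b_ (C2 u) + c_ (C1 u) * c_ (C2 u) = size (C1 u) * size (C2 u))%N.
Proof.
move=> KP P0 EP; have ku : ~ k12 u by move=> /kO.
have aP := asym_poly HO OV nu Hk12 kO KP P0.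
pose e (x1 x2 : conf F) : nat := ~~ (`[< O (ct x1) >] && `[< O (ct x2) >]) && ~~ (`[< O (cs x1) >] && `[< O (cs x2) >]).
have aQ : asym O u (\sum_(x2 <- C2 u) \sum_(x1 <- C1 u) e x1 x2) Pp.[u].
  rewrite EP //; apply: (asym_prod HO) => x2 x2s; rewrite /cpoly horner_prod.
  apply: (asym_prod HO) => x1 x1s; rewrite !hornerE; exact: asym_diff.
rewrite (asym_uniq HO OV nu aP aQ) /b_ /c_ -!sum1_count !(big_mkcond (fun x => `[< _ >])) /=.
rewrite -[size (C1 u)]sum1_size -[size (C2 u)]sum1_size.
rewrite exchange_big /= !big_distrlr /= -!big_split /=; apply: eq_big_seq => x1 x1s.
rewrite -!big_split /=; apply: eq_big_seq => x2 x2s.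
have kO1 : k1 `<=` O by apply: subset_trans kO.
have ku1 : ~ k1 u by move=> /kO1.
have E1 := cs_u HK HH1 Ka a0 a4 i1 Hbig ku1 x1s.
rewrite /e; have [t1|t1] := asboolP (O (ct x1)); have [s1|s1] := asboolP (O (cs x1)).
  by case: nu; rewrite -[u](subrK (ct x1)) -E1; exact: (subringD HO).
all: by do 2!case: asboolP.
Qed.
End Degree.

(** * The reflection *)

Section Reflection.
Variables (F : numClosedFieldType).

(* The reflection in the plane through the points 1 and 2, for q = ptQ (second _). *)
Definition refl (q : F) (x : conf F) : conf F := fun v => (ptQ (x v) / q, ptZ (x v), q * ptP (x v)).

Lemma reflK q : q != 0 -> involutive (refl q).
Proof.
move=> q0 x; apply/funext => v; case E : (x v) => [[a b] c].
by rewrite /refl E /ptP /ptZ /ptQ /=; congr (_, _, _); field.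
Qed.

Lemma dist_refl q (x : conf F) v w : q != 0 -> dist (refl q x v) (refl q x w) = dist (x v) (x w).
Proof.
move=> q0; rewrite /dist; case E : (x v) => [[a b] c]; case E' : (x w) => [[a' b'] c'].
by rewrite /refl E E' /ptP /ptZ /ptQ /=; field.
Qed.

Lemma cs_refl q x : q != 0 -> cs (refl q x) = cs x. Proof. exact: dist_refl. Qed.
Lemma ct_refl q x : q != 0 -> ct (refl q x) = ct x. Proof. exact: dist_refl. Qed.

Lemma second_neq0 (a : F) : a != 0 -> a != 4 -> ptQ (second a) != 0.
Proof.
move=> a0 a4; rewrite /second /ptQ /=; have -> : 1 - (1 - a / 2) ^+ 2 = a * (4 - a) / 4 by field.
by rewrite !mulf_neq0 ?invr_eq0 ?pnatr_eq0 // subr_eq0 eq_sym.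
Qed.

Lemma even_invol (T : eqType) (s : seq T) (f : T -> T) : uniq s -> (forall x, x \in s -> f x \in s) ->
  (forall x, x \in s -> f (f x) = x) -> (forall x, x \in s -> f x <> x) -> ~~ odd (size s).
Proof.
have [n] := ubnP (size s); elim: n s => // n IH [//|x s] sn us fs fK ff.
have xs : x \in x :: s by exact: mem_head.
have fxs : f x \in s by have := fs x xs; rewrite inE => /orP[/eqP E|//]; case: (ff x xs).
move: us => /= /andP[nx us]; have us' : uniq (rem (f x) s) by exact: rem_uniq.
have mem' y : y \in rem (f x) s = (y != f x) && (y \in s) by rewrite mem_rem_uniq // inE.
have ss : size s = (size (rem (f x) s)).+1 by rewrite size_rem //; case: (s) fxs.
rewrite /= ss /= negbK; apply: IH => //.
- by move: sn; rewrite /= ss !ltnS => /ltnW.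
- move=> y; rewrite !mem' => /andP[yf ys]; have ys' : y \in x :: s by rewrite inE ys orbT.
  have := fs y ys'; rewrite inE => /orP[/eqP fy|fy].
    by move: yf; rewrite -fy fK ?eqxx.
  rewrite fy andbT; apply/eqP => E; have := fK y ys'; rewrite E fK // => xy.
  by rewrite xy ys in nx.
- by move=> y; rewrite mem' => /andP[_ ys]; apply: fK; rewrite inE ys orbT.
- by move=> y; rewrite mem' => /andP[_ ys]; apply: ff; rewrite inE ys orbT.
Qed.

Variables (K : set F) (H : graph) (l : {fset nat} -> F).
Let l12 := l [fset 1; 2]%N%fset.
Hypotheses (HK : acf K) (HH : precal H) (Kl : K l12) (l0 : l12 != 0) (l4 : l12 != 4).
Hypothesis Hind : indep K (lens H l).
Let q := ptQ (second l12).
Let q0 : q != 0 := second_neq0 l0 l4.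

Lemma confs_refl x : confs H l x -> confs H l (refl q x).
Proof.
move=> [x1 x2 xn xq xe].
have rn : (ptQ (north F) / q, ptZ (north F), q * ptP (north F)) = north F.
  by rewrite /north /ptP /ptZ /ptQ /= mul0r mulr0.
split.
- by rewrite /refl x1.
- by rewrite /refl x2 -/l12 -/q /second; congr (_, _, _); rewrite /ptP /= ?mulr1 // mulfV.
- by move=> v vV; rewrite /refl xn.
- move=> v; have := xq v; rewrite /onq /refl; move: (x v) => [[a b] c].
  by move: q0; move: q => r r0; rewrite /ptP /ptZ /ptQ /= => <-; field.
- by move=> u v uv; rewrite dist_refl //; exact: xe.
Qed.

Lemma cs_north x : confs H l x -> cs x = 2 - 2 * ptZ (x 0%N).
Proof. by move=> [x1 _ _ _ _]; rewrite /cs x1 /dist /north /ptP /ptZ /ptQ /=; ring. Qed.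

(** A fixed vertex 0 satisfies ptQ = q ptP; with ptZ known from s, the equation of the sphere makes
    its position algebraic over s alone, against [gen_no_curve]. *)
Lemma refl_fix al be ga x : K al -> K be -> ~ spanf K (lens H l) ga -> cset H l al be ga x ->
  refl q x 0%N <> x 0%N.
Proof.
move=> Ka Kb kga Cx E; have Hx := Cx.1.
apply: (gen_no_curve HK HH Hx Kl l0 l4 Hind kga (cset_gen HK Kl Ka Kb Cx) (y := cs x)).
have HB := cl_acf HK (cs x); have Bs := acf_subring HB; have KB := @cl_sub _ _ HK (cs x).
have Bn m : cl K (cs x) m%:R by exact: (subring_nat Bs).
have Bq : cl K (cs x) q.
  by have [_ _ h] := inB_second Kl HB KB.
have BZ : cl K (cs x) (ptZ (x 0%N)).
  have -> : ptZ (x 0%N) = (2 - cs x) / 2 by rewrite (cs_north Hx); field.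
  by apply: (acf_div HB) => //; apply: (subringB Bs) => //; exact: cl_gen.
have [_ _ _ xq _] := Hx; have := xq 0%N; rewrite /onq.
move: E BZ; rewrite /refl; case: (x 0%N) => [[a b] c]; rewrite /ptP /ptZ /ptQ /= => -[E _] BZ.
have Ec : c = q * a by rewrite -E; field.
rewrite Ec => Eq; have Ba : cl K (cs x) a.
  apply: (acf_root HB (p := 'X^2 * q%:P + (b ^+ 2 - 1)%:P)).
  - apply: (povD Bs); last by apply: (povC Bs); apply: (subringB Bs); [exact: (subringX Bs)|exact: (Bn 1%N)].
    by apply: (povM Bs); [exact: (povXn Bs)|exact: (povC Bs)].
  - apply/eqP => /(congr1 (fun p : {poly F} => p`_2)); rewrite coefD coefMC coefXn coefC coef0 /= mul1r addr0.
    by apply/eqP.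
  - apply/rootP; rewrite !hornerE /=; transitivity (a * (q * a) + b ^+ 2 - 1); last by rewrite Eq subrr.
    by move: (q) => r; ring.
by split=> //=; apply: (subringM Bs).
Qed.

Lemma even_clist al be ga : (forall s, exists g, ~ spanf K s g) -> K al -> K be ->
  ~ spanf K (lens H l) ga -> ~~ odd (size (clist H l al be ga)).
Proof.
move=> Hbig Ka Kb kga; have [us ms] := clistP HK HH Kl l0 l4 Hind Hbig Ka Kb kga.
apply: (even_invol (f := refl q)) => // x /ms Cx.
- by apply/ms; split; [exact: confs_refl Cx.1|rewrite cs_refl // ct_refl //; exact: Cx.2].
- exact: reflK.
- by move=> E; apply: (refl_fix Ka Kb kga Cx); rewrite E.
Qed.
End Reflection.

Lemma uniq_flatten_key (T1 T2 : eqType) (R : seq T1) (S : T1 -> seq T2) (g : T2 -> T1) : uniq R ->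
  (forall r, r \in R -> uniq (S r)) -> (forall r x, r \in R -> x \in S r -> g x = r) ->
  uniq (flatten (map S R)).
Proof.
elim: R => //= r R IH /andP[rR uR] uS key; rewrite cat_uniq uS ?mem_head //=.
rewrite IH // ?andbT => [|r' r'R|r' x r'R]; last 1 first.
- by apply: key; rewrite inE r'R orbT.
- apply/hasPn => x /flattenP[_ /mapP[r' r'R ->] xr']; apply/negP => xr.
  have := key r x (mem_head _ _) xr; rewrite (key r' x) ?inE ?r'R ?orbT // => E.
  by rewrite -E r'R in rR.
- by apply: uS; rewrite inE r'R orbT.
Qed.

Lemma sum_count_undup (T : eqType) (s : seq T) : (\sum_(r <- undup s) count_mem r s)%N = size s.
Proof.
rewrite -[RHS](perm_size (perm_count_undup s)) size_flatten /shape sumnE !big_map.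
by apply: eq_bigr => r _; rewrite size_nseq.
Qed.

Lemma mx_prod (F : numClosedFieldType) (O : set F) (I : eqType) (s : seq I) (f : I -> F) : subring O ->
  (forall i, i \in s -> O (f i)) -> mx O (\prod_(i <- s) f i) -> exists2 i, i \in s & mx O (f i).
Proof.
move=> HO; elim: s => [|i s IH] h; first by rewrite big_nil => /(mx1 HO).
rewrite big_cons => m; case: (mx_prime HO _ _ m).
- by apply: h; exact: mem_head.
- by rewrite big_seq; apply: (subring_prod HO) => j js; apply: h; rewrite inE js orbT.
- by exists i => //; exact: mem_head.
- case/IH => [j js|j js mj]; first by apply: h; rewrite inE js orbT.
  by exists j => //; rewrite inE js orbT.
Qed.

(** * Counting common points and glued configurations *)

Section Core.
Variable F : numClosedFieldType.
Variables (K : set F) (H1 H2 : graph) (l1 l2 : {fset nat} -> F).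
Let a12 := l1 [fset 1; 2]%N%fset.
Let b12 := l2 [fset 1; 2]%N%fset.
Hypotheses (HK : acf K) (HH1 : precal H1) (HH2 : precal H2) (Eab : a12 = b12).
Hypotheses (Ka : K a12) (a0 : a12 != 0) (a4 : a12 != 4).
Hypothesis Hind : indep K (lens H1 l1 ++ lens H2 l2).
Hypothesis Hbig : forall s, exists g, ~ spanf K s g.
Let Kb : K b12. Proof. by rewrite -Eab. Qed.
Let b0 : b12 != 0. Proof. by rewrite -Eab. Qed.
Let b4 : b12 != 4. Proof. by rewrite -Eab. Qed.
Let L1 := lens H1 l1.
Let L2 := lens H2 l2.
Let k1 := spanf K L1.
Let k2 := spanf K L2.
Let k12 := spanf K (L1 ++ L2).
Let Hk1 : acf k1 := span_acf _ HK.
Let Hk2 : acf k2 := span_acf _ HK.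
Let Hk12 : acf k12 := span_acf _ HK.
Let C1 u := clist H1 l1 1 1 u.
Let C2 u := clist H2 l2 1 1 u.
Let i1 : indep K L1 := ind1 HK Hind.
Let i2 : indep K L2 := ind2 HK Hind.
Let sub1 : k1 `<=` k12 := @k1_12 F K H1 H2 l1 l2 HK.
Let sub2 : k2 `<=` k12 := @k2_12 F K H1 H2 l1 l2 HK.
Let Hind' : indep K (L2 ++ L1).
Proof. by apply: (indep_perm HK _ Hind); rewrite perm_catC. Qed.
Let k21E : spanf K (L2 ++ L1) = k12.
Proof. by apply: span_eq => // z; rewrite !mem_cat orbC. Qed.

(** Common points lie above the roots of the resultant, and by [mult_root] the multiplicity of a
    root is the number of pairs above it; summed over the roots this is the degree. *)
Lemma curves_meet : exists (Pp : {poly F}) (Q : seq (conf F * conf F)), [/\ pov k12 Pp, Pp != 0,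
  forall u, ~ k12 u -> Pp.[u] = \prod_(x2 <- C2 u) (cpoly (C1 u)).[ct x2],
  lists [set p | [/\ confs H1 l1 p.1, confs H2 l2 p.2, cs p.1 = cs p.2 & ct p.1 = ct p.2]] Q &
  size Q = (size Pp).-1].
Proof.
have [Pp [KP P0 EP]] := pair_poly HK HH1 HH2 Ka a0 a4 Kb b0 b4 Hind Hbig.
have [rs Ers] := closed_field_poly_normal Pp.
have lc0 : lead_coef Pp != 0 by rewrite lead_coef_eq0.
have rootrs r : (r \in rs) = root Pp r by rewrite Ers rootZ // root_prod_XsubC.
have rootk r : r \in rs -> [/\ k12 r, ~ k1 r & ~ k2 r].
  rewrite rootrs => rr; have kr : k12 r by exact: (acf_root Hk12 KP P0 rr).
  have [v kv] := Hbig (L1 ++ L2).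
  have nvr : ~ k12 (v - r).
    by move=> h; apply: kv; rewrite -[v](subrK r); exact: (subringD (acf_subring Hk12)).
  (* At a place over the root, some factor of the resultant tends to 0, which gives two
     configurations with a common limit ordinate. *)
  have [O HP] := place_exists Hk12 nvr; have [HO kO Ow Ow' OV] := HP.
  have Ov : O v by rewrite -[v](subrK r); apply: (subringD HO) => //; exact: kO.
  have kv1 : ~ k1 v by move=> /sub1.
  have kv2 : ~ k2 v by move=> /sub2.
  have O1 x : x \in C1 v -> O (ct x).
    by move=> xs; apply: (ct_integral HK HH1 Ka a0 a4 i1 Hbig HO OV _ kv1 Ov xs); exact: subset_trans kO.
  have O2 x : x \in C2 v -> O (ct x).
    by move=> xs; apply: (ct_integral HK HH2 Kb b0 b4 i2 Hbig HO OV _ kv2 Ov xs); exact: subset_trans kO.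
  have mw : mx O (v - r) by right.
  have := mx_horner Hk12 HO OV kO kr mw KP.
  rewrite EP // (rootP rr) subr0 => /(mx_prod HO)[x2 x2s|x2 x2s].
    by apply: (pov_horner HO); [exact: pov_cpoly|exact: O2].
  rewrite /cpoly horner_prod => /(mx_prod HO)[x1 x1s|x1 x1s].
    by rewrite !hornerE; apply: (subringB HO); [exact: O2|exact: O1].
  rewrite !hornerE => m; split=> //.
    apply: (root_generic HK HH1 HH2 Ka a0 a4 Kb b0 b4 Hind Hbig kv kr HP x1s x2s).
    by rewrite -opprB; exact: (mxN HO).
  have := @root_generic F K H2 H1 l2 l1 HK HH2 HH1 Kb b0 b4 Ka a0 a4 Hind' Hbig v r O x2 x1.
  by rewrite k21E; apply.
pose S r := [seq p <- allpairs pair (C1 r) (C2 r) | ct p.1 == ct p.2].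
have memS r p : ~ k1 r -> ~ k2 r -> p \in S r <-> [/\ confs H1 l1 p.1, confs H2 l2 p.2,
    cs p.1 + ct p.1 = r, cs p.2 + ct p.2 = r & ct p.1 = ct p.2].
  move=> kr1 kr2; have L1P := clist1P HK HH1 Ka a0 a4 i1 Hbig kr1.
  have L2P := clist1P HK HH2 Kb b0 b4 i2 Hbig kr2.
  rewrite mem_filter; split.
    case/andP=> /eqP Et /allpairsP[[x1 x2] /= [/L1P.2 h1 /L2P.2 h2 Ep]].
    by rewrite Ep /= in Et *; case: h1 => ?; case: h2 => ?; rewrite !mul1r => ? ?.
  move=> [h1 h2 e1 e2 Et]; rewrite Et eqxx /=; apply/allpairsP; exists p; split=> /=; last by case: (p).
    by apply/L1P.2; split=> //; rewrite !mul1r.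
  by apply/L2P.2; split=> //; rewrite !mul1r.
exists Pp, (flatten (map S (undup rs))); split=> //.
  split.
    apply: (uniq_flatten_key (g := fun p => cs p.1 + ct p.1)); first exact: undup_uniq.
      move=> r; rewrite mem_undup => /rootk[_ kr1 kr2]; apply: filter_uniq; apply: allpairs_uniq.
      - by have [] := clist1P HK HH1 Ka a0 a4 i1 Hbig kr1.
      - by have [] := clist1P HK HH2 Kb b0 b4 i2 Hbig kr2.
      - by move=> [x y] [x' y'].
    by move=> r p; rewrite mem_undup => /rootk[_ kr1 kr2] /(memS r p kr1 kr2)[].
  move=> p; split.
    case/flattenP=> S' /mapP[r]; rewrite mem_undup => /rootk[_ kr1 kr2] ->.
    case/(memS r p kr1 kr2) => h1 h2 e1 e2 Et.
    by split=> //; rewrite -[cs p.1](addrK (ct p.1)) e1 -e2 Et addrK.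
  move=> [h1 h2 Es Et]; pose r := cs p.1 + ct p.1.
  have kr1 : ~ k1 r := pair_generic HK HH1 HH2 Ka a0 a4 Kb b0 b4 Hind h1 h2 Es Et.
  have kr2 : ~ k2 r.
    by rewrite /r Es Et; exact: (pair_generic HK HH2 HH1 Kb b0 b4 Ka a0 a4 Hind' h2 h1 (esym Es) (esym Et)).
  have pS : p \in S r by apply/memS => //; split=> //; rewrite -Es -Et.
  have := pS; rewrite mem_filter => /andP[_ /allpairsP[[x1 x2] /= [x1s x2s Ep]]].
  have kr : k12 r.
    apply: contrapT => nkr; apply: (no_meet HK HH1 HH2 Ka a0 a4 Kb b0 b4 Hind Hbig nkr x1s x2s).
    by move: Et; rewrite Ep.
  apply/flattenP; exists (S r) => //; apply: map_f; rewrite mem_undup rootrs.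
  have := mult_root HK HH1 HH2 Ka a0 a4 Kb b0 b4 Hind Hbig KP P0 EP kr kr1 kr2.
  apply: contra_eqT => nr; rewrite mupNroot // eq_sym -lt0n.
  rewrite (big_rem x2) //=; apply: ltn_addr; rewrite -has_count; apply/hasP; exists x1 => //.
  by move: Et; rewrite Ep => /eqP.
rewrite size_flatten /shape -map_comp sumnE big_map /=.
have -> : (size Pp).-1 = size rs by rewrite {1}Ers size_scale // size_prod_XsubC.
rewrite -sum_count_undup; apply: eq_big_seq => r; rewrite mem_undup => /rootk[kr kr1 kr2].
have -> : count_mem r rs = mup r Pp by rewrite Ers mup_scale // mu_prod_XsubC.
rewrite (mult_root HK HH1 HH2 Ka a0 a4 Kb b0 b4 Hind Hbig KP P0 EP kr kr1 kr2).
rewrite size_filter -sum1_count big_mkcond big_allpairs exchange_big /=.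
by apply: eq_bigr => x2 _; rewrite -sum1_count [RHS]big_mkcond.
Qed.

(** The distances s and t fix ptZ, and then both the product of q ptP and ptQ and their sum; so
    these two numbers are determined up to their exchange, which is the reflection. *)
Lemma meet_cases x1 x2 : confs H1 l1 x1 -> confs H2 l2 x2 -> cs x1 = cs x2 -> ct x1 = ct x2 ->
  x1 0%N = x2 0%N \/ x1 0%N = refl (ptQ (second b12)) x2 0%N.
Proof.
move=> h1 h2; have q0 := second_neq0 b0 b4.
have [_ _ _ /(_ 0%N) + _] := h1; have [_ _ _ /(_ 0%N) + _] := h2.
have [_ x12 _ _ _] := h1; have [_ x22 _ _ _] := h2.
rewrite (cs_north h1) (cs_north h2) /ct x12 x22 -/a12 Eab /onq /refl /dist.
have -> : ptP (second b12) = 1 by [].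
move: (ptQ (second b12)) q0 (ptZ (second b12)) => q q0 z.
case: (x1 0%N) (x2 0%N) => [[a b] c] [[a' b'] c']; rewrite /ptP /ptZ /ptQ /= => E2 E1 Es Et.
have Eb : b = b' by apply: (@mulfI _ (2 : F)); rewrite ?pnatr_eq0 // -[LHS](subKr 2) Es subKr.
rewrite -Eb in E2 Et *.
have Ep : a * c = a' * c' by apply: (addIr (b ^+ 2)); rewrite E1.
have Esum : a * q + c = a' * q + c'.
  have -> : a * q + c = 2 - 2 * b * z - (2 - 2 * b * z - a * q - c * 1) by ring.
  by rewrite Et; ring.
have : (c - c') * (c - q * a') = 0.
  have -> : (c - c') * (c - q * a') = c * (c + a * q) - c * (c' + a' * q) - q * (a * c - a' * c') by ring.
  by rewrite Ep [c + _]addrC Esum; ring.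
move/eqP; rewrite mulf_eq0 => /orP[]; rewrite subr_eq0 => /eqP Ec; [left|right].
  have -> : a = a' by apply: (mulIf q0); apply: (addIr c); rewrite {2}Ec.
  by rewrite Ec.
have -> : a = c' / q by apply: (mulIf q0); rewrite divfK //; apply: (addIr c); rewrite Esum Ec; ring.
by rewrite Ec.
Qed.

Lemma core_count (O : set F) u : subring O -> (forall x, O x \/ O x^-1) -> k12 `<=` O -> ~ O u ->
  exists2 Q, lists [set p | [/\ confs H1 l1 p.1, confs H2 l2 p.2 & p.1 0%N = p.2 0%N]] Q &
  (2 * size Q + count (fun x => `[< O (cs x) >]) (C1 u) * count (fun x => `[< O (cs x) >]) (C2 u)
   + count (fun x => `[< O (ct x) >]) (C1 u) * count (fun x => `[< O (ct x) >]) (C2 u)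
   = size (C1 u) * size (C2 u))%N.
Proof.
move=> HO OV kO nu; have [Pp [Q [KP P0 EP [uQ mQ] sQ]]] := curves_meet.
have <- := degree_pair HK HH1 HH2 Ka a0 a4 Kb b0 b4 Hind Hbig HO OV kO nu KP P0 EP.
have q0 := second_neq0 b0 b4; set q := ptQ _ in q0.
pose e (p : conf F * conf F) := p.1 0%N == p.2 0%N.
have csE x1 x2 : confs H1 l1 x1 -> confs H2 l2 x2 -> x1 0%N = x2 0%N -> cs x1 = cs x2 /\ ct x1 = ct x2.
  by move=> [x11 x12 _ _ _] [x21 x22 _ _ _] E; rewrite /cs /ct x11 x12 x21 x22 E -/a12 Eab.
exists [seq p <- Q | e p].
  split; first exact: filter_uniq.
  move=> p; rewrite mem_filter; split; first by case/andP=> /eqP h /mQ[].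
  move=> [h1 h2 E]; rewrite /e E eqxx /=; apply/mQ.
  by have [? ?] := csE _ _ h1 h2 E.
(* Reflecting only the second configuration exchanges the pairs that agree at vertex 0 with those
   that do not. *)
pose f (p : conf F * conf F) := (p.1, refl q p.2).
have fK : involutive f by move=> [x y]; rewrite /f /= (reflK q0).
have fQ p : p \in Q -> f p \in Q.
  move/mQ=> [h1 h2 Es Et]; apply/mQ; split=> //=; first exact: confs_refl.
    by rewrite cs_refl.
  by rewrite ct_refl.
have ef p : p \in Q -> e (f p) = ~~ e p.
  move=> /mQ [h1 h2 Es Et].
  have nf : refl q p.2 0%N <> p.2 0%N.
    have kr2 : ~ k2 (cs p.2 + ct p.2).
      exact: (pair_generic HK HH2 HH1 Kb b0 b4 Ka a0 a4 Hind' h2 h1 (esym Es) (esym Et)).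
    apply: (refl_fix HK HH2 Kb b0 b4 i2 (K1 HK) (K1 HK) kr2); split=> //.
    by rewrite !mul1r.
  rewrite /e /=; case: (meet_cases h1 h2 Es Et) => E; rewrite E.
    by rewrite eqxx eq_sym; apply/eqP.
  by rewrite -/q eqxx; apply/esym/eqP.
have -> : (2 * size [seq p <- Q | e p] = (size Pp).-1)%N; last by [].
rewrite -sQ -(count_predC e Q) size_filter mul2n -addnn; congr (_ + _)%N.
have pe : perm_eq (map f Q) Q.
  apply: uniq_perm => //; first by rewrite map_inj_uniq //; exact: inv_inj.
  move=> p; apply/mapP/idP => [[p' /fQ h ->]//|pQ]; exists (f p); [exact: fQ|by rewrite fK].
rewrite -(permP pe) count_map; apply: eq_in_count => p pQ; exact: ef.
Qed.
End Core.

(** * The basic calligraphs *)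

Section TwoPoints.
Variable F : numClosedFieldType.

Definition nrm (p : pt F) := ptP p * ptQ p + ptZ p ^+ 2.
(** A Gram determinant: 1 - dist a b / 2 is the bilinear product of [a] and [b], also off the
    sphere. *)
Definition gram (a b : pt F) := nrm a * nrm b - (1 - dist a b / 2) ^+ 2.

Lemma gram_solve (n1 n2 n12 A B : F) : n1 * n2 - n12 ^+ 2 != 0 ->
  exists x y, [/\ x = (A * n2 - B * n12) / (n1 * n2 - n12 ^+ 2), y = (B * n1 - A * n12) / (n1 * n2 - n12 ^+ 2),
    x * n1 + y * n12 = A, x * n12 + y * n2 = B &
    (x ^+ 2 * n1 + 2 * x * y * n12 + y ^+ 2 * n2) * (n1 * n2 - n12 ^+ 2) =
      A ^+ 2 * n2 - 2 * A * B * n12 + B ^+ 2 * n1].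
Proof. by move=> g0; do 2!eexists; split; [reflexivity|reflexivity|field|field|field]. Qed.

(* The points at given distances from a and b lie on a line p0 + s d, where p0 is
   in the plane of a and b and d is orthogonal to it; so nothing linear in s is left. *)
Lemma two_points (k : set F) (a b : pt F) al be : acf k -> inB k a -> inB k b -> k be -> ~ k al ->
  nrm b != 0 -> gram a b != 0 ->
  exists p1 p2, [/\ p1 != p2,
    forall p, onq p /\ dist p a = al /\ dist p b = be <-> p = p1 \/ p = p2 &
    forall k' : set F, acf k' -> k `<=` k' -> k' al -> inB k' p1 /\ inB k' p2].
Proof.
case: a b => [[aP aZ] aQ] [[bP bZ] bQ]; rewrite /gram /nrm /dist /inB /ptP /ptZ /ptQ /=.
move=> Hk [kaP kaZ kaQ] [kbP kbZ kbQ] kbe nkal nb0.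
set naa := aP * aQ + _; set nbb := bP * bQ + _ in nb0 *; set g := naa * nbb - _ => g0.
pose A := 1 - al / 2; pose B := 1 - be / 2; pose nab := aZ * bZ + (aP * bQ + aQ * bP) / 2.
have Eg : g = naa * nbb - nab ^+ 2 by rewrite /g /nab; congr (_ - _ ^+ 2); field.
have [x [y [Ex Ey ExA EyB n0E]]] : exists x y, [/\ x = (A * nbb - B * nab) / g, y = (B * naa - A * nab) / g,
    x * naa + y * nab = A, x * nab + y * nbb = B &
    (x ^+ 2 * naa + 2 * x * y * nab + y ^+ 2 * nbb) * g = A ^+ 2 * nbb - 2 * A * B * nab + B ^+ 2 * naa].
  by rewrite Eg; apply: gram_solve; rewrite -Eg.
(* A multiple of the cross product of [a] and [b], in the isotropic coordinates; its norm is -4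
   g. *)
pose dP := 2 * (aZ * bP - aP * bZ); pose dZ := aP * bQ - aQ * bP; pose dQ := 2 * (aQ * bZ - aZ * bQ).
have Ed : dP * dQ + dZ ^+ 2 = - 4 * g by rewrite Eg /dP /dQ /dZ /naa /nbb /nab; field.
have g4 : - 4 * g != 0 by rewrite mulf_neq0 // oppr_eq0 pnatr_eq0.
pose n0 := x ^+ 2 * naa + 2 * x * y * nab + y ^+ 2 * nbb.
rewrite -/n0 in n0E.
have ks := acf_subring Hk; have kn m : k m%:R by exact: (subring_nat ks).
have kB : k B by apply: (subringB ks); [exact: (kn 1%N)|apply: (acf_div Hk)].
have knaa : k naa by apply: (subringD ks); [exact: (subringM ks)|exact: (subringX ks)].
have knbb : k nbb by apply: (subringD ks); [exact: (subringM ks)|exact: (subringX ks)].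
have knab : k nab.
  apply: (subringD ks); first exact: (subringM ks).
  by apply: (acf_div Hk) => //; apply: (subringD ks); exact: (subringM ks).
have kg : k g by rewrite Eg; apply: (subringB ks); [exact: (subringM ks)|exact: (subringX ks)].
(* [n0] is the norm of the point of the line in the plane of [a] and [b]. If it were 1, [A] and
   hence [al] would satisfy a quadratic equation over [k] with leading coefficient nrm b. *)
have n01 : 1 - n0 != 0.
  rewrite subr_eq0 eq_sym; apply/eqP => n01; apply: nkal.
  have kA : k A.
    apply: (acf_root Hk (p := 'X^2 * nbb%:P - 'X * (2 * B * nab)%:P + (B ^+ 2 * naa - g)%:P)).
    - apply: (povD ks); [apply: (povB ks); apply: (povM ks); [exact: (povXn ks)|exact: (povC ks)|exact: (povX ks)|]|].
        by apply: (povC ks); apply: (subringM ks) => //; apply: (subringM ks).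
      by apply: (povC ks); apply: (subringB ks) => //; apply: (subringM ks) => //; apply: (subringX ks).
    - apply/eqP => /(congr1 (fun p : {poly F} => p`_2)).
      by rewrite coefD coefB !coefMC coefXn coefX coefC coef0 /= mul1r mul0r subr0 addr0; apply/eqP.
    - apply/rootP; rewrite !hornerE /=; transitivity (n0 * g - g); last by rewrite n01 mul1r subrr.
      by rewrite n0E; ring.
  have -> : al = 2 * (1 - A) by rewrite /A; field.
  by apply: (subringM ks) => //; apply: (subringB ks) => //; exact: (kn 1%N).
pose s := sqrtC ((1 - n0) / (- 4 * g)).
have Es : s ^+ 2 * (- 4 * g) = 1 - n0 by rewrite sqrtCK divfK.
have s0 : s != 0 by rewrite sqrtC_eq0 mulf_neq0 // invr_eq0.
pose p (t : F) : pt F := (x * aP + y * bP + t * dP, x * aZ + y * bZ + t * dZ, x * aQ + y * bQ + t * dQ).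
have pQ t : ptP (p t) * ptQ (p t) + ptZ (p t) ^+ 2 = n0 + t ^+ 2 * (- 4 * g).
  by rewrite -Ed /p /ptP /ptZ /ptQ /= /n0 /naa /nbb /nab /dP /dZ /dQ; field.
have pa t : 2 - 2 * ptZ (p t) * aZ - ptP (p t) * aQ - ptQ (p t) * aP = al.
  have -> : al = 2 - 2 * (x * naa + y * nab).
    by rewrite ExA /A; field.
  by rewrite /p /ptP /ptZ /ptQ /= /naa /nab /dP /dZ /dQ; field.
have pb t : 2 - 2 * ptZ (p t) * bZ - ptP (p t) * bQ - ptQ (p t) * bP = be.
  have -> : be = 2 - 2 * (x * nab + y * nbb).
    by rewrite EyB /B; field.
  by rewrite /p /ptP /ptZ /ptQ /= /nbb /nab /dP /dZ /dQ; field.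
have onL r : 2 - 2 * ptZ r * aZ - ptP r * aQ - ptQ r * aP = al ->
    2 - 2 * ptZ r * bZ - ptP r * bQ - ptQ r * bP = be -> exists t, r = p t.
  case: r => [[rP rZ] rQ]; rewrite /ptP /ptZ /ptQ /= => ra rb.
  pose eP := rP - (x * aP + y * bP); pose eZ := rZ - (x * aZ + y * bZ); pose eQ := rQ - (x * aQ + y * bQ).
  have ea : 2 * eZ * aZ + eP * aQ + eQ * aP = 0.
    transitivity (al - (2 - 2 * rZ * aZ - rP * aQ - rQ * aP)); last by rewrite ra subrr.
    by rewrite -{1}(pa 0) /p /ptP /ptZ /ptQ /= /eP /eZ /eQ; ring.
  have eb : 2 * eZ * bZ + eP * bQ + eQ * bP = 0.
    transitivity (be - (2 - 2 * rZ * bZ - rP * bQ - rQ * bP)); last by rewrite rb subrr.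
    by rewrite -{1}(pb 0) /p /ptP /ptZ /ptQ /= /eP /eZ /eQ; ring.
  (* A vector orthogonal to both [a] and [b] is parallel to their cross product. *)
  have c1 : eP * dZ - eZ * dP = 0.
    transitivity (aP * (2 * eZ * bZ + eP * bQ + eQ * bP) - bP * (2 * eZ * aZ + eP * aQ + eQ * aP)).
      by rewrite /dP /dZ; ring.
    by rewrite ea eb !mulr0 subrr.
  have c2 : eZ * dQ - eQ * dZ = 0.
    transitivity (aQ * (2 * eZ * bZ + eP * bQ + eQ * bP) - bQ * (2 * eZ * aZ + eP * aQ + eQ * aP)).
      by rewrite /dQ /dZ; ring.
    by rewrite ea eb !mulr0 subrr.
  have c3 : eQ * dP - eP * dQ = 0.
    transitivity (2 * (aZ * (2 * eZ * bZ + eP * bQ + eQ * bP) - bZ * (2 * eZ * aZ + eP * aQ + eQ * aP))).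
      by rewrite /dQ /dP; ring.
    by rewrite ea eb !mulr0 subrr mulr0.
  exists ((eZ * dZ + (eP * dQ + eQ * dP) / 2) / (- 4 * g)).
  have Dn : dP * dQ + dZ ^+ 2 != 0 by rewrite Ed.
  rewrite /p -Ed; set D := dP * dQ + dZ ^+ 2 in Dn *.
  have comp (e d r0 r1 : F) : e = r0 - r1 -> D * e = (eZ * dZ + (eP * dQ + eQ * dP) / 2) * d ->
      r0 = r1 + (eZ * dZ + (eP * dQ + eQ * dP) / 2) / D * d.
    by move=> Ee E; rewrite mulrAC -E mulrC mulKf // Ee addrC subrK.
  congr (_, _, _); [apply: (comp eP)|apply: (comp eZ)|apply: (comp eQ)] => //.
  - apply/eqP; rewrite -subr_eq0; apply/eqP.
    transitivity (dZ * (eP * dZ - eZ * dP) - dP / 2 * (eQ * dP - eP * dQ)); first by rewrite /D; field.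
    by rewrite c1 c3 !mulr0 subrr.
  - apply/eqP; rewrite -subr_eq0; apply/eqP.
    transitivity (dP / 2 * (eZ * dQ - eQ * dZ) - dQ / 2 * (eP * dZ - eZ * dP)); first by rewrite /D; field.
    by rewrite c1 c2 !mulr0 subrr.
  - apply/eqP; rewrite -subr_eq0; apply/eqP.
    transitivity (dQ / 2 * (eQ * dP - eP * dQ) - dZ * (eZ * dQ - eQ * dZ)); first by rewrite /D; field.
    by rewrite c2 c3 !mulr0 subrr.
exists (p s), (p (- s)); split.
- apply/eqP => E; have h (d : F) : s * d = - s * d -> d = 0.
    move=> E'; have : 2 * s * d = 0.
      have -> : 2 * s * d = s * d - - s * d by ring.
      by rewrite E' subrr.
    by move/eqP; rewrite !mulf_eq0 pnatr_eq0 (negPf s0) /= => /eqP.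
  case: E => /addrI/h hP /addrI/h hZ /addrI/h hQ.
  by move: g4; rewrite -Ed hP hZ mul0r expr0n addr0 eqxx.
- move=> r; split.
    case=> rq [ra rb]; have [t Et] := onL r ra rb; move: rq; rewrite /onq Et pQ => Eq.
    have : t ^+ 2 == s ^+ 2.
      by apply/eqP; apply: (mulIf g4); rewrite Es; apply: (addrI n0); rewrite Eq addrC subrK.
    by rewrite eqf_sqr => /orP[]/eqP->; [left|right].
  case=> ->; (split; [rewrite /onq pQ ?sqrrN Es addrC subrK //|split; [exact: pa|exact: pb]]).
- move=> k' Hk' kk' k'al; have ks' := acf_subring Hk'.
  have kA : k' A by apply: (subringB ks'); [exact: (subring1 ks')|apply: (acf_div Hk') => //; exact: (subring_nat ks')].
  have k'g := kk' _ kg; have k'B := kk' _ kB.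
  have kx : k' x by rewrite Ex; apply: (acf_div Hk') => //; apply: (subringB ks'); apply: (subringM ks') => //; exact: kk'.
  have ky : k' y by rewrite Ey; apply: (acf_div Hk') => //; apply: (subringB ks'); apply: (subringM ks') => //; exact: kk'.
  have kd (w : F) : k w -> k' w by exact: kk'.
  have kdP : k' dP by apply/kk'/(subringM ks) => //; apply: (subringB ks); exact: (subringM ks).
  have kdZ : k' dZ by apply/kk'/(subringB ks); exact: (subringM ks).
  have kdQ : k' dQ by apply/kk'/(subringM ks) => //; apply: (subringB ks); exact: (subringM ks).
  have kn0 : k' n0.
    have -> : n0 = (A ^+ 2 * nbb - 2 * A * B * nab + B ^+ 2 * naa) / g by rewrite -n0E mulfK.
    apply: (acf_div Hk') => //; apply: (subringD ks'); [apply: (subringB ks')|]; apply: (subringM ks'); rewrite ?expr2;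
      do ?apply: (subringM ks') => //; by [|apply: kk'|apply: (subring_nat ks')].
  have k's : k' s.
    apply: (acf_root Hk' (p := 'X^2 - ((1 - n0) / (- 4 * g))%:P)).
    - apply: (povB ks'); [exact: (povXn ks')|apply: (povC ks'); apply: (acf_div Hk')].
        by apply: (subringB ks') => //; exact: (subring1 ks').
      by apply: (subringM ks') => //; apply: (subringN ks'); exact: (subring_nat ks').
    - by rewrite -size_poly_eq0 size_XnsubC.
    - by apply/rootP; rewrite !hornerE /= sqrtCK subrr.
  have comp (t c1 c2 d : F) : k' t -> k c1 -> k c2 -> k' d -> k' (x * c1 + y * c2 + t * d).
    move=> kt kc1 kc2 kd'; apply: (subringD ks'); last exact: (subringM ks').
    by apply: (subringD ks'); apply: (subringM ks') => //; exact: kk'.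
  by split; split; apply: comp => //; exact: (subringN ks').
Qed.
End TwoPoints.

Lemma lists_size (T : eqType) (X : set T) s s' : lists X s -> lists X s' -> size s = size s'.
Proof.
move=> [us ms] [us' ms']; apply/perm_size/uniq_perm => // x; apply/idP/idP.
  by move/ms/ms'.
by move/ms'/ms.
Qed.

Lemma fset2_eq (u v a b : nat) : a != b -> [fset u; v]%fset = [fset a; b]%fset ->
  (u = a /\ v = b) \/ (u = b /\ v = a).
Proof.
move=> ab /fsetP E; have := E u; have := E a; have := E b.
rewrite !inE !eqxx orbT /= => Eb Ea /esym/orP[]/eqP Eu; [left|right]; split=> //.
  by move/orP: Eb => [|/eqP->//]; rewrite Eu eq_sym (negPf ab).
by move/orP: Ea => [|/eqP->//]; rewrite Eu (negPf ab).
Qed.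

Section Basic.
Variable F : numClosedFieldType.

Lemma edge_dist (l : {fset nat} -> F) (x : conf F) a b : a != b ->
  dist (x a) (x b) = l [fset a; b]%N%fset ->
  forall u v, [fset u; v]%fset = [fset a; b]%fset -> dist (x u) (x v) = l [fset u; v]%fset.
Proof.
move=> ab E u v Euv; rewrite Euv -E.
by case: (fset2_eq ab Euv) => -[Eu Ev]; rewrite Eu Ev // distC.
Qed.

Definition conf3 (a : F) (p : pt F) : conf F :=
  fun v => if v == 0%N then p else if v == 2%N then second a else north F.

Definition conf4 (a : F) (v : nat) (p q : pt F) : conf F :=
  fun w => if w == v then q else conf3 a p w.

Lemma dist_ns (a : F) : dist (north F) (second a) = a.
Proof. by rewrite /dist /ptP /ptZ /ptQ /=; field. Qed.

Lemma onq_conf3 a p v : onq p -> onq (conf3 a p v).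
Proof.
by rewrite /conf3; do 2!case: ifP => // _; move=> _; [exact: onq_second|exact: onq_north].
Qed.

Lemma confs_L (l : {fset nat} -> F) x : confs basic_L_graph l x <->
  exists p, [/\ x = conf3 (l [fset 1; 2]%N%fset) p, onq p & dist p (north F) = l [fset 0; 1]%N%fset].
Proof.
split=> [[x1 x2 xn xq xe]|[p [-> pq pd]]].
  exists (x 0%N); split=> //; last by rewrite -x1; apply: xe; rewrite /= !inE eqxx orbT.
  apply/funext => v; rewrite /conf3; case: eqVneq => [->//|v0]; case: eqVneq => [->//|v2].
  by have [->//|v1] := eqVneq v 1%N; apply: xn; rewrite /= !inE !negb_or v0 v1.
split=> //; first by move=> v; rewrite /= !inE !negb_or => /andP[/andP[v0 _] v2]; rewrite /conf3 (negPf v0) (negPf v2).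
  by move=> v; exact: onq_conf3.
move=> u v; rewrite /= !inE => /orP[] /eqP E; apply: (edge_dist _ _ E) => //.
by rewrite /conf3 /= dist_ns.
Qed.

Lemma confs_R (l : {fset nat} -> F) x : confs basic_R_graph l x <->
  exists p, [/\ x = conf3 (l [fset 1; 2]%N%fset) p, onq p &
    dist p (second (l [fset 1; 2]%N%fset)) = l [fset 0; 2]%N%fset].
Proof.
split=> [[x1 x2 xn xq xe]|[p [-> pq pd]]].
  exists (x 0%N); split=> //; last by rewrite -x2; apply: xe; rewrite /= !inE eqxx orbT.
  apply/funext => v; rewrite /conf3; case: eqVneq => [->//|v0]; case: eqVneq => [->//|v2].
  by have [->//|v1] := eqVneq v 1%N; apply: xn; rewrite /= !inE !negb_or v0 v1.
split=> //; first by move=> v; rewrite /= !inE !negb_or => /andP[/andP[v0 _] v2]; rewrite /conf3 (negPf v0) (negPf v2).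
  by move=> v; exact: onq_conf3.
move=> u v; rewrite /= !inE => /orP[] /eqP E; apply: (edge_dist _ _ E) => //.
by rewrite /conf3 /= dist_ns.
Qed.

Lemma confs_C v (hv : v \notin [fset 0; 1; 2]%N%fset) (l : {fset nat} -> F) x :
  let a := l [fset 1; 2]%N%fset in confs (basic_C_graph hv) l x <->
  exists p q, [/\ x = conf4 a v p q, onq p /\ onq q, dist p q = l [fset 0; v]%N%fset,
    dist q (north F) = l [fset 1; v]%N%fset & dist q (second a) = l [fset 2; v]%N%fset].
Proof.
move=> a; have := hv; rewrite !inE !negb_or -andbA => /and3P[v0 v1 v2].
split=> [[x1 x2 xn xq xe]|[p [q [-> [pq qq] d0 d1 d2]]]].
  exists (x 0%N), (x v); split=> //.
  - apply/funext => w; rewrite /conf4; case: eqVneq => [->//|wv].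
    rewrite /conf3; case: eqVneq => [->//|w0]; case: eqVneq => [->//|w2].
    by have [->//|w1] := eqVneq w 1%N; apply: xn; rewrite /= !inE !negb_or w0 w1 w2 wv.
  - by apply: xe; rewrite /= !inE eqxx !orbT.
  - by rewrite -x1 distC; apply: xe; rewrite /= !inE eqxx !orbT.
  - by rewrite -x2 distC; apply: xe; rewrite /= !inE eqxx !orbT.
have cv : conf4 a v p q v = q by rewrite /conf4 eqxx.
have c0 : conf4 a v p q 0%N = p by rewrite /conf4 eq_sym (negPf v0).
have c1 : conf4 a v p q 1%N = north F by rewrite /conf4 eq_sym (negPf v1).
have c2 : conf4 a v p q 2%N = second a by rewrite /conf4 eq_sym (negPf v2).
split=> //.
- move=> w; rewrite /= !inE !negb_or -!andbA => /and4P[w0 w1 w2 wv].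
  by rewrite /conf4 (negPf wv) /conf3 (negPf w0) (negPf w2).
- by move=> w; rewrite /conf4; case: ifP => // _; exact: onq_conf3.
- move=> u w; rewrite /= !inE -!orbA => /or4P[] /eqP E; apply: (edge_dist _ _ E); rewrite 1?eq_sym //.
  + by rewrite c1 c2 dist_ns.
  + by rewrite c0 cv.
  + by rewrite c1 cv distC.
  + by rewrite c2 cv distC.
Qed.

Lemma gram_ns (a : F) : gram (second a) (north F) = ptQ (second a).
Proof. by rewrite /gram /nrm /dist /ptP /ptZ /ptQ /=; field. Qed.

Lemma gramC (a b : pt F) : gram a b = gram b a.
Proof. by rewrite /gram mulrC distC. Qed.

Lemma nrm1 (a : pt F) : onq a -> nrm a = 1. Proof. by []. Qed.

Variables (K : set F) (l : {fset nat} -> F).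
Let l12 := l [fset 1; 2]%N%fset.
Hypotheses (HK : acf K) (Kl : K l12) (l0 : l12 != 0) (l4 : l12 != 4).
Hypothesis Hbig : forall s, exists g, ~ spanf K s g.
Let q0 := second_neq0 l0 l4.
Let Ks := acf_subring HK.

Lemma lens_perm H s : uniq s -> [fset 1; 2]%N%fset \notin s -> eset H =i [fset 1; 2]%N%fset :: s ->
  perm_eq (lens H l) (map l s).
Proof.
move=> us n12 E; apply: perm_map; apply: uniq_perm => //; first exact: fset_uniq.
move=> e; rewrite !inE E inE; case: eqVneq => [->|] //=.
by rewrite (negPf n12).
Qed.

Lemma precal_L : precal basic_L_graph. Proof. by have [] := basic_L_calligraph. Qed.
Lemma precal_R : precal basic_R_graph. Proof. by have [] := basic_R_calligraph. Qed.
Lemma precal_C v (hv : v \notin [fset 0; 1; 2]%N%fset) : precal (basic_C_graph hv).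
Proof. by have [] := basic_C_calligraph hv. Qed.

Lemma lens_L : perm_eq (lens basic_L_graph l) [:: l [fset 0; 1]%N%fset].
Proof.
apply: (@lens_perm _ [:: [fset 0; 1]%N%fset]) => // [|e]; last by rewrite /= !inE.
by rewrite inE; apply/negP => /eqP/(fset2_eq (isT : 0%N != 1%N))[][].
Qed.

Lemma lens_R : perm_eq (lens basic_R_graph l) [:: l [fset 0; 2]%N%fset].
Proof.
apply: (@lens_perm _ [:: [fset 0; 2]%N%fset]) => // [|e]; last by rewrite /= !inE.
by rewrite inE; apply/negP => /eqP/(fset2_eq (isT : 0%N != 2%N))[][].
Qed.

Lemma clist_points H al be ga s : precal H -> indep K (lens H l) -> K al -> K be ->
  ~ spanf K (lens H l) ga -> lists (cset H l al be ga) s -> size (clist H l al be ga) = size s.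
Proof.
by move=> HH Hi Ka Kb kg; apply: lists_size; exact: (clistP HK HH Kl l0 l4 Hi Hbig Ka Kb kg).
Qed.

Lemma conf3_inj a : injective (conf3 a).
Proof. by move=> p p' /(congr1 (fun x : conf F => x 0%N)). Qed.

(* [m] is the weight of the free distance in the linear condition, [z] that of the
   prescribed one. *)
Lemma clist_3 H (a b : pt F) lab m z al be ga : precal H -> indep K (lens H l) ->
  perm_eq (lens H l) [:: lab] -> K al -> K be -> ~ spanf K (lens H l) ga ->
  inB K a -> inB K b -> onq b -> gram a b != 0 -> K m -> K z ->
  (forall p, al * cs (conf3 l12 p) + be * ct (conf3 l12 p) = m * dist p a + z * dist p b) ->
  (forall y, confs H l y <-> exists p, [/\ y = conf3 l12 p, onq p & dist p b = lab]) ->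
  size (clist H l al be ga) = if m == 0 then 0%N else 2.
Proof.
move=> HH Hi pl Ka Kb kg aK bK bq g0 Km Kz Ecs Hconf.
have Elab : spanf K (lens H l) = spanf K [:: lab] by apply: span_eq => // w; rewrite (perm_mem pl).
rewrite Elab in kg; set k := spanf K [:: lab] in kg; have Hk : acf k := span_acf _ HK.
have ks := acf_subring Hk; have Kk : K `<=` k := @span_sub _ K [:: lab] HK.
have klab : k lab by apply: span_mem => //; exact: mem_head.
have kg' : ~ spanf K (lens H l) ga by rewrite Elab.
have kzl : k (z * lab) by apply: (subringM ks) => //; exact: Kk.
case: eqVneq => [m0|m0].
  apply: (clist_points HH Hi Ka Kb kg' (s := [::])); split=> // y; split=> // -[/Hconf[p [-> _ Ep]]].
  by rewrite Ecs m0 mul0r add0r Ep => E; case: kg; rewrite -E.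
have kal : ~ k ((ga - z * lab) / m).
  move=> h; apply: kg; have -> : ga = (ga - z * lab) / m * m + z * lab by field.
  by apply: (subringD ks) => //; apply: (subringM ks) => //; exact: Kk.
have nb : nrm b != 0 by rewrite nrm1 // oner_eq0.
have [p1 [p2 [p12 Hp _]]] := two_points Hk (inB_sub Kk aK) (inB_sub Kk bK) klab kal nb g0.
apply: (clist_points HH Hi Ka Kb kg' (s := [:: conf3 l12 p1; conf3 l12 p2])); split.
  by rewrite /= inE andbT; apply: contra_neq p12 => /conf3_inj.
move=> y; rewrite !inE; split.
  have h p : p = p1 \/ p = p2 -> cset H l al be ga (conf3 l12 p).
    move/Hp => [pq [pa pb]]; split; first by apply/Hconf; exists p.
    by rewrite Ecs pa pb; field.
  by case/orP=> /eqP->; apply: h; [left|right].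
case=> /Hconf[p [-> pq pb]]; rewrite Ecs pb => E.
have : p = p1 \/ p = p2 by apply/Hp; split=> //; split=> //; rewrite -E; field.
by case=> ->; rewrite eqxx ?orbT.
Qed.

Let inN : inB K (north F) := inB_north HK.
Let inS : inB K (second l12).
Proof. by apply: (inB_second Kl HK). Qed.

(** For this graph s is a prescribed length. A condition on s alone with a generic right-hand side
    has no solution; any other fixes t and leaves two mirror positions of vertex 0. *)
Lemma clist_L al be ga : indep K (lens basic_L_graph l) -> K al -> K be ->
  ~ spanf K (lens basic_L_graph l) ga ->
  size (clist basic_L_graph l al be ga) = if be == 0 then 0%N else 2.
Proof.
move=> Hi Ka Kb kg; apply: (clist_3 precal_L Hi lens_L Ka Kb kg inS inN (onq_north F) _ Kb Ka).
- by rewrite gram_ns.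
- by move=> p; rewrite addrC.
- by move=> y; exact: confs_L.
Qed.

Lemma clist_R al be ga : indep K (lens basic_R_graph l) -> K al -> K be ->
  ~ spanf K (lens basic_R_graph l) ga ->
  size (clist basic_R_graph l al be ga) = if al == 0 then 0%N else 2.
Proof.
move=> Hi Ka Kb kg; apply: (clist_3 precal_R Hi lens_R Ka Kb kg inN inS (onq_second _) _ Ka Kb).
- by rewrite gramC gram_ns.
- by [].
- by move=> y; exact: confs_R.
Qed.

Lemma lens_C v (hv : v \notin [fset 0; 1; 2]%N%fset) :
  perm_eq (lens (basic_C_graph hv) l) [:: l [fset 0; v]; l [fset 1; v]; l [fset 2; v] ]%N%fset.
Proof.
have := hv; rewrite !inE !negb_or -andbA => /and3P[v0 v1 v2].
have ne (a b c : nat) : a != b -> a != v -> [fset a; v]%fset != [fset b; c]%fset \/ a = c.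
  move=> ab av; have [->|ac] := eqVneq a c; [by right|left].
  by apply: ne_fset2; rewrite !inE negb_or ab.
apply: (@lens_perm _ [:: [fset 0; v]; [fset 1; v]; [fset 2; v] ]%N%fset) => [||e].
- rewrite /= !inE !negb_or !andbT; repeat (apply/andP; split); apply: ne_fset2; rewrite !inE negb_or /= eq_sym //.
- rewrite !inE !negb_or; repeat (apply/andP; split); apply/eqP => /fsetP /(_ v);
  by rewrite !inE eqxx orbT (negPf v1) (negPf v2).
- by rewrite /= !inE -!orbA.
Qed.

Lemma conf4_inj v (p q p' q' : pt F) a : v != 0%N -> conf4 a v p q = conf4 a v p' q' -> p = p' /\ q = q'.
Proof.
move=> v0 E; have := congr1 (fun x : conf F => x 0%N) E; have := congr1 (fun x : conf F => x v) E.
by rewrite /conf4 /conf3 /= eqxx eq_sym (negPf v0).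
Qed.

(** The lengths to 1 and 2 leave two positions of [v]. The linear condition prescribes the product
    with b = al north + be second, a point in general off the sphere, so each position of [v] leaves
    two positions of 0. The assumption on al and be says that the norm of b is nonzero. *)
Lemma clist_C v (hv : v \notin [fset 0; 1; 2]%N%fset) al be ga :
  indep K (lens (basic_C_graph hv) l) -> K al -> K be ->
  al ^+ 2 + be ^+ 2 + 2 * al * be * (1 - l12 / 2) != 0 ->
  ~ spanf K (lens (basic_C_graph hv) l) ga ->
  size (clist (basic_C_graph hv) l al be ga) = 4.
Proof.
move=> Hi Ka Kb n0 kg; have pl := lens_C hv.
have := hv; rewrite !inE !negb_or -andbA => /and3P[v0 v1 v2].
set e0 := l [fset 0; v]%N%fset in pl; set e1 := l [fset 1; v]%N%fset in pl; set e2 := l [fset 2; v]%N%fset in pl.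
have Hi' := indep_perm HK pl Hi; have [ne0 [ne1 [ne2 _]]] := Hi'.
have Hg : indep K [:: ga; e0; e1; e2].
  by split=> //; rewrite -(@span_eq _ _ (lens (basic_C_graph hv) l)) // => w; exact: perm_mem pl w.
have [ne0g _] : indep K [:: e0; ga; e1; e2].
  by apply: (indep_perm HK _ Hg); rewrite -[_ :: _]/([:: ga] ++ e0 :: [:: e1; e2]) perm_catC /= perm_cons perm_sym -[_ :: _]/([:: ga] ++ [:: e1; e2]) perm_catC.
set k3 := spanf K [:: ga; e1; e2] in ne0g.
have Hk3 : acf k3 := span_acf _ HK; have k3s := acf_subring Hk3.
have k3g : k3 ga by apply: span_mem => //; exact: mem_head.
have K3 : K `<=` k3 by exact: span_sub.
set k2 := spanf K [:: e2] in ne1; have Hk2 : acf k2 := span_acf _ HK; have k2s := acf_subring Hk2.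
have k2e : k2 e2 by apply: span_mem => //; exact: mem_head.
have K2 : K `<=` k2 by exact: span_sub.
have nS : nrm (second l12) != 0 by rewrite nrm1 ?oner_eq0 //; exact: onq_second.
have gS : gram (north F) (second l12) != 0 by rewrite gramC gram_ns.
have [q1 [q2 [q12 Hq inq]]] := two_points Hk2 (inB_sub K2 inN) (inB_sub K2 inS) k2e ne1 nS gS.
have [q1in q2in] : inB k3 q1 /\ inB k3 q2.
  apply: inq => //; last by apply: span_mem => //; rewrite !inE eqxx orbT.
  by apply: span_subseq => // w; rewrite !inE => ->; rewrite !orbT.
pose b : pt F := (be, al + be * (1 - l12 / 2), be * (1 - (1 - l12 / 2) ^+ 2)).
have inb : inB K b.
  have [i1 i2 i3] := inS; split; rewrite /b //=; last exact: (subringM Ks).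
  by apply: (subringD Ks) => //; exact: (subringM Ks).
have nb : nrm b != 0.
  rewrite /nrm /b /ptP /ptZ /ptQ /=; apply: contra_neq n0 => E; rewrite -[RHS]E; ring.
have db p : dist p b = 2 - 2 * al - 2 * be + (al * dist p (north F) + be * dist p (second l12)).
  by rewrite /dist /b /ptP /ptZ /ptQ /=; ring.
have Kn m : K m%:R by exact: (subring_nat Ks).
have Kc : K (2 - 2 * al - 2 * be).
  by apply: (subringB Ks); [apply: (subringB Ks)|] => //; exact: (subringM Ks).
have gammaK : ~ K (al * e1 + be * e2).
  move=> h; have [a0|a0] := eqVneq al 0; last first.
    apply: ne1; have -> : e1 = (al * e1 + be * e2 - be * e2) / al by field.
    apply: (acf_div Hk2); last exact: K2.
    by apply: (subringB k2s); [exact: K2|apply: (subringM k2s) => //; exact: K2].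
  have b0 : be != 0 by apply: contra_neq n0 => ->; rewrite a0; ring.
  by apply: ne2; have -> : e2 = (al * e1 + be * e2) / be; [rewrite a0; field|apply: (acf_div HK)].
(* A vanishing Gram determinant would make al e1 + be e2 algebraic over [K]. *)
have gq q : onq q /\ dist q (north F) = e1 /\ dist q (second l12) = e2 -> gram q b != 0.
  case=> qq [d1 d2]; rewrite /gram nrm1 // mul1r db d1 d2; apply/eqP => E.
  have Kh : K (1 - (2 - 2 * al - 2 * be + (al * e1 + be * e2)) / 2).
    apply: (acf_root HK (p := 'X^2 - (nrm b)%:P)).
    - apply: (povB Ks); [exact: (povXn Ks)|apply: (povC Ks)].
      by case: inb => ? ? ?; apply: (subringD Ks); [exact: (subringM Ks)|exact: (subringX Ks)].
    - by rewrite -size_poly_eq0 size_XnsubC.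
    - by apply/rootP; rewrite hornerD hornerN hornerXn hornerC -[RHS]oppr0 -E opprB.
  apply: gammaK; have -> : al * e1 + be * e2 =
    2 * (1 - (1 - (2 - 2 * al - 2 * be + (al * e1 + be * e2)) / 2)) - (2 - 2 * al - 2 * be) by field.
  apply: (subringB Ks) => //; apply: (subringM Ks) => //; apply: (subringB Ks) => //.
  exact: (Kn 1%N).
have k3b : k3 (2 - 2 * al - 2 * be + ga) by apply: (subringD k3s) => //; exact: K3.
have pq q : q = q1 \/ q = q2 -> exists p1 p2, p1 != p2 /\
    forall p, onq p /\ dist p q = e0 /\ dist p b = 2 - 2 * al - 2 * be + ga <-> p = p1 \/ p = p2.
  move=> Eq; have kq : inB k3 q by case: Eq => ->.
  have [p1 [p2 [p12 Hp _]]] := two_points Hk3 kq (inB_sub K3 inb) k3b ne0g nb (gq q ((Hq q).2 Eq)).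
  by exists p1, p2.
have [p11 [p12 [n1 H1]]] := pq q1 (or_introl erefl).
have [p21 [p22 [n2 H2]]] := pq q2 (or_intror erefl).
have cE p q : cs (conf4 l12 v p q) = dist p (north F) /\ ct (conf4 l12 v p q) = dist p (second l12).
  rewrite /cs /ct /conf4 /conf3 /= ![_ == v]eq_sym.
  by rewrite (negPf v0) (negPf v1) (negPf v2).
apply: (clist_points (precal_C hv) Hi Ka Kb kg (s := [:: conf4 l12 v p11 q1; conf4 l12 v p12 q1;
  conf4 l12 v p21 q2; conf4 l12 v p22 q2])); split.
  have ni p q p' q' : (p != p') || (q != q') -> conf4 l12 v p q != conf4 l12 v p' q'.
    by move=> h; apply/eqP => /(conf4_inj v0)[E E']; move: h; rewrite E E' !eqxx.
  have u4 (T : eqType) (w x y z : T) : w != x -> w != y -> w != z -> x != y -> x != z -> y != z ->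
      uniq [:: w; x; y; z].
    by move=> ? ? ? ? ? ?; rewrite /= !inE !negb_or andbT; do !(apply/andP; split).
  by apply: u4; apply: ni; rewrite ?n1 ?n2 ?q12 ?orbT.
move=> y; rewrite !inE; have in_cset p q : onq q /\ dist q (north F) = e1 /\ dist q (second l12) = e2 ->
    onq p /\ dist p q = e0 /\ dist p b = 2 - 2 * al - 2 * be + ga ->
    cset (basic_C_graph hv) l al be ga (conf4 l12 v p q).
  move=> [qq [d1 d2]] [pp [d0 dd]]; split; first by apply/confs_C; exists p, q.
  have [-> ->] := cE p q; move: dd; rewrite db => /addrI //.
split.
  have h1 := (Hq q1).2 (or_introl erefl); have h2 := (Hq q2).2 (or_intror erefl).
  by case/or4P=> /eqP->; apply: in_cset => //; [apply/H1; left|apply/H1; right|apply/H2; left|apply/H2; right].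
case=> /confs_C[p [q [-> [pp qq] d0 d1 d2]]]; have [-> ->] := cE p q => Eg.
have := (Hq q).1 (conj qq (conj d1 d2)).
have hp : onq p /\ dist p q = e0 /\ dist p b = 2 - 2 * al - 2 * be + ga by rewrite db Eg.
by case=> Eq; rewrite Eq in hp *; [case/H1: hp => ->|case/H2: hp => ->]; rewrite eqxx ?orbT.
Qed.
End Basic.

(** * Independence of the generic choice *)

Lemma acf_preim (F : numClosedFieldType) (G : set (F * F)) (k : set F) : piso G -> acf (dom G) ->
  acf k -> acf [set a | exists2 b, G (a, b) & k b].
Proof.
move=> HG Hd Hk; have ks := acf_subring Hk; split.
  split=> [|a b [a' Ga ka] [b' Gb kb]|a b [a' Ga ka] [b' Gb kb]].
  - by exists 1; [exact: (G1 HG)|exact: (subring1 ks)].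
  - by exists (a' - b'); [exact: (GB HG)|exact: (subringB ks)].
  - by exists (a' * b'); [exact: (GM HG)|exact: (subringM ks)].
move=> p y kp p0 py.
have [w Gy] : dom G y.
  by apply: (acf_root Hd _ p0 py) => i; have [b Gb _] := kp i; exists b.
have /choice[f Hf] : forall i, exists b, G (p`_i, b) /\ k b by move=> i; have [b] := kp i; exists b.
pose q := \poly_(i < size p) f i.
have pq : prel G p q.
  move=> i; rewrite coef_poly; case: ltnP => h; first exact: (Hf i).1.
  by rewrite nth_default //; exact: (G0 HG).
exists w => //; apply: (acf_root Hk (p := q)).
- by move=> i; rewrite coef_poly; case: ifP => _; [exact: (Hf i).2|exact: (subring0 ks)].
- apply: contra_neq p0 => q0; apply/polyP => i; rewrite coef0.
  by have [/= _ h] := HG.2 _ (pq i); apply: h; rewrite q0 coef0.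
- apply/rootP; apply: (piso_fun HG (x := 0)); last exact: (G0 HG).
  by rewrite -(rootP py); exact: prel_horner.
Qed.

(** The entries are matched one by one with [piso_transc]. The graph found there may be too large,
    so at each step it is cut down to the two closures. *)
Lemma piso_seq (F : numClosedFieldType) (K : set F) (s s' : seq F) : acf K ->
  indep K s -> indep K s' -> size s = size s' ->
  exists G, [/\ piso G, dom G = spanf K s, cod G = spanf K s', idon K `<=` G &
    forall i, (i < size s)%N -> G (s`_i, s'`_i)].
Proof.
move=> HK; elim: s s' => [|x s IH] [|x' s'] //=.
  move=> _ _ _; exists (idon K); split=> //; first by apply: piso_id; exact: acf_subring.
    by apply/seteqP; split=> a; [case=> b []|exists a].
  by apply/seteqP; split=> a; [case=> b [/= ? ->]|exists a].
move=> [nx is_] [nx' is'] [ss]; have [G [HG dG cG sub Gs]] := IH s' is_ is' ss.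
have [||||G3 [sub3 HG3 Hd3 Hc3 Gx]] := @piso_transc F G x x' HG; rewrite ?dG ?cG //; try exact: span_acf.
set k := cl (spanf K s) x; set k' := cl (spanf K s') x'.
have Hk : acf k by apply: cl_acf; exact: span_acf.
have Hk' : acf k' by apply: cl_acf; exact: span_acf.
have kx : k x by apply: cl_gen; exact: span_acf.
have kx' : k' x' by apply: cl_gen; exact: span_acf.
have dk : dom G `<=` k by rewrite dG; apply: cl_sub; exact: span_acf.
have ck : cod G `<=` k' by rewrite cG; apply: cl_sub; exact: span_acf.
have domk a : k a -> exists2 b, G3 (a, b) & k' b.
  apply: (@cl_min F _ _ [set a | exists2 b, G3 (a, b) & k' b]).
  - exact: acf_preim.
  - by move=> y; rewrite -dG => -[z Gyz]; exists z; [exact: sub3|apply: ck; exists y].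
  - by exists x'.
have codk b : k' b -> exists2 a, G3 (a, b) & k a.
  apply: (@cl_min F _ _ [set b | exists2 a, G3 (a, b) & k a]).
  - exact: (acf_preim (piso_sym HG3)).
  - by move=> y; rewrite -cG => -[z Gyz]; exists z; [exact: sub3|apply: dk; exists y].
  - by exists x.
have ks := acf_subring Hk; have ks' := acf_subring Hk'; have GG := HG3.1.
exists [set a | [/\ G3 a, k a.1 & k' a.2]]; split.
- split; last by move=> a [Ga _ _]; exact: HG3.2.
  split=> [|a b [Ga a1 a2] [Gb b1 b2]|a b [Ga a1 a2] [Gb b1 b2]].
  + by split; [exact: (subring1 GG)|exact: (subring1 ks)|exact: (subring1 ks')].
  + by split; [exact: (subringB GG)|exact: (subringB ks)|exact: (subringB ks')].
  + by split; [exact: (subringM GG)|exact: (subringM ks)|exact: (subringM ks')].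
- by apply/seteqP; split=> a; [case=> b []|move=> ka; have [b] := domk a ka; exists b].
- by apply/seteqP; split=> b; [case=> a []|move=> kb; have [a] := codk b kb; exists a].
- move=> a /sub Ga; split; first exact: sub3.
    by apply: dk; exists a.2; case: (a) Ga.
  by apply: ck; exists a.1; case: (a) Ga.
- case=> [|i] /= hi; first by split.
  have Gi := Gs i hi; split; [exact: sub3|apply: dk|apply: ck].
    by exists s'`_i.
  by exists s`_i.
Qed.

Section Generic.
Variables (F : numClosedFieldType) (K0 : set F).
Hypotheses (HK0 : acf K0) (Hbig : forall s, exists g, ~ spanf K0 s g).

Definition generic (H : graph) (l : {fset nat} -> F) (ga : F) :=
  indep K0 (ga :: [seq l e | e <- eset H]).

Lemma cl_big y s : exists g, ~ spanf (cl K0 y) s g.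
Proof. by rewrite span_cl. Qed.

Lemma eset_perm H l : [fset 1; 2]%N%fset \in eset H ->
  perm_eq [seq l e | e <- eset H] (l [fset 1; 2]%N%fset :: lens H l :> seq F).
Proof.
move=> e12; rewrite -[_ :: lens H l]/(map l ([fset 1; 2]%N%fset :: (eset H `\ [fset 1; 2]%N)%fset)).
apply: perm_map; apply: uniq_perm => [||e]; first exact: fset_uniq.
  by rewrite /= fset_uniq andbT !inE eqxx.
by rewrite !inE; case: eqVneq => [->|].
Qed.

Lemma notK0 y m : ~ K0 y -> y != m%:R.
Proof. by move=> h; apply/eqP => E; apply: h; rewrite E; apply: (subring_nat (acf_subring HK0)). Qed.

Lemma base_facts y : ~ K0 y -> [/\ acf (cl K0 y), cl K0 y y, y != 0 & y != 4].
Proof. by move=> h; split; [exact: cl_acf|exact: cl_gen|exact: (@notK0 _ 0)|exact: (@notK0 _ 4)]. Qed.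

Lemma generic_facts H l ga : precal H -> generic H l ga ->
  [/\ ~ K0 (l [fset 1; 2]%N%fset), indep (cl K0 (l [fset 1; 2]%N%fset)) (lens H l) &
      ~ spanf (cl K0 (l [fset 1; 2]%N%fset)) (lens H l) ga].
Proof.
move=> [_ e12 _] [ng gi]; have pe := eset_perm l e12.
have := indep_perm HK0 pe gi; rewrite -[_ :: _]/([:: l [fset 1; 2]%N%fset] ++ lens H l).
move/(indep_perm HK0 (permEl (perm_catC _ _))).
rewrite indep_catE // => -[[nl _] il]; split=> //; rewrite span_cl // => h; apply: ng.
by rewrite (@span_eq _ _ _ (l [fset 1; 2]%N%fset :: lens H l)) // => z; exact: perm_mem.
Qed.

(** An isomorphism over [K0] carries one generic choice to the other, and [transport] turns it into
    a bijection of configurations. *)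
Lemma clist_indep H l l' al be ga ga' : precal H -> K0 al -> K0 be ->
  generic H l ga -> generic H l' ga' -> size (clist H l al be ga) = size (clist H l' al be ga').
Proof.
move=> HH Ka Kb g1 g2; have [_ e12 _] := HH.
have [n1 i1 s1] := generic_facts HH g1; have [n2 i2 s2] := generic_facts HH g2.
have [HK1 Kl1 l10 l14] := base_facts n1; have [HK2 Kl2 l20 l24] := base_facts n2.
have [|G [HG dG cG sub Gs]] := piso_seq HK0 g1 g2; first by rewrite /= !size_map.
have Ka1 := cl_sub HK0 (l [fset 1; 2]%N%fset) Ka; have Kb1 := cl_sub HK0 (l [fset 1; 2]%N%fset) Kb.
have Ka2 := cl_sub HK0 (l' [fset 1; 2]%N%fset) Ka; have Kb2 := cl_sub HK0 (l' [fset 1; 2]%N%fset) Kb.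
have big1 := cl_big (l [fset 1; 2]%N%fset); have big2 := cl_big (l' [fset 1; 2]%N%fset).
have Gl e : e \in eset H -> G (l e, l' e).
  move=> eE; have ie : (index e (eset H) < size (eset H))%N by rewrite index_mem.
  have := Gs (index e (eset H)).+1; rewrite /= size_map ltnS => /(_ ie).
  by rewrite !(nth_map fset0) // nth_index.
have sub1 (m : {fset nat} -> F) g : spanf (cl K0 (m [fset 1; 2]%N%fset)) (g :: lens H m) `<=`
    spanf K0 (g :: [seq m e | e <- eset H]).
  rewrite span_cl //; apply: span_subseq => // z; rewrite !inE (perm_mem (eset_perm m e12)) inE.
  by rewrite orbCA.
have Ad : acf (dom G) by rewrite dG; exact: span_acf.
have Ac : acf (cod G) by rewrite cG; exact: span_acf.
have Ga : G (al, al) by exact: sub.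
have Gb : G (be, be) by exact: sub.
have in1 x : x \in clist H l al be ga -> forall v, inB (dom G) (x v).
  move=> /(clistP HK1 HH Kl1 l10 l14 i1 big1 Ka1 Kb1 s1).2 Cx v.
  by apply: inB_sub (cset_in HK1 HH Kl1 l10 l14 i1 Ka1 Kb1 s1 Cx v); rewrite dG; exact: sub1.
have in2 x : x \in clist H l' al be ga' -> forall v, inB (cod G) (x v).
  move=> /(clistP HK2 HH Kl2 l20 l24 i2 big2 Ka2 Kb2 s2).2 Cx v.
  by apply: inB_sub (cset_in HK2 HH Kl2 l20 l24 i2 Ka2 Kb2 s2 Cx v); rewrite cG; exact: sub1.
have [phi [pe _]] := transport HG HH Ad Ac Gl Ga Gb (Gs 0%N isT)
  (clistP HK1 HH Kl1 l10 l14 i1 big1 Ka1 Kb1 s1) (clistP HK2 HH Kl2 l20 l24 i2 big2 Ka2 Kb2 s2) in1 in2.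
by rewrite -(perm_size pe) size_map.
Qed.

(** The count at any generic choice of lengths and right-hand side; 0 is a default for the absence
    of a generic choice. *)
Definition cnt (H : graph) (al be : F) : nat :=
  if pselect (exists lg : ({fset nat} -> F) * F, generic H lg.1 lg.2) is left p
  then let lg := projT1 (cid p) in size (clist H lg.1 al be lg.2) else 0.

Lemma cntE H l al be ga : precal H -> K0 al -> K0 be -> generic H l ga ->
  size (clist H l al be ga) = cnt H al be.
Proof.
move=> HH Ka Kb g; rewrite /cnt; case: pselect => [p|[]]; last by exists (l, ga).
exact: clist_indep Ka Kb g (projT2 (cid p)).
Qed.
End Generic.

(** * Gluing with the calligraphs L and R *)

Section Sides.
Variables (F : numClosedFieldType) (K : set F) (H : graph) (l : {fset nat} -> F).
Let l12 := l [fset 1; 2]%N%fset.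
Hypotheses (HK : acf K) (HH : precal H) (Kl : K l12) (l0 : l12 != 0) (l4 : l12 != 4).
Hypothesis Hbig : forall s, exists g, ~ spanf K s g.
Variables (sg : F) (O : set F) (u : F).
Hypothesis Hind : indep K (lens H l ++ [:: sg]).
Hypotheses (HO : subring O) (OV : forall x, O x \/ O x^-1).
Hypotheses (kO : spanf K (lens H l ++ [:: sg]) `<=` O) (nu : ~ O u).

(** The length function for L and R: their only edge besides {1, 2} receives the new length [sg]. *)
Let l' (e : {fset nat}) := if e == [fset 1; 2]%N%fset then l12 else sg.
Let El12 : l12 = l' [fset 1; 2]%N%fset. Proof. by rewrite /l' eqxx. Qed.
Let Kl' : K (l' [fset 1; 2]%N%fset). Proof. by rewrite -El12. Qed.
Let l0' : l' [fset 1; 2]%N%fset != 0. Proof. by rewrite -El12. Qed.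
Let l4' : l' [fset 1; 2]%N%fset != 4. Proof. by rewrite -El12. Qed.
Let il : indep K (lens H l) := indep_subseq HK Hind.
Let nsg : ~ spanf K (lens H l) sg.
Proof.
have : indep K ([:: sg] ++ lens H l) by apply: (indep_perm HK _ Hind); rewrite perm_catC.
by case.
Qed.
Let Osg : O sg.
Proof. by apply: kO; apply: span_mem => //; rewrite mem_cat mem_head orbT. Qed.

Lemma side_gen (B : graph) : precal B -> perm_eq (lens B l') [:: sg] ->
  exists2 Q, lists [set p | [/\ confs H l p.1, confs B l' p.2 & p.1 0%N = p.2 0%N]] Q &
  [/\ indep K (lens B l'), ~ spanf K (lens B l') u &
  (2 * size Q + count (fun x => `[< O (cs x) >]) (clist H l 1 1 u) * count (fun x => `[< O (cs x) >]) (clist B l' 1 1 u)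
   + count (fun x => `[< O (ct x) >]) (clist H l 1 1 u) * count (fun x => `[< O (ct x) >]) (clist B l' 1 1 u)
   = size (clist H l 1 1 u) * size (clist B l' 1 1 u))%N].
Proof.
move=> HB pB; have Hi : indep K (lens H l ++ lens B l').
  by apply: (indep_perm HK _ Hind); rewrite perm_cat2l perm_sym.
have E : spanf K (lens H l ++ lens B l') = spanf K (lens H l ++ [:: sg]).
  by apply: span_eq => // z; rewrite !mem_cat (perm_mem pB).
have kO' : spanf K (lens H l ++ lens B l') `<=` O by rewrite E.
have [Q lQ EQ] := core_count HK HH HB El12 Kl l0 l4 Hi Hbig HO OV kO' nu.
exists Q => //; split=> //; first exact: (ind2 HK Hi).
by move=> /(k2_12 H l HK)/kO'.
Qed.

Lemma count_cs (B : graph) : precal B -> indep K (lens B l') -> ~ spanf K (lens B l') u ->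
  (forall x, confs B l' x -> O (cs x)) ->
  count (fun x => `[< O (cs x) >]) (clist B l' 1 1 u) = size (clist B l' 1 1 u) /\
  count (fun x => `[< O (ct x) >]) (clist B l' 1 1 u) = 0%N.
Proof.
move=> HB Hi ku h; have P := clist1P HK HB Kl' l0' l4' Hi Hbig ku.
split; first by apply/eqP; rewrite -all_count; apply/allP => x /P.2[Hx _]; apply/asboolP; exact: h.
apply/eqP; rewrite -leqn0 leqNgt -has_count; apply/negP => /hasP[x xs /asboolP Ox].
have [Hx _] := (P.2 x).1 xs; apply: nu.
have := cs_u HK HB Kl' l0' l4' Hi Hbig ku xs => /eqP; rewrite eq_sym subr_eq => /eqP ->.
by apply: (subringD HO) => //; exact: h.
Qed.

Lemma count_ct (B : graph) : precal B -> indep K (lens B l') -> ~ spanf K (lens B l') u ->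
  (forall x, confs B l' x -> O (ct x)) ->
  count (fun x => `[< O (ct x) >]) (clist B l' 1 1 u) = size (clist B l' 1 1 u) /\
  count (fun x => `[< O (cs x) >]) (clist B l' 1 1 u) = 0%N.
Proof.
move=> HB Hi ku h; have P := clist1P HK HB Kl' l0' l4' Hi Hbig ku.
split; first by apply/eqP; rewrite -all_count; apply/allP => x /P.2[Hx _]; apply/asboolP; exact: h.
apply/eqP; rewrite -leqn0 leqNgt -has_count; apply/negP => /hasP[x xs /asboolP Ox].
have [Hx _] := (P.2 x).1 xs; apply: nu.
have := cs_u HK HB Kl' l0' l4' Hi Hbig ku xs => /eqP; rewrite eq_sym subr_eq => /eqP ->.
by apply: (subringD HO) => //; exact: h.
Qed.

Let K0 : K 0 := subring0 (acf_subring HK).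

(** L has two branches, both with s = sg finite and t infinite, so a factor 2 cancels in the count
    of glued pairs; these pairs are the configurations of [H] on the line s = sg. *)
Lemma side_L : (size (clist H l 1 0 sg) + count (fun x => `[< O (cs x) >]) (clist H l 1 1 u)
  = size (clist H l 1 1 u))%N.
Proof.
have El : l' [fset 0; 1]%N%fset = sg.
  by rewrite /l' ifF //; apply/negbTE; apply: ne_fset2; rewrite !inE.
have pL : perm_eq (lens basic_L_graph l') [:: sg] by rewrite -El; exact: lens_L.
have [Q lQ [Hi ku EQ]] := side_gen precal_L pL.
have dx x : confs basic_L_graph l' x -> cs x = sg by move=> /confs_L[p [-> _ E]]; rewrite -El -E.
have [|b2 c0] := count_cs precal_L Hi ku; first by move=> x /dx ->.
have d2 := clist_L HK Kl' l0' l4' Hbig Hi (K1 HK) (K1 HK) ku; rewrite oner_eq0 in d2.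
rewrite b2 c0 d2 muln0 addn0 [(2 * _)%N]mulnC -mulnDl in EQ.
move/eqP: EQ; rewrite eqn_pmul2r // => /eqP <-; congr (_ + _)%N.
have P := clistP HK HH Kl l0 l4 il Hbig (K1 HK) K0 nsg.
rewrite -(size_map (fun x => (x, conf3 l12 (x 0%N))) (clist H l 1 0 sg)).
apply: lists_size lQ; split; first by rewrite map_inj_uniq; [case: P|move=> x y []].
move=> p; split.
  case/mapP=> x /P.2[Hx Ex] ->; split=> //=; apply/confs_L; exists (x 0%N); split.
  - by rewrite -El12.
  - by case: Hx.
  - by rewrite El -Ex mul1r mul0r addr0 /cs; case: Hx => ->.
case: p => x y [/= Hx Hy E]; apply/mapP; exists x; last first.
  by congr (_, _); case/confs_L: Hy E => p [-> _ _] ->; rewrite -El12.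
apply/P.2; split=> //; rewrite mul1r mul0r addr0 -(dx y Hy) /cs E.
by case: Hx => -> _ _ _ _; case: Hy => ->.
Qed.

Lemma side_R : (size (clist H l 0 1 sg) + count (fun x => `[< O (ct x) >]) (clist H l 1 1 u)
  = size (clist H l 1 1 u))%N.
Proof.
have El : l' [fset 0; 2]%N%fset = sg.
  by rewrite /l' ifF //; apply/negbTE; apply: ne_fset2; rewrite !inE.
have pR : perm_eq (lens basic_R_graph l') [:: sg] by rewrite -El; exact: lens_R.
have [Q lQ [Hi ku EQ]] := side_gen precal_R pR.
have dx x : confs basic_R_graph l' x -> ct x = sg by move=> /confs_R[p [-> _ E]]; rewrite -El -E.
have [|c2 b0] := count_ct precal_R Hi ku; first by move=> x /dx ->.
have d2 := clist_R HK Kl' l0' l4' Hbig Hi (K1 HK) (K1 HK) ku; rewrite oner_eq0 in d2.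
rewrite b0 c2 d2 muln0 addn0 [(2 * _)%N]mulnC -mulnDl in EQ.
move/eqP: EQ; rewrite eqn_pmul2r // => /eqP <-; congr (_ + _)%N.
have P := clistP HK HH Kl l0 l4 il Hbig K0 (K1 HK) nsg.
rewrite -(size_map (fun x => (x, conf3 l12 (x 0%N))) (clist H l 0 1 sg)).
apply: lists_size lQ; split; first by rewrite map_inj_uniq; [case: P|move=> x y []].
move=> p; split.
  case/mapP=> x /P.2[Hx Ex] ->; split=> //=; apply/confs_R; exists (x 0%N); split.
  - by rewrite -El12.
  - by case: Hx.
  - by rewrite El -Ex mul1r mul0r add0r -El12 /ct; case: Hx => _ ->.
case: p => x y [/= Hx Hy E]; apply/mapP; exists x; last first.
  by congr (_, _); case/confs_R: Hy E => p [-> _ _] ->; rewrite -El12.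
apply/P.2; split=> //; rewrite mul1r mul0r add0r -(dx y Hy) /ct E.
by case: Hx => _ -> _ _ _; case: Hy => _ ->; rewrite -El12.
Qed.
End Sides.

(** * The number of glued configurations in terms of generic counts *)

Section SplitNumber.
Variables (F : numClosedFieldType) (K0 : set F).
Hypotheses (HK0 : acf K0) (Hbig : forall s, exists g, ~ spanf K0 s g).

Lemma generic_intro H l ga : precal H -> ~ K0 (l [fset 1; 2]%N%fset) ->
  indep (cl K0 (l [fset 1; 2]%N%fset)) (lens H l) ->
  ~ spanf (cl K0 (l [fset 1; 2]%N%fset)) (lens H l) ga -> generic K0 H l ga.
Proof.
move=> [_ e12 _] ny il; rewrite span_cl // => ng.
have pe := eset_perm l e12; rewrite /generic; split.
  by rewrite (@span_eq _ _ _ (l [fset 1; 2]%N%fset :: lens H l)) // => z; exact: perm_mem.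
apply: (indep_perm HK0 (s := lens H l ++ [:: l [fset 1; 2]%N%fset])).
  by rewrite perm_catC /= perm_sym.
by rewrite indep_catE //.
Qed.

Let K00 : K0 0 := subring0 (acf_subring HK0).
Let K01 : K0 1 := subring1 (acf_subring HK0).

Lemma even_cnt H al be : precal H -> K0 al -> K0 be -> ~~ odd (cnt K0 H al be).
Proof.
move=> HH Ka Kb; rewrite /cnt; case: pselect => // p; case: (cid p) => -[l ga] /= g.
have [n1 i1 s1] := generic_facts HK0 HH g; have [HK Kl l0 l4] := base_facts HK0 n1.
apply: (even_clist HK HH Kl l0 l4 i1 (cl_big HK0 Hbig _)) => //; exact: cl_sub.
Qed.

Definition pairs H1 H2 (l1 l2 : {fset nat} -> F) : set (conf F * conf F) :=
  [set p | [/\ confs H1 l1 p.1, confs H2 l2 p.2 & p.1 0%N = p.2 0%N]].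

Lemma split_number H1 H2 (l1 l2 : {fset nat} -> F) : precal H1 -> precal H2 ->
  l1 [fset 1; 2]%N%fset = l2 [fset 1; 2]%N%fset ->
  indep K0 (l1 [fset 1; 2]%N%fset :: lens H1 l1 ++ lens H2 l2) ->
  exists b1 c1 b2 c2 : nat, exists2 Q, lists (pairs H1 H2 l1 l2) Q &
  [/\ (2 * size Q + b1 * b2 + c1 * c2 = cnt K0 H1 1 1 * cnt K0 H2 1 1)%N,
      (cnt K0 H1 1 0 + b1 = cnt K0 H1 1 1)%N, (cnt K0 H1 0 1 + c1 = cnt K0 H1 1 1)%N,
      (cnt K0 H2 1 0 + b2 = cnt K0 H2 1 1)%N & (cnt K0 H2 0 1 + c2 = cnt K0 H2 1 1)%N].
Proof.
move=> HH1 HH2 E12; set y := l1 _ => iall; pose K := cl K0 y.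
have [ny il] : ~ K0 y /\ indep K (lens H1 l1 ++ lens H2 l2).
  move: iall; rewrite -[_ :: _]/([:: y] ++ _) => /(indep_perm HK0 (permEl (perm_catC _ _))).
  by move/(indep_catE _ _ HK0) => [[? _] ?].
have [HK Ky y0 y4] := base_facts HK0 ny; have big := cl_big HK0 Hbig y; rewrite -/K in HK Ky big.
set S := lens H1 l1 ++ lens H2 l2 in il *.
(* [sg] is a length independent of all the others, for the gluings with L and R; [u] is infinite at
   a place that is trivial on the closure of all of them. *)
have [sg nsg] := big S; have [u nu] := big (sg :: S).
have nuV : ~ spanf K (sg :: S) u^-1.
  by move=> h; apply: nu; rewrite -[u]invrK; apply: acf_inv => //; exact: span_acf.
have [O [HO kO _ Ow' OV]] := place_exists (span_acf (sg :: S) HK) nuV; rewrite invrK in Ow'.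
have iS : indep K (sg :: S) by [].
have sub (T : seq F) : {subset T <= sg :: S} -> spanf K T `<=` O.
  by move=> h; apply: subset_trans kO; exact: span_subseq.
have i1 : indep K (lens H1 l1 ++ [:: sg]).
  apply: (indep_perm HK (s := sg :: lens H1 l1)); first by rewrite -cat1s perm_catC.
  by apply: (@indep_subseq _ _ _ (lens H2 l2)).
have i2 : indep K (lens H2 l2 ++ [:: sg]).
  apply: (indep_perm HK (s := sg :: lens H2 l2)); first by rewrite -cat1s perm_catC.
  apply: (@indep_subseq _ _ _ (lens H1 l1)) => //; apply: (indep_perm HK _ iS).
  by rewrite /= perm_cons perm_catC.
have s1 : {subset lens H1 l1 ++ [:: sg] <= sg :: S}.
  by move=> z; rewrite !(inE, mem_cat) => /orP[->|->]; rewrite ?orbT.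
have s2 : {subset lens H2 l2 ++ [:: sg] <= sg :: S}.
  by move=> z; rewrite !(inE, mem_cat) => /orP[->|->]; rewrite ?orbT.
have Ky2 : K (l2 [fset 1; 2]%N%fset) by rewrite -E12.
have y02 : l2 [fset 1; 2]%N%fset != 0 by rewrite -E12.
have y42 : l2 [fset 1; 2]%N%fset != 4 by rewrite -E12.
have kOS : spanf K S `<=` O by apply: sub => z; rewrite inE => ->; rewrite orbT.
have [Q lQ EQ] := core_count HK HH1 HH2 E12 Ky y0 y4 il big HO OV kOS Ow'.
have L1 := side_L HK HH1 Ky y0 y4 big i1 HO OV (sub _ s1) Ow'.
have R1 := side_R HK HH1 Ky y0 y4 big i1 HO OV (sub _ s1) Ow'.
have L2 := side_L HK HH2 Ky2 y02 y42 big i2 HO OV (sub _ s2) Ow'.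
have R2 := side_R HK HH2 Ky2 y02 y42 big i2 HO OV (sub _ s2) Ow'.
have gen1 g : ~ spanf K S g -> generic K0 H1 l1 g.
  move=> ng; apply: generic_intro => //; first exact: indep_subseq il.
  by move=> h; apply: ng; apply: span_subseq h => // z; rewrite mem_cat => ->.
have gen2 g : ~ spanf K S g -> generic K0 H2 l2 g.
  move=> ng; apply: generic_intro => //; rewrite -E12 //.
    by move: il; rewrite indep_catE // => -[].
  by move=> h; apply: ng; apply: span_subseq h => // z; rewrite mem_cat => ->; rewrite orbT.
have nuS : ~ spanf K S u.
  by move=> h; apply: nu; apply: span_subseq h => // z; rewrite inE => ->; rewrite orbT.
rewrite !(cntE HK0 Hbig HH1 K01 K01 (gen1 _ nuS), cntE HK0 Hbig HH2 K01 K01 (gen2 _ nuS)) in EQ L1 L2 R1 R2.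
rewrite (cntE HK0 Hbig HH1 K01 K00 (gen1 _ nsg)) in L1; rewrite (cntE HK0 Hbig HH1 K00 K01 (gen1 _ nsg)) in R1.
rewrite (cntE HK0 Hbig HH2 K01 K00 (gen2 _ nsg)) in L2; rewrite (cntE HK0 Hbig HH2 K00 K01 (gen2 _ nsg)) in R2.
by do 4!eexists; exists Q; [exact: lQ|split; [exact: EQ|exact: L1|exact: R1|exact: L2|exact: R2]].
Qed.
End SplitNumber.

(** * Existence of generic lengths *)

Section Enumerable.

Definition enumb (T : Type) (A : set T) := exists f : nat -> T, A `<=` range f.

(** Each element of [B] is computed from a finite list over [A] and an index, and such pairs are
    enumerated by [pickle]. *)
Lemma enumb_lift (T : eqType) (U : Type) (A : set T) (B : set U) (g : seq T -> nat -> U) : enumb A ->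
  (forall y, B y -> exists s i, (forall t, t \in s -> A t) /\ y = g s i) -> enumb B.
Proof.
move=> [f fA] h.
exists (fun n => if (choice.unpickle n : option (seq nat * nat)) is Some si then g (map f si.1) si.2 else g [::] 0%N).
move=> y /h[s [i [sA ->]]].
have [s' Es] : exists s', map f s' = s.
  elim: s sA => [|t s IH] sA; first by exists [::].
  have [|s' Es] := IH; first by move=> z zs; apply: sA; rewrite inE zs orbT.
  by have [n _ En] := fA t (sA t (mem_head _ _)); exists (n :: s'); rewrite /= Es En.
by exists (choice.pickle (s', i)) => //; rewrite choice.pickleK /= Es.
Qed.

Variable F : numClosedFieldType.

Lemma pov_seq (S : set F) (p : {poly F}) t : pov S p -> t \in (p : seq F) -> S t.
Proof. by move=> Sp tp; rewrite -(nth_index 0 tp); exact: Sp. Qed.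

Lemma enumb_alg (S : set F) : enumb S -> enumb (alg S).
Proof.
have /choice[rt Hrt] : forall p : {poly F}, exists r : seq F, p = lead_coef p *: \prod_(z <- r) ('X - z%:P).
  by move=> p; have [r E] := closed_field_poly_normal p; exists r.
move=> hS; apply: (enumb_lift (g := fun s i => (rt (Poly s))`_i) hS) => y [p [Sp p0 py]].
exists (p : seq F), (index y (rt p)); split=> [t|]; first exact: pov_seq.
rewrite polyseqK nth_index //; move: py; rewrite {1}(Hrt p) rootZ ?lead_coef_eq0 //.
by rewrite root_prod_XsubC.
Qed.

Lemma enumb_cl (K : set F) x : enumb K -> enumb (cl K x).
Proof.
move=> hK; apply: enumb_alg; apply: (enumb_lift (g := fun s _ => (Poly s).[x]) hK) => _ [p Kp <-].
by exists (p : seq F), 0%N; rewrite polyseqK; split=> // t; exact: pov_seq.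
Qed.

Lemma enumb_span (K : set F) s : enumb K -> enumb (spanf K s).
Proof. by move=> hK; elim: s => //= x s; exact: enumb_cl. Qed.

Definition intset : set F := [set x | exists m n : nat, x = m%:R - n%:R].

Lemma intset_subring : subring intset.
Proof.
split=> [|_ _ [m [n ->]] [p [q ->]]|_ _ [m [n ->]] [p [q ->]]].
- by exists 1%N, 0%N; rewrite subr0.
- by exists (m + q)%N, (n + p)%N; rewrite !natrD; ring.
- by exists (m * p + n * q)%N, (m * q + n * p)%N; rewrite !(natrD, natrM); ring.
Qed.

Lemma enumb_intset : enumb intset.
Proof.
exists (fun k => if (choice.unpickle k : option (nat * nat)) is Some mn then mn.1%:R - mn.2%:R else 0).
by move=> _ [m [n ->]]; exists (choice.pickle (m, n)) => //; rewrite choice.pickleK.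
Qed.

(** The field of algebraic numbers inside [F]. *)
Lemma countable_acf : exists2 K0 : set F, acf K0 & enumb K0.
Proof. by exists (alg intset); [exact: alg_acf intset_subring|exact: enumb_alg enumb_intset]. Qed.
End Enumerable.

(* Nested intervals, the n-th one avoiding f n. *)
Lemma real_not_enumb (R : realType) : ~ enumb [set: R].
Proof.
move=> [f fR].
pose step (n : nat) (ab : R * R) : R * R := let: (a, b) := ab in
  if f n < a + (b - a) * 2 / 3 then (a + (b - a) * 2 / 3, b) else (a, a + (b - a) / 3).
pose I := fix I n := if n is n'.+1 then step n' (I n') else (0, 1) : R * R.
have stepP n a b : a < b -> let ab := step n (a, b) in
    [/\ a <= ab.1, ab.1 < ab.2, ab.2 <= b & f n < ab.1 \/ ab.2 < f n].
  move=> ab; rewrite /step; have d0 : 0 < b - a by rewrite subr_gt0.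
  have t0 : 0 < (b - a) / 3 by rewrite divr_gt0.
  have E1 : a + (b - a) * 2 / 3 = a + (b - a) / 3 + (b - a) / 3 by field.
  have E2 : b = a + (b - a) / 3 + (b - a) / 3 + (b - a) / 3 by field.
  rewrite E1; case: ltP => h /=; split => //; rewrite ?[leRHS]E2 ?[ltRHS]E2.
  - by rewrite -addrA lerDl addr_ge0 // ltW.
  - by rewrite ltrDl.
  - by left.
  - by rewrite ltrDl.
  - by rewrite -addrA lerDl addr_ge0 // ltW.
  - by right; apply: lt_le_trans h; rewrite ltrDl.
have Iab n : (I n).1 < (I n).2.
  elim: n => [|n IH] /=; first exact: ltr01.
  by case E : (I n) IH => [a b] /= IH; have [] := stepP n a b IH.
have Istep n : [/\ (I n).1 <= (I n.+1).1, (I n.+1).2 <= (I n).2 & f n < (I n.+1).1 \/ (I n.+1).2 < f n].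
  by have := Iab n; rewrite /=; case: (I n) => a b /= ab; have [] := stepP n a b ab.
have mono n m : (n <= m)%N -> (I n).1 <= (I m).1 /\ (I m).2 <= (I n).2.
  move=> /subnK <-; elim: (m - n)%N => // k [h1 h2]; rewrite addSn.
  by have [g1 g2 _] := Istep (k + n)%N; split; [exact: le_trans g1|exact: le_trans h2].
have cross n m : (I n).1 <= (I m).2.
  case/orP: (leq_total n m) => /mono[h1 h2].
    by apply: le_trans h1 _; exact: ltW.
  by apply: le_trans h2; exact: ltW.
pose E := [set (I n).1 | n in [set: nat]].
have ubE n : ubound E (I n).2 by move=> _ [m _ <-].
have hE : has_ubound E by exists (I 0%N).2.
have E0 : E !=set0 by exists (I 0%N).1, 0%N.
have [n _ fn] := fR (sup E) Logic.I.
have [_ _] := Istep n; rewrite fn; case; apply/negP; rewrite -leNgt.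
  by apply: ub_le_sup => //; exists n.+1.
by apply: ge_sup.
Qed.

(** * Polynomials at algebraically independent points *)

Section Monomials.
Variable F : numClosedFieldType.

Fixpoint mon (s : seq F) (m : seq nat) : F :=
  if s is x :: s' then x ^+ head 0%N m * mon s' (behead m) else 1.

Lemma mon_span (K : set F) s m : acf K -> spanf K s (mon s m).
Proof.
move=> HK; elim: s m => [|x s IH] m /=; first exact: (subring1 (acf_subring HK)).
have Hs := span_acf s HK; apply: (subringM (acf_subring (cl_acf Hs x))).
  by apply: (subringX (acf_subring (cl_acf Hs x))); exact: cl_gen.
by apply: cl_sub.
Qed.

(** Collected by powers of the first entry, the sum is a polynomial over the closure of the others,
    so each of its coefficients vanishes and the induction continues with shorter exponent lists. *)
Lemma mon_indep (K : set F) s (ms : seq (seq nat)) (c : seq nat -> F) : acf K -> indep K s ->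
  uniq ms -> (forall m, m \in ms -> size m = size s) -> (forall m, K (c m)) ->
  \sum_(m <- ms) c m * mon s m = 0 -> forall m, m \in ms -> c m = 0.
Proof.
move=> HK; elim: s ms c => [|x s IH] ms c.
  move=> _ ums sz Kc; case: ms ums sz => [|m0 [|m1 ms]] // ums sz.
    by rewrite big_seq1 mulr1 => h m; rewrite inE => /eqP ->.
  have e0 : m0 = [::] by apply: size0nil; apply: sz; exact: mem_head.
  have e1 : m1 = [::] by apply: size0nil; apply: sz; rewrite !inE eqxx orbT.
  by case/andP: ums; rewrite e0 e1 inE eqxx.
move=> [nx is_] ums sz Kc S0 m mms; have Hs := span_acf s HK; have Ss := acf_subring Hs.
pose q : {poly F} := \sum_(m <- ms) (c m * mon s (behead m)) *: 'X^(head 0%N m).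
have q0 : q = 0.
  apply: (acf_horner0 Hs nx).
    apply: (subring_sum (pov_subring Ss)) => m' _; apply: (povZ Ss); last exact: (povXn Ss).
    by apply: (subringM Ss); [exact: span_sub|exact: mon_span].
  rewrite -[RHS]S0 horner_sum; apply: eq_bigr => m' _; rewrite hornerZ hornerXn /=.
  by rewrite mulrAC mulrA.
pose e := head 0%N m; have em : e :: behead m = m.
  by have := sz m mms; rewrite /e; case: (m).
have := congr1 (fun p : {poly F} => p`_e) q0; rewrite coef_sum coef0.
under eq_bigr do rewrite coefZ coefXn.
move=> Se; rewrite -em; apply: (IH [seq behead m' | m' <- ms & head 0%N m' == e] (fun m' => c (e :: m'))) => //.
- rewrite map_inj_in_uniq ?filter_uniq // => m1 m2; rewrite !mem_filter.
  move=> /andP[/eqP h1 /sz s1] /andP[/eqP h2 /sz s2] E.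
  by move: s1 s2 h1 h2 E; case: (m1) (m2) => [|a1 t1] [|a2 t2] //= _ _ -> -> ->.
- by move=> m'' /mapP[m']; rewrite mem_filter => /andP[_ /sz h] ->; rewrite size_behead h.
- rewrite big_map big_filter -[RHS]Se [LHS]big_mkcond; apply: eq_big_seq => m' /sz.
  case: m' => //= a t _; rewrite eq_sym; case: eqP => [->|_]; last by rewrite mulr0.
  by rewrite mulr1.
- by apply/mapP; exists m => //; rewrite mem_filter eqxx.
Qed.

Lemma meval_indep n (p : {mpoly F[n]}) (K : set F) (v : 'I_n -> F) : acf K -> p != 0 ->
  (forall m, K p@_m) -> indep K [seq v i | i <- enum 'I_n] -> p.@[v] != 0.
Proof.
move=> HK p0 Kp Hi; apply: contra_neq p0 => pv; apply/mpolyP => m; rewrite mcoeff0.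
have [ms|] := boolP (m \in msupp p); last by move=> /memN_msupp_eq0.
pose ex (m : 'X_{1..n}) : seq nat := [seq m i | i <- enum 'I_n].
have exI : injective ex.
  move=> m1 m2 E; apply/mnmP => i.
  have /eq_in_map h : ex m1 = ex m2 := E.
  by apply: h; rewrite mem_enum.
have monE m' : mon [seq v i | i <- enum 'I_n] (ex m') = \prod_i v i ^+ m' i.
  by rewrite -big_enum /= /ex; elim: (enum 'I_n) => [|i s IH]; rewrite ?big_nil ?big_cons //= IH.
pose c (s : seq nat) := if [pick m' : 'X_{1..n < msize p} | ex m' == s] is Some m' then p@_m' else 0.
have cE m' : m' \in msupp p -> c (ex m') = p@_m'.
  move=> /msize_mdeg_lt h; rewrite /c; case: pickP => [m'' /eqP/exI -> //|/(_ (BMultinom h))].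
  by rewrite eqxx.
rewrite -(cE m ms); apply: (mon_indep HK Hi (ms := map ex (msupp p))).
- by rewrite map_inj_uniq ?msupp_uniq.
- by move=> _ /mapP[m' _ ->]; rewrite !size_map.
- by move=> s; rewrite /c; case: pickP => // _; exact: (subring0 (acf_subring HK)).
- rewrite big_map -[RHS]pv mevalE; apply: eq_big_seq => m' h.
  by rewrite cE // monE.
- exact: map_f.
Qed.
End Monomials.

(** * Realizations up to rotations *)

Section Spherical.
Variable R : realType.
Local Notation C := (R[i]).
Local Notation "'j0" := (ord0 : 'I_3).
Local Notation "'j1" := (lift ord0 ord0 : 'I_3).
Local Notation "'j2" := (lift ord0 (lift ord0 ord0) : 'I_3).
Implicit Types (u v w : 'cV[C]_3) (A M : 'M[C]_3).

Lemma bilinE u v : bilin u v = u 'j0 0 * v 'j0 0 + u 'j1 0 * v 'j1 0 + u 'j2 0 * v 'j2 0.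
Proof. by rewrite /bilin !big_ord_recl big_ord0 addr0 addrA. Qed.

Lemma bilin_mx u v : bilin u v = (u^T *m v) 0 0.
Proof. by rewrite mxE; apply: eq_bigr => k _; rewrite mxE. Qed.

Lemma bilin_SO3 A u v : SO3 A -> bilin (A *m u) (A *m v) = bilin u v.
Proof. by move=> [AA _]; rewrite !bilin_mx trmx_mul -mulmxA (mulmxA A^T) AA mul1mx. Qed.

Lemma cV3P u v : u 'j0 0 = v 'j0 0 -> u 'j1 0 = v 'j1 0 -> u 'j2 0 = v 'j2 0 -> u = v.
Proof.
move=> h0 h1 h2; apply/colP => -[[|[|[|//]]] hk].
- by have -> : Ordinal hk = 'j0 by apply: val_inj.
- by have -> : Ordinal hk = 'j1 by apply: val_inj.
- by have -> : Ordinal hk = 'j2 by apply: val_inj.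
Qed.

Definition cross u v : 'cV[C]_3 := \col_k (nth 0 [:: u 'j1 0 * v 'j2 0 - u 'j2 0 * v 'j1 0;
  u 'j2 0 * v 'j0 0 - u 'j0 0 * v 'j2 0; u 'j0 0 * v 'j1 0 - u 'j1 0 * v 'j0 0] k).

Definition fr u v w : 'M[C]_3 := \matrix_(i, k) (nth 0 [:: u i 0; v i 0; w i 0] k).

Lemma mul_fr A u v w : A *m fr u v w = fr (A *m u) (A *m v) (A *m w).
Proof.
apply/matrixP => i [[|[|[|//]]] hk]; rewrite !mxE /=; apply: eq_bigr => k _; by rewrite mxE.
Qed.

Lemma fr_inj u v w u' v' w' : fr u v w = fr u' v' w' -> [/\ u = u', v = v' & w = w'].
Proof.
move=> /matrixP E; split; apply/colP => i.
- by have := E i 'j0; rewrite !mxE.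
- by have := E i 'j1; rewrite !mxE.
- by have := E i 'j2; rewrite !mxE.
Qed.

Lemma tr_fr u v w x : (fr u v w)^T *m x = \col_k (nth 0 [:: bilin u x; bilin v x; bilin w x] k).
Proof.
apply/colP => -[[|[|[|//]]] hk]; rewrite !mxE /=; apply: eq_bigr => k _; by rewrite !mxE.
Qed.

Lemma det_fr u v w : \det (fr u v w) = bilin (cross u v) w.
Proof.
rewrite (expand_det_row _ ord0) !big_ord_recl big_ord0 /cofactor.
rewrite !(expand_det_row _ ord0) !big_ord_recl !big_ord0 /cofactor !det_mx11.
rewrite bilinE /cross !mxE /=; ring.
Qed.

Lemma cross_bilin u v : bilin (cross u v) u = 0 /\ bilin (cross u v) v = 0.
Proof. by split; rewrite bilinE /cross !mxE /=; ring. Qed.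

Lemma cross_norm u v : bilin (cross u v) (cross u v) = bilin u u * bilin v v - bilin u v ^+ 2.
Proof. by rewrite !bilinE /cross !mxE /=; ring. Qed.

Lemma bilinC u v : bilin u v = bilin v u.
Proof. by rewrite !bilinE; ring. Qed.

Lemma fr_unit u v : bilin u u * bilin v v - bilin u v ^+ 2 != 0 -> fr u v (cross u v) \in unitmx.
Proof. by move=> h; rewrite unitmxE unitfE det_fr cross_norm. Qed.

Lemma gram_fr u v : (fr u v (cross u v))^T *m fr u v (cross u v) =
  fr (\col_k (nth 0 [:: bilin u u; bilin u v; 0] k)) (\col_k (nth 0 [:: bilin u v; bilin v v; 0] k))
     (\col_k (nth 0 [:: 0; 0; bilin u u * bilin v v - bilin u v ^+ 2] k)).
Proof.
have [c1 c2] := cross_bilin u v.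
rewrite mul_fr !tr_fr c1 c2 (bilinC u (cross u v)) (bilinC v (cross u v)) c1 c2 cross_norm.
by rewrite (bilinC v u).
Qed.

(** The matrix that carries the frame of a, b and their cross product to that of n and s is
    orthogonal because the Gram matrices agree. Its determinant is 1 because the determinant of such
    a frame is the norm of the cross product, equal on both sides. *)
Lemma frame_move a b n s : bilin a a = bilin n n -> bilin b b = bilin s s -> bilin a b = bilin n s ->
  bilin n n * bilin s s - bilin n s ^+ 2 != 0 -> exists A, [/\ SO3 A, A *m a = n & A *m b = s].
Proof.
move=> Eaa Ebb Eab g0; pose M := fr a b (cross a b); pose N := fr n s (cross n s).
have MU : M \in unitmx by apply: fr_unit; rewrite Eaa Ebb Eab.
have E : M^T *m M = N^T *m N by rewrite !gram_fr Eaa Ebb Eab.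
have [A AM] : exists A, A *m M = N by exists (N *m invmx M); rewrite mulmxKV.
have AA : A^T *m A = 1%:M.
  apply: (can_inj (mulmxK MU)); apply: (can_inj (mulKmx (_ : M^T \in unitmx))).
    by rewrite unitmx_tr.
  by rewrite mul1mx -!mulmxA AM mulmxA -trmx_mul AM.
have dA : \det A = 1.
  have dM : \det M != 0 by rewrite -unitfE -unitmxE.
  apply: (mulIf dM); rewrite -det_mulmx AM mul1r !det_fr !cross_norm.
  by rewrite Eaa Ebb Eab.
exists A; split; [by split| |].
- by have := AM; rewrite mul_fr => /fr_inj[].
- by have := AM; rewrite mul_fr => /fr_inj[].
Qed.

(** A rotation preserves products and determinants, so it also fixes the cross product of n and s
    and thus a basis. *)
Lemma frame_uniq A n s : SO3 A -> bilin n n * bilin s s - bilin n s ^+ 2 != 0 ->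
  A *m n = n -> A *m s = s -> A = 1%:M.
Proof.
move=> SA g0 An As; have NU := fr_unit g0; set N := fr n s (cross n s) in NU.
suff Ec : A *m cross n s = cross n s.
  by apply: (can_inj (mulmxK NU)); rewrite mul1mx mul_fr An As Ec.
have [c1 c2] := cross_bilin n s; have NtU : N^T \in unitmx by rewrite unitmx_tr.
apply: (can_inj (mulKmx NtU)); rewrite !tr_fr.
have -> : bilin n (A *m cross n s) = bilin n (cross n s) by rewrite -{1}An bilin_SO3.
have -> : bilin s (A *m cross n s) = bilin s (cross n s) by rewrite -{1}As bilin_SO3.
have -> // : bilin (cross n s) (A *m cross n s) = bilin (cross n s) (cross n s).
by rewrite -!det_fr -{1}An -{1}As -mul_fr det_mulmx SA.2 mul1r.
Qed.

Definition vec (p : pt C) : 'cV[C]_3 := \col_k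
  (nth 0 [:: (ptP p + ptQ p) / 2; (ptP p - ptQ p) / (2 * 'i); ptZ p] k).
Definition unvec u : pt C := (u 'j0 0 + 'i * u 'j1 0, u 'j2 0, u 'j0 0 - 'i * u 'j1 0).

Lemma two_i_neq0 : (2 * 'i : C) != 0.
Proof. by rewrite mulf_neq0 ?pnatr_eq0 // neq0Ci. Qed.

Lemma unvecK : cancel unvec vec.
Proof.
move=> u; have i0 : ('i : C) != 0 := neq0Ci _.
by apply: cV3P; rewrite /vec /unvec !mxE /ptP /ptZ /ptQ /=; field.
Qed.

Lemma vec_inj : injective vec.
Proof.
move=> [[a b] c] [[a' b'] c'] E; have i0 := two_i_neq0.
have := congr1 (fun u : 'cV[C]_3 => u 'j0 0) E; have := congr1 (fun u : 'cV[C]_3 => u 'j1 0) E.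
have := congr1 (fun u : 'cV[C]_3 => u 'j2 0) E; rewrite /vec !mxE /ptP /ptZ /ptQ /= => -> h1 h0.
have t0 : (2 : C) != 0 by rewrite pnatr_eq0.
have d1 := divIf i0 h1; have d0 := divIf t0 h0.
have Ea : a = a'.
  apply: (mulfI t0); transitivity ((a + c) + (a - c)); first by ring.
  by rewrite d0 d1; ring.
by move: d0; rewrite Ea => /addrI ->.
Qed.

Lemma bilin_vec p q : bilin (vec p) (vec q) = ptZ p * ptZ q + (ptP p * ptQ q + ptQ p * ptP q) / 2.
Proof.
have i0 : ('i : C) != 0 := neq0Ci _.
rewrite bilinE /vec !mxE /=; have i2 : 'i * 'i = -1 :> C by rewrite -expr2 sqrCi.
have -> : (ptP p - ptQ p) / (2 * 'i) * ((ptP q - ptQ q) / (2 * 'i)) =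
    (ptP p - ptQ p) * (ptP q - ptQ q) / (4 * ('i * 'i)) by field.
by rewrite i2; field.
Qed.

Lemma onq_vec p : onq p <-> on_sphere (vec p).
Proof.
rewrite /onq /on_sphere bilin_vec.
have -> : ptZ p * ptZ p + (ptP p * ptQ p + ptQ p * ptP p) / 2 = ptP p * ptQ p + ptZ p ^+ 2 by field.
by [].
Qed.

Lemma bilin_sub u v : bilin (u - v) (u - v) = bilin u u + bilin v v - 2 * bilin u v.
Proof. by rewrite !bilinE !mxE; ring. Qed.

Lemma dist_vec p q : onq p -> onq q -> bilin (vec p - vec q) (vec p - vec q) = dist p q.
Proof.
by move=> /onq_vec hp /onq_vec hq; rewrite bilin_sub hp hq bilin_vec /dist; field.
Qed.
End Spherical.

Section Classes.
Variables (R : realType) (G : graph) (lam : edge_lengths R G).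
Local Notation C := (R[i]).
Hypothesis HG : framed G.
Let e12 : [fset 1; 2]%N%fset \in eset G := HG.2.
Let lamC (e : {fset nat}) : C := if (insub e : option (eset G)) is Some e' then (lam e')%:C%C else 0.
Let l12 := lamC [fset 1; 2]%N%fset.
Hypotheses (l0 : l12 != 0) (l4 : l12 != 4).

Definition place_of (x : conf C) : placement R G := [ffun v => vec (x (val v))].

Lemma lamCE (e : eset G) : lamC (val e) = (lam e)%:C%C.
Proof. by rewrite /lamC valK. Qed.

Lemma realizationsP (rho : placement R G) : realizations lam rho <-> (forall v, on_sphere (rho v)) /\
  forall u v : vset G, [fset val u; val v]%fset \in eset G ->
    bilin (rho u - rho v) (rho u - rho v) = lamC [fset val u; val v]%fset.
Proof.
split=> -[h1 h2]; split=> // u v.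
  by move=> uv; rewrite (h2 u v [` uv]%fset) // -lamCE.
by move=> e E; rewrite -lamCE E; apply: h2; rewrite -E; exact: (valP e).
Qed.

Lemma place_real x : confs G lamC x -> realizations lam (place_of x).
Proof.
move=> [x1 x2 xn xq xe]; apply/realizationsP; split=> [v|u v uv]; rewrite !ffunE.
  by apply/onq_vec; exact: xq.
by rewrite dist_vec; [exact: xe|exact: xq|exact: xq].
Qed.

Lemma mem1 : 1%N \in vset G. Proof. by apply: (fsubsetP HG.1); rewrite !inE. Qed.
Lemma mem2 : 2%N \in vset G. Proof. by apply: (fsubsetP HG.1); rewrite !inE. Qed.

Let n := vec (north C).
Let s := vec (second l12).

Lemma frame_gram : [/\ bilin n n = 1, bilin s s = 1, bilin n s = 1 - l12 / 2 &
  bilin n n * bilin s s - bilin n s ^+ 2 != 0].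
Proof.
have hn : bilin n n = 1 by apply/onq_vec; exact: onq_north.
have hs : bilin s s = 1 by apply/onq_vec; exact: onq_second.
have hns : bilin n s = 1 - l12 / 2 by rewrite bilin_vec /ptP /ptZ /ptQ /=; field.
split=> //; rewrite hn hs hns; have -> : 1 * 1 - (1 - l12 / 2) ^+ 2 = l12 * (4 - l12) / 4 by field.
by rewrite !mulf_neq0 ?invr_eq0 ?pnatr_eq0 // subr_eq0 eq_sym.
Qed.

Lemma SO3_mul (A B : 'M[C]_3) : SO3 A -> SO3 B -> SO3 (A *m B).
Proof.
move=> [AA dA] [BB dB]; split; last by rewrite det_mulmx dA dB mulr1.
by rewrite trmx_mul -mulmxA (mulmxA A^T) AA mul1mx BB.
Qed.

Lemma SO3_inv (A : 'M[C]_3) : SO3 A -> SO3 A^T /\ A *m A^T = 1%:M.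
Proof.
move=> [AA dA]; have h : A *m A^T = 1%:M by exact: mulmx1C.
by split=> //; split; [rewrite trmxK|rewrite det_tr].
Qed.

Lemma orbit_eq (rho rho' : placement R G) (A : 'M[C]_3) : SO3 A -> (forall v, rho' v = A *m rho v) ->
  rotation_orbit rho = rotation_orbit rho'.
Proof.
move=> SA E; have [SA' AA] := SO3_inv SA; apply/seteqP; split=> r [B SB rB].
  exists (B *m A^T); first exact: SO3_mul.
  by move=> v; rewrite E -mulmxA (mulmxA A^T) SA.1 mul1mx.
by exists (B *m A); [exact: SO3_mul|move=> v; rewrite rB E mulmxA].
Qed.

(** A rotation between two configurations in normal position fixes the points of vertices 1 and 2,
    hence is the identity by [frame_uniq]. *)
Lemma place_inj x y : confs G lamC x -> confs G lamC y ->
  rotation_orbit (place_of x) = rotation_orbit (place_of y) -> x = y.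
Proof.
move=> [x1 x2 xn _ _] [y1 y2 yn _ _] E.
have : rotation_orbit (place_of y) (place_of y).
  by exists 1%:M; [split; rewrite ?trmx1 ?mul1mx ?det1|move=> v; rewrite mul1mx].
rewrite -E => -[A SA HA]; have [_ _ _ g0] := frame_gram.
have A1 : A = 1%:M.
  apply: (frame_uniq SA g0).
    by have := HA [` mem1]%fset; rewrite !ffunE /= x1 y1.
  by have := HA [` mem2]%fset; rewrite !ffunE /= x2 y2.
apply/funext => v; have [vV|vV] := boolP (v \in vset G); last by rewrite xn // yn.
by have := HA [` vV]%fset; rewrite !ffunE A1 mul1mx /= => /vec_inj.
Qed.

Lemma place_orbit rho : realizations lam rho -> exists2 x, confs G lamC x &
  rotation_orbit rho = rotation_orbit (place_of x).
Proof.
move=> /realizationsP[hs he]; have [gn gs gns g0] := frame_gram.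
pose v1 : vset G := [` mem1]%fset; pose v2 : vset G := [` mem2]%fset.
have [A [SA A1 A2]] : exists A, [/\ SO3 A, A *m rho v1 = n & A *m rho v2 = s].
  apply: frame_move => //; rewrite ?gn ?gs ?gns; [exact: hs|exact: hs|].
  by have := he v1 v2 e12; rewrite bilin_sub (hs v1) (hs v2) -/l12 => <-; field.
pose x : conf C := fun v => if (insub v : option (vset G)) is Some v' then unvec (A *m rho v') else north C.
have xE (v : vset G) : x (val v) = unvec (A *m rho v) by rewrite /x valK.
have xq v : onq (x v).
  rewrite /x; case: insubP => [v' _ _|_]; last exact: onq_north.
  by apply/onq_vec; rewrite unvecK /on_sphere bilin_SO3 //; exact: hs.
exists x.
  split=> //.
  - by rewrite (xE v1) A1; apply: vec_inj; rewrite unvecK.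
  - by rewrite (xE v2) A2; apply: vec_inj; rewrite unvecK.
  - by move=> v vV; rewrite /x insubF //; apply/negbTE.
  - move=> u v uv; have [sub _] := edgeP uv.
    have uV : u \in vset G by apply: (fsubsetP sub); rewrite !inE eqxx.
    have vV : v \in vset G by apply: (fsubsetP sub); rewrite !inE eqxx orbT.
    rewrite -dist_vec // (xE [` uV]%fset) (xE [` vV]%fset) !unvecK -mulmxBr bilin_SO3 //.
    exact: (he [` uV]%fset [` vV]%fset).
by apply: (orbit_eq SA) => v; rewrite ffunE xE unvecK.
Qed.

Lemma classes_card (xs : seq (conf C)) : lists (confs G lamC) xs ->
  (realization_classes lam #= `I_(size xs))%card.
Proof.
move=> [us ms].
have -> : realization_classes lam = (fun x => rotation_orbit (place_of x)) @` [set` xs].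
  apply/seteqP; split=> [_ [rho hr <-]|_ [x /ms cx <-]].
    by have [x cx E] := place_orbit hr; exists x => //; exact/ms.
  by exists (place_of x) => //; exact: place_real.
apply: card_eq_trans (inj_card_eq _) _.
  by move=> x y /set_mem/ms cx /set_mem/ms cy; exact: place_inj.
apply/card_set_bijP; exists (fun x => index x xs); split.
- by move=> x /= xs_x; rewrite /mkset index_mem.
- move=> x y /set_mem hx /set_mem hy E.
  by rewrite -(nth_index x (hx : x \in xs)) E nth_index.
- move=> i /= hi; exists (nth (fun=> north C) xs i); first by rewrite /= mem_nth.
  by rewrite index_uniq.
Qed.
End Classes.

(** * Splits *)

Section Gluing.
Variables (F : numClosedFieldType) (G G1 G2 : graph) (l : {fset nat} -> F).
Hypotheses (HG1 : precal G1) (HG2 : precal G2) (HS : is_split G G1 G2).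

Definition glue (p : conf F * conf F) : conf F := fun v => if v \in vset G1 then p.1 v else p.2 v.
Definition restr (V : {fset nat}) (x : conf F) : conf F := fun v => if v \in V then x v else north F.

Lemma framed_split : framed G.
Proof.
have [EV EE _ _] := HS; have [sV e12 _] := HG1; split.
  by rewrite EV; apply: fsubset_trans sV (fsubsetUl _ _).
by rewrite EE inE e12.
Qed.

Lemma frame_mem v : v \in [fset 0; 1; 2]%N%fset -> v \in vset G1 /\ v \in vset G2.
Proof.
have [sV1 _ _] := HG1; have [sV2 _ _] := HG2.
by move=> h; split; [exact: (fsubsetP sV1)|exact: (fsubsetP sV2)].
Qed.

Lemma glue2 p v : pairs G1 G2 l l p -> v \in vset G2 -> glue p v = p.2 v.
Proof.
move=> [h1 h2 E] v2; rewrite /glue; case: ifP => // v1.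
have [_ _ EI _] := HS; have : v \in [fset 0; 1; 2]%N%fset by rewrite -EI inE v1 v2.
have [x1 x2 _ _ _] := h1; have [y1 y2 _ _ _] := h2.
by rewrite !inE -orbA => /or3P[] /eqP ->; rewrite ?x1 ?x2 ?y1 ?y2.
Qed.

Lemma confs_glue p : pairs G1 G2 l l p -> confs G l (glue p).
Proof.
move=> hp; have [[x1 x2 xn xq xe] [y1 y2 yn yq ye] E] := hp; have [EV EE _ _] := HS.
have m1 : 1%N \in vset G1 by apply: (frame_mem _).1; rewrite !inE.
have m2 : 2%N \in vset G1 by apply: (frame_mem _).1; rewrite !inE.
split; [by rewrite /glue m1|by rewrite /glue m2| | |].
- by move=> v; rewrite EV inE negb_or => /andP[v1 v2]; rewrite /glue (negPf v1) yn.
- by move=> v; rewrite /glue; case: ifP.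
move=> u v; rewrite EE inE => /orP[] uv; have [/fsubsetP sub _] := edgeP uv.
  have u1 := sub u; have v1 := sub v; rewrite !inE !eqxx orbT in u1 v1.
  by rewrite /glue u1 // v1 //; exact: xe.
have u2 := sub u; have v2 := sub v; rewrite !inE !eqxx orbT in u2 v2.
by rewrite (glue2 hp (u2 isT)) (glue2 hp (v2 isT)); exact: ye.
Qed.

Lemma confs_restr Gi x : precal Gi -> (eset Gi `<=` eset G)%fset ->
  confs G l x -> confs Gi l (restr (vset Gi) x).
Proof.
move=> [sV e12 _] sE [x1 x2 xn xq xe].
have m1 : 1%N \in vset Gi by apply: (fsubsetP sV); rewrite !inE.
have m2 : 2%N \in vset Gi by apply: (fsubsetP sV); rewrite !inE.
split; [by rewrite /restr m1|by rewrite /restr m2| | |].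
- by move=> v vV; rewrite /restr (negPf vV).
- by move=> v; rewrite /restr; case: ifP => // _; exact: onq_north.
move=> u v uv; have [/fsubsetP sub _] := edgeP uv.
have u1 := sub u; have v1 := sub v; rewrite !inE !eqxx orbT in u1 v1.
by rewrite /restr u1 // v1 //; apply: xe; exact: (fsubsetP sE).
Qed.

Lemma split_confs Q : lists (pairs G1 G2 l l) Q -> lists (confs G l) (map glue Q).
Proof.
move=> [uQ mQ]; have [EV EE EI _] := HS.
split.
  rewrite map_inj_in_uniq // => p q /mQ hp /mQ hq E.
  have [[_ _ pn _ _] [_ _ pn2 _ _] _] := hp; have [[_ _ qn _ _] [_ _ qn2 _ _] _] := hq.
  have Ev v := congr1 (fun x : conf F => x v) E.
  rewrite [p]surjective_pairing [q]surjective_pairing; congr (_, _); apply/funext => v.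
    have := Ev v; rewrite /glue; case: (boolP (v \in vset G1)) => // v1 _.
    by rewrite pn // qn.
  case: (boolP (v \in vset G2)) => v2; last by rewrite pn2 // qn2.
  by have := Ev v; rewrite !glue2.
move=> x; split=> [/mapP[p /mQ hp ->]|cx]; first exact: confs_glue.
apply/mapP; exists (restr (vset G1) x, restr (vset G2) x).
  apply/mQ; split=> /=.
  - by apply: confs_restr => //; rewrite EE; exact: fsubsetUl.
  - by apply: confs_restr => //; rewrite EE; exact: fsubsetUr.
  - have [|m1 m2] := @frame_mem 0%N; first by rewrite !inE.
    by rewrite /restr m1 m2.
apply/funext => v; rewrite /glue /restr /=; case: (boolP (v \in vset G1)) => // v1.
case: (boolP (v \in vset G2)) => // v2; have [_ _ xn _ _] := cx; apply: xn.
by rewrite EV inE negb_or v1 v2.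
Qed.

Lemma split_perm : perm_eq [seq l e | e <- eset G]
  (l [fset 1; 2]%N%fset :: lens G1 l ++ lens G2 l :> seq F).
Proof.
have [_ EE _ EI] := HS; have [_ e1 _] := HG1; have [_ e2 _] := HG2.
rewrite /lens -map_cat -[_ :: map _ _]/(map l ([fset 1; 2]%N%fset :: _ ++ _)).
have E12 e : e \in eset G1 -> e \in eset G2 -> e = [fset 1; 2]%N%fset.
  by move=> h1 h2; apply/eqP; have : e \in (eset G1 `&` eset G2)%fset by [rewrite inE h1 h2]; rewrite EI inE.
apply: perm_map; apply: uniq_perm => [||e]; first exact: fset_uniq.
  rewrite /= cat_uniq !fset_uniq mem_cat !inE eqxx /= andbT.
  apply/hasPn => e; rewrite !inE => /andP[ne h2]; rewrite negb_and ne /=.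
  by apply/negP => h1; rewrite (E12 e h1 h2) eqxx in ne.
rewrite inE mem_cat EE !inE; case: eqVneq => [->|//].
by rewrite e1.
Qed.
End Gluing.

Lemma indep_base (F : numClosedFieldType) (K K' : set F) s : acf K -> acf K' -> K `<=` K' ->
  indep K' s -> indep K s.
Proof.
move=> HK HK' KK; elim: s => //= x s IH [nx /IH h]; split=> // xs; apply: nx.
exact: (span_base HK HK' KK).
Qed.

(** * Generic lengths over a countable field *)

Section GenericPoint.
Variables (F : numClosedFieldType) (K0 : set F).
Hypotheses (HK0 : acf K0) (eK0 : enumb K0) (nF : ~ enumb [set: F]).

Lemma enumb_big (K : set F) s : acf K -> enumb K -> exists g, ~ spanf K s g.
Proof.
move=> HK eK; apply: contrapT => h; apply: nF; have [f fs] := enumb_span s eK; exists f => g _.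
by apply: fs; apply: contrapT => ng; apply: h; exists g.
Qed.

Lemma indep_exists (K : set F) n : acf K -> enumb K -> exists2 s, size s = n & indep K s.
Proof.
move=> HK eK; elim: n => [|n [s sn is_]]; first by exists [::].
by have [g ng] := enumb_big s HK eK; exists (g :: s); rewrite /= ?sn.
Qed.

(** The lengths are chosen independent over the closure of [K0] with the coefficients of [p], where
    a nonzero [p] cannot vanish. *)
Lemma generic_point (H : graph) (p : {mpoly F[#|{: eset H}|]}) : p != 0 ->
  exists2 l : {fset nat} -> F, indep K0 [seq l e | e <- eset H] &
    p.@[fun i => l (val (enum_val i))] != 0.
Proof.
move=> p0; pose K := spanf K0 [seq p@_m | m <- msupp p].
have HK : acf K := span_acf _ HK0; have eK : enumb K := enumb_span _ eK0.
have [s sn is_] := indep_exists #|{: eset H}| HK eK.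
pose l (e : {fset nat}) := if (insub e : option (eset H)) is Some e' then s`_(enum_rank e') else 0.
have lv (e : eset H) : l (val e) = s`_(enum_rank e) by rewrite /l valK.
pose ev (i : 'I_#|{: eset H}|) : {fset nat} := val (enum_val i).
have sE : [seq (l \o ev) i | i <- enum 'I_#|{: eset H}|] = s.
  apply: (@eq_from_nth _ 0); rewrite size_map size_enum_ord // => i hi.
  rewrite (nth_map (Ordinal hi)) ?size_enum_ord //= lv enum_valK.
  by rewrite /= nth_enum_ord.
exists l; last first.
  apply: (meval_indep HK p0) => [m|]; last by have := is_; rewrite -{1}sE.
  have [ms|/memN_msupp_eq0 ->] := boolP (m \in msupp p); last exact: (subring0 (acf_subring HK)).
  by apply: span_mem => //; exact: map_f.
apply: (indep_base HK0 HK); first exact: span_sub.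
apply: (indep_perm HK _ is_); rewrite -{1}sE perm_sym (map_comp l ev); apply: perm_map.
apply: uniq_perm => [||e]; first exact: fset_uniq.
  by rewrite map_inj_uniq ?enum_uniq // => i j /val_inj/enum_val_inj.
apply/idP/mapP => [eH|[i _ ->]]; last exact: (valP (enum_val i)).
by exists (enum_rank [` eH]%fset); rewrite ?mem_enum // /ev enum_rankK.
Qed.
End GenericPoint.

(** * From complex to real exceptional loci *)

Section RealPart.
Variable R : realType.

Lemma complex_not_enumb : ~ enumb [set: R[i]].
Proof.
move=> [f fC]; apply: (@real_not_enumb R); exists (fun n => complex.Re (f n)) => x _.
by have [n _ En] := fC (x%:C)%C Logic.I; exists n; rewrite // En.
Qed.

(** [f] stands for the real or the imaginary part. Being linear over the reals, it commutes with
    evaluation at a real point, so a zero of [p] there is a zero of the polynomial with coefficients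
    f(p_m). *)
Lemma real_component n (p : {mpoly R[i][n]}) (f : R[i] -> R) (m0 : 'X_{1..n}) :
  f 0 = 0 -> (forall a b, f (a + b) = f a + f b) ->
  (forall a (w : R), f (a * (w%:C)%C) = f a * w) -> f p@_m0 != 0 ->
  exists2 pr : {mpoly R[n]}, pr != 0 & forall v : 'I_n -> R, pr.@[v] != 0 -> p.@[fun i => ((v i)%:C)%C] != 0.
Proof.
move=> f0 fD fM fm0; exists (\sum_(m <- msupp p) f p@_m *: 'X_[m]).
  apply: contra_neq fm0 => h; transitivity (\sum_(m <- msupp p) f p@_m *: 'X_[m])@_m0; last by rewrite h mcoeff0.
  rewrite linear_sum /=.
  have [ms|nm] := boolP (m0 \in msupp p); last first.
    rewrite (memN_msupp_eq0 nm) f0 big_seq big1 // => m hm.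
    by rewrite mcoeffZ mcoeffX; case: eqP => [E|_]; rewrite ?mulr0 // -E hm in nm *.
  rewrite (bigD1_seq m0) ?msupp_uniq //= mcoeffZ mcoeffX eqxx mulr1 big1 ?addr0 // => m.
  by move=> /negPf ne; rewrite mcoeffZ mcoeffX ne mulr0.
move=> v; apply: contra_neq => pv; rewrite -[RHS]f0 -pv [in RHS]mevalE (big_morph f fD f0) raddf_sum /=.
apply: eq_bigr => m _; rewrite mevalZ mevalX -fM rmorph_prod /=; congr (f (_ * _)).
by apply: eq_bigr => i _; rewrite rmorphXn.
Qed.

Lemma real_avoid n (p : {mpoly R[i][n]}) : p != 0 ->
  exists2 pr : {mpoly R[n]}, pr != 0 & forall v : 'I_n -> R, pr.@[v] != 0 -> p.@[fun i => ((v i)%:C)%C] != 0.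
Proof.
move=> p0; have [m pm] : exists m, p@_m != 0.
  apply: contrapT => h; move/eqP: p0; apply; apply/mpolyP => m; rewrite mcoeff0.
  by apply: contrapT => /eqP pm; apply: h; exists m.
have [re0|re0] := eqVneq (complex.Re p@_m) 0; last first.
  by apply: (real_component (f := @complex.Re R)) re0 => // [[a b] [c d]|[a b] w] //=; rewrite mulr0 subr0.
have im0 : complex.Im p@_m != 0.
  by apply: contra_neq pm; move: re0; case: (p@_m) => a b /= -> ->.
by apply: (real_component (f := @complex.Im R)) im0 => // [[a b] [c d]|[a b] w] //=; rewrite mulr0 add0r.
Qed.
End RealPart.

Lemma split_arith (c b1 b2 c1 c2 d1 d2 n1 n2 m1 m2 : nat) :
  (2 * c + b1 * b2 + c1 * c2 = d1 * d2)%N ->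
  (n1 + b1 = d1)%N -> (m1 + c1 = d1)%N -> (n2 + b2 = d2)%N -> (m2 + c2 = d2)%N ->
  ~~ odd d1 -> ~~ odd d2 -> ~~ odd n1 -> ~~ odd n2 -> ~~ odd m1 -> ~~ odd m2 ->
  Posz c = zform (d1./2%:Z, d1./2%:Z - n1./2%:Z, d1./2%:Z - m1./2%:Z)
                 (d2./2%:Z, d2./2%:Z - n2./2%:Z, d2./2%:Z - m2./2%:Z).
Proof.
have half (n : nat) : ~~ odd n -> n%:Z = 2 * n./2%:Z.
  by move=> /negPf h; rewrite -{1}[n]odd_double_half h add0n -mul2n PoszM.
move=> E B1 C1 B2 C2 od1 od2 on1 on2 om1 om2.
have hd1 := half _ od1; have hd2 := half _ od2; have hn1 := half _ on1.
have hn2 := half _ on2; have hm1 := half _ om1; have hm2 := half _ om2.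
have sub (a b d : nat) : (a + b = d)%N -> b%:Z = d%:Z - a%:Z by move=> <-; rewrite PoszD; ring.
have eb1 := sub _ _ _ B1; have eb2 := sub _ _ _ B2; have ec1 := sub _ _ _ C1; have ec2 := sub _ _ _ C2.
have E2 : 2 * c%:Z = d1%:Z * d2%:Z - b1%:Z * b2%:Z - c1%:Z * c2%:Z.
  by rewrite -!PoszM -E !PoszD !PoszM; ring.
apply: (@mulfI _ (2 : int)) => //; rewrite E2 eb1 eb2 ec1 ec2 hd1 hd2 hn1 hn2 hm1 hm2 /zform; ring.
Qed.

(** * The class of a calligraph *)

Section ClassOf.
Variables (F : numClosedFieldType) (K0 : set F).
Hypotheses (HK0 : acf K0) (eK0 : enumb K0) (nF : ~ enumb [set: F]).
Let Hbig s : exists g, ~ spanf K0 s g := enumb_big nF s HK0 eK0.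
Let K00 : K0 0 := subring0 (acf_subring HK0).
Let K01 : K0 1 := subring1 (acf_subring HK0).

(* The components are halved because of the reflection. *)
Definition cls_of (H : graph) : int * int * int :=
  let d := cnt K0 H 1 1 in
  (d./2%:Z, d./2%:Z - (cnt K0 H 1 0)./2%:Z, d./2%:Z - (cnt K0 H 0 1)./2%:Z).

Lemma generic_ex H : exists lg : ({fset nat} -> F) * F, generic K0 H lg.1 lg.2.
Proof.
have [l il _] := generic_point HK0 eK0 nF (oner_neq0 {mpoly F[#|{: eset H}|]}).
by have [g ng] := Hbig [seq l e | e <- eset H]; exists (l, g).
Qed.

Lemma cls_L : cls_of basic_L_graph = (1, 1, 0).
Proof.
have [[l ga] /= g] := generic_ex basic_L_graph; have [ny il ng] := generic_facts HK0 precal_L g.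
have [HK Ky y0 y4] := base_facts HK0 ny.
have c al be : K0 al -> K0 be -> cnt K0 basic_L_graph al be = if be == 0 then 0%N else 2.
  move=> Ka Kb; rewrite -(cntE HK0 Hbig precal_L Ka Kb g).
  by apply: (clist_L HK Ky y0 y4 (cl_big HK0 Hbig _) il _ _ ng); exact: cl_sub.
by rewrite /cls_of !c // eqxx oner_eq0.
Qed.

Lemma cls_R : cls_of basic_R_graph = (1, 0, 1).
Proof.
have [[l ga] /= g] := generic_ex basic_R_graph; have [ny il ng] := generic_facts HK0 precal_R g.
have [HK Ky y0 y4] := base_facts HK0 ny.
have c al be : K0 al -> K0 be -> cnt K0 basic_R_graph al be = if al == 0 then 0%N else 2.
  move=> Ka Kb; rewrite -(cntE HK0 Hbig precal_R Ka Kb g).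
  by apply: (clist_R HK Ky y0 y4 (cl_big HK0 Hbig _) il _ _ ng); exact: cl_sub.
by rewrite /cls_of !c // eqxx oner_eq0.
Qed.

Lemma cls_C v (hv : v \notin [fset 0; 1; 2]%N%fset) : cls_of (basic_C_graph hv) = (2, 0, 0).
Proof.
have [[l ga] /= g] := generic_ex (basic_C_graph hv).
have [ny il ng] := generic_facts HK0 (precal_C hv) g.
have [HK Ky y0 y4] := base_facts HK0 ny; set y := l _ in ny il ng HK Ky y0 y4.
have c al be : K0 al -> K0 be -> al ^+ 2 + be ^+ 2 + 2 * al * be * (1 - y / 2) != 0 ->
    cnt K0 (basic_C_graph hv) al be = 4.
  move=> Ka Kb h; rewrite -(cntE HK0 Hbig (precal_C hv) Ka Kb g).
  exact: (clist_C HK Ky y0 y4 (cl_big HK0 Hbig _) il (cl_sub HK0 y Ka) (cl_sub HK0 y Kb) h ng).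
have h10 : (1 : F) ^+ 2 + 0 ^+ 2 + 2 * 1 * 0 * (1 - y / 2) != 0.
  have -> : (1 : F) ^+ 2 + 0 ^+ 2 + 2 * 1 * 0 * (1 - y / 2) = 1 by ring.
  exact: oner_neq0.
have h01 : (0 : F) ^+ 2 + 1 ^+ 2 + 2 * 0 * 1 * (1 - y / 2) != 0.
  have -> : (0 : F) ^+ 2 + 1 ^+ 2 + 2 * 0 * 1 * (1 - y / 2) = 1 by ring.
  exact: oner_neq0.
have h11 : (1 : F) ^+ 2 + 1 ^+ 2 + 2 * 1 * 1 * (1 - y / 2) != 0.
  have -> : (1 : F) ^+ 2 + 1 ^+ 2 + 2 * 1 * 1 * (1 - y / 2) = 4 - y by field.
  by rewrite subr_eq0 eq_sym.
by rewrite /cls_of !c.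
Qed.

Lemma split_size G G1 G2 (l : {fset nat} -> F) : precal G1 -> precal G2 -> is_split G G1 G2 ->
  indep K0 [seq l e | e <- eset G] ->
  exists2 s, lists (confs G l) s & Posz (size s) = zform (cls_of G1) (cls_of G2).
Proof.
move=> H1 H2 HS il; have il' := indep_perm HK0 (split_perm l H1 H2 HS) il.
have [b1 [c1 [b2 [c2 [Q lQ [E B1 C1 B2 C2]]]]]] := split_number HK0 Hbig H1 H2 erefl il'.
exists (map (glue G1) Q); first exact: (split_confs H1 H2 HS lQ).
rewrite size_map; apply: (split_arith E B1 C1 B2 C2); by apply: even_cnt.
Qed.
End ClassOf.

(** * Transfer to real edge lengths outside an algebraic subset *)

Section Count.
Variables (R : realType) (K0 : set R[i]).
Hypotheses (HK0 : acf K0) (eK0 : enumb K0).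

(** The number c is known at a generic complex point. The existence of c, and of c + 1, distinct
    configurations has a constant truth value off p1 p2 = 0, so both values can be read off at that
    point and hold at every real point off a real hypersurface. *)
Lemma split_count G G1 G2 : precal G1 -> precal G2 -> is_split G G1 G2 ->
  exists2 c, sphere_realization_count R G c & Posz c = zform (cls_of K0 G1) (cls_of K0 G2).
Proof.
move=> H1 H2 HS; have nF := @complex_not_enumb R; have HG := framed_split H1 HS.
have size_of := @split_size _ _ HK0 eK0 nF G G1 G2 _ H1 H2 HS.
have [l0 il0 _] := generic_point HK0 eK0 nF (oner_neq0 {mpoly R[i][#|{: eset G}|]}).
have [s0 ls0 Es0] := size_of l0 il0; exists (size s0) => //; set c := size s0.
have [p1 [t1 [p10 h1]]] := generic_count R[i] HG c.
have [p2 [t2 [p20 h2]]] := generic_count R[i] HG c.+1.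
have p12 : p1 * p2 != 0 by rewrite mulf_neq0.
have [l il lp] := generic_point HK0 eK0 nF p12; have [s [us ms] Es] := size_of l il.
have sc : size s = c by move: Es; rewrite -Es0 => -[].
move: lp; rewrite mevalM mulf_eq0 negb_or => /andP[lp1 lp2].
have t1E : t1 = true by apply/(h1 l lp1); exists s; split=> // x /ms.
have t2E : t2 = false.
  apply/negP => /(h2 l lp2) [xs [sx ux cx]].
  have := uniq_leq_size ux (fun x xxs => (ms x).2 (cx x xxs)).
  by rewrite sx sc ltnn.
have [pr pr0 hpr] := real_avoid p12.
pose i12 := enum_rank [` HG.2]%fset.
(* The second factor keeps vertices 1 and 2 from being antipodal; that they are distinct follows
   from the positivity of the length. *)
exists (pr * ('X_i12 - 4%:MP)).
  rewrite mulf_neq0 //; apply/eqP => /(congr1 (meval (fun=> 0 : R))).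
  by rewrite mevalB mevalXU mevalC raddf0 add0r => /eqP; rewrite oppr_eq0 pnatr_eq0.
move=> lam lam0; rewrite mevalM mulf_eq0 negb_or mevalB mevalXU mevalC enum_rankK subr_eq0.
case/andP=> /hpr hp l4.
pose lC (e : {fset nat}) : R[i] := if (insub e : option (eset G)) is Some e' then ((lam e')%:C)%C else 0.
have lCE (e : eset G) : lC (val e) = ((lam e)%:C)%C by rewrite /lC valK.
have lC12 : lC [fset 1; 2]%N%fset = ((lam [` HG.2]%fset)%:C)%C by exact: (lCE [` HG.2]%fset).
have real_eq (a b : R) : ((a%:C)%C == (b%:C)%C) = (a == b) by rewrite (inj_eq (@complexI R)).
have lC0 : lC [fset 1; 2]%N%fset != 0 by rewrite lC12 real_eq gt_eqF.
have lC4 : lC [fset 1; 2]%N%fset != 4.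
  by rewrite lC12 -(rmorph_nat (real_complex R) 4) real_eq.
have lp : (p1 * p2).@[fun i => lC (val (enum_val i))] != 0.
  by move: hp; congr (_ != 0); apply: meval_eq => i; rewrite -lCE.
move: lp; rewrite mevalM mulf_eq0 negb_or => /andP[/h1 g1 /h2 g2].
have [xs [sx ux cx]] := g1.2 t1E.
rewrite -/c -sx; apply: (classes_card HG lC0 lC4); split=> // x; split=> [/cx //|Cx].
apply: contrapT => /negP nx; have := g2.1; rewrite t2E => h; apply: notF; apply: h.
exists (x :: xs); split; [by rewrite /= sx|by rewrite /= nx|].
by move=> z; rewrite inE => /orP[/eqP ->|/cx].
Qed.
End Count.

Local Close Scope classical_set_scope.
Local Close Scope ring_scope.

Theorem theorem2p7 (R : realType) :
  exists cls : calligraph -> int * int * int,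
    (forall (G : graph) (G1 G2 : calligraph),
       minimally_rigid G -> is_split G G1 G2 ->
       exists2 c : nat, sphere_realization_count R G c &
         Posz c = zform (cls G1) (cls G2)) /\
    cls basic_L = (1%Z, 1%Z, 0%Z) /\
    cls basic_R = (1%Z, 0%Z, 1%Z) /\
    (forall (v : nat) (hv : v \notin [fset 0; 1; 2]%fset),
       cls (basic_C hv) = (2%Z, 0%Z, 0%Z)).
Proof.
have [K0 HK0 eK0] := countable_acf R[i]; have nF := @complex_not_enumb R.
have pre (H : calligraph) : precal H by have [] := calligP H.
exists (fun H => cls_of K0 H); split; [|split; [|split]].
- by move=> G G1 G2 _ HS; exact: (split_count HK0 eK0 (pre G1) (pre G2) HS).
- exact: cls_L.
- exact: cls_R.
- by move=> v hv; exact: cls_C.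
Qed.
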